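(* Let $n\ge 3$. Let $\Omega'$ be an open subset of $\Omega$ such that $0\notin\overline{\Omega'}$. Then there are $\boldsymbol\varepsilon'\in\,]\mathbf 0,\boldsymbol\varepsilon^{\rm ad}[$ with $\overline{\omega_{\boldsymbol\varepsilon}}\cap\overline{\Omega'}=\emptyset$ for all $\boldsymbol\varepsilon\in\,]-\boldsymbol\varepsilon',\boldsymbol\varepsilon'[$ and a real analytic map $\mathfrak U_{\Omega'}$ from $]-\boldsymbol\varepsilon',\boldsymbol\varepsilon'[$ to $C^{1,\alpha}(\overline{\Omega'})$ such that $$u_{\boldsymbol\varepsilon|\overline{\Omega'}}=\mathfrak U_{\Omega'}[\boldsymbol\varepsilon]\qquad\forall\,\boldsymbol\varepsilon\in\,]\mathbf 0,\boldsymbol\varepsilon'[\,.$$ Furthermore, $\mathfrak U_{\Omega'}[\mathbf 0]=u_{0|\overline{\Omega'}}$.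
   Context: Let $n\ge3$, $\alpha\in\,]0,1[$ (open intervals are written $]a,b[$), $\mathbb R^n_+=\{x\in\mathbb R^n: x_n>0\}$, $B(0,r)$ the open ball, $B^+(0,r)=B(0,r)\cap\mathbb R^n_+$. $C^{k,\alpha}$ denotes the usual Schauder classes. Domain: $\Omega$ is an open bounded connected subset of $\mathbb R^n_+$ of class $C^{1,\alpha}$. Set $\partial_0\Omega=\partial\Omega\cap\partial\mathbb R^n_+$, $\partial_+\Omega=\partial\Omega\cap\mathbb R^n_+$. Assume $\partial_0\Omega$ is a neighbourhood of $0$ in $\partial\mathbb R^n_+$ and that $\overline{\partial_+\Omega}$ is a compact submanifold with boundary of $\mathbb R^n$ of class $C^{1,\alpha}$. Hole: $\omega$ is a bounded open connected subset of $\mathbb R^n$ of class $C^{1,\alpha}$ with $0\in\omega$; $p=(p_1,\dots,p_n)\in\mathbb R^n_+$ is fixed. For $\boldsymbol\varepsilon=(\varepsilon_1,\varepsilon_2)\in\mathbb R^2$ let $\omega_{\boldsymbol\varepsilon}=\varepsilon_1p+\varepsilon_1\varepsilon_2\,\omega$. Inequalities between pairs are componentwise, $]\boldsymbol\varepsilon',\boldsymbol\varepsilon''[$ is the open rectangle of $\boldsymbol\varepsilon\in\mathbb R^2$ with $\boldsymbol\varepsilon'<\boldsymbol\varepsilon<\boldsymbol\varepsilon''$, and $\mathbf 0=(0,0)$. Fix $\boldsymbol\varepsilon^{\rm ad}\in\,]0,+\infty[^2$ with $\varepsilon^{\rm ad}_1<1<\varepsilon_2^{\rm ad}<1/\varepsilon_1^{\rm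 ad}$ such that $\overline{\omega_{\boldsymbol\varepsilon}}\subseteq\Omega$ for all $\boldsymbol\varepsilon\in\,]\mathbf 0,\boldsymbol\varepsilon^{\rm ad}[$; set $\Omega_{\boldsymbol\varepsilon}=\Omega\setminus\overline{\omega_{\boldsymbol\varepsilon}}$. Data: $g^{\mathrm o}\in C^{1,\alpha}(\partial\Omega)$, $g^{\mathrm i}\in C^{1,\alpha}(\partial\omega)$, and there is $r_0>0$ such that the restriction of $g^{\mathrm o}$ to $B(0,r_0)\cap\partial_0\Omega$ is real analytic. For $\boldsymbol\varepsilon\in\,]\mathbf 0,\boldsymbol\varepsilon^{\rm ad}[$, $u_{\boldsymbol\varepsilon}\in C^{1,\alpha}(\overline{\Omega_{\boldsymbol\varepsilon}})$ is the unique solution of $\Delta u=0$ in $\Omega_{\boldsymbol\varepsilon}$, $u=g^{\mathrm o}$ on $\partial\Omega$, $u(x)=g^{\mathrm i}\big(\frac{x-\varepsilon_1p}{\varepsilon_1\varepsilon_2}\big)$ for $x\in\partial\omega_{\boldsymbol\varepsilon}$. $u_0\in C^{1,\alpha}(\overline\Omega)$ is the unique solution of $\Delta u_0=0$ in $\Omega$, $u_0=g^{\mathrm o}$ on $\partial\Omega$. There are $r_1\in\,]0,r_0]$ with $B^+(0,r_1)\subseteq\Omega$ and a function $U_0$ on $\overline{B(0,r_1)}$, harmonic in $B(0,r_1)$, with $U_0=u_0$ on $\overline{B^+(0,r_1)}$; these are fixed and $\varepsilon_1^{\rm ad}$ is taken so small that $\varepsilon_1p+\varepsilon_1\varepsilon_2\overline\omega\subseteq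 B(0,r_1)$ for all $\boldsymbol\varepsilon\in\,]-\boldsymbol\varepsilon^{\rm ad},\boldsymbol\varepsilon^{\rm ad}[$. Real analytic maps between (open subsets of) Banach spaces are those locally given by convergent power series. *)

(* Defs.v *)
From HB Require Import structures.
From mathcomp Require Import all_boot all_order all_algebra.
From mathcomp Require Import all_classical all_reals all_analysis.

Set Implicit Arguments.
Unset Strict Implicit.
Unset Printing Implicit Defensive.

Import Order.TTheory GRing.Theory Num.Theory.
Import numFieldNormedType.Exports.

Local Open Scope classical_set_scope.
Local Open Scope ring_scope.

(* Throughout, the ambient space is 'rV[R]_n.+1, so the "n" of R^n is n.+1
   here. The topology of 'rV is the usual one, but its library norm is the max
   norm; balls and Hoelder quotients below use the Euclidean norm. *)

Section Euclidean.
Context {R : realType} {n : nat}.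
Implicit Types (x : 'rV[R]_n.+1) (A : set 'rV[R]_n.+1) (r : R).

Definition enorm x : R := Num.sqrt (\sum_(i < n.+1) x 0 i ^+ 2).

Definition eball r : set 'rV[R]_n.+1 := [set x | enorm x < r].

Definition lastc x : R := x 0 ord_max.

Definition upper_half : set 'rV[R]_n.+1 := [set x | 0 < lastc x].

Definition hyperplane : set 'rV[R]_n.+1 := [set x | lastc x = 0].

Definition eball_plus r : set 'rV[R]_n.+1 := eball r `&` upper_half.

Definition boundary A : set 'rV[R]_n.+1 := closure A `\` interior A.

(* (x_1, ..., x_n) |-> (x_1, ..., x_{n-1}, 0) *)
Definition flatten_last x : 'rV[R]_n.+1 :=
  \row_j (if j == ord_max then 0 else x 0 j).

End Euclidean.

Section Smoothness.
Context {R : realType} {n : nat}.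
Implicit Types (O S : set 'rV[R]_n.+1) (f g : 'rV[R]_n.+1 -> R^o) (a : R).

Definition partial (i : 'I_n.+1) f : 'rV[R]_n.+1 -> R^o :=
  'D_(delta_mx 0 i) f.

Fixpoint Ck (k : nat) O f : Prop :=
  (forall x, O x -> {for x, continuous f}) /\
  if k is k'.+1 then
    forall i : 'I_n.+1,
      (forall x, O x -> derivable f x (delta_mx 0 i)) /\ Ck k' O (partial i f)
  else True.

Definition harmonic_in O f : Prop :=
  Ck 2 O f /\
  forall x, O x -> \sum_(i < n.+1) partial i (partial i f) x = 0.

Definition holder_quot a g (xy : 'rV[R]_n.+1 * 'rV[R]_n.+1) : R^o :=
  (g xy.1 - g xy.2) / enorm (xy.1 - xy.2) `^ a.

(* f is of class C^{1,a}(closure O), for O open: f is continuous on closure O,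
   its first partial derivatives exist in O, extend continuously to closure O
   and are uniformly a-Hoelder. Boundedness of f and of its derivatives is
   automatic when O is bounded; it is included so that the norm is finite for
   every O. By continuity, sups and Hoelder constants of the derivatives over
   O and over closure O agree. *)
Definition C1a a O f : Prop :=
  [/\ {within closure O, continuous f},
      [bounded f x | x in closure O] &
      forall i : 'I_n.+1,
      [/\ (forall x, O x -> derivable f x (delta_mx 0 i)),
          (exists g, {within closure O, continuous g} /\
                     forall x, O x -> g x = partial i f x),
          [bounded partial i f x | x in O] &
          [bounded holder_quot a (partial i f) xy | xy in O `*` O]]].

End Smoothness.

Section Supnorm.
Context {R : realType} {T : Type}.
Implicit Types (S : set T) (f g : T -> R^o).

Definition supnorm S f : R := sup [set `|f x| | x in S].

Lemma supnorm0 f : supnorm set0 f = 0.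
Proof. by rewrite /supnorm image_set0 sup0. Qed.

Lemma bounded_has_ubound S f :
  [bounded f x | x in S] -> has_ubound [set `|f x| | x in S].
Proof.
move=> [M [_ Mf]]; exists (M + 1) => _ [x Sx <-].
by apply: (Mf (M + 1) _ x Sx); rewrite ltrDl.
Qed.

Lemma le_supnorm S f x : [bounded f x | x in S] -> S x -> `|f x| <= supnorm S f.
Proof.
by move=> /bounded_has_ubound bf Sx; apply: ub_le_sup => //; exists x.
Qed.

Lemma supnorm_le S f (M : R) : 0 <= M -> (forall x, S x -> `|f x| <= M) ->
  supnorm S f <= M.
Proof.
move=> M0 fM; have [->|/set0P [x Sx]] := eqVneq S set0; first by rewrite supnorm0.
by apply: ge_sup => [|_ [y Sy <-]]; [exists `|f x|, x | exact: fM].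
Qed.

Lemma supnorm_ge0 S f : 0 <= supnorm S f.
Proof.
rewrite /supnorm.
have [->|/set0P [x Sx]] := eqVneq S set0; first by rewrite image_set0 sup0.
have [bf|nbf] := pselect (has_ubound [set `|f x| | x in S]).
  by apply: le_trans (ub_le_sup bf (ex_intro2 _ _ x Sx erefl)).
by rewrite sup_out// => -[].
Qed.

Lemma bounded_onD S f g h : (forall x, S x -> h x = f x + g x) ->
  [bounded f x | x in S] -> [bounded g x | x in S] -> [bounded h x | x in S].
Proof.
move=> hfg bf bg; exists (supnorm S f + supnorm S g); split; first exact: num_real.
move=> M ltM x Sx /=; rewrite hfg//; apply: le_trans (ler_normD _ _) _.
by apply: le_trans (ltW ltM); apply: lerD; exact: le_supnorm.
Qed.

Lemma bounded_onZ S (k : R) f h : (forall x, S x -> h x = k * f x) ->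
  [bounded f x | x in S] -> [bounded h x | x in S].
Proof.
move=> hf bf; exists (`|k| * supnorm S f); split; first exact: num_real.
move=> M ltM x Sx /=; rewrite hf// normrM.
by apply: le_trans (ltW ltM); apply: ler_wpM2l => //; exact: le_supnorm.
Qed.

Lemma supnormD S f g h : (forall x, S x -> h x = f x + g x) ->
  [bounded f x | x in S] -> [bounded g x | x in S] ->
  supnorm S h <= supnorm S f + supnorm S g.
Proof.
move=> hfg bf bg; apply: supnorm_le; first by rewrite addr_ge0// supnorm_ge0.
move=> x Sx; rewrite hfg//; apply: le_trans (ler_normD _ _) _.
by apply: lerD; exact: le_supnorm.
Qed.

Lemma supnormZ S (k : R) f h : (forall x, S x -> h x = k * f x) ->
  [bounded f x | x in S] -> supnorm S h = `|k| * supnorm S f.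
Proof.
move=> hf bf; apply/eqP; rewrite eq_le; apply/andP; split.
  apply: supnorm_le; first by rewrite mulr_ge0// supnorm_ge0.
  by move=> x Sx; rewrite hf// normrM ler_wpM2l//; exact: le_supnorm.
have [->|k0] := eqVneq k 0; first by rewrite normr0 mul0r supnorm_ge0.
rewrite -ler_pdivlMl ?normr_gt0//; apply: supnorm_le.
  by rewrite mulr_ge0// ?supnorm_ge0// invr_ge0.
move=> x Sx; rewrite ler_pdivlMl ?normr_gt0// -normrM -hf//.
by apply: le_supnorm => //; exact: bounded_onZ hf bf.
Qed.

End Supnorm.

(* The Banach space C^{1,a}(closure O). A function on closure O is represented
   by its extension by zero to the whole space, so that two elements are equal
   if and only if they agree on closure O. *)
Section SchauderSpace.
Context {R : realType} {n : nat}.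
Variables (a : R) (O : set 'rV[R]_n.+1).
Implicit Types (f g : 'rV[R]_n.+1 -> R^o).

Lemma partialD f g i x :
  derivable f x (delta_mx 0 i) -> derivable g x (delta_mx 0 i) ->
  partial i (f + g) x = partial i f x + partial i g x.
Proof. exact: deriveD. Qed.

Lemma partialZ (k : R) f i x : derivable f x (delta_mx 0 i) ->
  partial i (k *: f) x = k * partial i f x.
Proof. exact: deriveZ. Qed.

Lemma holder_quotD f g h xy : (O `*` O) xy ->
  (forall x, O x -> h x = f x + g x) ->
  holder_quot a h xy = holder_quot a f xy + holder_quot a g xy.
Proof.
by case=> x1 x2 e; rewrite /holder_quot !e// -mulrDl opprD addrACA.
Qed.

Lemma holder_quotZ (k : R) f h xy : (O `*` O) xy ->
  (forall x, O x -> h x = k * f x) ->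
  holder_quot a h xy = k * holder_quot a f xy.
Proof. by case=> x1 x2 e; rewrite /holder_quot !e// -mulrBr mulrA. Qed.

Lemma C1a0 : C1a a O 0.
Proof.
have p0 i : partial i (0 : 'rV[R]_n.+1 -> R^o) = 0.
  by apply/funext => x; rewrite /partial derive_cst.
have b0 (T : Type) (S : set T) : [bounded (0 : R^o) | x in S].
  by exists 0; split => // M M0 x _ /=; rewrite normr0 ltW.
have c0 : {within closure O, continuous (0 : 'rV[R]_n.+1 -> R^o)}.
  by move=> x; exact: cst_continuous.
split=> // i; rewrite !p0; split.
- by move=> x _; exact: derivable_cst.
- by exists 0.
- exact: b0.
- apply: (@bounded_onZ _ _ _ 0 0) => [xy _|]; last exact: b0.
  by rewrite mul0r /holder_quot subr0 mul0r.
Qed.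

Lemma C1aD f g : C1a a O f -> C1a a O g -> C1a a O (f + g).
Proof.
move=> [cf bf pf] [cg bg pg]; split.
- by move=> x; apply: continuousD; [exact: cf|exact: cg].
- exact: bounded_onD bf bg.
- move=> i; have [df [f' [cf' ff']] bdf hf] := pf i.
  have [dg [g' [cg' gg']] bdg hg] := pg i.
  have pD x : O x -> partial i (f + g) x = partial i f x + partial i g x.
    by move=> Ox; apply: partialD; [exact: df|exact: dg].
  split.
  + by move=> x Ox; apply: derivableD; [exact: df|exact: dg].
  + exists (f' + g'); split => [x|x Ox].
      by apply: continuousD; [exact: cf'|exact: cg'].
    by rewrite pD// -ff'// -gg'.
  + exact: bounded_onD bdf bdg.
  + by apply: bounded_onD hf hg => xy Oxy; exact: holder_quotD.
Qed.

Lemma C1aZ (k : R) f : C1a a O f -> C1a a O (k *: f).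
Proof.
move=> [cf bf pf]; split.
- move=> x; apply: continuousZl_tmp; exact: cf.
- exact: (@bounded_onZ _ _ _ k) bf.
- move=> i; have [df [f' [cf' ff']] bdf hf] := pf i.
  have pZ x : O x -> partial i (k *: f) x = k * partial i f x.
    by move=> Ox; apply: partialZ; exact: df.
  split.
  + by move=> x Ox; apply: derivableZ; exact: df.
  + exists (k *: f'); split => [x|x Ox].
      apply: continuousZl_tmp; exact: cf'.
    by rewrite pZ// -ff'.
  + exact: bounded_onZ pZ bdf.
  + by apply: (bounded_onZ (k := k)) hf => xy Oxy; exact: holder_quotZ.
Qed.

Definition C1a_space_pred : {pred 'rV[R]_n.+1 -> R^o} :=
  [pred f | `[< C1a a O f /\ forall x, ~ closure O x -> f x = 0 >]].

Lemma C1a_space_submod : submod_closed C1a_space_pred.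
Proof.
split; first by apply/asboolP; split; [exact: C1a0|].
move=> k f g /asboolP[Cf f0] /asboolP[Cg g0].
apply/asboolP; split; first by apply: C1aD => //; exact: C1aZ.
by move=> x Ox; rewrite addrfctE scalrfctE f0// g0// scaler0 addr0.
Qed.

HB.instance Definition _ := GRing.isSubmodClosed.Build R ('rV[R]_n.+1 -> R^o)
  C1a_space_pred C1a_space_submod.

Record C1a_space := MkC1a {
  C1a_fun :> 'rV[R]_n.+1 -> R^o;
  C1a_funP : C1a_fun \in C1a_space_pred
}.

HB.instance Definition _ := [isSub for C1a_fun].
HB.instance Definition _ := [Choice of C1a_space by <:].
HB.instance Definition _ := [SubChoice_isSubLmodule of C1a_space by <:].

Lemma C1a_spaceP (f : C1a_space) :
  C1a a O f /\ forall x, ~ closure O x -> f x = 0.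
Proof. exact/asboolP/C1a_funP. Qed.

Definition C1a_norm (f : 'rV[R]_n.+1 -> R^o) : R :=
  supnorm (closure O) f +
  \sum_(i < n.+1) (supnorm O (partial i f) +
                   supnorm (O `*` O) (holder_quot a (partial i f))).

Lemma C1a_normD (f g : C1a_space) :
  C1a_norm (f + g) <= C1a_norm f + C1a_norm g.
Proof.
have [[_ bf pf] _] := C1a_spaceP f; have [[_ bg pg] _] := C1a_spaceP g.
rewrite /C1a_norm addrACA; apply: lerD; first exact: supnormD.
rewrite -big_split/=; apply: ler_sum => i _; rewrite addrACA.
have [df _ bdf hf] := pf i; have [dg _ bdg hg] := pg i.
have pD x : O x -> partial i (f + g : C1a_space) x = partial i f x + partial i g x.
  by move=> Ox; apply: partialD; [exact: df|exact: dg].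
apply: lerD; first exact: supnormD.
by apply: supnormD => // xy Oxy; exact: holder_quotD.
Qed.

Lemma C1a_normZ (k : R) (f : C1a_space) :
  C1a_norm (k *: f) = `|k| * C1a_norm f.
Proof.
have [[_ bf pf] _] := C1a_spaceP f.
rewrite /C1a_norm mulrDr mulr_sumr; congr (_ + _); first exact: supnormZ.
apply: eq_bigr => i _; rewrite mulrDr; have [df _ bdf hf] := pf i.
have pZ x : O x -> partial i (k *: f : C1a_space) x = k * partial i f x.
  by move=> Ox; apply: partialZ; exact: df.
congr (_ + _); first exact: supnormZ.
by apply: supnormZ => // xy Oxy; exact: holder_quotZ.
Qed.

Lemma C1a_norm_eq0 (f : C1a_space) : C1a_norm f = 0 -> f = 0.
Proof.
have [[_ bf _] f0] := C1a_spaceP f; rewrite /C1a_norm => nf0.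
have sf0 : supnorm (closure O) f <= 0.
  rewrite -nf0 lerDl; apply: sumr_ge0 => i _.
  by rewrite addr_ge0// supnorm_ge0.
apply/val_inj/funext => x /=.
have [Ox|/f0->//] := pselect (closure O x).
by apply/eqP; rewrite -normr_le0; apply: le_trans sf0; exact: le_supnorm.
Qed.

HB.instance Definition _ := Lmodule_isNormed.Build R C1a_space
  C1a_normD C1a_normZ C1a_norm_eq0.

End SchauderSpace.

Section RealAnalytic.
Context {R : realType} {V W : normedModType R}.

Definition multilinear (k : nat) (A : ('I_k -> V) -> W) : Prop :=
  forall (i : 'I_k) (v : 'I_k -> V),
    linear (fun x : V => A (fun j => if j == i then x else v j)).

(* Around each point x0 of S, f coincides on S with the sum of a power series
   of bounded k-linear maps A k converging normally on a ball. For S not open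
   this says that f is locally the restriction of an analytic function; in
   particular a function on a relatively open part of the hyperplane x_n = 0
   is analytic in this sense iff it is analytic in (x_1, ..., x_{n-1}). *)
Definition real_analytic_on (S : set V) (f : V -> W) : Prop :=
  forall x0, S x0 ->
  exists (A : forall k, ('I_k -> V) -> W) (c : R^nat) (r : R),
    [/\ 0 < r,
        forall k, multilinear (A k),
        forall k (v : 'I_k -> V), `|A k v| <= c k * \prod_(i < k) `|v i|,
        cvgn (series (fun k => c k * r ^+ k)) &
        forall x, S x -> `|x - x0| < r ->
          series (fun k => A k (fun=> x - x0)) @ \oo --> f x].

End RealAnalytic.

Section Manifolds.
Context {R : realType} {n : nat}.
Implicit Types (O M W D : set 'rV[R]_n.+1) (a : R).

(* Hoelder bounds are uniform on W and D: shrinking the chart, this is the same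
   as asking for local ones. *)
Definition C1a_diffeo a W D (psi phi : 'rV[R]_n.+1 -> 'rV[R]_n.+1) : Prop :=
  [/\ open W /\ open D,
      (forall x, W x -> D (psi x) /\ phi (psi x) = x),
      (forall y, D y -> W (phi y) /\ psi (phi y) = y),
      (forall j, C1a a W (fun x => psi x 0 j)) &
      (forall j, C1a a D (fun y => phi y 0 j))].

Definition boundary_chart a O W D psi phi : Prop :=
  C1a_diffeo a W D psi phi /\
  forall x, W x -> (O x <-> 0 < lastc (psi x)) /\
                   (boundary O x <-> lastc (psi x) = 0).

Definition of_class_C1a a O : Prop :=
  forall x0, boundary O x0 ->
  exists W D psi phi, W x0 /\ boundary_chart a O W D psi phi.

(* M is an (n-1)-dimensional submanifold with (possibly empty) boundary of R^n,
   of class C^{1,a}: locally, a C^{1,a} diffeomorphism of open sets of R^n maps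
   M onto {y_n = 0, y_{n-1} >= 0}. A model centred at an interior point of the
   half-space covers the points of M that are not in its boundary. *)
Definition C1a_submanifold_with_boundary a M : Prop :=
  forall x0, M x0 ->
  exists W D psi phi, [/\ W x0, C1a_diffeo a W D psi phi &
    forall x, W x ->
      (M x <-> lastc (psi x) = 0 /\ 0 <= psi x 0 (inord n.-1))].

(* g is of class C^{1,a}(boundary O): in local charts, (g \o phi)(y', 0) is a
   C^{1,a} function of y' in R^{n-1}. It is viewed as a function on R^n not
   depending on y_n. *)
Definition C1a_on_boundary a O (g : 'rV[R]_n.+1 -> R^o) : Prop :=
  forall x0, boundary O x0 ->
  exists W D psi phi, [/\ W x0, boundary_chart a O W D psi phi &
    C1a a [set y | D (flatten_last y)] (fun y => g (phi (flatten_last y)))].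

End Manifolds.

Section Holes.
Context {R : realType} {n : nat}.
Implicit Types (e : R * R) (p : 'rV[R]_n.+1).

Definition rect (e1 e2 : R * R) : set (R * R) :=
  [set e | e1.1 < e.1 < e2.1 /\ e1.2 < e.2 < e2.2].

Definition scaled p (A : set 'rV[R]_n.+1) e : set 'rV[R]_n.+1 :=
  [set e.1 *: p + (e.1 * e.2) *: y | y in A].

Definition perforated (Om om : set 'rV[R]_n.+1) p e : set 'rV[R]_n.+1 :=
  Om `\` closure (scaled p om e).

End Holes.

(* Main.v *)
(* Everything rests on the maximum principle. Dirichlet problems are solved by
   Perron's method with cone barriers. A harmonic function vanishing on the
   boundary has a first order expansion at each boundary point with an error of
   order 1 + alpha (iterated odd reflection across the tangent plane); with
   interior gradient estimates this turns a sup bound away from 0 into a bound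
   in C^{1,alpha} of the closure of Omega'.

   A boundary datum f on the hole is extended by the decaying exterior solution
   minus its mirror image minus a harmonic corrector that restores the zero
   datum on the boundary of Omega. Kelvin's transform gives the multipole
   expansion of the exterior solution, so this extension is a double power series
   in (e1, e2), and on the hole it equals f minus a series s_{ab}[f] e1^a e2^b
   with s_{a0} = 0. As the order in e2 increases, the data f_{AB} whose
   extensions, times e1^A e2^B, sum up to u_e - u_0 are therefore determined
   recursively. Uniqueness for the Dirichlet problem identifies the sum with
   u_e, and re-centring the power series gives analyticity. *)

Require Import Defs.
From HB Require Import structures.
From mathcomp Require Import all_boot all_order all_algebra.
From mathcomp Require Import all_classical all_reals all_analysis.
From mathcomp Require Import ring lra zify.

Set Implicit Arguments.
Unset Strict Implicit.
Unset Printing Implicit Defensive.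

Import Order.TTheory GRing.Theory Num.Theory.
Import numFieldNormedType.Exports.

Local Open Scope classical_set_scope.
Local Open Scope ring_scope.

(** The hole collapses onto a boundary point of [Om], while its distance to the boundary, of order
    [e1], and its relative size [e2] vary independently. Seen from the hole, the mirror hole is at a
    distance of order [1 / e2] whatever [e1] is, so the feedback on the hole contains pure powers of
    [e2] and no smallness can be drawn from [e1]. What makes the recursion triangular is that in
    dimension at least 3 the multipole of order 0 vanishes: every feedback gains a factor [e2]. The
    expansions at the hole have to be centred at 0, where functions on [Om] live on one side only.
    For [u0] the given [U0] supplies the other side; for the correctors it is supplied by odd
    reflection across the flat part of the boundary. Convergence is always stated with an error
    [C 2^-K] uniform in the point. This form lets the maximum principle move the error of a partial
    sum from the boundary to the interior. The threshold [1 / 64] for the parameters comes from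
    convolutions: [K^4 <= 16^K] terms of size [64^-K] still leave [2^-K]. *)

Lemma le_of_eq (R : realType) (a b : R) : a = b -> a <= b.
Proof. by move->. Qed.

(** For open [D] these are exactly the boundary points ([bdryE]). *)
Notation "'\bd' z 'of' D , P" := (forall z, closure D z -> ~ D z -> P)
  (at level 200, z name, P at level 200, only parsing).

(** * Euclidean norm, limits and directional derivatives *)

Section Euclid.
Context {R : realType} {n : nat}.
Local Notation V := 'rV[R]_n.+1.
Implicit Types (x y z v : V) (c r : R).

Definition dotp x y : R := \sum_(i < n.+1) x 0 i * y 0 i.
Definition ee (i : 'I_n.+1) : V := delta_mx 0 i.

Lemma eeE i j : ee i 0 j = (j == i)%:R.
Proof. by rewrite /ee mxE eqxx. Qed.

Lemma dotpC x y : dotp x y = dotp y x.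
Proof. by apply: eq_bigr => i _; rewrite mulrC. Qed.

Lemma dotpDl x y z : dotp (x + y) z = dotp x z + dotp y z.
Proof. by rewrite /dotp -big_split; apply: eq_bigr => i _ /=; rewrite mxE mulrDl. Qed.

Lemma dotpDr x y z : dotp z (x + y) = dotp z x + dotp z y.
Proof. by rewrite !(dotpC z) dotpDl. Qed.

Lemma dotpZl c x y : dotp (c *: x) y = c * dotp x y.
Proof. by rewrite /dotp big_distrr/=; apply: eq_bigr => i _; rewrite mxE mulrA. Qed.

Lemma dotpZr c x y : dotp y (c *: x) = c * dotp y x.
Proof. by rewrite !(dotpC y) dotpZl. Qed.

Lemma dotpNl x y : dotp (- x) y = - dotp x y.
Proof. by rewrite -scaleN1r dotpZl mulN1r. Qed.

Lemma dotpNr x y : dotp y (- x) = - dotp y x.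
Proof. by rewrite !(dotpC y) dotpNl. Qed.

Lemma dotpBl x y z : dotp (x - y) z = dotp x z - dotp y z.
Proof. by rewrite dotpDl dotpNl. Qed.

Lemma dotpBr x y z : dotp z (x - y) = dotp z x - dotp z y.
Proof. by rewrite dotpDr dotpNr. Qed.

Lemma dotp0l x : dotp 0 x = 0.
Proof. by rewrite -(scale0r 0) dotpZl mul0r. Qed.

Lemma dotp0r x : dotp x 0 = 0.
Proof. by rewrite dotpC dotp0l. Qed.

Lemma dotp_ee x i : dotp x (ee i) = x 0 i.
Proof.
rewrite /dotp (bigD1 i)//= eeE eqxx mulr1 big1 ?addr0// => j ji.
by rewrite eeE (negbTE ji) mulr0.
Qed.

Lemma dotpxx_ge0 x : 0 <= dotp x x.
Proof. by apply: sumr_ge0 => i _; rewrite -expr2 sqr_ge0. Qed.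

Lemma enormE x : enorm x = Num.sqrt (dotp x x).
Proof. by congr (Num.sqrt _); apply: eq_bigr => i _; rewrite expr2. Qed.

Lemma enorm_sqr x : enorm x ^+ 2 = dotp x x.
Proof. by rewrite enormE sqr_sqrtr// dotpxx_ge0. Qed.

Lemma enorm_ge0 x : 0 <= enorm x.
Proof. exact: sqrtr_ge0. Qed.

Lemma enorm0 : enorm (0 : V) = 0.
Proof. by rewrite enormE dotp0l sqrtr0. Qed.

Lemma enormZ c x : enorm (c *: x) = `|c| * enorm x.
Proof.
by rewrite !enormE dotpZl dotpZr mulrA -expr2 sqrtrM ?sqr_ge0// sqrtr_sqr.
Qed.

Lemma enormN x : enorm (- x) = enorm x.
Proof. by rewrite -scaleN1r enormZ normrN1 mul1r. Qed.

Lemma enorm_distC x y : enorm (x - y) = enorm (y - x).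
Proof. by rewrite -enormN opprB. Qed.

Lemma coord_le_enorm x i : `|x 0 i| <= enorm x.
Proof.
rewrite enormE -sqrtr_sqr ler_wsqrtr// /dotp (bigD1 i)//= expr2 lerDl.
by apply: sumr_ge0 => j _; rewrite -expr2 sqr_ge0.
Qed.

Lemma enorm_eq0 x : (enorm x == 0) = (x == 0).
Proof.
apply/eqP/eqP => [x0|->]; last exact: enorm0.
apply/rowP => i; rewrite mxE; apply/eqP; rewrite -normr_le0 -x0.
exact: coord_le_enorm.
Qed.

Lemma enorm_gt0 x : (0 < enorm x) = (x != 0).
Proof. by rewrite lt_def enorm_ge0 andbT enorm_eq0. Qed.

Lemma cauchy_schwarz x y : `|dotp x y| <= enorm x * enorm y.
Proof.
have [->|y0] := eqVneq y 0; first by rewrite dotp0r normr0 enorm0 mulr0.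
rewrite -(@ler_pXn2r _ 2)// ?nnegrE ?mulr_ge0 ?enorm_ge0//.
rewrite exprMn !enorm_sqr -normrX ger0_norm ?sqr_ge0//.
have yy : 0 < dotp y y by rewrite -enorm_sqr exprn_gt0// enorm_gt0.
have := dotpxx_ge0 (dotp y y *: x - dotp x y *: y).
rewrite dotpBl !dotpBr !dotpZl !dotpZr (dotpC y x) => h.
rewrite -(ler_pM2l yy) -subr_ge0.
by apply: le_trans h _; apply: le_of_eq; ring.
Qed.

Lemma enormD x y : enorm (x + y) <= enorm x + enorm y.
Proof.
rewrite -(@ler_pXn2r _ 2)// ?nnegrE ?addr_ge0 ?enorm_ge0//.
rewrite sqrrD !enorm_sqr dotpDl !dotpDr (dotpC y x).
have := le_trans (ler_norm _) (cauchy_schwarz x y).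
rewrite -mulr_natr; nra.
Qed.

Lemma enorm_tri z x y : enorm (x - y) <= enorm (x - z) + enorm (z - y).
Proof. by rewrite -{1}(subrK z x) -addrA; apply: enormD. Qed.

Lemma enorm_rdist x y : `|enorm x - enorm y| <= enorm (x - y).
Proof.
rewrite ler_norml; apply/andP; split.
  have := enormD (y - x) x; rewrite subrK enorm_distC; lra.
have := enormD (x - y) y; rewrite subrK; lra.
Qed.

Lemma enorm_ee i : enorm (ee i) = 1.
Proof. by rewrite enormE dotp_ee eeE eqxx sqrtr1. Qed.

Lemma enorm_le_sum x : enorm x <= \sum_(i < n.+1) `|x 0 i|.
Proof.
rewrite {1}(row_sum_delta x).
apply: (big_ind2 (fun (a : V) (b : R) => enorm a <= b)) => [|a b c d ab cd|i _].
- by rewrite enorm0.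
- exact: le_trans (enormD _ _) (lerD ab cd).
- by rewrite enormZ enorm_ee mulr1.
Qed.

Lemma coord_le_norm x i : `|x 0 i| <= `|x|.
Proof.
rewrite /Num.Def.normr/= mx_normrE; exact: (le_bigmax _ (fun ij : 'I_1 * 'I_n.+1 => `|x ij.1 ij.2|) (0, i)).
Qed.

Lemma norm_le_enorm x : `|x| <= enorm x.
Proof.
rewrite [leLHS]mx_normrE; apply: bigmax_le; first exact: enorm_ge0.
by move=> -[i j] _ /=; rewrite ord1; exact: coord_le_enorm.
Qed.

Lemma enorm_le_norm x : enorm x <= n.+1%:R * `|x|.
Proof.
apply: le_trans (enorm_le_sum x) _.
have /le_trans -> // : \sum_(i < n.+1) `|x 0 i| <= \sum_(i < n.+1) `|x|.
  by apply: ler_sum => i _; exact: coord_le_norm.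
by rewrite sumr_const card_ord mulr_natl.
Qed.

(** The max norm and the Euclidean norm differ by a factor at most [n.+1]. From here on every
    topological argument is run with Euclidean balls, which reflections preserve. *)
Lemma enbhsP x (A : set V) :
  nbhs x A <-> exists2 r : R, 0 < r & forall y, enorm (y - x) < r -> A y.
Proof.
split.
  move=> /nbhs_ballP[r /= r0 rA]; exists r => // y yx; apply: rA.
  rewrite -ball_normE /ball_/= distrC.
  exact: le_lt_trans (norm_le_enorm _) yx.
move=> [r r0 rA]; apply/nbhs_ballP; exists (r / n.+1%:R) => /=.
  by rewrite divr_gt0.
move=> y; rewrite -ball_normE /ball_/= distrC ltr_pdivlMr// mulrC => yx.
by apply: rA; apply: le_lt_trans (enorm_le_norm _) yx.
Qed.

Lemma openP_enorm (O : set V) : open O <->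
  forall x, O x -> exists2 r : R, 0 < r & forall y, enorm (y - x) < r -> O y.
Proof.
rewrite openE; split => [h x Ox|h x Ox]; first exact/enbhsP/h.
exact/enbhsP/h.
Qed.

Lemma open_ball_in (O : set V) x : open O -> O x ->
  exists2 r : R, 0 < r & forall y, enorm (y - x) < r -> O y.
Proof. by move=> /openP_enorm; exact. Qed.

Lemma closure_enormP (A : set V) x : closure A x <->
  forall r : R, 0 < r -> exists2 y, A y & enorm (y - x) < r.
Proof.
split => [cA r r0|h B /enbhsP[r r0 rB]].
  have /cA[y [Ay yx]] : nbhs x [set y | enorm (y - x) < r].
    by apply/enbhsP; exists r.
  by exists y.
by have [y Ay yx] := h r r0; exists y; split => //; apply: rB.
Qed.

Definition cont_at (f : V -> R) x := forall e : R, 0 < e ->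
  exists2 d : R, 0 < d & forall y, enorm (y - x) < d -> `|f y - f x| < e.

(** The point [x] is not excluded: if it lies in [D], the limit must be [f x]. At a boundary point
    of an open [D] the value [f x] does not enter, so a solution can have boundary limits without
    being redefined there. *)
Definition blim (D : set V) (f : V -> R) x l := forall e : R, 0 < e ->
  exists2 d : R, 0 < d & forall y, D y -> enorm (y - x) < d -> `|f y - l| < e.

Lemma cont_atP (f : V -> R^o) x : {for x, continuous f} <-> cont_at f x.
Proof.
split => [/cvgrPdist_lt cf e e0|cf].
  have /enbhsP[d d0 fd] := cf e e0; exists d => // y /fd; by rewrite distrC.
apply/(@cvgrPdist_lt R R^o V (nbhs x)) => e e0; apply/enbhsP.
by have [d d0 fd] := cf e e0; exists d => // y /fd; rewrite distrC.
Qed.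

Lemma withinP (A : set V) (f : V -> R^o) : {within A, continuous f} <->
  forall x, A x -> blim A f x (f x).
Proof.
split => [/subspace_continuousP cf x Ax e e0|cf].
  have /cvgrPdist_lt /(_ e e0) := cf x Ax.
  rewrite near_withinE => /enbhsP[d d0 h].
  by exists d => // y Ay yx; rewrite distrC; exact: h.
apply/subspace_continuousP => x Ax.
apply/(@cvgrPdist_lt R R^o V (within A (nbhs x))) => e e0.
rewrite near_withinE; apply/enbhsP.
have [d d0 h] := cf x Ax e e0; exists d => // y yx Ay.
by rewrite distrC; exact: h.
Qed.

(** The error form avoids division by [h] and holds at [h = 0] too, which makes estimates and
    changes of variables direct. *)
Lemma is_deriveP (f : V -> R^o) x v (l : R) : is_derive x v f l <->
  forall e : R, 0 < e -> exists2 d : R, 0 < d & forall h : R, `|h| < d ->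
    `|f (x + h *: v) - f x - h * l| <= e * `|h|.
Proof.
split.
  move=> [df fl] e e0.
  have /cvgrPdist_le /(_ e e0) : (fun h => h^-1 *: ((f \o shift x) (h *: v) - f x)) @ 0^' --> (l : R^o).
    by rewrite -fl; exact: df.
  rewrite near_withinE => /nbhs_ballP[d /= d0 h]; exists d => // t td.
  have [->|t0] := eqVneq t 0; first by rewrite scale0r addr0 subrr sub0r mul0r oppr0 normr0 mulr0.
  have /h /(_ t0) : ball 0 d t by rewrite -ball_normE /ball_/= sub0r normrN.
  rewrite /= /shift/= [t *: v + x]addrC => h1.
  rewrite -ler_pdivrMr ?normr_gt0// -normfV -normrM; apply: le_trans h1.
  by rewrite distrC mulrBl (mulrC t) mulfK// mulrC.
move=> h.
have cv : (fun h => h^-1 *: ((f \o shift x) (h *: v) - f x)) @ 0^' --> (l : R^o).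
  apply/(@cvgrPdist_le R R^o R) => e e0; rewrite near_withinE; apply/nbhs_ballP.
  have [d d0 hd] := h e e0; exists d => //= t.
  rewrite -ball_normE /ball_/= sub0r normrN => td t0.
  have := hd t td; rewrite -ler_pdivrMr ?normr_gt0// -normfV -normrM.
  rewrite [t *: v + x]addrC => /(le_trans _); apply.
  by rewrite distrC mulrBl (mulrC t) mulfK// mulrC.
by apply: DeriveDef; [apply/cvg_ex; exists l|exact/cvg_lim].
Qed.

(** Reduces directional derivatives to one real variable, where the mean value theorem is
    available. *)
Lemma is_derive_line (f : V -> R^o) x v (t l : R) :
  is_derive (x + t *: v) v f l <-> is_derive t (1 : R) (fun s : R => f (x + s *: v)) l.
Proof.
have e : (fun h => h^-1 *: ((f \o shift (x + t *: v)) (h *: v) - f (x + t *: v))) =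
  (fun h => h^-1 *: (((fun s : R => f (x + s *: v)) \o shift t) (h *: 1) - f (x + t *: v))).
  apply/funext => h /=; congr (_ *: (f _ - _)).
  by rewrite /shift/= scalerDl [h *: 1]mulr1 addrCA.
split => -[df fl].
  by apply: DeriveDef; [move: df|move: fl]; rewrite /derivable /derive e.
by apply: DeriveDef; [move: df|move: fl]; rewrite /derivable /derive e.
Qed.

Lemma is_derive_cont1 (g : R -> R^o) (t l : R) : is_derive t (1 : R) g l ->
  {for t, continuous g}.
Proof. by move=> [/derivable1_diffP/differentiable_continuous]. Qed.

Lemma MVT_line (f : V -> R^o) x v (g : R -> R) (a b : R) : a < b ->
  (forall t : R, a <= t <= b -> is_derive (x + t *: v) v f (g t)) ->
  exists2 c : R, a < c < b & f (x + b *: v) - f (x + a *: v) = g c * (b - a).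
Proof.
move=> ab h.
have [||c cab e] := @MVT R (fun s : R => f (x + s *: v)) g a b ab.
- move=> t; rewrite in_itv/= => /andP[ta tb]; apply/is_derive_line/h.
  by rewrite !ltW.
- apply: continuous_in_subspaceT => t; rewrite inE/= in_itv/= => tab.
  by apply: (@is_derive_cont1 _ _ (g t)); exact/is_derive_line/h.
by exists c => //; move: cab; rewrite in_itv.
Qed.

Lemma MVT_line_le (f : V -> R^o) x v (g : R -> R) (M h : R) : 0 <= h ->
  (forall t : R, 0 <= t <= h -> is_derive (x + t *: v) v f (g t)) ->
  (forall t : R, 0 <= t <= h -> `|g t| <= M) ->
  `|f (x + h *: v) - f x| <= M * h.
Proof.
rewrite le_eqVlt => /orP[/eqP<-|h0] dg gM.
  by rewrite scale0r addr0 subrr normr0 mulr0.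
have [c /andP[c0 ch]] := MVT_line h0 dg.
rewrite scale0r addr0 subr0 => ->; rewrite normrM (gtr0_norm h0).
by apply: ler_wpM2r; [exact: ltW|apply: gM; rewrite !ltW].
Qed.

End Euclid.

(** * Functions of class C^2, harmonic functions and the maximum principle *)

Section Calculus.
Context {R : realType} {n : nat}.
Local Notation V := 'rV[R]_n.+1.
Local Notation I := 'I_n.+1.
Implicit Types (x y z v : V) (c r : R) (O D : set V) (f g : V -> R^o).

Lemma cont_cst c x : cont_at (fun=> c) x.
Proof. by move=> e e0; exists 1 => // y _; rewrite subrr normr0. Qed.

Lemma contD f g x : cont_at f x -> cont_at g x -> cont_at (fun y => f y + g y) x.
Proof. by move=> /cont_atP cf /cont_atP cg; apply/cont_atP; exact: (@continuousD _ _ _ f g). Qed.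

Lemma contM f g x : cont_at f x -> cont_at g x -> cont_at (fun y => f y * g y) x.
Proof. by move=> /cont_atP cf /cont_atP cg; apply/cont_atP; exact: (@continuousM _ _ f g). Qed.

Lemma contZ c f x : cont_at f x -> cont_at (fun y => c * f y) x.
Proof. by apply: contM; exact: cont_cst. Qed.

Lemma contN f x : cont_at f x -> cont_at (fun y => - f y) x.
Proof. by move=> cf e /cf[d d0 h]; exists d => // y /h; rewrite -opprD normrN. Qed.

Lemma contB f g x : cont_at f x -> cont_at g x -> cont_at (fun y => f y - g y) x.
Proof. by move=> cf /contN; exact: contD. Qed.

Lemma cont_sum (m : nat) (F : 'I_m -> V -> R) x : (forall i, cont_at (F i) x) ->
  cont_at (fun y => \sum_i F i y) x.
Proof.
elim: m F => [|m IH] F cF.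
  by rewrite (_ : (fun _ => _) = cst 0) ?funeqE => [|y]; [exact: cont_cst|rewrite big_ord0].
rewrite (_ : (fun _ => _) = (fun y => \sum_(i < m) F (widen_ord (leqnSn m) i) y + F ord_max y)).
  by apply: contD => //; exact: IH.
by apply/funext => y; rewrite big_ord_recr.
Qed.

Lemma cont_coord i x : cont_at (fun y => y 0 i) x.
Proof.
move=> e e0; exists e => // y; apply: le_lt_trans.
by have := coord_le_enorm (y - x) i; rewrite !mxE.
Qed.

Lemma cont_comp (h : R -> R^o) f x : {for f x, continuous h} -> cont_at f x ->
  cont_at (fun y => h (f y)) x.
Proof.
move=> ch /cont_atP cf; apply/cont_atP.
by apply: (@continuous_comp _ _ _ f h).
Qed.

Lemma cont_aff f c b x : cont_at f (b + c *: x) -> cont_at (fun y => f (b + c *: y)) x.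
Proof.
move=> cf e /cf[d d0 h]; exists (d / (`|c| + 1)).
  by rewrite divr_gt0// ltr_wpDl.
move=> y; rewrite ltr_pdivlMr ?ltr_wpDl// => yx; apply: h.
rewrite opprD addrACA subrr add0r -scalerBr enormZ; apply: le_lt_trans yx.
by rewrite mulrC ler_wpM2l ?enorm_ge0// lerDl.
Qed.

Lemma cont_congr O f g x : open O -> O x -> (forall y, O y -> f y = g y) ->
  cont_at f x -> cont_at g x.
Proof.
move=> oO Ox fg cf e /cf[d d0 h].
have [r r0 rO] := open_ball_in oO Ox.
exists (Num.min d r); first by rewrite lt_min d0.
move=> y; rewrite lt_min => /andP[yd yr].
by rewrite -!fg//; [exact: h|exact: rO].
Qed.

Lemma is_derive_congr O f g x v (l : R) : open O -> O x ->
  (forall y, O y -> f y = g y) -> is_derive x v f l -> is_derive x v g l.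
Proof.
move=> oO Ox fg; apply: near_eq_is_derive.
have [r r0 rO] := open_ball_in oO Ox.
by apply/enbhsP; exists r => // y /rO /fg.
Qed.

Lemma is_derive_aff f c b x v (l : R) : is_derive (b + c *: x) v f l ->
  is_derive x v (fun y => f (b + c *: y)) (c * l).
Proof.
move=> /is_deriveP df; apply/is_deriveP => e e0.
have [|d d0 h] := df (e / (`|c| + 1)); first by rewrite divr_gt0// ltr_wpDl.
exists (d / (`|c| + 1)); first by rewrite divr_gt0// ltr_wpDl.
move=> t; rewrite ltr_pdivlMr ?ltr_wpDl// => td.
rewrite scalerDr addrA scalerA mulrA [t * c]mulrC.
have /h/le_trans : `|c * t| < d.
  by rewrite normrM; apply: le_lt_trans td; rewrite mulrC ler_wpM2l// lerDl.
apply; rewrite normrM mulrA ler_wpM2r// mulrAC ler_pdivrMr ?ltr_wpDl//.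
by rewrite ler_wpM2l ?(ltW e0)// lerDl.
Qed.

Lemma is_derive_coord x i j : is_derive x (ee j) (fun y : V => y 0 i : R^o) ((i == j)%:R : R).
Proof.
apply/is_deriveP => e e0; exists 1 => // t _.
by rewrite !mxE eqxx/= [_ + t * _]addrC addrK subrr normr0 mulr_ge0// ltW.
Qed.

(** Derivatives are carried as explicit functions, so that sums, products and substitutions yield
    Laplacians by plain algebra. *)
Definition hasC2 O f (fd : I -> V -> R) (fdd : I -> I -> V -> R) :=
  forall x, O x -> [/\ cont_at f x, forall i, cont_at (fd i) x,
    forall i j, cont_at (fdd i j) x,
    forall i, is_derive x (ee i) f (fd i x : R) &
    forall i j, is_derive x (ee j) (fd i : V -> R^o) (fdd i j x : R)].

(** Only pure second derivatives enter, and without continuity: this is the regularity with which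
    the maximum principle works. *)
Definition lapl O f (L : V -> R) := exists fd fdd : I -> V -> R,
  forall x, O x -> [/\ cont_at f x, forall i, is_derive x (ee i) f (fd i x : R),
    forall i, is_derive x (ee i) (fd i : V -> R^o) (fdd i x : R) &
    L x = \sum_i fdd i x].

Definition harm O f := exists fd fdd, hasC2 O f fd fdd /\
  forall x, O x -> \sum_i fdd i i x = 0.

Lemma hasC2_lapl O f fd fdd : hasC2 O f fd fdd -> lapl O f (fun x => \sum_i fdd i i x).
Proof. by move=> h; exists fd, (fun i => fdd i i) => x /h[]. Qed.

Lemma harm_lapl O f : harm O f -> lapl O f (fun=> 0).
Proof.
by move=> [fd [fdd [h h0]]]; exists fd, (fun i => fdd i i) => x Ox; have [] := h x Ox; rewrite h0.
Qed.

Lemma harm_sub O D f : D `<=` O -> harm O f -> harm D f.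
Proof.
by move=> DO [fd [fdd [h h0]]]; exists fd, fdd; split => x /DO; [exact: h|exact: h0].
Qed.

Lemma lapl_sub O D f L : D `<=` O -> lapl O f L -> lapl D f L.
Proof. by move=> DO [fd [fdd h]]; exists fd, fdd => x /DO; exact: h. Qed.

Lemma harm_cont O f x : harm O f -> O x -> cont_at f x.
Proof. by move=> [fd [fdd [h _]]] /h[]. Qed.

Lemma hasC2_congr O f g fd fdd : open O -> (forall x, O x -> f x = g x) ->
  hasC2 O f fd fdd -> hasC2 O g fd fdd.
Proof.
move=> oO fg h x Ox; have [a b c d e] := h x Ox; split => //.
  exact: cont_congr fg a.
by move=> i; apply: is_derive_congr fg (d i).
Qed.

Lemma harm_congr O f g : open O -> (forall x, O x -> f x = g x) ->
  harm O f -> harm O g.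
Proof.
move=> oO fg [fd [fdd [h h0]]]; exists fd, fdd; split => //; exact: hasC2_congr fg h.
Qed.

Lemma hasC2D O f g fd fdd gd gdd : hasC2 O f fd fdd -> hasC2 O g gd gdd ->
  hasC2 O (fun x => f x + g x) (fun i x => fd i x + gd i x)
    (fun i j x => fdd i j x + gdd i j x).
Proof.
move=> hf hg x Ox; have [a b c d e] := hf x Ox; have [a' b' c' d' e'] := hg x Ox.
split => [|i|i j|i|i j]; try exact: contD.
  exact: (@is_deriveD _ _ _ f g).
exact: (@is_deriveD _ _ _ (fd i : V -> R^o) (gd i : V -> R^o)).
Qed.

Lemma hasC2Z O k f fd fdd : hasC2 O f fd fdd ->
  hasC2 O (fun x => k * f x) (fun i x => k * fd i x) (fun i j x => k * fdd i j x).
Proof.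
move=> hf x Ox; have [a b c d e] := hf x Ox.
split => [|i|i j|i|i j]; try exact: contZ.
  exact: (@is_deriveZ _ _ _ f k).
exact: (@is_deriveZ _ _ _ (fd i : V -> R^o) k).
Qed.

Lemma hasC2_cst O c : hasC2 O (fun=> c) (fun _ _ => 0) (fun _ _ _ => 0).
Proof.
by move=> x Ox; split => [|i|i j|i|i j]; try exact: cont_cst; exact: is_derive_cst.
Qed.

Lemma hasC2_coord O k : hasC2 O (fun x => x 0 k) (fun i _ => (k == i)%:R) (fun _ _ _ => 0).
Proof.
move=> x Ox; split => [|i|i j|i|i j]; try exact: cont_cst.
- exact: cont_coord.
- exact: is_derive_coord.
- exact: is_derive_cst.
Qed.

Lemma is_deriveMe (f g : V -> R^o) x v (df dg : R) :
  is_derive x v f df -> is_derive x v g dg ->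
  is_derive x v (fun y => f y * g y : R^o) (df * g x + f x * dg).
Proof.
move=> hf hg; have := @is_deriveM _ _ f g x v df dg hf hg.
by move/is_derive_eq; apply; rewrite addrC /GRing.scale/= (mulrC (g x)).
Qed.

Lemma hasC2M O f g fd fdd gd gdd : hasC2 O f fd fdd -> hasC2 O g gd gdd ->
  hasC2 O (fun x => f x * g x) (fun i x => fd i x * g x + f x * gd i x)
    (fun i j x => (fdd i j x * g x + fd i x * gd j x) + (fd j x * gd i x + f x * gdd i j x)).
Proof.
move=> hf hg x Ox; have [a b c d e] := hf x Ox; have [a' b' c' d' e'] := hg x Ox.
split => [|i|i j|i|i j]; try (by repeat (apply: contD || apply: contM)).
  exact: is_deriveMe.
apply: (@is_deriveD _ _ _ (fun x => fd i x * g x : R^o) (fun x => f x * gd i x : R^o)).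
  exact: (@is_deriveMe (fd i) g).
exact: (@is_deriveMe f (gd i)).
Qed.

Lemma hasC2_aff O f fd fdd c b : hasC2 O f fd fdd ->
  hasC2 [set x | O (b + c *: x)] (fun x => f (b + c *: x))
    (fun i x => c * fd i (b + c *: x)) (fun i j x => c * (c * fdd i j (b + c *: x))).
Proof.
move=> h x Ox; have [a b' c' d e] := h _ Ox.
split => [|i|i j|i|i j]; try (by repeat (apply: contZ); exact: cont_aff).
  exact: is_derive_aff.
apply: (@is_deriveZ _ _ _ (fun y => fd i (b + c *: y) : R^o) c).
exact: is_derive_aff.
Qed.

Lemma harmD O f g : harm O f -> harm O g -> harm O (fun x => f x + g x).
Proof.
move=> [fd [fdd [hf f0]]] [gd [gdd [hg g0]]].
do 2 eexists; split; first exact: hasC2D hf hg.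
by move=> x Ox; rewrite /= big_split/= f0// g0// addr0.
Qed.

Lemma harmZ O k f : harm O f -> harm O (fun x => k * f x).
Proof.
move=> [fd [fdd [hf f0]]]; do 2 eexists; split; first exact: hasC2Z hf.
by move=> x Ox; rewrite /= -big_distrr/= f0// mulr0.
Qed.

Lemma harmN O f : harm O f -> harm O (fun x => - f x).
Proof.
move=> /(harmZ (-1)) hf; rewrite (_ : (fun _ => _) = (fun x => -1 * f x))//.
by apply/funext => x; rewrite mulN1r.
Qed.

Lemma harmB O f g : harm O f -> harm O g -> harm O (fun x => f x - g x).
Proof. by move=> hf /harmN; exact: harmD. Qed.

Lemma harm_cst O c : harm O (fun=> c).
Proof.
do 2 eexists; split; first exact: hasC2_cst.
by move=> x _; rewrite big1.
Qed.

Lemma harm_coord O k : harm O (fun x => x 0 k).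
Proof.
do 2 eexists; split; first exact: hasC2_coord.
by move=> x _; rewrite big1.
Qed.

Lemma harm_sum O (m : nat) (F : 'I_m -> V -> R) : (forall i, harm O (F i)) ->
  harm O (fun y => \sum_i F i y).
Proof.
elim: m F => [|m IH] F cF.
  by rewrite (_ : (fun _ => _) = cst 0) ?funeqE => [|y]; [exact: harm_cst|rewrite big_ord0].
rewrite (_ : (fun _ => _) = (fun y => \sum_(i < m) F (widen_ord (leqnSn m) i) y + F ord_max y)).
  by apply: harmD => //; exact: IH.
by apply/funext => y; rewrite big_ord_recr.
Qed.

Lemma harm_aff O f c b : harm O f ->
  harm [set x | O (b + c *: x)] (fun x => f (b + c *: x)).
Proof.
move=> [fd [fdd [hf f0]]]; do 2 eexists; split; first exact: hasC2_aff hf.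
by move=> x Ox; rewrite /= -!big_distrr/= f0// !mulr0.
Qed.

Lemma harm_dotp O v : harm O (fun x => dotp v x).
Proof.
apply: (@harm_sum O n.+1 (fun i x => v 0 i * x 0 i)) => i.
by apply: harmZ; exact: harm_coord.
Qed.

Lemma cont_dotp v x : cont_at (fun x => dotp v x) x.
Proof. exact: (@harm_cont setT _ x (harm_dotp setT v)). Qed.

(** Openness matters for second derivatives: a first order witness coincides with [partial i f]
    inside [O] only, and differentiating it requires this on a neighbourhood. *)
Lemma harmonic_inP O f : open O -> harmonic_in O f <-> harm O f.
Proof.
move=> oO; split.
  move=> [[cf d1] hl]; exists (fun i => partial i f), (fun i j => partial j (partial i f)).
  split => // x Ox; split => [|i|i j|i|i j].
  - exact/cont_atP/cf.
  - by have [_ /= [h _]] := d1 i; exact/cont_atP/h.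
  - by have [_ /= [_ /(_ j)[_ [h _]]]] := d1 i; exact/cont_atP/h.
  - by have [h _] := d1 i; apply: derivableP; exact: h.
  - by have [_ /= [_ /(_ j)[h _]]] := d1 i; apply: derivableP; exact: h.
move=> [fd [fdd [h h0]]].
have e1 i x : O x -> fd i x = partial i f x.
  by move=> Ox; have [_ _ _ d _] := h x Ox; have := d i; case.
have e2 i j x : O x -> fdd i j x = partial j (partial i f) x.
  move=> Ox; have [_ _ _ _ d] := h x Ox.
  by have := is_derive_congr oO Ox (e1 i) (d i j); case.
split; last by move=> x Ox; rewrite -[RHS](h0 x Ox); apply: eq_bigr => i _; rewrite e2.
split; first by move=> x Ox; apply/cont_atP; have [] := h x Ox.
move=> i; split; first by move=> x Ox; have [_ _ _ d _] := h x Ox; have := d i; case.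
split.
  move=> x Ox; apply/cont_atP; have [_ c _ _ _] := h x Ox.
  exact: cont_congr oO Ox (e1 i) (c i).
move=> j; split.
  move=> x Ox; have [_ _ _ _ d] := h x Ox.
  by have := is_derive_congr oO Ox (e1 i) (d i j); case.
split => //= x Ox; apply/cont_atP; have [_ _ c _ _] := h x Ox.
exact: cont_congr oO Ox (e2 i j) (c i j).
Qed.

Lemma laplD O f g L M : lapl O f L -> lapl O g M ->
  lapl O (fun x => f x + g x) (fun x => L x + M x).
Proof.
move=> [fd [fdd hf]] [gd [gdd hg]].
exists (fun i x => fd i x + gd i x), (fun i x => fdd i x + gdd i x) => x Ox.
have [a b c d] := hf x Ox; have [a' b' c' d'] := hg x Ox; split => [|i|i|].
- exact: contD.
- exact: (@is_deriveD _ _ _ f g).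
- exact: (@is_deriveD _ _ _ (fd i : V -> R^o) (gd i : V -> R^o)).
- by rewrite big_split/= d d'.
Qed.

Lemma laplZ O k f L : lapl O f L -> lapl O (fun x => k * f x) (fun x => k * L x).
Proof.
move=> [fd [fdd hf]].
exists (fun i x => k * fd i x), (fun i x => k * fdd i x) => x Ox.
have [a b c d] := hf x Ox; split => [|i|i|].
- exact: contZ.
- exact: (@is_deriveZ _ _ _ f k).
- exact: (@is_deriveZ _ _ _ (fd i : V -> R^o) k).
- by rewrite -big_distrr/= d.
Qed.

Lemma lapl_eq O f L M : (forall x, O x -> L x = M x) -> lapl O f L -> lapl O f M.
Proof.
move=> LM [fd [fdd h]]; exists fd, fdd => x Ox; have [a b c d] := h x Ox.
by split => //; rewrite -LM.
Qed.

Lemma lapl_sum O (m : nat) (F : 'I_m -> V -> R) (L : 'I_m -> R) :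
  (forall i, lapl O (F i) (fun=> L i)) ->
  lapl O (fun y => \sum_i F i y) (fun=> \sum_i L i).
Proof.
elim: m F L => [|m IH] F L cF.
  rewrite (_ : (fun _ => _) = cst 0) ?funeqE => [|y]; last by rewrite big_ord0.
  by apply: lapl_eq (harm_lapl (@harm_cst O 0)) => x _; rewrite big_ord0.
rewrite (_ : (fun _ => _) = (fun y => \sum_(i < m) F (widen_ord (leqnSn m) i) y + F ord_max y)).
  apply: lapl_eq (laplD (IH _ _ (fun i => cF (widen_ord (leqnSn m) i))) (cF ord_max)) => x _.
  by rewrite big_ord_recr.
by apply/funext => y; rewrite big_ord_recr.
Qed.

Lemma lapl_sq O b : lapl O (fun x => dotp (x - b) (x - b)) (fun=> 2 * n.+1%:R).
Proof.
have h i : lapl O (fun x : V => (x 0 i - b 0 i) * (x 0 i - b 0 i)) (fun=> 2).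
  have h1 := hasC2D (@hasC2_coord O i) (@hasC2_cst O (- b 0 i)).
  apply: lapl_eq (hasC2_lapl (hasC2M h1 h1)) => x _ /=.
  rewrite (bigD1 i)//= eqxx big1 ?addr0 => [|j ji]; last by rewrite [i == j]eq_sym (negbTE ji) mulr0n; ring.
  by rewrite mulr1n; ring.
have -> : (fun x => dotp (x - b) (x - b)) = (fun x : V => \sum_(i < n.+1) (x 0 i - b 0 i) * (x 0 i - b 0 i)).
  by apply/funext => x; apply: eq_bigr => i _; rewrite !mxE.
by apply: lapl_eq (lapl_sum h) => x _; rewrite sumr_const card_ord mulr_natr.
Qed.

Lemma local_max_d1 f x v (l : R) r : 0 < r -> enorm v = 1 ->
  (forall y, enorm (y - x) < r -> f y <= f x) -> is_derive x v f l -> l = 0.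
Proof.
move=> r0 v1 fx /is_deriveP df; apply/eqP; rewrite -normr_le0 leNgt; apply/negP => l0.
have [d d0 h] := df (`|l| / 2) ltac:(lra).
pose t : R := Num.min (d / 2) (r / 2).
have t0 : 0 < t by rewrite lt_min; apply/andP; split; lra.
have td : t < d by rewrite /t gt_min; apply/orP; left; lra.
have tr : t < r by rewrite /t gt_min; apply/orP; right; lra.
have fxt s : `|s| = t -> f (x + s *: v) <= f x.
  by move=> st; apply: fx; rewrite addrC addKr enormZ v1 mulr1 st.
have hs s : `|s| = t -> s * l = t * `|l| -> False.
  move=> st sl; have := h s; rewrite st => /(_ td); have := fxt s st.
  rewrite sl => a b.
  have : t * `|l| <= `|l| / 2 * t by apply: le_trans b; rewrite distrC; apply: le_trans (ler_norm _); lra.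
  have := mulr_gt0 t0 l0; lra.
have [lp|lp] := leP 0 l.
  by apply: (hs t); [rewrite gtr0_norm|rewrite (ger0_norm lp)].
by apply: (hs (- t)); [rewrite normrN gtr0_norm|rewrite (ltr0_norm lp) mulNr mulrN].
Qed.

(** A positive [l] would make [g] positive just after [x], and the mean value theorem would lift [f]
    above its maximum. *)
Lemma local_max_d2 O f (g : V -> R^o) x v (l : R) r : 0 < r -> enorm v = 1 ->
  (forall y, enorm (y - x) < r -> f y <= f x) ->
  (forall y, enorm (y - x) < r -> is_derive y v f (g y : R)) ->
  is_derive x v g l -> l <= 0.
Proof.
move=> r0 v1 fx df dg; rewrite leNgt; apply/negP => l0.
have g0 : g x = 0.
  by apply: (local_max_d1 r0 v1 fx); apply: df; rewrite subrr enorm0.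
move/is_deriveP : dg => /(_ (l / 2) ltac:(lra))[d d0 h].
pose t : R := Num.min (d / 2) (r / 2).
have t0 : 0 < t by rewrite lt_min; apply/andP; split; lra.
have td : t < d by rewrite /t gt_min; apply/orP; left; lra.
have tr : t < r by rewrite /t gt_min; apply/orP; right; lra.
have en s : enorm (x + s *: v - x) = `|s| by rewrite addrC addKr enormZ v1 mulr1.
have [|c /andP[c0 ct]] := @MVT_line _ _ f x v (fun s => g (x + s *: v)) 0 t t0.
  move=> s /andP[s0 st]; apply: df; rewrite en ger0_norm//; exact: le_lt_trans tr.
rewrite scale0r addr0 subr0 => e.
have : f (x + t *: v) <= f x by apply: fx; rewrite en gtr0_norm.
rewrite -subr_le0 e leNgt => /negP; apply; rewrite mulr_gt0//.
have := h c; rewrite (gtr0_norm c0) => /(_ (lt_trans ct td)).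
rewrite g0 subr0 ler_norml => /andP[+ _].
have := mulr_gt0 c0 l0; lra.
Qed.

Definition ebounded O := exists B : R, forall x, O x -> enorm x <= B.

Lemma eboundedP O : bounded_set O <-> ebounded O.
Proof.
split.
  move=> [M [_ h]]; exists (n.+1%:R * (M + 1)) => x Ox.
  apply: le_trans (enorm_le_norm x) _; rewrite ler_wpM2l//.
  by apply: (h (M + 1) _ x Ox); rewrite ltrDl.
move=> [B h]; exists B; split; first exact: num_real.
move=> M BM x Ox /=; apply: le_trans (norm_le_enorm x) _.
exact: le_trans (h x Ox) (ltW BM).
Qed.

(** The boundary condition keeps the superlevel set of [f x0] away from the boundary, so that this
    set is closed in the whole space and compact. *)
Lemma max_attained O f x0 : open O -> ebounded O -> (forall x, O x -> cont_at f x) ->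
  O x0 -> (\bd z of O,
     exists2 d : R, 0 < d & forall x, O x -> enorm (x - z) < d -> f x < f x0) ->
  exists2 x1, O x1 & forall x, O x -> f x <= f x1.
Proof.
move=> oO [B bO] cf Ox0 hb.
pose K := [set x | O x /\ f x0 <= f x].
have cK : closed K.
  move=> z cz.
  have cOz : closure O z.
    by apply: closure_subset cz => x -[].
  have [Oz|nOz] := pselect (O z).
    split => //; rewrite leNgt; apply/negP => fz.
    have [d d0 h] := cf z Oz (f x0 - f z) ltac:(lra).
    move/closure_enormP : cz => /(_ d d0)[y [Oy fy] /h].
    rewrite ltr_norml => /andP[_]; lra.
  have [d d0 h] := hb z cOz nOz.
  move/closure_enormP : cz => /(_ d d0)[y [Oy fy] yz].
  have := h y Oy yz; lra.
have compK : compact K.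
  apply: bounded_closed_compact => //; apply/eboundedP; exists B => x [Ox _]; exact: bO.
have [||c Kc mc] := @EVT_max_rV R n.+1 f K _ compK.
- by exists x0.
- apply/withinP => x [Ox _] e e0; have [d d0 h] := cf x Ox e e0.
  by exists d => // y _; exact: h.
move/set_mem : Kc => [Oc fc]; exists c => // x Ox.
have [xx|xx] := leP (f x0) (f x); last by apply: le_trans (ltW xx) fc.
by apply: mc; apply/mem_set.
Qed.

(** Bounds the upper limit of [f] at each boundary point, without asking [f] for boundary values. *)
Definition bsup O f (g : V -> R) := \bd z of O,
  forall e : R, 0 < e -> exists2 d : R, 0 < d &
    forall x, O x -> enorm (x - z) < d -> f x <= g z + e.

(** Adding [eta |x|^2] makes the Laplacian strictly positive, which excludes an interior maximum.
    With [eta = m / (4 B^2)] the perturbation is at most a quarter of the excess [m = f x0 - c], so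
    the maximum cannot escape to the boundary either. *)
Lemma max_principle O f L c : open O -> ebounded O -> lapl O f L ->
  (forall x, O x -> 0 <= L x) -> bsup O f (fun=> c) ->
  forall x, O x -> f x <= c.
Proof.
move=> oO bO lf L0 bf x0 Ox0; rewrite leNgt; apply/negP => fx0.
have [B0 hB0] := bO; pose B : R := `|B0| + 1.
have hB x : O x -> enorm x <= B.
  by move=> /hB0/le_trans; apply; rewrite /B; apply: le_trans (ler_norm _) _; rewrite lerDl.
have B1 : 0 < B by rewrite ltr_wpDl.
pose m : R := f x0 - c; have m0 : 0 < m by rewrite /m; lra.
pose eta : R := m / (4 * B ^+ 2).
have eta0 : 0 < eta by rewrite divr_gt0// mulr_gt0// exprn_gt0.
pose F x : R := f x + eta * dotp (x - 0) (x - 0).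
have lF : lapl O F (fun x => L x + eta * (2 * n.+1%:R)).
  by apply: laplD => //; apply: laplZ; exact: lapl_sq.
have sqle x : O x -> eta * dotp (x - 0) (x - 0) <= m / 4.
  move=> Ox; rewrite subr0 -enorm_sqr.
  have -> : m / 4 = eta * B ^+ 2.
    rewrite /eta -mulrA [_^-1 * _]mulrC invfM; field.
    by rewrite lt0r_neq0.
  by rewrite ler_wpM2l ?(ltW eta0)// lerXn2r ?nnegrE ?enorm_ge0 ?hB// ltW.
have sq0 x : 0 <= eta * dotp (x - 0) (x - 0) by rewrite mulr_ge0 ?(ltW eta0) ?dotpxx_ge0.
have [||x1 Ox1 mx1] := @max_attained O F x0 oO bO _ Ox0.
- by move=> x Ox; have [fd [fdd /(_ x Ox)[]]] := lF.
- move=> z cz nz; have [d d0 h] := bf z cz nz (m / 4) ltac:(lra).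
  exists d => // x Ox xz; have := h x Ox xz; have := sqle x Ox; have := sq0 x0.
  by rewrite /F /m; lra.
have [F1 [F2 hF]] := lF.
have [_ _ _ sF] := hF x1 Ox1.
have [r r0 rO] := open_ball_in oO Ox1.
suff : \sum_i F2 i x1 <= 0.
  rewrite -sF => h; have := L0 x1 Ox1.
  have : 0 < eta * (2 * n.+1%:R) by rewrite mulr_gt0// mulr_gt0// ltr0n.
  lra.
apply: sumr_le0 => i _.
apply: (@local_max_d2 O F (F1 i) x1 (ee i) (F2 i x1) r r0 (enorm_ee i)).
- by move=> y yr; apply: mx1; exact: rO.
- by move=> y yr; have [] := hF y (rO y yr).
- by have [] := hF x1 Ox1.
Qed.

End Calculus.

(** * Orthogonal invariance and the interior gradient estimate *)

Section Interior.
Context {R : realType} {n : nat}.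
Local Notation V := 'rV[R]_n.+1.
Local Notation I := 'I_n.+1.
Local Notation N := (n.+1%:R : R).
Implicit Types (x y z v nu : V) (c r : R) (O D : set V) (f g u w : V -> R^o).

Definition eB x r : set V := [set y | enorm (y - x) < r].

Lemma eB_open x r : open (eB x r).
Proof.
apply/openP_enorm => y yx; exists (r - enorm (y - x)); first by rewrite subr_gt0.
move=> z zy; rewrite /eB/=; have := enorm_tri y z x; lra.
Qed.

Lemma eB_center x r : 0 < r -> eB x r x.
Proof. by move=> r0; rewrite /eB/= subrr enorm0. Qed.

Lemma eB_sub x y r s : enorm (y - x) + s <= r -> eB y s `<=` eB x r.
Proof.
by move=> h z; rewrite /eB/= => zy; have := enorm_tri y z x; lra.
Qed.

Lemma eB_bounded x r : ebounded (eB x r).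
Proof.
exists (r + enorm x) => y yx; have := enormD (y - x) x; rewrite subrK.
by move: yx; rewrite /eB/=; lra.
Qed.

Lemma MVT_signed f x v (g : R -> R) (h l M : R) :
  (forall t : R, `|t| <= `|h| -> is_derive (x + t *: v) v f (g t)) ->
  (forall t : R, `|t| <= `|h| -> `|g t - l| <= M) ->
  `|f (x + h *: v) - f x - h * l| <= M * `|h|.
Proof.
move=> df gM; have [->|h0] := eqVneq h 0.
  by rewrite scale0r addr0 subrr mul0r subr0 normr0 mulr0.
have [hp|hp] := leP 0 h.
  have hlt : 0 < h by rewrite lt_def h0.
  have [|c /andP[c0 ch]] := @MVT_line _ _ f x v g 0 h hlt.
    by move=> t /andP[t0 th]; apply: df; rewrite !ger0_norm.
  rewrite scale0r addr0 subr0 => ->; rewrite mulrC -mulrBr normrM mulrC ler_wpM2r//.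
  by apply: gM; rewrite !ger0_norm// ltW.
have [|c /andP[c0 ch]] := @MVT_line _ _ f x v g h 0 hp.
  by move=> t /andP[t0 th]; apply: df; rewrite ler0_norm// ltr0_norm// lerN2.
rewrite scale0r addr0 sub0r => e.
have -> : f (x + h *: v) - f x - h * l = h * (g c - l).
  have -> : f (x + h *: v) = f x + g c * h by move: e; rewrite mulrN; lra.
  by ring.
rewrite normrM mulrC ler_wpM2r//; apply: gM.
by rewrite ltr0_norm// ltr0_norm// lerN2 ltW.
Qed.

Lemma enorm_sum (m : nat) (F : 'I_m -> V) (P : pred 'I_m) :
  enorm (\sum_(i | P i) F i) <= \sum_(i | P i) enorm (F i).
Proof.
apply: (big_ind2 (fun (a : V) (b : R) => enorm a <= b)) => [|a b c d ab cd|i _]//.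
  by rewrite enorm0.
exact: le_trans (enormD _ _) (lerD ab cd).
Qed.

(** The displacement is split into steps parallel to the axes. On each step the mean value theorem
    compares the increment with the partial derivative at [x], and continuity at [x] controls the
    sum. *)
Lemma dirder O f (fd : I -> V -> R) x v : open O -> O x ->
  (forall i y, O y -> is_derive y (ee i) f (fd i y : R)) ->
  (forall i, cont_at (fd i) x) ->
  is_derive x v f (\sum_i v 0 i * fd i x : R).
Proof.
move=> oO Ox df cf; apply/is_deriveP => e e0.
have [r r0 rO] := open_ball_in oO Ox.
pose S : R := \sum_i `|v 0 i| + 1.
have S0 : 0 < S by rewrite ltr_wpDl// sumr_ge0.
have [d d0 hd] : exists2 d : R, 0 < d & forall i y, enorm (y - x) < d -> `|fd i y - fd i x| < e / S.
  have /choice[D hD] : forall i, exists d : R, 0 < d /\ forall y, enorm (y - x) < d -> `|fd i y - fd i x| < e / S.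
    by move=> i; have [d d0 h] := cf i (e / S) ltac:(by rewrite divr_gt0); exists d.
  exists (\big[Num.min/1]_i D i).
    by apply/bigmin_gtP; split => // i _; have [] := hD i.
  move=> i y yx; have [_ h] := hD i; apply: h; apply: lt_le_trans yx _.
  exact: bigmin_le_cond.
exists (Num.min d r / S); first by rewrite divr_gt0// lt_min d0.
move=> h; rewrite ltr_pdivlMr// lt_min => /andP[hS hr].
(* [y k] has already moved by the first [k] coordinates of [h *: v], so consecutive points differ
   along one axis. *)
pose y k : V := x + h *: \sum_(i < n.+1 | (i < k)%N) v 0 i *: ee i.
have yS (k : I) : y k.+1 = y k + (h * v 0 k) *: ee k.
  rewrite /y (bigD1 k)//= scalerDr scalerA addrCA addrC; congr (x + h *: _ + _).
  apply: eq_bigl => i; rewrite ltnS andbC ltn_neqAle; congr (_ && _).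
have y0 : y 0%N = x by rewrite /y big_pred0 ?scaler0 ?addr0// => i; rewrite ltn0.
have yn : y n.+1 = x + h *: v.
  rewrite /y [in RHS](row_sum_delta v); congr (x + h *: _).
  by apply: eq_bigl => i; rewrite ltn_ord.
have dy (k : I) (t : R) : `|t| <= `|h * v 0 k| -> enorm (y k + t *: ee k - x) <= `|h| * S.
  move=> ht; rewrite /y addrAC [x + _]addrC addrK.
  apply: le_trans (enormD _ _) _; rewrite !enormZ enorm_ee mulr1.
  apply: le_trans (lerD (lexx _) ht) _; rewrite normrM -mulrDr ler_wpM2l//.
  apply: le_trans (lerD (enorm_sum _ _) (lexx _)) _.
  under eq_bigr do rewrite enormZ enorm_ee mulr1.
  rewrite /S; apply: ler_wpDr => //; rewrite [leRHS](bigD1 k)//= [leLHS]addrC; apply: lerD => //.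
  rewrite big_mkcond [leRHS]big_mkcond/=; apply: ler_sum => i _.
  case: ltnP => ik; last by case: ifP.
  by rewrite ifT//; apply: contraTneq ik => ->; rewrite ltnn.
have tel : f (x + h *: v) - f x = \sum_(k < n.+1) (f (y k.+1) - f (y k)).
  rewrite -yn -[in LHS]y0.
  by rewrite -(telescope_sumr (fun k => f (y k)) (leq0n n.+1)) big_mkord.
rewrite tel mulr_sumr -sumrB.
apply: le_trans (ler_norm_sum _ _ _) _.
apply: (@le_trans _ _ (\sum_(k < n.+1) e / S * `|h * v 0 k|)).
  apply: ler_sum => k _; rewrite yS mulrA.
  apply: (@MVT_signed f (y k) (ee k) (fun t => fd k (y k + t *: ee k)) (h * v 0 k) (fd k x)).
    move=> t ht; apply: df; apply: rO; exact: le_lt_trans (dy k t ht) hr.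
  by move=> t ht; apply/ltW/hd; exact: le_lt_trans (dy k t ht) hS.
under eq_bigr do rewrite normrM mulrCA.
rewrite -mulr_sumr mulrC -mulr_sumr ler_wpM2r// mulrAC -mulrA ger_pMr// ler_pdivrMr// mul1r.
by rewrite /S lerDl.
Qed.

Lemma hasC2_dirder O f fd fdd x v : open O -> hasC2 O f fd fdd -> O x ->
  is_derive x v f (\sum_i v 0 i * fd i x : R).
Proof.
move=> oO h Ox; apply: (dirder v oO Ox).
  by move=> i y /h[].
by move=> i; have [] := h x Ox.
Qed.

Lemma hasC2_dirder1 O f fd fdd x v i : open O -> hasC2 O f fd fdd -> O x ->
  is_derive x v (fd i : V -> R^o) (\sum_j v 0 j * fdd i j x : R).
Proof.
move=> oO h Ox; apply: (dirder (fd := fdd i) v oO Ox).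
  by move=> j y /h[].
by move=> j; have [] := h x Ox.
Qed.

Lemma is_derive_sumf (m : nat) (F : 'I_m -> V -> R) x v (d : 'I_m -> R) :
  (forall i, is_derive x v (F i : V -> R^o) (d i)) ->
  is_derive x v (fun y => \sum_i F i y : R^o) (\sum_i d i).
Proof.
move=> h; rewrite (_ : (fun y => _) = \sum_(i < m) (F i : V -> R^o)).
  exact: (@is_derive_sum R V R^o m (fun i => (F i : V -> R^o)) x v d).
by apply/funext => y; rewrite fct_sumE.
Qed.

Lemma dotp_mulmx x y : dotp x y = (x *m y^T) 0 0.
Proof. by rewrite mxE; apply: eq_bigr => i _; rewrite mxE. Qed.

Lemma is_derive_mulmx f (A : 'M[R]_n.+1) x v (l : R) :
  is_derive (x *m A) (v *m A) f l -> is_derive x v (fun y => f (y *m A)) l.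
Proof.
move=> /is_deriveP h; apply/is_deriveP => e /h[d d0 hd]; exists d => // t /hd.
by rewrite mulmxDl -scalemxAl.
Qed.

Lemma cont_mulmx f (A : 'M[R]_n.+1) x : A *m A^T = 1%:M ->
  cont_at f (x *m A) -> cont_at (fun y => f (y *m A)) x.
Proof.
move=> AA cf e /cf[d d0 h]; exists d => // y yx; apply: h.
by rewrite -mulmxBl enormE dotp_mulmx trmx_mul mulmxA -[_ *m A *m _]mulmxA AA mulmx1 -dotp_mulmx -enormE.
Qed.

(** Two applications of the chain rule contract the Hessian with [A^T A], which is the identity, so
    its trace is unchanged. *)
Lemma harm_orth O f (A : 'M[R]_n.+1) : open O -> A *m A^T = 1%:M -> A^T *m A = 1%:M ->
  harm O f -> harm [set x | O (x *m A)] (fun x => f (x *m A)).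
Proof.
move=> oO AA AA' [fd [fdd [h h0]]].
have rA i k : ((ee i : V) *m A) 0 k = A i k.
  by rewrite /ee -rowE mxE.
exists (fun i x => \sum_k A i k * fd k (x *m A)),
  (fun i j x => \sum_k A i k * \sum_l A j l * fdd k l (x *m A)); split.
  move=> x Ox; have [a b c d e] := h _ Ox; split => [|i|i j|i|i j].
  - exact: cont_mulmx.
  - by apply: cont_sum => k; apply: contZ; apply: cont_mulmx.
  - by apply: cont_sum => k; apply: contZ; apply: cont_sum => l; apply: contZ; apply: cont_mulmx.
  - have := hasC2_dirder (ee i *m A) oO h Ox; under eq_bigr do rewrite rA.
    exact: is_derive_mulmx.
  - apply: (@is_derive_sumf _ (fun k y => A i k * fd k (y *m A)) x (ee j)
         (fun k => A i k * (\sum_l A j l * fdd k l (x *m A)))) => k.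
    apply: (@is_deriveZ _ _ _ (fun y => fd k (y *m A) : R^o) (A i k)).
    have := hasC2_dirder1 (ee j *m A) k oO h Ox; under eq_bigr do rewrite rA.
    exact: is_derive_mulmx.
move=> x Ox; rewrite exchange_big/= -[RHS](h0 _ Ox); apply: eq_bigr => k _.
under eq_bigr do rewrite mulr_sumr; rewrite exchange_big/=.
have e l : \sum_i A i k * (A i l * fdd k l (x *m A)) = (k == l)%:R * fdd k l (x *m A).
  under eq_bigr do rewrite mulrA; rewrite -mulr_suml; congr (_ * _).
  have := congr1 (fun B : 'M[R]_n.+1 => B k l) AA'; rewrite !mxE => <-.
  by apply: eq_bigr => i _; rewrite mxE.
under eq_bigr do rewrite e; rewrite (bigD1 k)//= eqxx mul1r big1 ?addr0// => l lk.
by rewrite eq_sym (negbTE lk) mul0r.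
Qed.

Definition refl nu x : V := x - (2 * dotp nu x) *: nu.

Lemma dotp_refl nu x : enorm nu = 1 -> dotp nu (refl nu x) = - dotp nu x.
Proof.
by move=> h; rewrite /refl dotpBr dotpZr -enorm_sqr h expr1n mulr1; ring.
Qed.

Lemma reflK nu : enorm nu = 1 -> involutive (refl nu).
Proof.
move=> h x; rewrite {1}/refl dotp_refl// /refl mulrN scaleNr opprK.
by rewrite subrK.
Qed.

Lemma enorm_refl nu x : enorm nu = 1 -> enorm (refl nu x) = enorm x.
Proof.
move=> h; rewrite !enormE /refl dotpBl !dotpBr !dotpZl !dotpZr -(enorm_sqr nu) h.
by rewrite (dotpC x nu); congr (Num.sqrt _); ring.
Qed.

Lemma reflB nu x y : refl nu (x - y) = refl nu x - refl nu y.
Proof.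
by rewrite /refl dotpBr; apply/rowP => i; rewrite !mxE; ring.
Qed.

(** On row vectors the reflection is right multiplication by the symmetric matrix [1 - 2 nu^T nu],
    its own inverse for a unit vector [nu]. *)
Lemma harm_refl nu O f : enorm nu = 1 -> open O -> harm O f ->
  harm [set x | O (refl nu x)] (fun x => f (refl nu x)).
Proof.
move=> h oO hf; pose A : 'M[R]_n.+1 := 1%:M - 2 *: (nu^T *m nu).
have At : A^T = A by rewrite /A !raddfB/= trmx1 linearZ/= trmx_mul trmxK.
have nn : nu *m nu^T = 1%:M.
  by apply/matrixP => i j; rewrite !ord1 -dotp_mulmx -enorm_sqr h expr1n mxE eqxx.
have AA : A *m A = 1%:M.
  rewrite /A mulmxBl mul1mx mulmxBr mulmx1 -scalemxAl -scalemxAr mulmxA -[_ *m nu *m _]mulmxA nn mulmx1.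
  by move: (nu^T *m nu) => P; apply/matrixP => i j; rewrite !mxE; ring.
have rE x : refl nu x = x *m A.
  rewrite /refl /A mulmxBr mulmx1; congr (_ - _).
  rewrite -scalemxAr mulmxA -scalerA; congr (_ *: _).
  have -> : x *m nu^T = (dotp nu x)%:M.
    by apply/matrixP => i j; rewrite !ord1 -dotp_mulmx mxE eqxx dotpC.
  by rewrite mul_scalar_mx.
have := @harm_orth O f A oO; rewrite At => /(_ AA AA hf).
have -> : [set x | O (refl nu x)] = [set x | O (x *m A)].
  by apply/seteqP; split => x /=; rewrite rE.
by rewrite (_ : (fun x => f (refl nu x)) = (fun x => f (x *m A)))//; apply/funext => x; rewrite rE.
Qed.

Lemma bsup_cont O f c : (\bd z of O, cont_at f z /\ f z <= c) ->
  bsup O f (fun=> c).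
Proof.
move=> h z cz nz e e0; have [cf fz] := h z cz nz; have [d d0 hd] := cf e e0.
exists d => // x _ /hd; rewrite ltr_norml => /andP[_]; lra.
Qed.

Lemma sumR_eq (m : nat) (F G : 'I_m -> R) : (forall i, F i = G i) ->
  \sum_i F i = \sum_i G i.
Proof. by move=> FG; apply: eq_bigr. Qed.

Lemma lapl_dotp2 O v : lapl O (fun x => dotp v x * dotp v x) (fun=> 2 * dotp v v).
Proof.
have h : hasC2 O (fun x => dotp v x) (fun i _ => v 0 i) (fun _ _ _ => 0).
  move=> x Ox; split => [|i|i j|i|i j]; try exact: cont_cst; try exact: cont_dotp.
    apply/is_deriveP => e e0; exists 1 => // t _.
    by rewrite dotpDr dotpZr dotp_ee [dotp v x + _]addrC addrK subrr normr0 mulr_ge0// ltW.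
  exact: is_derive_cst.
apply: lapl_eq (hasC2_lapl (hasC2M h h)) => x _ /=.
apply: (etrans (sumR_eq (G := fun i => 2 * (v 0 i * v 0 i)) _)); last by rewrite -mulr_sumr.
by move=> i; ring.
Qed.

(* The part of [u] that is odd in the direction [nu] is compared on a half-ball
   with a quadratic harmonic polynomial vanishing at the centre. *)
Lemma grad_est_le u x0 r nu (M d : R) : 0 < r -> enorm nu = 1 ->
  harm (eB x0 r) u -> (forall x, eB x0 r x -> `|u x| <= M) ->
  is_derive x0 nu u d -> d <= 2 * N * M / r.
Proof.
move=> r0 nu1 hu uM du.
have M0 : 0 <= M by apply: le_trans (uM x0 (eB_center _ r0)).
pose w x : R := u (x0 + 1 *: x).
have hw : harm (eB 0 r) w.
  apply: harm_sub (harm_aff 1 x0 hu) => x; rewrite /eB/= subr0 scale1r.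
  by rewrite addrC addKr.
have wM x : enorm x < r -> `|w x| <= M.
  by move=> xr; apply: uM; rewrite /eB/= scale1r addrC addKr.
pose phi x : R := 2^-1 * (w x - w (refl nu x)).
have hphi : harm (eB 0 r) phi.
  apply: harmZ; apply: harmB => //.
  apply: harm_sub (harm_refl nu1 (@eB_open 0 r) hw) => x.
  by rewrite /eB/= !subr0 enorm_refl.
pose rho : R := r / 2.
have rho0 : 0 < rho by rewrite /rho; lra.
(* With [t = nu.x] this is [M / rho^2 (|x|^2 - N t^2 + N rho t)]: harmonic because [2 N - 2 N = 0],
   nonnegative on the flat face, at least [M] on the spherical face, and of slope [N M / rho] at the
   centre. *)
pose psi x : R := M / rho ^+ 2 * ((dotp (x - 0) (x - 0) + - N * (dotp nu x * dotp nu x)) + N * rho * dotp nu x).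
have lpsi O : lapl O psi (fun=> 0).
  rewrite /psi; have h1 := laplD (laplD (lapl_sq O 0) (laplZ (- N) (lapl_dotp2 O nu)))
    (laplZ (N * rho) (harm_lapl (harm_dotp O nu))).
  apply: lapl_eq (laplZ (M / rho ^+ 2) h1) => x _ /=.
  rewrite -(enorm_sqr nu) nu1; ring.
pose H := eB 0 rho `&` [set x | 0 < dotp nu x].
have oH : open H.
  apply: openI; first exact: eB_open.
  apply/openP_enorm => x /= x0'; have [e e0 h] := @cont_dotp R n nu x _ x0'.
  exists e => // y /h; rewrite ltr_norml => /andP[]; lra.
have clH z : closure H z -> enorm z <= rho /\ 0 <= dotp nu z.
  move=> /closure_enormP cz; split; rewrite leNgt; apply/negP => hz.
    have [y [yB _] yz] := cz (enorm z - rho) ltac:(lra).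
    move: yB; rewrite /eB/= subr0 => yB; have := enorm_rdist y z.
    rewrite ler_norml => /andP[]; lra.
  have [e e0 he] := @cont_dotp R n nu z (- dotp nu z) ltac:(lra).
  have [y [_ /= yB] /he] := cz e e0; rewrite ltr_norml => /andP[]; lra.
have psi_ge z : enorm z <= rho -> 0 <= dotp nu z -> 0 <= psi z.
  move=> zr tz; rewrite /psi mulr_ge0 ?divr_ge0 ?sqr_ge0// subr0.
  have := dotpxx_ge0 z.
  have tr : dotp nu z <= rho.
    by apply: le_trans (ler_norm _) _; apply: le_trans (cauchy_schwarz _ _) _; rewrite nu1 mul1r.
  have : 0 <= N * (dotp nu z * (rho - dotp nu z)) by rewrite !mulr_ge0// subr_ge0.
  lra.
have hle x : H x -> phi x <= psi x.
  have [B hB] := eB_bounded 0 rho.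
  move=> Hx; rewrite -subr_le0 -[- psi x]mulN1r.
  apply: (@max_principle _ _ H (fun x => phi x + -1 * psi x) (fun=> 0 + -1 * 0) 0) => //.
  - by exists B => y [yB _]; exact: hB.
  - apply: laplD; last exact: laplZ.
    apply/harm_lapl/(harm_sub _ hphi) => y [+ _]; rewrite /eB/= !subr0 => yr.
    by apply: lt_trans yr _; rewrite /rho; lra.
  - apply: bsup_cont => z cz nz; have [zr tz] := clH z cz.
    have zr' : enorm z < r by apply: le_lt_trans zr _; rewrite /rho; lra.
    split.
      apply: contD; first by apply: harm_cont hphi _; rewrite /eB/= subr0.
      apply: contZ; have [fd [fdd h]] := lpsi setT; by have []  := h z Logic.I.
    have [tz0|tz0] := eqVneq (dotp nu z) 0.
      have -> : phi z = 0 by rewrite /phi /refl tz0 mulr0 scale0r subr0 subrr mulr0.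
      have := psi_ge z zr tz; lra.
    have ez : enorm z = rho.
      apply/eqP; rewrite eq_le zr leNgt; apply/negP => zr2; apply: nz; split => /=.
        by rewrite /eB/= subr0.
      by rewrite lt_def tz0.
    have : phi z <= M.
      have := wM z zr'; have := wM (refl nu z); rewrite enorm_refl// => /(_ zr').
      rewrite !ler_norml /phi => /andP[a b] /andP[c e]; lra.
    suff : M <= psi z by lra.
    rewrite /psi subr0 -enorm_sqr ez.
    have -> : M / rho ^+ 2 * (rho ^+ 2 + - N * (dotp nu z * dotp nu z) + N * rho * dotp nu z)
       = M + M / rho ^+ 2 * (N * (dotp nu z * (rho - dotp nu z))).
      by field; rewrite lt0r_neq0.
    rewrite lerDl mulr_ge0 ?divr_ge0 ?sqr_ge0// !mulr_ge0// subr_ge0.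
    by apply: le_trans (ler_norm _) _; apply: le_trans (cauchy_schwarz _ _) _; rewrite nu1 mul1r.
have key t : 0 < t < rho -> phi (t *: nu) <= N * M / rho * t.
  move=> /andP[t0 tr]; apply: le_trans (hle _ _) _.
    split; first by rewrite /eB/= subr0 enormZ nu1 mulr1 gtr0_norm.
    by rewrite /= dotpZr -enorm_sqr nu1 expr1n mulr1.
  rewrite /psi subr0 !dotpZr dotpZl -enorm_sqr nu1 expr1n !mulr1.
  have -> : M / rho ^+ 2 * (t * t + - N * (t * t) + N * rho * t) =
     N * M / rho * t - M / rho ^+ 2 * ((N - 1) * t ^+ 2).
    by field; rewrite lt0r_neq0.
  rewrite lerBlDr lerDl; apply: mulr_ge0; first by rewrite divr_ge0 ?sqr_ge0.
  by rewrite mulr_ge0 ?sqr_ge0// subr_ge0 ler1n.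
have -> : 2 * N * M / r = N * M / rho by rewrite /rho; field; rewrite lt0r_neq0.
apply/ler_addgt0Pr => e e0.
move/is_deriveP : du => /(_ e e0)[del del0 hdel].
pose t : R := Num.min (del / 2) (rho / 2).
have t0 : 0 < t by rewrite lt_min; apply/andP; split; lra.
have td : t < del by rewrite /t gt_min; apply/orP; left; lra.
have tr : t < rho by rewrite /t gt_min; apply/orP; right; lra.
have := key t ltac:(by rewrite t0 tr).
have := hdel t ltac:(by rewrite gtr0_norm); have := hdel (- t) ltac:(by rewrite normrN gtr0_norm).
rewrite normrN (gtr0_norm t0) /phi /w !scale1r.
have -> : refl nu (t *: nu) = - t *: nu.
  rewrite /refl dotpZr -enorm_sqr nu1 expr1n mulr1 -scalerBl; congr (_ *: _); ring.
rewrite !ler_norml => /andP[a1 a2] /andP[a3 a4] a5.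
have : t * d <= t * (N * M / rho + e) by nra.
by rewrite ler_pM2l.
Qed.

Lemma grad_est u x0 r nu (M d : R) : 0 < r -> enorm nu = 1 ->
  harm (eB x0 r) u -> (forall x, eB x0 r x -> `|u x| <= M) ->
  is_derive x0 nu u d -> `|d| <= 2 * N * M / r.
Proof.
move=> r0 nu1 hu uM du; rewrite ler_norml; apply/andP; split; last exact: grad_est_le du.
rewrite lerNl; apply: (grad_est_le r0 nu1 (harmN hu)).
  by move=> x /uM; rewrite normrN.
Qed.

End Interior.

(** * Limits with explicit rates *)

Section Limits.
Context {R : realType}.

(** The reference speed of convergence: errors written as a constant times [ik k] replace
    filters. *)
Definition ik (k : nat) : R := k.+1%:R^-1.

Lemma ik_gt0 k : 0 < ik k.
Proof. by rewrite /ik invr_gt0. Qed.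

Lemma ik_small (e : R) : 0 < e -> exists k, ik k < e.
Proof.
move=> e0; exists (Num.truncn e^-1); rewrite /ik invf_plt ?posrE//.
exact: truncnS_gt.
Qed.

(** All lower bounds [a k - b k] lie below all upper bounds [a l + b l]; the supremum of the former
    is a limit that inherits the rate [b]. *)
Lemma seq_lim (a b : nat -> R) : (forall k l, `|a k - a l| <= b k + b l) ->
  exists s, forall k, `|a k - s| <= b k.
Proof.
move=> h; pose S := [set a k - b k | k in setT].
have ub l : ubound S (a l + b l).
  move=> _ [k _ <-]; have := h k l; rewrite ler_norml => /andP[_]; lra.
exists (sup S) => k; rewrite ler_distl; apply/andP; split.
  by rewrite lerBlDr; apply: ge_sup; [exists (a 0%N - b 0%N), 0%N|exact: ub].
rewrite -lerBlDr; apply: ub_le_sup; last by exists k.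
by exists (a k + b k); exact: ub.
Qed.

Lemma le_lim_ik (x y c : R) : (forall k, x <= y + c * ik k) -> x <= y.
Proof.
move=> h; apply/ler_addgt0Pr => e e0.
have [k kk] := @ik_small (e / (`|c| + 1)) ltac:(by rewrite divr_gt0// ltr_wpDl).
apply: le_trans (h k) _; rewrite lerD2l.
apply: le_trans (ler_wpM2r (ltW (ik_gt0 k)) (ler_norm c)) _.
move: kk; rewrite ltr_pdivlMr ?ltr_wpDl// => kk.
apply: le_trans (ltW kk); rewrite mulrC ler_wpM2l ?(ltW (ik_gt0 _))//.
by rewrite lerDl.
Qed.

End Limits.

(** * Second derivative estimates, uniform limits and derivatives of harmonic functions *)

Section Smooth.
Context {R : realType} {n : nat}.
Local Notation V := 'rV[R]_n.+1.
Local Notation N := (n.+1%:R : R).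
Implicit Types (x y z v : V) (c r M : R) (O D : set V) (g u w : V -> R^o) (i j : 'I_n.+1).

Lemma sum_lin0 (m : nat) (F G : 'I_m -> R) (a : R) : \sum_i F i = 0 ->
  \sum_i G i = 0 -> \sum_i (F i + a * G i) = 0.
Proof. by move=> F0 G0; rewrite big_split/= -mulr_sumr F0 G0 mulr0 addr0. Qed.

Lemma sum_close0 (m : nat) (F G : 'I_m.+1 -> R) (a b : R) : \sum_i F i = 0 ->
  (forall k, `|F k - G k| <= a * b) -> `|\sum_i G i| <= m.+1%:R * a * b.
Proof.
move=> F0 FG; have -> : \sum_k G k = - \sum_k (F k - G k) by rewrite sumrB F0 sub0r opprK.
rewrite normrN.
apply: le_trans (ler_norm_sum _ _ _) _.
apply: (@le_trans _ _ (\sum_(i < m.+1) a * b)).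
  exact: ler_sum.
by rewrite sumr_const card_ord -[leRHS]mulrA mulr_natl.
Qed.

Lemma partial_est u fd fdd x0 r M i : 0 < r -> hasC2 (eB x0 r) u fd fdd ->
  (forall x, eB x0 r x -> \sum_i fdd i i x = 0) ->
  (forall x, eB x0 r x -> `|u x| <= M) ->
  forall x, eB x0 (r / 2) x -> `|fd i x| <= 4 * N * M / r.
Proof.
move=> r0 hu h0 uM x xB.
have sB : eB x (r / 2) `<=` eB x0 r by apply: eB_sub; move: xB; rewrite /eB/=; lra.
have hx : harm (eB x (r / 2)) u.
  by apply: harm_sub sB _; exists fd, fdd.
have [_ _ _ d _] := hu x (sB x (@eB_center _ _ x (r / 2) ltac:(lra))).
apply: le_trans (grad_est _ (enorm_ee i) hx _ (d i)) _; first lra.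
  by move=> y /sB; exact: uM.
by apply: le_of_eq; field; rewrite lt0r_neq0.
Qed.

(** First derivatives are not yet known to be harmonic, so the gradient estimate is applied to the
    increment of [u] along axis [j]. It is harmonic and of size [h] times the gradient bound;
    dividing by [h] gives the second derivative. *)
Lemma snd_est u fd fdd x0 r M i j : 0 < r -> hasC2 (eB x0 r) u fd fdd ->
  (forall x, eB x0 r x -> \sum_i fdd i i x = 0) ->
  (forall x, eB x0 r x -> `|u x| <= M) ->
  `|fdd i j x0| <= 32 * N ^+ 2 * M / r ^+ 2.
Proof.
move=> r0 hu h0 uM.
have pe := partial_est _ r0 hu h0 uM.
have M0 : 0 <= M by apply: le_trans (uM x0 (eB_center _ r0)).
have [_ _ _ _ d] := hu x0 (eB_center _ r0).
apply/ler_addgt0Pr => e e0.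
have /is_deriveP /(_ e e0)[del del0 hdel] := d i j.
pose h : R := Num.min (del / 2) (r / 8).
have hp : 0 < h by rewrite lt_min; apply/andP; split; lra.
have hd : h < del by rewrite /h gt_min; apply/orP; left; lra.
have hr : h <= r / 8 by rewrite /h ge_min lexx orbT.
pose D x : R := u (h *: ee j + 1 *: x) - u x.
have sB : eB x0 (r / 4) `<=` eB x0 r by apply: eB_sub; rewrite subrr enorm0; lra.
have hD : harm (eB x0 (r / 4)) D.
  have hu' : harm (eB x0 r) u by exists fd, fdd.
  apply: harmB; last exact: harm_sub sB _.
  apply: harm_sub (harm_aff 1 (h *: ee j) hu') => x; rewrite /eB/= scale1r => xB.
  rewrite -addrA; apply: le_lt_trans (enormD _ _) _.
  by rewrite enormZ enorm_ee mulr1 (gtr0_norm hp); lra.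
have DM x : eB x0 (r / 4) x -> `|D x| <= 4 * N * M / r * h.
  move=> xB; rewrite /D scale1r addrC [_ + x]addrC addrC.
  have tB t : 0 <= t <= h -> eB x0 (r / 2) (x + t *: ee j).
    move=> /andP[t0 th]; rewrite /eB/= addrAC; apply: le_lt_trans (enormD _ _) _.
    by move: xB; rewrite /eB/= enormZ enorm_ee mulr1 (ger0_norm t0); lra.
  apply: (@MVT_line_le _ _ u x (ee j) (fun t => fd j (x + t *: ee j))) => [|t tt|t /tB]; first exact: ltW.
    have : eB x0 r (x + t *: ee j) by have := tB t tt; rewrite /eB/=; lra.
    by move=> /hu[_ _ _ dd _]; exact: dd.
  exact: pe.
have dD : is_derive x0 (ee i) D (fd i (x0 + h *: ee j) - fd i x0 : R).
  apply: is_deriveB; last by have [_ _ _ dd _] := hu x0 (eB_center _ r0); exact: dd.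
  have : eB x0 r (x0 + h *: ee j).
    by rewrite /eB/= addrC addKr enormZ enorm_ee mulr1 (gtr0_norm hp); lra.
  move=> /hu[_ _ _ dd _]; have := dd i; rewrite addrC -{1}[x0]scale1r => dd'.
  by have := is_derive_aff dd'; rewrite mul1r.
have r40 : 0 < r / 4 by lra.
have := grad_est r40 (enorm_ee i) hD DM dD.
have := hdel h; rewrite (gtr0_norm hp) => /(_ hd).
have -> : 2 * N * (4 * N * M / r * h) / (r / 4) = (32 * N ^+ 2 * M / r ^+ 2) * h.
  by field; rewrite lt0r_neq0.
move=> a b; rewrite -(ler_pM2r hp) mulrDl -{1}(gtr0_norm hp) -normrM mulrC.
have -> : h * fdd i j x0 = (fd i (x0 + h *: ee j) - fd i x0) - (fd i (x0 + h *: ee j) - fd i x0 - h * fdd i j x0) by ring.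
by apply: le_trans (ler_normB _ _) _; apply: lerD.
Qed.

Lemma snd_est_half u fd fdd x0 r M i j : 0 < r -> hasC2 (eB x0 r) u fd fdd ->
  (forall x, eB x0 r x -> \sum_i fdd i i x = 0) ->
  (forall x, eB x0 r x -> `|u x| <= M) ->
  forall x, eB x0 (r / 2) x -> `|fdd i j x| <= 128 * N ^+ 2 * M / r ^+ 2.
Proof.
move=> r0 hu h0 uM x xB.
have sB : eB x (r / 2) `<=` eB x0 r by apply: eB_sub; move: xB; rewrite /eB/=; lra.
apply: le_trans (@snd_est u fd fdd x (r / 2) M i j _ _ _ _) _; first lra.
- by move=> y /sB; exact: hu.
- by move=> y /sB; exact: h0.
- by move=> y /sB; exact: uM.
by apply: le_of_eq; field; rewrite lt0r_neq0.
Qed.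

Lemma harm_partial_wit O u : open O -> harm O u ->
  hasC2 O u (fun i => partial i u) (fun i j => partial j (partial i u)) /\
  forall x, O x -> \sum_i (partial i (partial i u) x : R) = 0.
Proof.
move=> oO /(harmonic_inP _ oO)[[cf d1] hl]; split => // x Ox; split => [|i|i j|i|i j].
- exact/cont_atP/cf.
- by have [_ /= [h _]] := d1 i; exact/cont_atP/h.
- by have [_ /= [_ /(_ j)[_ [h _]]]] := d1 i; exact/cont_atP/h.
- by have [h _] := d1 i; apply: derivableP; exact: h.
- by have [_ /= [_ /(_ j)[h _]]] := d1 i; apply: derivableP; exact: h.
Qed.

(** [partial] provides witnesses that do not depend on the ball, so nothing has to be glued. *)
Lemma harm_local O u :
  (forall x, O x -> exists2 r : R, 0 < r & harm (eB x r) u) -> harm O u.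
Proof.
move=> h; exists (fun i => partial i u), (fun i j => partial j (partial i u)).
split => x Ox; have [r r0 hr] := h x Ox;
  have [a b] := harm_partial_wit (@eB_open _ _ x r) hr.
  exact/a/eB_center.
exact/b/eB_center.
Qed.

(** The mean value theorem is applied to [a_ l - a_ k], whose derivative is at most
    [C ik k + C ik l]. Letting [l] grow compares the increment of [a] with that of a fixed
    [a_ k]. *)
Lemma deriv_lim (a_ b_ : nat -> V -> R^o) (a b : V -> R^o) (C : R) x r v : 0 < r ->
  (forall k y, eB x r y -> is_derive y v (a_ k) (b_ k y : R)) ->
  (forall k y, eB x r y -> `|a_ k y - a y| <= C * ik k) ->
  (forall k y, eB x r y -> `|b_ k y - b y| <= C * ik k) ->
  is_derive x v a (b x : R).
Proof.
move=> r0 da aa bb.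
have C0 : 0 <= C.
  have := le_trans (normr_ge0 _) (aa 0%N x (eB_center _ r0)).
  by rewrite pmulr_lge0// ik_gt0.
apply/is_deriveP => e e0.
have [k kk] := @ik_small _ (e / (4 * C + 1)) ltac:(rewrite divr_gt0//; lra).
have Ck : 3 * C * ik k <= e / 2 + e / 4.
  have := ik_gt0 (R := R) k; move: kk; rewrite ltr_pdivlMr; last lra.
  by move=> a1 a2; nra.
have /is_deriveP /(_ (e / 4) ltac:(lra))[d d0 hd] := da k x (eB_center _ r0).
exists (Num.min d (r / (enorm v + 1))).
  by rewrite lt_min d0 divr_gt0// ltr_wpDl// enorm_ge0.
move=> h; rewrite lt_min => /andP[hd1 hr].
have tB t : `|t| <= `|h| -> eB x r (x + t *: v).
  move=> th; rewrite /eB/= addrC addKr enormZ.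
  move: hr; rewrite ltr_pdivlMr ?ltr_wpDl// ?enorm_ge0//; apply: le_lt_trans.
  apply: ler_pM => //; first exact: enorm_ge0.
  by rewrite lerDl.
have step l : `|(a_ l (x + h *: v) - a_ k (x + h *: v)) - (a_ l x - a_ k x)| <= (C * ik k + C * ik l) * `|h|.
  have := @MVT_signed _ _ (fun y => a_ l y - a_ k y) x v
    (fun t => b_ l (x + t *: v) - b_ k (x + t *: v)) h 0 (C * ik k + C * ik l).
  rewrite mulr0 subr0; apply.
    by move=> t th; apply: is_deriveB; apply: da; exact: tB.
  move=> t /tB tt; rewrite subr0.
  have := bb l _ tt; have := bb k _ tt; rewrite !ler_norml => /andP[? ?] /andP[? ?].
  by apply/andP; split; lra.
have lim : `|(a (x + h *: v) - a_ k (x + h *: v)) - (a x - a_ k x)| <= C * ik k * `|h|.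
  apply: (@le_lim_ik _ _ _ (C * `|h| + C + C)) => l.
  have hB := tB h (lexx _); have xB := eB_center x r0.
  move: (step l) (aa l _ hB) (aa l _ xB); rewrite !ler_norml mulrDl !mulrDl.
  rewrite -(mulrA C (ik l)) -(mulrA C `|h|) (mulrC (ik l)).
  move=> /andP[? ?] /andP[? ?] /andP[? ?]; apply/andP; split; lra.
have := hd h hd1; move: lim; have := bb k x (eB_center _ r0).
have hh : 0 <= `|h| by [].
move=> b1 b2 b3.
have b4 : `|h * b_ k x - h * b x| <= C * ik k * `|h|.
  by rewrite -mulrBr normrM mulrC ler_wpM2r.
have : 3 * C * ik k * `|h| <= (e / 2 + e / 4) * `|h| by rewrite ler_wpM2r.
move: b2 b3 b4; rewrite !ler_norml => /andP[? ?] /andP[? ?] /andP[? ?] ?.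
by apply/andP; split; lra.
Qed.

Lemma cont_lim (a_ : nat -> V -> R) (a : V -> R) (C : R) x r : 0 < r ->
  (forall k, cont_at (a_ k) x) ->
  (forall k y, eB x r y -> `|a_ k y - a y| <= C * ik k) -> cont_at a x.
Proof.
move=> r0 ca aa e e0.
have C0 : 0 <= C.
  have := le_trans (normr_ge0 _) (aa 0%N x (eB_center _ r0)).
  by rewrite pmulr_lge0// ik_gt0.
have [k kk] := @ik_small _ (e / (4 * C + 1)) ltac:(rewrite divr_gt0//; lra).
have Ck : C * ik k <= e / 4.
  have := ik_gt0 (R := R) k; move: kk; rewrite ltr_pdivlMr; last lra.
  by move=> a1 a2; nra.
have [d d0 hd] := ca k (e / 4) ltac:(lra).
exists (Num.min d r); first by rewrite lt_min d0.
move=> y; rewrite lt_min => /andP[yd yr].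
have := hd y yd; have := aa k y yr; have := aa k x (eB_center _ r0).
by rewrite !ler_norml !ltr_norml => /andP[? ?] /andP[? ?] /andP[? ?]; apply/andP; split; lra.
Qed.

(** Interior estimates applied to the differences [u_ k - u_ l] make first and second derivatives
    Cauchy at the same rate, and the Laplacian of the limit is a limit of zeros. The radius is
    halved once for the estimates and once more to keep a full ball around each point. *)
Lemma harm_lim_seq (u_ : nat -> V -> R^o) u x0 r : 0 < r ->
  (forall k, harm (eB x0 r) (u_ k)) ->
  (forall k x, eB x0 r x -> `|u_ k x - u x| <= ik k) ->
  harm (eB x0 (r / 4)) u.
Proof.
move=> r0 hu uu.
pose fd k i : V -> R := partial i (u_ k).
pose fdd k i j : V -> R := partial j (partial i (u_ k)).
have wit k := harm_partial_wit (@eB_open _ _ x0 r) (hu k).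
pose C1 : R := 4 * N / r; pose C2 : R := 128 * N ^+ 2 / r ^+ 2.
have diffw k l : hasC2 (eB x0 r) (fun x => u_ k x + -1 * u_ l x)
    (fun i x => fd k i x + -1 * fd l i x) (fun i j x => fdd k i j x + -1 * fdd l i j x).
  by apply: hasC2D; [have [] := wit k|apply: hasC2Z; have [] := wit l].
have diff0 k l x : eB x0 r x -> \sum_i (fdd k i i x + -1 * fdd l i i x) = 0.
  move=> xB.
  have e1 m : \sum_i fdd m i i x = 0 by have [_] := wit m; exact.
  exact: (@sum_lin0 n.+1 (fun i => fdd k i i x) (fun i => fdd l i i x) (-1) (e1 k) (e1 l)).
have diffM k l x : eB x0 r x -> `|u_ k x + -1 * u_ l x| <= ik k + ik l.
  move=> xB; have := uu k x xB; have := uu l x xB.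
  by rewrite !ler_norml => /andP[? ?] /andP[? ?]; apply/andP; split; lra.
have c1 i x : eB x0 (r / 2) x -> exists s, forall k, `|fd k i x - s| <= C1 * ik k.
  move=> xB; apply: seq_lim => k l.
  have := partial_est i r0 (diffw k l) (diff0 k l) (diffM k l) xB.
  by rewrite mulN1r => /le_trans; apply; rewrite /C1 -mulrDr mulrAC.
have c2 i j x : eB x0 (r / 2) x -> exists s, forall k, `|fdd k i j x - s| <= C2 * ik k.
  move=> xB; apply: seq_lim => k l.
  have := snd_est_half i j r0 (diffw k l) (diff0 k l) (diffM k l) xB.
  by rewrite mulN1r => /le_trans; apply; rewrite /C2 -mulrDr mulrAC.
have /choice[g1 hg1] : forall ix : 'I_n.+1 * V, exists s, eB x0 (r / 2) ix.2 ->
    forall k, `|fd k ix.1 ix.2 - s| <= C1 * ik k.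
  move=> [i x] /=; have [xB|nB] := pselect (eB x0 (r / 2) x); last by exists 0.
  by have [s hs] := c1 i x xB; exists s.
have /choice[g2 hg2] : forall ix : 'I_n.+1 * 'I_n.+1 * V, exists s, eB x0 (r / 2) ix.2 ->
    forall k, `|fdd k ix.1.1 ix.1.2 ix.2 - s| <= C2 * ik k.
  move=> [[i j] x] /=; have [xB|nB] := pselect (eB x0 (r / 2) x); last by exists 0.
  by have [s hs] := c2 i j x xB; exists s.
pose C : R := 1 + C1 + C2.
have C10 : 0 <= C1 by rewrite divr_ge0// ?mulr_ge0// ltW.
have C20 : 0 <= C2 by apply: divr_ge0; [apply: mulr_ge0 => //; apply: exprn_ge0|apply/exprn_ge0/ltW].
have ik0 k : 0 <= ik (R := R) k by rewrite ltW// ik_gt0.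
have up (a b c : R) k : 0 <= c -> a <= b * ik k -> c = C - b -> a <= C * ik k.
  move=> c0 ab e; apply: le_trans ab _; rewrite ler_wpM2r//; lra.
have sub4 x : eB x0 (r / 4) x -> eB x (r / 4) `<=` eB x0 (r / 2).
  by move=> xB; apply: eB_sub; move: xB; rewrite /eB/=; lra.
have sub2 : eB x0 (r / 2) `<=` eB x0 r by apply: eB_sub; rewrite subrr enorm0; lra.
have uC k y : eB x0 (r / 2) y -> `|u_ k y - u y| <= C * ik k.
  move=> /sub2/uu h; apply: (@up _ 1 (C1 + C2) k); first exact: addr_ge0.
    by rewrite mul1r.
  by rewrite /C; ring.
have g1C k i y : eB x0 (r / 2) y -> `|fd k i y - g1 (i, y)| <= C * ik k.
  move=> h; apply: (@up _ C1 (1 + C2) k); first by rewrite addr_ge0.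
    exact: (hg1 (i, y)).
  by rewrite /C; ring.
have g2C k i j y : eB x0 (r / 2) y -> `|fdd k i j y - g2 (i, j, y)| <= C * ik k.
  move=> h; apply: (@up _ C2 (1 + C1) k); first by rewrite addr_ge0.
    exact: (hg2 (i, j, y)).
  by rewrite /C; ring.
have r40 : 0 < r / 4 by lra.
exists (fun i x => g1 (i, x)), (fun i j x => g2 (i, j, x)); split.
  move=> x xB; have sB := sub4 x xB.
  have xr : eB x0 r x by apply/sub2/sB/eB_center.
  split => [|i|i j|i|i j].
  - apply: (cont_lim r40 (a_ := u_) (C := C)).
      by move=> k; have [/(_ x xr)[]] := wit k.
    by move=> k y /sB; exact: uC.
  - apply: (cont_lim r40 (a_ := fun k => fd k i) (C := C)).
      by move=> k; have [/(_ x xr)[_ h _ _ _] _] := wit k; exact: h.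
    by move=> k y /sB; exact: g1C.
  - apply: (cont_lim r40 (a_ := fun k => fdd k i j) (C := C)).
      by move=> k; have [/(_ x xr)[_ _ h _ _] _] := wit k; exact: h.
    by move=> k y /sB; exact: g2C.
  - apply: (@deriv_lim u_ (fun k => fd k i) u (fun x => g1 (i, x)) C x (r / 4)) => //.
    + by move=> k y /sB/sub2 yB; have [/(_ y yB)[_ _ _ h _] _] := wit k; exact: h.
    + by move=> k y /sB; exact: uC.
    + by move=> k y /sB; exact: g1C.
  - apply: (@deriv_lim (fun k => fd k i) (fun k => fdd k i j) (fun x => g1 (i, x)) (fun x => g2 (i, j, x)) C x (r / 4)) => //.
    + by move=> k y /sB/sub2 yB; have [/(_ y yB)[_ _ _ _ h] _] := wit k; exact: h.
    + by move=> k y /sB; exact: g1C.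
    + by move=> k y /sB; exact: g2C.
move=> x xB; have x2 : eB x0 (r / 2) x by apply/(sub4 x xB)/eB_center.
apply/eqP; rewrite -normr_le0; apply: (@le_lim_ik _ _ _ (N * C)) => k; rewrite add0r.
have [_ h0] := wit k; have /h0 e := sub2 x x2.
have e1 : \sum_i fdd k i i x = 0 by exact: e.
apply: (sum_close0 e1) => i; exact: g2C.
Qed.

(** This closure property later produces derivatives, coefficients of expansions, Perron envelopes
    and sums of series, none of which is differentiated by hand. *)
Lemma harm_approx O u :
  (forall x, O x -> exists2 r : R, 0 < r & forall e : R, 0 < e ->
     exists2 w, harm (eB x r) w & forall y, eB x r y -> `|w y - u y| <= e) ->
  harm O u.
Proof.
move=> h; apply: harm_local => x Ox; have [r r0 hr] := h x Ox.
have /choice[w hw] : forall k, exists w : V -> R^o, harm (eB x r) w /\ forall y, eB x r y -> `|w y - u y| <= ik k.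
  by move=> k; have [w hw1 hw2] := hr (ik k) (ik_gt0 k); exists w.
exists (r / 4); first lra.
by apply: (harm_lim_seq r0 (u_ := w)) => k; have [] := hw k.
Qed.

Lemma harm_bounded_near O u x : open O -> harm O u -> O x ->
  exists r M : R, [/\ 0 < r, eB x r `<=` O & forall y, eB x r y -> `|u y| <= M].
Proof.
move=> oO hu Ox; have [r r0 rO] := open_ball_in oO Ox.
have [d d0 hd] := harm_cont hu Ox (ltr01 : 0 < 1 :> R).
exists (Num.min r d), (`|u x| + 1); split; first by rewrite lt_min r0.
  by move=> y; rewrite /eB/= lt_min => /andP[yr _]; exact: rO.
move=> y; rewrite /eB/= lt_min => /andP[_ /hd].
have := ler_normD (u y - u x) (u x); rewrite subrK; lra.
Qed.

(** Difference quotients of [u] are harmonic and, by the bound on second derivatives, converge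
    uniformly near [x]. *)
Lemma harm_partial O u i : open O -> harm O u -> harm O (partial i u).
Proof.
move=> oO hu; apply: harm_approx => x Ox.
have [r [M [r0 rO uM]]] := harm_bounded_near oO hu Ox.
have [h h0] := harm_partial_wit oO hu.
pose K : R := 128 * N ^+ 2 * M / r ^+ 2.
have hK y : eB x (r / 2) y -> `|partial i (partial i u) y| <= K.
  by apply: (@snd_est_half u (fun i => partial i u) (fun i j => partial j (partial i u)) x r M i i r0 _ _ uM y) => z /rO; [exact: h|exact: h0].
have K0 : 0 <= K by apply: le_trans (hK x _) => //; apply: eB_center; lra.
exists (r / 4); first lra.
move=> e e0; pose t : R := Num.min (r / 8) (e / (K + 1)).
have t0 : 0 < t by rewrite lt_min; apply/andP; split; [lra|rewrite divr_gt0// ltr_wpDl].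
have tr : t <= r / 8 by rewrite /t ge_min lexx.
have te : t <= e / (K + 1) by rewrite /t ge_min lexx orbT.
have near y s : eB x (r / 4) y -> `|s| <= `|t| -> eB x (r / 2) (y + s *: ee i).
  rewrite (gtr0_norm t0) => yB st; rewrite /eB/= addrAC; apply: le_lt_trans (enormD _ _) _.
  by move: yB; rewrite /eB/= enormZ enorm_ee mulr1; lra.
exists (fun y => t^-1 * (u (t *: ee i + 1 *: y) - u y)).
  apply: harmZ; apply: harmB; last first.
    by apply: harm_sub hu => y yB; apply: rO; move: yB; rewrite /eB/=; lra.
  apply: harm_sub (harm_aff 1 (t *: ee i) hu) => y yB /=; apply: rO.
  rewrite scale1r addrC; have := near y t yB (lexx _); rewrite /eB/=; lra.
move=> y yB; rewrite scale1r [t *: _ + _]addrC.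
have -> : t^-1 * (u (y + t *: ee i) - u y) - partial i u y =
  t^-1 * (u (y + t *: ee i) - u y - t * partial i u y).
  by rewrite [in RHS]mulrBr mulrA mulVf ?mul1r// lt0r_neq0.
rewrite normrM normfV (gtr0_norm t0) ler_pdivrMl//.
have := @MVT_signed _ _ u y (ee i) (fun s => partial i u (y + s *: ee i)) t (partial i u y) (K * t).
rewrite (gtr0_norm t0) => hm; apply: le_trans (hm _ _) _.
- move=> s st; have : O (y + s *: ee i).
    by apply: rO; have := near y s yB; rewrite (gtr0_norm t0) => /(_ st); rewrite /eB/=; lra.
  by move=> /h[].
- move=> s st; have := @MVT_signed _ _ (partial i u) y (ee i) (fun q => partial i (partial i u) (y + q *: ee i)) s 0 K.
  rewrite mulr0 subr0 => hm2; apply: le_trans (hm2 _ _) _.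
  + move=> q qs; have : O (y + q *: ee i).
      apply: rO; have := near y q yB; rewrite (gtr0_norm t0) => /(_ (le_trans qs st)); rewrite /eB/=; lra.
    by move=> /h[].
  + by move=> q qs; rewrite subr0; apply/hK/near => //; rewrite (gtr0_norm t0); exact: le_trans st.
  + by rewrite ler_wpM2l.
- rewrite mulrC ler_wpM2l ?(ltW t0)//; move: te; rewrite ler_pdivlMr ?ltr_wpDl//.
  nra.
Qed.

End Smooth.

(** * Cauchy estimates and Taylor expansions of harmonic functions *)

Section Taylor.
Context {R : realType} {n : nat}.
Local Notation V := 'rV[R]_n.+1.
Local Notation N := (n.+1%:R : R).
Implicit Types (x y z v : V) (c r M : R) (O : set V) (f g u : V -> R^o) (i : 'I_n.+1).

Definition Dv v f : V -> R := fun x => \sum_i v 0 i * partial i f x.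

Lemma harm_Dv O v f : open O -> harm O f -> harm O (Dv v f).
Proof.
by move=> oO hf; apply: harm_sum => i; apply: harmZ; exact: harm_partial.
Qed.

Lemma is_derive_Dv O v f x : open O -> harm O f -> O x -> is_derive x v f (Dv v f x).
Proof.
move=> oO hf Ox; have [h _] := harm_partial_wit oO hf.
exact: (hasC2_dirder v oO h Ox).
Qed.

Lemma Dv_eq O v f x (l : R) : open O -> harm O f -> O x -> is_derive x v f l -> l = Dv v f x.
Proof.
move=> oO hf Ox d1; have d2 := is_derive_Dv v oO hf Ox.
by rewrite -(@derive_val _ _ _ _ _ _ _ d1) -[RHS](@derive_val _ _ _ _ _ _ _ d2).
Qed.

Fixpoint Dvk (k : nat) v f : V -> R := if k is k'.+1 then Dv v (Dvk k' v f) else f.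

Lemma harm_Dvk O k v f : open O -> harm O f -> harm O (Dvk k v f).
Proof. by move=> oO hf; elim: k => //= k IH; exact: harm_Dv. Qed.

Lemma is_deriveZdir f x v (l c : R) : is_derive x v f l -> is_derive x (c *: v) f (c * l).
Proof.
move=> /is_deriveP h; apply/is_deriveP => e e0.
have [|d d0 hd] := h (e / (`|c| + 1)); first by rewrite divr_gt0// ltr_wpDl.
exists (d / (`|c| + 1)); first by rewrite divr_gt0// ltr_wpDl.
move=> t; rewrite ltr_pdivlMr ?ltr_wpDl// => td.
rewrite scalerA mulrA; apply: le_trans (hd _ _) _.
  by rewrite normrM; apply: le_lt_trans td; rewrite ler_wpM2l// lerDl.
rewrite normrM.
have -> : e / (`|c| + 1) * (`|t| * `|c|) = e * `|t| * (`|c| / (`|c| + 1)) by ring.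
by rewrite ler_piMr ?mulr_ge0 ?(ltW e0)// ler_pdivrMr ?ltr_wpDl// mul1r lerDl.
Qed.

Lemma Dv_est v f x r M : 0 < r -> harm (eB x r) f ->
  (forall y, eB x r y -> `|f y| <= M) -> `|Dv v f x| <= 2 * N * enorm v / r * M.
Proof.
move=> r0 hf fM.
have [->|v0] := eqVneq v 0.
  by rewrite /Dv big1 => [|i _]; rewrite ?mxE ?mul0r// normr0 enorm0 mulr0 !mul0r.
have ev : 0 < enorm v by rewrite enorm_gt0.
have d := is_derive_Dv v (@eB_open _ _ x r) hf (eB_center x r0).
have := grad_est r0 _ hf fM (is_deriveZdir (enorm v)^-1 d).
rewrite enormZ gtr0_norm ?invr_gt0// mulVf ?lt0r_neq0// => /(_ erefl).
rewrite normrM gtr0_norm ?invr_gt0// ler_pdivrMl// => /le_trans; apply.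
by apply: le_of_eq; ring.
Qed.

(** The radius is spent in [m] equal steps: each derivative costs one gradient estimate on a ball of
    radius [r / m]. *)
Lemma Dvk_est v f x r M m : 0 < r -> harm (eB x r) f ->
  (forall y, eB x r y -> `|f y| <= M) ->
  `|Dvk m v f x| <= (2 * N * enorm v * m%:R / r) ^+ m * M.
Proof.
move=> r0 hf fM; have M0 : 0 <= M by apply: le_trans (fM x (eB_center _ r0)).
case: m => [|m]; first by rewrite /= expr0 mul1r; apply/fM/eB_center.
set q := _ / r; pose s : R := r / m.+1%:R.
have s0 : 0 < s by rewrite divr_gt0.
have sm : s * m.+1%:R = r by rewrite /s divfK.
have H : forall k y, (k <= m.+1)%N -> enorm (y - x) <= r - s * k%:R ->
     (k = 0%N -> eB x r y) -> `|Dvk k v f y| <= q ^+ k * M.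
  elim=> [|k IH] y km yB y0; first by rewrite /= expr0 mul1r; apply: fM; exact: y0.
  have inr z : eB y s z -> enorm (z - x) < r - s * k%:R.
    move=> zB; have := enorm_tri y z x; move: zB; rewrite /eB/=.
    move: yB; rewrite -[k.+1]addn1 natrD mulrDr mulr1; lra.
  have inB z : eB y s z -> eB x r z.
    move=> /inr h; rewrite /eB/=; apply: lt_le_trans h _.
    by rewrite gerBl; apply: mulr_ge0 => //; exact: ltW.
  have hk : harm (eB y s) (Dvk k v f).
    apply: harm_Dvk; first exact: eB_open.
    by apply: harm_sub hf => z; exact: inB.
  have := @Dv_est v (Dvk k v f) y s (q ^+ k * M) s0 hk.
  have -> : 2 * N * enorm v / s * (q ^+ k * M) = q ^+ k.+1 * M.
    have -> : 2 * N * enorm v / s = q by rewrite /q /s invf_div mulrA.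
    by rewrite exprS mulrA.
  apply => z zB; apply: IH; [exact: ltnW| |by move=> _; exact: inB].
  exact/ltW/inr.
by apply: H => //; rewrite subrr enorm0 sm subrr.
Qed.

(** The coefficient of [t^k] in the Taylor expansion of [f (x + t v)] at [t = 0]. *)
Definition tc (k : nat) v f x : R := Dvk k v f x / k`!%:R.

Lemma harm_tc O k v f : open O -> harm O f -> harm O (tc k v f).
Proof.
move=> oO hf; rewrite /tc; under eq_fun do rewrite mulrC.
by apply: harmZ; exact: harm_Dvk.
Qed.

(** The factor [2 N] is that of the gradient estimate; [e] comes from [m^m <= m! e^m], which trades
    the [m^m] of [Dvk_est] for the factorial in [tc]. *)
Definition A0 : R := 2 * N * expR 1.

Lemma A0_ge1 : 1 <= A0.
Proof.
rewrite /A0; have h1 : 1 <= expR 1 :> R by have := expR_ge1Dx (1 : R); lra.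
have h2 : 1 <= N by rewrite ler1n.
nra.
Qed.

Lemma A0_gt0 : 0 < A0.
Proof. by apply: lt_le_trans A0_ge1. Qed.

Lemma expn_le_fact m : (m%:R : R) ^+ m <= m`!%:R * expR 1 ^+ m.
Proof.
case: m => [|m]; first by rewrite !expr0 fact0 mulr1.
have h := @expR_ge1Dxn R m.+1%:R m (ler0n _ _).
rewrite -expRM_natl mulr1 -ler_pdivrMl ?ltr0n ?fact_gt0// mulrC.
lra.
Qed.

Lemma tc_est v f x r M m : 0 < r -> harm (eB x r) f ->
  (forall y, eB x r y -> `|f y| <= M) ->
  `|tc m v f x| <= M * (A0 * enorm v / r) ^+ m.
Proof.
move=> r0 hf fM; have M0 : 0 <= M by apply: le_trans (fM x (eB_center _ r0)).
rewrite /tc normrM normfV [`|m`!%:R|]ger0_norm// ler_pdivrMr ?ltr0n ?fact_gt0//.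
apply: le_trans (Dvk_est v m r0 hf fM) _.
rewrite [leLHS]mulrC -[leRHS]mulrA ler_wpM2l//.
have -> : 2 * N * enorm v * m%:R / r = (2 * N * enorm v / r) * m%:R by rewrite mulrAC.
have -> : A0 * enorm v / r = (2 * N * enorm v / r) * expR 1 by rewrite /A0; ring.
rewrite [leLHS]exprMn [X in _ <= X * _]exprMn -[leRHS]mulrA ler_wpM2l//; last by rewrite mulrC expn_le_fact.
apply: exprn_ge0; apply: divr_ge0; last exact: ltW.
by apply: mulr_ge0; [exact: mulr_ge0|exact: enorm_ge0].
Qed.

(** Induction on the number of terms, over all sequences of successive derivatives at once: the
    derivative of the remainder is the remainder of the shifted sequence, and the mean value theorem
    integrates its bound. *)
Lemma taylor_1d (K : nat) : forall (phi : nat -> R -> R^o) (s S : R), 0 <= s ->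
  (forall j t, 0 <= t <= s -> is_derive t (1 : R) (phi j) (phi j.+1 t : R)) ->
  (forall t, 0 <= t <= s -> `|phi K t| <= S) ->
  forall t, 0 <= t <= s ->
  `|phi 0%N t - \sum_(j < K) t ^+ j / j`!%:R * phi j 0| <= S * t ^+ K / K`!%:R.
Proof.
elim: K => [|K IH] phi s S s0 dphi phiS t ts.
  by rewrite big_ord0 subr0 expr0 fact0 mulr1 divr1; exact: phiS.
have IH' := IH (fun j => phi j.+1) s S s0 (fun j => dphi j.+1) phiS.
pose P (q : R) : R := \sum_(j < K.+1) q ^+ j / j`!%:R * phi j 0.
pose P' (q : R) : R := \sum_(j < K) q ^+ j / j`!%:R * phi j.+1 0.
have dmon j q : is_derive q (1 : R) (fun q : R => q ^+ j.+1 / j.+1`!%:R : R^o) (q ^+ j / j`!%:R : R).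
  have -> : (fun q : R => q ^+ j.+1 / j.+1`!%:R : R^o) = (j.+1`!%:R^-1 : R) *: ((fun q : R => q) ^+ j.+1 : R -> R^o).
    by apply/funext => a; rewrite scalrfctE exprfctE mulrC.
  apply: is_derive_eq; rewrite /GRing.scale/= mulr1 factS natrM.
  rewrite -[in RHS]mulr_natl; field; rewrite pnatr_eq0 -lt0n fact_gt0/=.
  by rewrite addrC natr1 pnatr_eq0.
have dP q : is_derive q (1 : R) (P : R -> R^o) (P' q).
  have -> : (P : R -> R^o) = (fun q => phi 0%N 0 + \sum_(j < K) q ^+ j.+1 / j.+1`!%:R * phi j.+1 0).
    by apply/funext => a; rewrite /P big_ord_recl expr0 fact0 divr1 mul1r.
  rewrite -[P' q]add0r; apply: is_deriveD.
  rewrite (_ : (fun _ => _) = \sum_(j < K) (fun q : R => q ^+ j.+1 / j.+1`!%:R * phi j.+1 0 : R^o)); last first.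
    by apply/funext => a; rewrite fct_sumE.
  apply: (@is_derive_sum R R^o R^o K (fun j q => q ^+ j.+1 / j.+1`!%:R * phi j.+1 0) q 1 (fun j => q ^+ j / j`!%:R * phi j.+1 0)) => j.
  under eq_fun do rewrite mulrC; rewrite mulrC.
  exact: (@is_deriveZ _ _ _ (fun q : R => q ^+ j.+1 / j.+1`!%:R : R^o) (phi j.+1 0)).
have P0 : P 0 = phi 0%N 0.
  rewrite /P big_ord_recl expr0 fact0 divr1 mul1r big1 ?addr0// => j _.
  by rewrite expr0n/= !mul0r.
have mono (sg : R) : sg = 1 \/ sg = -1 -> sg * (phi 0%N t - P t) <= S * t ^+ K.+1 / K.+1`!%:R.
  move=> sgE; move: ts => /andP[t0 ts].
  have [->|tn0] := eqVneq t 0.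
    by rewrite P0 subrr mulr0 expr0n/= mulr0 mul0r.
  have tp : 0 < t by rewrite lt_def tn0.
  pose g (q : R) : R^o := sg * (phi 0%N q - P q) - S * (q ^+ K.+1 / K.+1`!%:R).
  have dg q : 0 <= q <= s -> is_derive q (1 : R) g (sg * (phi 1%N q - P' q) - S * (q ^+ K / K`!%:R) : R).
    move=> qs; apply: is_deriveB.
      apply: (@is_deriveZ _ _ _ (fun q => phi 0%N q - P q : R^o) sg).
      apply: is_deriveB; exact: dphi.
  pose g' (q : R) : R := sg * (phi 1%N q - P' q) - S * (q ^+ K / K`!%:R).
  have [||c ct e] := @MVT R g g' 0 t tp.
  - move=> q; rewrite in_itv/= => /andP[q0 qt]; apply: dg.
    by rewrite ltW//= (le_trans _ ts)// ltW.
  - apply: continuous_in_subspaceT => q; rewrite inE/= in_itv/= => /andP[q0 qt].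
    apply: is_derive_cont1; apply: dg; by rewrite q0 (le_trans qt ts).
  move: ct; rewrite in_itv/= => /andP[c0 ct].
  have g0 : g 0 = 0 by rewrite /g P0 subrr mulr0 expr0n/= mul0r mulr0 subrr.
  have : g t <= 0.
    move: e; rewrite g0 !subr0 => ->; rewrite pmulr_lle0// /g' subr_le0 mulrA.
    have := IH' c; rewrite (ltW c0) (le_trans (ltW ct) ts) => /(_ isT).
    rewrite ler_norml -/(P' c) => /andP[a b].
    by case: sgE => ->; rewrite ?mul1r ?mulN1r; lra.
  by rewrite /g mulrA; lra.
rewrite ler_norml; apply/andP; split.
  have := mono (-1) (or_intror erefl); rewrite mulN1r -/(P t); lra.
by have := mono 1 (or_introl erefl); rewrite mul1r.
Qed.

(** The remainder involves derivatives at points within [r / 2] of [x], around which a ball of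
    radius [r / 2] is left; hence the factor 2 in the ratio. *)
Lemma taylor v f x r M (K : nat) : 0 < r -> harm (eB x r) f ->
  (forall y, eB x r y -> `|f y| <= M) -> enorm v <= r / 2 ->
  `|f (x + v) - \sum_(j < K) tc j v f x| <= M * (2 * A0 * enorm v / r) ^+ K.
Proof.
move=> r0 hf fM vr.
have oB := @eB_open _ _ x r.
have inB t : 0 <= t <= 1 -> eB (x + t *: v) (r / 2) `<=` eB x r.
  move=> /andP[t0 t1]; apply: eB_sub; rewrite [x + _]addrC addrK enormZ ger0_norm//.
  have := enorm_ge0 v; nra.
pose phi j (t : R) : R^o := Dvk j v f (x + t *: v).
have r20 : 0 < r / 2 by lra.
have := @taylor_1d K phi 1 (M * (2 * A0 * enorm v / r) ^+ K * K`!%:R) ler01.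
move=> /(_ _ _ 1 _).
rewrite expr1n mulr1 mulfK ?pnatr_eq0 -?lt0n ?fact_gt0//.
rewrite /phi scale1r scale0r addr0/=.
under eq_bigr do rewrite expr1n mul1r mulrC.
apply.
- move=> j t ts; apply/is_derive_line; apply: (is_derive_Dv v oB).
    exact: harm_Dvk.
  exact/(inB t ts)/eB_center.
- move=> t ts.
  have h2 : harm (eB (x + t *: v) (r / 2)) f by apply: harm_sub (inB t ts) hf.
  have := tc_est v K r20 h2 (fun y yB => fM y (inB t ts y yB)).
  rewrite /tc normrM normfV [`|K`!%:R|]ger0_norm// ler_pdivrMr ?ltr0n ?fact_gt0//.
  by move/le_trans; apply; rewrite invf_div mulrA [A0 * _ * 2]mulrC mulrA.
- by rewrite lexx ler01.
Qed.

Lemma DvZ O v f g c x : open O -> harm O f -> O x ->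
  (forall y, O y -> g y = c * f y) -> Dv v g x = c * Dv v f x.
Proof.
move=> oO hf Ox gf; have hg : harm O g.
  by apply: harm_congr (harmZ c hf) => // y Oy; rewrite gf.
apply/esym; apply: (Dv_eq oO hg Ox).
apply: (is_derive_congr oO Ox (f := fun y => c * f y : R^o)).
  by move=> y Oy; rewrite gf.
exact: (@is_deriveZ _ _ _ f c x v _ (is_derive_Dv v oO hf Ox)).
Qed.

Lemma Dvk_scale O v f c k : open O -> harm O f ->
  forall x, O x -> Dvk k (c *: v) f x = c ^+ k * Dvk k v f x.
Proof.
move=> oO hf; elim: k => [|k IH] x Ox /=; first by rewrite expr0 mul1r.
have -> : Dv (c *: v) (Dvk k (c *: v) f) x = c * Dv v (Dvk k (c *: v) f) x.
  by rewrite /Dv mulr_sumr; apply: eq_bigr => i _; rewrite mxE mulrA.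
by rewrite (DvZ (c := c ^+ k) v oO (harm_Dvk k v oO hf) Ox IH) mulrA -exprS.
Qed.

Lemma tc_scale O v f c k x : open O -> harm O f -> O x ->
  tc k (c *: v) f x = c ^+ k * tc k v f x.
Proof. by move=> oO hf Ox; rewrite /tc (Dvk_scale _ _ _ oO hf Ox) mulrA. Qed.

(** By induction, [c_ k] is the uniform limit, as [t] tends to 0, of the harmonic functions
    [t^-k (u_ t - sum_(j < k) t^j c_ j)], the error being at most a multiple of [t]. *)
Lemma coef_harm O (u_ : R -> V -> R) (c_ : nat -> V -> R) (C A t0 : R) : open O ->
  0 < t0 -> (forall t, 0 < t < t0 -> harm O (u_ t)) ->
  (forall K t x, 0 < t < t0 -> O x ->
     `|u_ t x - \sum_(j < K) t ^+ j * c_ j x| <= C * (A * t) ^+ K) ->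
  forall k, harm O (c_ k).
Proof.
move=> oO t00 hu huc k; elim/ltn_ind: k => k IH.
apply: harm_approx => x Ox; have [r r0 rO] := open_ball_in oO Ox.
exists r => // e e0; pose B : R := `|C * A ^+ k.+1| + 1.
have B0 : 0 < B by rewrite ltr_wpDl.
pose t : R := Num.min (t0 / 2) (e / B).
have tp : 0 < t by rewrite lt_min; apply/andP; split; [lra|rewrite divr_gt0].
have tt0 : 0 < t < t0 by rewrite tp /t gt_min; apply/orP; left; lra.
have te : t <= e / B by rewrite /t ge_min lexx orbT.
exists (fun y => t ^- k * (u_ t y - \sum_(j < k) t ^+ j * c_ j y)).
  apply: harmZ; apply: harmB; first by apply: harm_sub (hu t tt0) => y; exact: rO.
  by apply: harm_sum => j; apply: harmZ; apply: harm_sub (IH j (ltn_ord j)) => y; exact: rO.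
move=> y yB; have := huc k.+1 t y tt0 (rO y yB).
rewrite big_ord_recr/= opprD addrA => h.
have tk : 0 < t ^+ k by rewrite exprn_gt0.
have -> : t ^- k * (u_ t y - \sum_(j < k) t ^+ j * c_ j y) - c_ k y =
   t ^- k * (u_ t y - \sum_(j < k) t ^+ j * c_ j y - t ^+ k * c_ k y).
  by rewrite [in RHS]mulrBr mulrA mulVf ?mul1r// lt0r_neq0.
rewrite normrM normfV (gtr0_norm tk) ler_pdivrMl//; apply: le_trans h _.
rewrite exprMn ![_ ^+ k.+1]exprS.
move: te; rewrite ler_pdivlMr// => te.
have h1 : C * A ^+ k.+1 <= B by rewrite /B; apply: le_trans (ler_norm _) _; rewrite lerDl.
have -> : C * (A * A ^+ k * (t * t ^+ k)) = (t * (C * A ^+ k.+1)) * t ^+ k by rewrite exprS; ring.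
rewrite mulrC ler_wpM2l ?(ltW tk)//; apply: le_trans te.
by rewrite ler_wpM2l// ltW.
Qed.

End Taylor.

(** * Homogeneous polynomials and Fischer's decomposition *)

Section Polynomials.
Context {R : realType} {n : nat}.
Local Notation V := 'rV[R]_n.+1.
Local Notation N := (n.+1%:R : R).
Implicit Types (x y : V) (c M : R) (O : set V) (f g : V -> R) (i j : 'I_n.+1).

Definition sqn x : R := dotp x x.

Lemma sqnE x : sqn x = enorm x ^+ 2.
Proof. by rewrite enorm_sqr. Qed.

Inductive hpoly : nat -> (V -> R) -> Prop :=
| hpC c : hpoly 0 (fun=> c)
| hp0 m : hpoly m (fun=> 0)
| hpX i m f : hpoly m f -> hpoly m.+1 (fun x => x 0 i * f x)
| hpD m f g : hpoly m f -> hpoly m g -> hpoly m (fun x => f x + g x).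

Lemma hpoly_eq m f g : (forall x, f x = g x) -> hpoly m f -> hpoly m g.
Proof. by move=> fg; rewrite (_ : g = f)//; apply/funext => x; rewrite fg. Qed.

Lemma hpolyZ m f c : hpoly m f -> hpoly m (fun x => c * f x).
Proof.
elim=> [d|k|i k h _ IH|k h h' _ IH _ IH'].
- exact: (hpC (c * d)).
- by apply: hpoly_eq (hp0 k) => x; rewrite mulr0.
- by apply: hpoly_eq (hpX i IH) => x; rewrite mulrCA.
- by apply: hpoly_eq (hpD IH IH') => x; rewrite mulrDr.
Qed.

Lemma hpolyM m k f g : hpoly m f -> hpoly k g -> hpoly (m + k) (fun x => f x * g x).
Proof.
move=> + hg; elim=> [d|p|i p h _ IH|p h h' _ IH _ IH'].
- exact: hpolyZ.
- by apply: hpoly_eq (hp0 (p + k)) => x; rewrite mul0r.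
- by rewrite addSn; apply: hpoly_eq (hpX i IH) => x; rewrite mulrA.
- by apply: hpoly_eq (hpD IH IH') => x; rewrite mulrDl.
Qed.

Lemma hpoly_sum m (k : nat) (F : 'I_k -> V -> R) : (forall q, hpoly m (F q)) ->
  hpoly m (fun x => \sum_q F q x).
Proof.
elim: k F => [|k IH] F hF.
  by apply: hpoly_eq (hp0 m) => x; rewrite big_ord0.
apply: hpoly_eq (hpD (IH _ (fun q => hF (widen_ord (leqnSn k) q))) (hF ord_max)) => x.
by rewrite big_ord_recr.
Qed.

Lemma hpoly_coord i : hpoly 1 (fun x => x 0 i).
Proof. by apply: hpoly_eq (hpX i (hpC 1)) => x; rewrite mulr1. Qed.

Lemma hpoly_sqn k : hpoly k.*2 (fun x => sqn x ^+ k).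
Proof.
elim: k => [|k IH]; first by apply: hpoly_eq (hpC 1) => x; rewrite expr0.
have h2 : hpoly 2 sqn by apply: hpoly_sum => i; exact: (hpX i (hpoly_coord i)).
by rewrite doubleS -add2n; apply: hpoly_eq (hpolyM h2 IH) => x; rewrite exprS.
Qed.

Lemma hpoly_homog m f t x : hpoly m f -> f (t *: x) = t ^+ m * f x.
Proof.
elim=> [d|k|i k h _ IH|k h h' _ IH _ IH'].
- by rewrite expr0 mul1r.
- by rewrite mulr0.
- by rewrite IH mxE exprS; ring.
- by rewrite IH IH' mulrDr.
Qed.

(** The last clause is Euler's identity. The truncated [m.-1] is compensated by the second clause:
    in degree 0 the derivatives vanish. *)
Lemma hpoly_d m f : hpoly m f -> exists fd : 'I_n.+1 -> V -> R,
  [/\ forall i, hpoly m.-1 (fd i), m = 0%N -> forall i x, fd i x = 0,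
    forall i x, is_derive x (ee i) (f : V -> R^o) (fd i x : R) &
    forall x, \sum_i x 0 i * fd i x = m%:R * f x].
Proof.
elim=> [d|k|j k h hh [hd [h1 h2 h3 h4]]|k h g hh [hd [h1 h2 h3 h4]] gg [gd [g1 g2 g3 g4]]].
- exists (fun _ _ => 0); split => //.
  + by move=> i; exact: hp0.
  + by move=> i x; exact: is_derive_cst.
  + by move=> x; rewrite mul0r big1// => i _; rewrite mulr0.
- exists (fun _ _ => 0); split => //.
  + by move=> i; exact: hp0.
  + by move=> i x; exact: is_derive_cst.
  + by move=> x; rewrite mulr0 big1// => i _; rewrite mulr0.
- exists (fun i x => (j == i)%:R * h x + x 0 j * hd i x); split => //=.
  + move=> i; apply: hpD; first exact: hpolyZ.
    have [k0|k0] := posnP k.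
      by rewrite k0; apply: hpoly_eq (hp0 0) => x; rewrite h2// mulr0.
    by rewrite -(prednK k0); apply: hpX; exact: h1.
  + by move=> i x; apply: is_deriveMe => //; exact: is_derive_coord.
  + move=> x; under eq_bigr do rewrite mulrDr.
    rewrite big_split/= (bigD1 j)//= eqxx mul1r big1 ?addr0 => [|i /negbTE ij]; last first.
      by rewrite eq_sym ij mul0r mulr0.
    under eq_bigr do rewrite mulrCA; rewrite -mulr_sumr h4 -[k.+1]addn1 natrD; ring.
- exists (fun i x => hd i x + gd i x); split => //=.
  + by move=> i; apply: hpD.
  + by move=> k0 i x; rewrite h2// g2// addr0.
  + by move=> i x; exact: (@is_deriveD _ _ _ (h : V -> R^o) (g : V -> R^o)).
  + by move=> x; under eq_bigr do rewrite mulrDr; rewrite big_split/= h4 g4 mulrDr.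
Qed.

Lemma hpoly_cont m f x : hpoly m f -> cont_at f x.
Proof.
elim=> [d|k|i k h _ IH|k h h' _ IH _ IH']; try exact: cont_cst.
- by apply: contM => //; exact: cont_coord.
- exact: contD.
Qed.

Lemma hpoly_wit m f : hpoly m f -> exists (fd : 'I_n.+1 -> V -> R) fdd,
  [/\ hasC2 setT f fd fdd, forall i j, hpoly m.-2 (fdd i j),
    (m < 2)%N -> forall i j x, fdd i j x = 0 &
    forall x, \sum_i x 0 i * fd i x = m%:R * f x].
Proof.
move=> hf; have [fd [h1 h2 h3 h4]] := hpoly_d hf.
have /choice[fdd hfdd] := fun i => hpoly_d (h1 i).
exists fd, fdd; split => //.
- move=> x _; split => [|i|i j|i|i j].
  + exact: hpoly_cont hf.
  + exact: hpoly_cont (h1 i).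
  + by have [a _ _ _] := hfdd i; exact: hpoly_cont (a j).
  + exact: h3.
  + by have [_ _ a _] := hfdd i; exact: a.
- by move=> i j; have [a _ _ _] := hfdd i; exact: a.
- move=> m2 i j x; have [_ a _ _] := hfdd i; apply: a; lia.
Qed.

Lemma radial_hasC2 O (p p1 p2 : V -> R) :
  (forall x, O x -> [/\ cont_at p x, cont_at p1 x, cont_at p2 x,
     forall i, is_derive x (ee i) (p : V -> R^o) (2 * x 0 i * p1 x : R) &
     forall i, is_derive x (ee i) (p1 : V -> R^o) (2 * x 0 i * p2 x : R)]) ->
  hasC2 O p (fun i x => 2 * x 0 i * p1 x)
    (fun i j x => 2 * (i == j)%:R * p1 x + (2 * x 0 i) * (2 * x 0 j * p2 x)).
Proof.
move=> h x Ox; have [a b c d e] := h x Ox; split => // [i|i j|i j].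
- by apply: contM => //; apply: contZ; exact: cont_coord.
- apply: contD; first exact: contZ.
  apply: contM; first by apply: contZ; exact: cont_coord.
  by apply: contM => //; apply: contZ; exact: cont_coord.
- apply: (@is_deriveMe _ _ (fun x => 2 * x 0 i) p1) => //.
  apply: (@is_deriveZ _ _ _ (fun x : V => x 0 i : R^o) 2 x (ee j) _ (is_derive_coord x i j)).
Qed.

(** Here [p] is a function of [|x|^2], and [p1], [p2] are its first two derivatives in that
    variable; the cross term is evaluated by Euler's identity for [h]. The formula covers the
    integer powers of Fischer's decomposition and the real powers of Kelvin's transform and of the
    barriers. *)
Lemma radial_lapl O (p p1 p2 : V -> R) h hd hdd (k : R) :
  (forall x, O x -> [/\ cont_at p x, cont_at p1 x, cont_at p2 x,
     forall i, is_derive x (ee i) (p : V -> R^o) (2 * x 0 i * p1 x : R) &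
     forall i, is_derive x (ee i) (p1 : V -> R^o) (2 * x 0 i * p2 x : R)]) ->
  hasC2 O h hd hdd -> (forall x, O x -> \sum_i hdd i i x = 0) ->
  (forall x, O x -> \sum_i x 0 i * hd i x = k * h x) ->
  exists fd fdd, hasC2 O (fun x => p x * h x) fd fdd /\
   forall x, O x -> \sum_i fdd i i x = (2 * N * p1 x + 4 * sqn x * p2 x + 4 * k * p1 x) * h x.
Proof.
move=> hp hh h0 hE; do 2 eexists; split; first exact: (hasC2M (radial_hasC2 hp) hh).
move=> x Ox /=.
apply: (etrans (sumR_eq (G := fun i => (2 * p1 x * h x + 4 * (x 0 i * x 0 i) * p2 x * h x) + (4 * p1 x * (x 0 i * hd i x) + p x * hdd i i x)) _)).
  by move=> i; rewrite eqxx mulr1; ring.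
rewrite !big_split/= sumr_const card_ord -!mulr_sumr h0// hE//.
have -> : \sum_(i < n.+1) 4 * (x 0 i * x 0 i) * p2 x * h x = 4 * sqn x * p2 x * h x.
  by rewrite /sqn /dotp -!mulr_suml -mulr_sumr.
rewrite -mulr_natl; ring.
Qed.

Lemma is_derive_sqn x i : is_derive x (ee i) (sqn : V -> R^o) (2 * x 0 i : R).
Proof.
apply/is_deriveP => e e0; exists e => // t te.
have -> : sqn (x + t *: ee i) = sqn x + t * (2 * x 0 i) + t * t.
  rewrite /sqn dotpDl !dotpDr !dotpZl !dotpZr (dotpC (ee i) x) !dotp_ee eeE eqxx mulr1.
  by ring.
have -> : sqn x + t * (2 * x 0 i) + t * t - sqn x - t * (2 * x 0 i) = t * t by ring.
by rewrite normrM ler_wpM2r// ltW.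
Qed.

Lemma cont_sqn x : cont_at sqn x.
Proof. by apply: hpoly_cont (@hpoly_eq _ _ _ _ (hpoly_sqn 1)) => y; rewrite expr1. Qed.

Lemma is_derive_comp_sqn (h : R -> R) (x : V) i (l : R) :
  is_derive (sqn x) (1 : R) (h : R -> R^o) l ->
  is_derive x (ee i) (fun y => h (sqn y) : R^o) (2 * x 0 i * l : R).
Proof.
move=> dh; rewrite -[x]addr0 -[X in x + X](scale0r (ee i)).
apply/is_derive_line.
have d1 : is_derive (0 : R) (1 : R) (fun s : R => sqn (x + s *: ee i) : R^o) (2 * x 0 i : R).
  by apply/is_derive_line; rewrite scale0r addr0; exact: is_derive_sqn.
rewrite scale0r addr0.
rewrite mulrC; apply: (@is_derive1_comp R h (fun s : R => sqn (x + s *: ee i)) 0 l (2 * x 0 i)).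
by rewrite scale0r addr0.
Qed.

(** This is [|x|^(2 a)]; the exponent refers to [|x|^2] to match [radial_lapl]. *)
Definition pw (a : R) x : R := sqn x `^ a.

Lemma sqn_gt0 x : (0 < sqn x) = (x != 0).
Proof. by rewrite sqnE exprn_even_gt0//= enorm_eq0. Qed.

Lemma pw_profile (a : R) x : x != 0 ->
  [/\ cont_at (pw a) x, cont_at (fun x => a * pw (a - 1) x) x,
      cont_at (fun x => a * ((a - 1) * pw (a - 1 - 1) x)) x,
     forall i, is_derive x (ee i) (pw a : V -> R^o) (2 * x 0 i * (a * pw (a - 1) x) : R) &
     forall i, is_derive x (ee i) (fun x => a * pw (a - 1) x : R^o) (2 * x 0 i * (a * ((a - 1) * pw (a - 1 - 1) x)) : R)].
Proof.
move=> x0; have s0 : 0 < sqn x by rewrite sqn_gt0.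
have dpw b i : is_derive x (ee i) (pw b : V -> R^o) (2 * x 0 i * (b * pw (b - 1) x) : R).
  by apply: (@is_derive_comp_sqn (fun s => s `^ b)); exact: is_derive1_powR.
have cpw b : cont_at (pw b) x.
  apply: (@cont_comp _ _ (fun s : R => s `^ b) (sqn : V -> R^o)); last exact: cont_sqn.
  by apply: (@is_derive_cont1 _ _ _); exact: is_derive1_powR.
split => //.
- exact: contZ.
- by apply: contZ; exact: contZ.
- move=> i; have := @is_deriveZ _ _ _ (pw (a - 1) : V -> R^o) a x (ee i) _ (dpw (a - 1) i).
  by rewrite /GRing.scale/= mulrCA.
Qed.

Lemma sqnX_profile (k : nat) x :
  [/\ cont_at (fun x => sqn x ^+ k) x, cont_at (fun x => k%:R * sqn x ^+ k.-1) x,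
      cont_at (fun x => k%:R * (k.-1%:R * sqn x ^+ k.-2)) x,
     forall i, is_derive x (ee i) (fun x => sqn x ^+ k : R^o) (2 * x 0 i * (k%:R * sqn x ^+ k.-1) : R) &
     forall i, is_derive x (ee i) (fun x => k%:R * sqn x ^+ k.-1 : R^o) (2 * x 0 i * (k%:R * (k.-1%:R * sqn x ^+ k.-2)) : R)].
Proof.
have d m i : is_derive x (ee i) (fun x => sqn x ^+ m : R^o) (2 * x 0 i * (m%:R * sqn x ^+ m.-1) : R).
  apply: (@is_derive_comp_sqn (fun s => s ^+ m)).
  apply: DeriveDef; first exact: exprn_derivable.
  by rewrite exp_derive /GRing.scale/= mulr1.
have c m : cont_at (fun x => sqn x ^+ m) x by apply: hpoly_cont (hpoly_sqn m).
split => //.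
- exact: contZ.
- by apply: contZ; exact: contZ.
- move=> i; have := @is_deriveZ _ _ _ (fun x => sqn x ^+ k.-1 : R^o) k%:R x (ee i) _ (d k.-1 i).
  by rewrite /GRing.scale/= mulrCA.
Qed.

Definition hharm m f := hpoly m f /\ harm setT f.

Lemma hharm0 m : hharm m (fun=> 0).
Proof. by split; [exact: hp0|exact: harm_cst]. Qed.

Lemma hharmD m f g : hharm m f -> hharm m g -> hharm m (fun x => f x + g x).
Proof. by move=> [a b] [c d]; split; [exact: hpD|exact: harmD]. Qed.

Lemma hharmZ m f c : hharm m f -> hharm m (fun x => c * f x).
Proof. by move=> [a b]; split; [exact: hpolyZ|exact: harmZ]. Qed.

(* The Laplacian of a homogeneous polynomial extends to a witness with explicit
   derivatives, so that harmonicity can be read off [hpoly_wit]. *)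
Lemma hpoly_wit_harm m f : hharm m f -> exists (fd : 'I_n.+1 -> V -> R) fdd,
  [/\ hasC2 setT f fd fdd, forall x, \sum_i fdd i i x = 0 &
    forall x, \sum_i x 0 i * fd i x = m%:R * f x].
Proof.
move=> [hf [gd [gdd [hg g0]]]]; have [fd [fdd [h1 _ _ h4]]] := hpoly_wit hf.
exists fd, fdd; split => // x; rewrite -[RHS](g0 x Logic.I); apply: sumR_eq => i.
have e y j : fd j y = gd j y.
  have [_ _ _ d1 _] := h1 y Logic.I; have [_ _ _ d2 _] := hg y Logic.I.
  by rewrite -(@derive_val _ _ _ _ _ _ _ (d1 j)) -(@derive_val _ _ _ _ _ _ _ (d2 j)).
have [_ _ _ _ d1] := h1 x Logic.I; have [_ _ _ _ d2] := hg x Logic.I.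
have := d1 i i; rewrite (_ : fd i = gd i); last by apply/funext => y; rewrite e.
move=> d3; rewrite -(@derive_val _ _ _ _ _ _ _ d3).
by have d4 := d2 i i; rewrite -(@derive_val _ _ _ _ _ _ _ d4).
Qed.

Lemma lapl_sqnX m f (k : nat) : hharm m f -> exists fd fdd,
  hasC2 setT (fun x => sqn x ^+ k.+1 * f x) fd fdd /\
  forall x, \sum_i fdd i i x = 2 * k.+1%:R * (N + 2 * k%:R + 2 * m%:R) * (sqn x ^+ k * f x).
Proof.
move=> /hpoly_wit_harm[hd [hdd [hh h0 hE]]].
have [fd [fdd [h1 h2]]] := @radial_lapl setT _ _ _ f hd hdd m%:R
  (fun x _ => sqnX_profile k.+1 x) hh (fun x _ => h0 x) (fun x _ => hE x).
exists fd, fdd; split => // x; rewrite h2//=.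
case: k h1 h2 => [|k] _ _ /=; first by rewrite !expr0; ring.
by rewrite exprS; ring.
Qed.

(** Induction on the degree: the Laplacian of [f] is decomposed first, [lapl_sqnX] gives a preimage
    of each term [|x|^(2 k) H k], and [f] minus these preimages is harmonic. *)
Lemma fischer m : forall f, hpoly m f -> exists H : nat -> V -> R,
  [/\ forall k, hharm (m - k.*2) (H k), forall k, (m < k.*2)%N -> forall x, H k x = 0 &
  forall x, f x = \sum_(k < m.+1) sqn x ^+ k * H k x].
Proof.
elim/ltn_ind: m => m IH f hf.
have [fd [fdd [h1 h2 h3 h4]]] := hpoly_wit hf.
have [m2|m2] := ltnP m 2.
  exists (fun k => if k == 0%N then f else fun=> 0); split.
  - move=> k; case: ifP => [/eqP->|_]; last exact: hharm0.
    rewrite subn0; split => //; exists fd, fdd; split => // x _.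
    by rewrite big1// => i _; exact: h3.
  - by move=> [|k].
  - move=> x; rewrite big_ord_recl/= expr0 mul1r big1 ?addr0// => k _.
    by rewrite mulr0.
have mE : m = (m - 2).+2 by lia.
have hL : hpoly (m - 2) (fun x => \sum_i fdd i i x).
  by rewrite subn2; apply: hpoly_sum => i; exact: h2.
have mlt : (m - 2 < m)%N by lia.
have [H [H1 H2 H3]] := IH _ mlt _ hL.
pose c (k : nat) : R := 2 * k.+1%:R * (N + 2 * k%:R + 2 * (m - 2 - k.*2)%:R).
have c0 k : 0 < c k.
  rewrite /c; apply: mulr_gt0; first exact: mulr_gt0.
  by apply: ltr_wpDr; [exact: mulr_ge0|apply: ltr_wpDr => //; exact: mulr_ge0].
pose Q x := \sum_(k < m.-1) (c k)^-1 * (sqn x ^+ k.+1 * H k x).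
have m1E : m.-1 = (m - 2).+1 by lia.
have hQ : hpoly m Q.
  apply: hpoly_sum => k; apply: hpolyZ.
  have [km|km] := leqP k.+1.*2 m.
    have e : m = (k.+1.*2 + (m - 2 - k.*2))%N by lia.
    by rewrite [X in hpoly X _]e; apply: hpolyM; [exact: hpoly_sqn|have [] := H1 k].
  apply: hpoly_eq (hp0 m) => x; rewrite H2 ?mulr0//; lia.
have [qd [qdd [q1 q2]]] : exists qd qdd, hasC2 setT Q qd qdd /\ forall x, \sum_i qdd i i x = \sum_(k < m.-1) sqn x ^+ k * H k x.
  rewrite /Q; elim: (m.-1) => [|p [qd [qdd [q1 q2]]]].
    exists (fun _ _ => 0), (fun _ _ _ => 0); split.
      rewrite (_ : (fun x => _) = (fun=> 0)); first exact: hasC2_cst.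
      by apply/funext => x; rewrite big_ord0.
    by move=> x; rewrite big_ord0 big1.
  have [fd' [fdd' [e1 e2]]] := lapl_sqnX p (H1 p).
  exists (fun i x => qd i x + (c p)^-1 * fd' i x), (fun i j x => qdd i j x + (c p)^-1 * fdd' i j x).
  split.
    rewrite (_ : (fun x => _) = (fun x => \sum_(k < p) (c k)^-1 * (sqn x ^+ k.+1 * H k x) + (c p)^-1 * (sqn x ^+ p.+1 * H p x))).
      by apply: hasC2D => //; exact: hasC2Z.
    by apply/funext => x; rewrite big_ord_recr.
  move=> x; rewrite big_split/= q2 -mulr_sumr e2 big_ord_recr/= -/(c p) mulrA mulVf ?mul1r//.
  exact: lt0r_neq0.
exists (fun k => if k is k'.+1 then (fun x => (c k')^-1 * H k' x) else (fun x => f x + -1 * Q x)).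
split.
- move=> [|k] /=.
    rewrite subn0; split; first by apply: hpD => //; exact: hpolyZ.
    exists (fun i x => fd i x + -1 * qd i x), (fun i j x => fdd i j x + -1 * qdd i j x).
    split; first by apply: hasC2D => //; exact: hasC2Z.
    by move=> x _; rewrite big_split/= -mulr_sumr q2 H3 m1E mulN1r subrr.
  by apply: hharmZ; have := H1 k; rewrite (_ : (m - 2 - k.*2)%N = (m - k.+1.*2)%N)//; lia.
- by move=> [|k] km x //; rewrite H2 ?mulr0//; lia.
- move=> x; rewrite big_ord_recl/= expr0 mul1r /Q.
  have key p : m = p.+1 -> \sum_(k < p.+1) sqn x ^+ k.+1 * ((c k)^-1 * H k x) =
      \sum_(k < p) (c k)^-1 * (sqn x ^+ k.+1 * H k x).
    move=> mp; rewrite big_ord_recr/= [H p x]H2; last lia.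
    by rewrite !mulr0 addr0; apply: sumR_eq => k; rewrite mulrCA.
  have e : m = m.-1.+1 by lia.
  have := key m.-1 e; rewrite -e => {key} h.
  rewrite (_ : \sum_(k < m) sqn x ^+ bump 0 k * _ = \sum_(k < m.-1) (c k)^-1 * (sqn x ^+ k.+1 * H k x)).
    by rewrite mulN1r subrK.
  exact: h.
Qed.

Inductive psum : (V -> R) -> Prop :=
| psH m f : hpoly m f -> psum f
| psD f g : psum f -> psum g -> psum (fun x => f x + g x).

Lemma psum_eq f g : (forall x, f x = g x) -> psum f -> psum g.
Proof. by move=> fg; rewrite (_ : g = f)//; apply/funext => x; rewrite fg. Qed.

Lemma psumM f g : psum f -> psum g -> psum (fun x => f x * g x).
Proof.
move=> pf; elim=> [m h hh|h h' _ IH _ IH'].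
  elim: pf => [k p hp|p p' _ IH _ IH']; first exact: psH (hpolyM hp hh).
  by apply: psum_eq (psD IH IH') => x; rewrite mulrDl.
by apply: psum_eq (psD IH IH') => x; rewrite mulrDr.
Qed.

Lemma psum_cst c : psum (fun=> c).
Proof. exact: psH (hpC c). Qed.

Lemma psum_coord i : psum (fun x => x 0 i).
Proof. exact: psH (hpoly_coord i). Qed.

(** One component per degree is kept, because Kelvin's transform multiplies each degree by its own
    power of [|x|]. *)
Definition sph f := exists (M : nat) (H : nat -> V -> R),
  [/\ forall m, hharm m (H m), forall m, (M <= m)%N -> forall x, H m x = 0 &
   forall x, sqn x = 1 -> f x = \sum_(m < M) H m x].

Lemma sphD f g : sph f -> sph g -> sph (fun x => f x + g x).
Proof.
move=> [M [H [a b c]]] [K [G [a' b' c']]].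
exists (maxn M K), (fun m x => H m x + G m x); split.
- by move=> m; exact: hharmD.
- by move=> m; rewrite geq_max => /andP[? ?] x; rewrite b// b'// addr0.
- move=> x x1; rewrite big_split/= c// c'//.
  have ext (L : nat) (F : nat -> V -> R) : (L <= maxn M K)%N ->
      (forall m, (L <= m)%N -> forall x, F m x = 0) ->
      \sum_(m < L) F m x = \sum_(m < maxn M K) F m x.
    move=> LM F0; rewrite -!(big_mkord xpredT (fun m => F m x)) [RHS](big_cat_nat _ LM)//=.
    rewrite [X in _ + X]big_nat_cond [X in _ + X]big1 ?addr0// => m /andP[/andP[Lm _] _].
    exact: F0.
  by rewrite (ext M H) ?leq_maxl// (ext K G) ?leq_maxr.
Qed.

Lemma sph_hharm m f : hharm m f -> sph f.
Proof.
move=> hf; exists m.+1, (fun k => if k == m then f else fun=> 0); split.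
- by move=> k; case: eqP => [->//|_]; exact: hharm0.
- by move=> k mk x; rewrite gtn_eqF.
- move=> x _; rewrite big_ord_recr/= eqxx big1 ?add0r// => k _.
  by rewrite ltn_eqF.
Qed.

(** On the unit sphere the factors [|x|^(2 k)] of Fischer's decomposition equal 1. *)
Lemma psum_sph f : psum f -> sph f.
Proof.
elim=> [m h /fischer[H [H1 _ H3]]|h h' _ IH _ IH']; last exact: sphD.
have : sph (fun x => \sum_(k < m.+1) H k x).
  elim: m.+1 => [|p IH].
    have [M [G [a b c]]] := sph_hharm (hharm0 0).
    by exists M, G; split => // x x1; rewrite big_ord0 -c.
  have [M [G [a b c]]] := sphD IH (sph_hharm (H1 p)).
  by exists M, G; split => // x x1; rewrite big_ord_recr/= -c.
move=> [M [G [a b c]]]; exists M, G; split => // x x1; rewrite -c// H3.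
by apply: sumR_eq => k; rewrite x1 expr1n mul1r.
Qed.

End Polynomials.

(** * Compactness arguments *)

Section CompactTools.
Context {R : realType} {n : nat}.
Local Notation V := 'rV[R]_n.+1.
Implicit Types (x y z : V) (K A B : set V) (Q : set V -> Prop) (g : V -> R).

(** Heine-Borel packaged as an induction, so that a common radius, bound or approximant is obtained
    without handling finite subcovers. *)
Lemma compact_ind K Q : compact K -> Q set0 ->
  (forall A B, Q A -> Q B -> Q (A `|` B)) ->
  (forall A B, A `<=` B -> Q B -> Q A) ->
  (forall x, K x -> exists2 r : R, 0 < r & Q (eB x r)) -> Q K.
Proof.
move=> cK Q0 QU Qsub Qloc.
have /choice[r hr] : forall x, exists r : R, K x -> 0 < r /\ Q (eB x r).
  move=> x; have [Kx|nK] := pselect (K x); last by exists 0.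
  by have [r r0 Qr] := Qloc x Kx; exists r.
move: cK; rewrite compact_cover => /(_ V K (fun x => eB x (r x))).
move=> [||D' D'K Kcov].
- by move=> x _; exact: eB_open.
- by move=> x Kx; exists x => //; apply: eB_center; have [] := hr x Kx.
apply: (Qsub _ _ Kcov).
have : forall s : seq V, (forall x, x \in s -> K x) -> Q (\bigcup_(x in [set y | y \in s]) eB x (r x)).
  elim=> [|x s IH] sK; first by apply: (Qsub _ _ _ Q0) => y [z].
  apply: (@Qsub _ (eB x (r x) `|` \bigcup_(x in [set y | y \in s]) eB x (r x))).
    move=> y [z /=]; rewrite inE => /orP[/eqP->|zs] zB; [by left|by right; exists z].
  apply: QU; first by have [] := hr x (sK x (mem_head _ _)).
  by apply: IH => z zs; apply: sK; rewrite inE zs orbT.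
move=> /(_ (finmap.enum_fset D')) h; apply: (Qsub _ _ _ (h _)); last first.
  by move=> x xD; apply/set_mem/D'K.
by move=> y [z zD zB]; exists z.
Qed.

Lemma compact_bounded_near K (P : V -> R -> Prop) : compact K ->
  (forall x a b, P x a -> b <= a -> 0 < b -> P x b) ->
  (forall x, K x -> exists2 r : R, 0 < r & forall y, K y -> enorm (y - x) < r -> P y r) ->
  exists2 r : R, 0 < r & forall x, K x -> P x r.
Proof.
move=> cK Pm h.
pose Q A := exists2 r : R, 0 < r & forall x, A x -> K x -> P x r.
suff [r r0 hr] : Q K by exists r => // x Kx; exact: hr.
apply: compact_ind => //.
- by exists 1.
- move=> A B [r r0 hr] [s s0 hs]; exists (Num.min r s); first by rewrite lt_min r0.
  move=> x [Ax|Bx] Kx.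
    by apply: Pm (hr x Ax Kx) _ _; [rewrite ge_min lexx|rewrite lt_min r0].
  by apply: Pm (hs x Bx Kx) _ _; [rewrite ge_min lexx orbT|rewrite lt_min r0].
- by move=> A B AB [r r0 hr]; exists r => // x /AB; exact: hr.
- move=> x Kx; have [r r0 hr] := h x Kx; exists r => //; exists r => // y yx Ky; exact: hr.
Qed.

Lemma compact_unif_cont K g : compact K -> (forall x, K x -> blim K g x (g x)) ->
  forall e : R, 0 < e -> exists2 d : R, 0 < d &
    forall x y, K x -> K y -> enorm (x - y) < d -> `|g x - g y| < e.
Proof.
move=> cK cg e e0.
have [||d d0 hd] := @compact_bounded_near K
  (fun x d => forall y, K y -> enorm (x - y) < d -> `|g x - g y| < e) cK.
- move=> x a b h ba b0 y Ky xy; apply: h => //; exact: lt_le_trans ba.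
- move=> x Kx; have [d d0 hd] := cg x Kx (e / 2) ltac:(lra).
  exists (d / 2); first lra.
  move=> y Ky yx z Kz yz; have h1 := hd y Ky ltac:(lra).
  have h2 := hd z Kz ltac:(have := enorm_tri y z x; rewrite (enorm_distC z y); lra).
  rewrite -(subrKA (g x)); apply: le_lt_trans (ler_normD _ _) _.
  by rewrite (distrC (g x)); lra.
by exists d => // x y Kx; exact: hd.
Qed.

(** The bound is encoded as the inverse of a radius, so that [compact_bounded_near] applies. *)
Lemma compact_bound K g : compact K -> (forall x, K x -> blim K g x (g x)) ->
  exists2 M : R, 0 < M & forall x, K x -> `|g x| <= M.
Proof.
move=> cK cg.
have [||d d0 hd] := @compact_bounded_near K (fun x d => `|g x| <= d^-1) cK.
- move=> x a b h ba b0; apply: le_trans h _; rewrite lef_pV2// posrE//.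
  exact: lt_le_trans ba.
- move=> x Kx; have [d d0 hd] := cg x Kx 1 ltr01.
  pose m : R := `|g x| + 1; have m0 : 0 < m by rewrite ltr_wpDl.
  exists (Num.min d m^-1); first by rewrite lt_min d0 invr_gt0.
  move=> y Ky; rewrite lt_min => /andP[yd _].
  apply: (@le_trans _ _ m).
    have := hd y Ky yd; have := ler_normD (g y - g x) (g x); rewrite subrK /m; lra.
  rewrite -[leLHS]invrK lef_pV2 ?posrE ?invr_gt0 ?lt_min ?d0 ?invr_gt0//.
  by rewrite ge_min lexx orbT.
by exists d^-1; [rewrite invr_gt0|].
Qed.

Lemma compact_sphere (c : V) (r : R) : compact [set x | enorm (x - c) = r].
Proof.
apply: bounded_closed_compact.
  by apply/eboundedP; exists (r + enorm c) => x /= xr; have := enormD (x - c) c; rewrite subrK xr.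
move=> z /closure_enormP cz; apply/eqP; rewrite eq_le; apply/andP; split; apply/ler_addgt0Pr => e e0.
  by have [y /= yr yz] := cz e e0; have := enorm_tri y z c; rewrite (enorm_distC z y); lra.
by have [y /= yr yz] := cz e e0; have := enorm_tri z y c; lra.
Qed.

Lemma closed_cball (c : V) (r : R) : closed [set x | enorm (x - c) <= r].
Proof.
move=> z /closure_enormP cz; apply/ler_addgt0Pr => e e0.
by have [y /= yr yz] := cz e e0; have := enorm_tri y z c; rewrite (enorm_distC z y); lra.
Qed.

Lemma compact_cball (c : V) (r : R) : compact [set x | enorm (x - c) <= r].
Proof.
apply: bounded_closed_compact; last exact: closed_cball.
by apply/eboundedP; exists (r + enorm c) => x /= xr; have := enormD (x - c) c; rewrite subrK; lra.
Qed.

Lemma closure_eB (c : V) (r : R) z : closure (eB c r) z -> enorm (z - c) <= r.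
Proof.
move=> h; apply: (@closed_cball c r z).
by apply: closure_subset h => x /ltW.
Qed.

End CompactTools.

(** * Polynomial approximation on the sphere by Bernstein's method *)

Section Bernstein.
Context {R : realType} {n : nat}.
Local Notation V := 'rV[R]_n.+1.
Local Notation N := (n.+1%:R : R).
Implicit Types (x y z : V) (F G : V -> R) (i j : 'I_n.+1) (phi psi : nat -> R).

(* Expectation of [phi] under the binomial distribution of parameters m, t. *)
Fixpoint bE (m : nat) (t : R) phi : R :=
  if m is m'.+1 then t * bE m' t (fun k => phi k.+1) + (1 - t) * bE m' t phi
  else phi 0%N.

Lemma bE_ext m t phi psi : (forall k, phi k = psi k) -> bE m t phi = bE m t psi.
Proof. by move=> h; congr (bE m t _); apply/funext. Qed.

Lemma bE_cst m t (c : R) : bE m t (fun=> c) = c.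
Proof. by elim: m => //= m ->; ring. Qed.

Lemma bED m t phi psi : bE m t (fun k => phi k + psi k) = bE m t phi + bE m t psi.
Proof. by elim: m phi psi => //= m IH phi psi; rewrite !IH; ring. Qed.

Lemma bEZ m t (c : R) phi : bE m t (fun k => c * phi k) = c * bE m t phi.
Proof. by elim: m phi => //= m IH phi; rewrite !IH; ring. Qed.

Lemma bE_mono m t phi psi : 0 <= t <= 1 -> (forall k, phi k <= psi k) ->
  bE m t phi <= bE m t psi.
Proof.
move=> /andP[t0 t1]; elim: m phi psi => //= m IH phi psi h.
by apply: lerD; rewrite ler_wpM2l ?subr_ge0// IH.
Qed.

Lemma bE_var m t : bE m t (fun k => (k%:R - m%:R * t) ^+ 2) = m%:R * (t * (1 - t)).
Proof.
elim: m => [|m IH] /=; first by rewrite !mul0r subr0 expr0n.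
rewrite -!bEZ -bED.
rewrite (@bE_ext _ _ _ (fun k => (k%:R - m%:R * t) ^+ 2 + t * (1 - t))).
  by rewrite bED IH bE_cst -[m.+1]addn1 natrD; ring.
by move=> k; rewrite -[k.+1]addn1 -[m.+1]addn1 !natrD; ring.
Qed.

Definition nd (m k : nat) : R := 2 * k%:R / m%:R - 1.

Lemma bE_nd m (a : R) : (0 < m)%N ->
  bE m ((a + 1) / 2) (fun k => (nd m k - a) ^+ 2) = (1 - a ^+ 2) / m%:R.
Proof.
move=> m0; have mn : (m%:R : R) != 0 by rewrite pnatr_eq0 -lt0n.
rewrite (@bE_ext _ _ _ (fun k => (2 / m%:R) ^+ 2 * (k%:R - m%:R * ((a + 1) / 2)) ^+ 2)).
  by rewrite bEZ bE_var; field.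
by move=> k; rewrite /nd; field.
Qed.

Definition upd y i (c : R) : V := y + (c - y 0 i) *: ee i.

Lemma updE y i c j : upd y i c 0 j = if j == i then c else y 0 j.
Proof.
rewrite /upd !mxE eqxx/=; case: eqP => [->|_]; first by rewrite mulr1 addrC subrK.
by rewrite mulr0 addr0.
Qed.

(** Tensor product of the one-dimensional expectations: the first [i] coordinates are replaced by
    random nodes of mean [x 0 j], the others are those of [y]. *)
Fixpoint mE (m : nat) x (i : nat) F y : R :=
  if i is i'.+1 then
    bE m ((x 0 (inord i') + 1) / 2) (fun k => mE m x i' F (upd y (inord i') (nd m k)))
  else F y.

Lemma mE_cst m x (i : nat) (c : R) y : mE m x i (fun=> c) y = c.
Proof.
elim: i y => //= i IH y; rewrite (@bE_ext _ _ _ (fun=> c)); first exact: bE_cst.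
by move=> k; exact: IH.
Qed.

Lemma mED m x (i : nat) F G y : mE m x i (fun y => F y + G y) y = mE m x i F y + mE m x i G y.
Proof.
elim: i y => //= i IH y; rewrite -bED; apply: bE_ext => k; exact: IH.
Qed.

Lemma mEZ m x (i : nat) (c : R) F y : mE m x i (fun y => c * F y) y = c * mE m x i F y.
Proof. by elim: i y => //= i IH y; rewrite -bEZ; apply: bE_ext => k; exact: IH. Qed.

Lemma mE_mono m x (i : nat) F G y : (forall j, -1 <= x 0 j <= 1) -> (forall y, F y <= G y) ->
  mE m x i F y <= mE m x i G y.
Proof.
move=> hx FG; elim: i y => //= i IH y; apply: bE_mono => //.
by have /andP[a b] := hx (inord i); apply/andP; split; lra.
Qed.

Lemma mE_sq m x (i : nat) j y : (0 < m)%N -> (i <= n.+1)%N ->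
  mE m x i (fun y => (y 0 j - x 0 j) ^+ 2) y =
  if (j < i)%N then (1 - x 0 j ^+ 2) / m%:R else (y 0 j - x 0 j) ^+ 2.
Proof.
move=> m0; elim: i y => //= i IH y iN.
rewrite (@bE_ext _ _ _ _ (fun k => IH (upd y (inord i) (nd m k)) (ltnW iN))).
have [ji|ji|ji] := ltngtP j i.
- by rewrite bE_cst ltnS ltnW.
- rewrite ltnS leqNgt ji/= (@bE_ext _ _ _ (fun=> (y 0 j - x 0 j) ^+ 2)) ?bE_cst// => k.
  rewrite updE ifF//; apply/negP => /eqP e; move: ji; rewrite e inordK// ltnn.
  by [].
- have e : inord i = j by apply/val_inj; rewrite /= inordK.
  rewrite ji ltnS leqnn e -bE_nd//; apply: bE_ext => k.
  by rewrite updE eqxx.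
Qed.

Lemma mE_sum m x (i : nat) (k : nat) (G : 'I_k -> V -> R) y :
  mE m x i (fun y => \sum_q G q y) y = \sum_q mE m x i (G q) y.
Proof.
elim: k G => [|k IH] G.
  rewrite big_ord0 (_ : (fun y => _) = (fun=> 0)) ?mE_cst//.
  by apply/funext => z; rewrite big_ord0.
rewrite big_ord_recr/= -IH -mED; congr (mE m x i _ y).
by apply/funext => z; rewrite big_ord_recr.
Qed.

(** The expectation of [|y - x|^2] is a sum of [N] variances, each at most [1 / m], so a quadratic
    modulus of continuity can be averaged. *)
Lemma mE_approx m x F (e K : R) : (0 < m)%N -> enorm x = 1 -> 0 <= K ->
  (forall y, `|F y - F x| <= e + K * sqn (y - x)) ->
  `|mE m x n.+1 F 0 - F x| <= e + K * (N / m%:R).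
Proof.
move=> m0 x1 K0 h.
have hx j : -1 <= x 0 j <= 1 by rewrite -ler_norml -x1 coord_le_enorm.
have hq : mE m x n.+1 (fun y => e + K * sqn (y - x)) 0 <= e + K * (N / m%:R).
  rewrite mED mE_cst mEZ lerD2l ler_wpM2l//.
  rewrite (_ : (fun y => sqn (y - x)) = (fun y => \sum_j (y 0 j - x 0 j) ^+ 2)); last first.
    by apply/funext => y; apply: eq_bigr => j _; rewrite !mxE.
  rewrite mE_sum; apply: (@le_trans _ _ (\sum_(j < n.+1) m%:R^-1)).
    apply: ler_sum => j _; rewrite mE_sq// ltn_ord.
    by rewrite ler_pdivrMr ?ltr0n// mulVf ?pnatr_eq0 -?lt0n// gerBl sqr_ge0.
  by rewrite sumr_const card_ord [leRHS]mulrC mulr_natr.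
rewrite ler_distl; apply/andP; split.
  apply: (@le_trans _ _ (mE m x n.+1 (fun y => F x + -1 * (e + K * sqn (y - x))) 0)).
    by rewrite mED mE_cst mEZ mulN1r lerD2l lerN2.
  apply: mE_mono => // y; have := h y; rewrite ler_norml => /andP[]; lra.
apply: (@le_trans _ _ (mE m x n.+1 (fun y => F x + (e + K * sqn (y - x))) 0)).
  apply: mE_mono => // y; have := h y; rewrite ler_norml => /andP[]; lra.
by rewrite mED mE_cst lerD2l.
Qed.

Lemma psum_bE m (t : V -> R) (phi : nat -> V -> R) : psum t ->
  (forall k, psum (phi k)) -> psum (fun x => bE m (t x) (fun k => phi k x)).
Proof.
move=> pt; elim: m phi => [|m IH] phi pphi /=; first exact: pphi.
apply: psD; first by apply: psumM => //; exact: IH.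
apply: psumM; last exact: IH.
apply: (@psum_eq _ _ (fun x => 1 + -1 * t x)); first by move=> x; rewrite mulN1r.
by apply: psD; [exact: psum_cst|apply: psumM => //; exact: psum_cst].
Qed.

(** The probabilities of the nodes are polynomial in [x], so the expectation is a polynomial however
    irregular [F] is. *)
Lemma psum_mE m (i : nat) F y : psum (fun x => mE m x i F y).
Proof.
elim: i y => [|i IH] y /=; first exact: psum_cst.
apply: psum_bE => [|k]; last exact: IH.
apply: (@psum_eq _ _ (fun x => 2^-1 * (x 0 (inord i) + 1))); first by move=> x; rewrite mulrC.
by apply: psumM; [exact: psum_cst|apply: psD; [exact: psum_coord|exact: psum_cst]].
Qed.

Lemma sphere_approx (g : V -> R) (e : R) :
  (forall x, enorm x = 1 -> blim [set y | enorm y = 1] g x (g x)) -> 0 < e ->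
  exists2 P, psum P & forall x, enorm x = 1 -> `|P x - g x| <= e.
Proof.
move=> cg e0.
have cS : compact [set y : V | enorm y = 1].
  by rewrite (_ : mkset _ = [set y | enorm (y - 0) = 1]); [exact: compact_sphere|apply/seteqP; split => y /=; rewrite subr0].
have [M M0 gM] := compact_bound cS cg.
have [d d0 hd] := compact_unif_cont cS cg (ltac:(lra) : 0 < e / 2).
(* Radial extension of [g], set to 0 near the origin. The jump does no harm: away from [x] the
   quadratic term with [K = 2 M / d'^2] dominates the oscillation [2 M]. *)
pose F y : R := if 2^-1 <= enorm y then g ((enorm y)^-1 *: y) else 0.
pose d' : R := Num.min (d / 2) (2^-1).
have d'0 : 0 < d' by rewrite lt_min; apply/andP; split; lra.
pose K : R := 2 * M / d' ^+ 2.
have K0 : 0 <= K by rewrite divr_ge0 ?sqr_ge0// mulr_ge0// ltW.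
have FM y : `|F y| <= M.
  rewrite /F; case: ifP => [y2|_]; last by rewrite normr0 ltW.
  apply: gM; rewrite /= enormZ ger0_norm ?invr_ge0 ?enorm_ge0// mulVf//.
  by rewrite gt_eqF//; lra.
have Fx x : enorm x = 1 -> F x = g x.
  by move=> x1; rewrite /F x1 invr1 scale1r ifT//; lra.
have hF x : enorm x = 1 -> forall y, `|F y - F x| <= e / 2 + K * sqn (y - x).
  move=> x1 y; have [yx|yx] := ltP (enorm (y - x)) d'.
    have y2 : 2^-1 <= enorm y.
      have := enorm_rdist y x; rewrite x1 ler_norml => /andP[h _].
      move: yx; rewrite lt_min => /andP[_]; lra.
    have yp : 0 < enorm y by lra.
    apply: (@le_trans _ _ (e / 2)); last first.
      by rewrite lerDl mulr_ge0// sqnE sqr_ge0.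
    rewrite (Fx x x1) /F y2; apply/ltW/hd => //=.
      by rewrite enormZ ger0_norm ?invr_ge0 ?enorm_ge0// mulVf// gt_eqF.
    apply: le_lt_trans (enorm_tri y _ _) _.
    have -> : (enorm y)^-1 *: y - y = ((enorm y)^-1 - 1) *: y by rewrite scalerBl scale1r.
    rewrite enormZ -{2}(ger0_norm (enorm_ge0 y)) -normrM mulrBl mulVf ?gt_eqF// mul1r.
    have := enorm_rdist x y; rewrite x1 (enorm_distC x).
    move: yx; rewrite lt_min => /andP[h _]; lra.
  have h1 : `|F y - F x| <= 2 * M.
    by apply: le_trans (ler_normB _ _) _; have := FM y; have := FM x; lra.
  apply: le_trans h1 _; apply: (@le_trans _ _ (K * sqn (y - x))); last by rewrite lerDr; lra.
  rewrite /K mulrAC ler_pdivlMr ?exprn_gt0// ler_wpM2l; [by []|lra|].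
  by rewrite sqnE lerXn2r ?nnegrE ?enorm_ge0// ltW.
pose m := (Num.truncn (2 * K * N / e)).+1.
exists (fun x => mE m x n.+1 F 0); first exact: psum_mE.
move=> x x1; rewrite -(Fx x x1); apply: le_trans (mE_approx (m := m) _ x1 K0 (hF x x1)) _ => //.
have : 2 * K * N / e < m%:R by rewrite /m; exact: truncnS_gt.
rewrite ltr_pdivrMr// => h.
have mp : (0 : R) < m%:R by rewrite ltr0n.
have : K * (N / m%:R) <= e / 2.
  rewrite mulrA ler_pdivrMr//; lra.
lra.
Qed.

End Bernstein.

(** * The Dirichlet problem in a ball and Kelvin's transform *)

Section BallSolver.
Context {R : realType} {n : nat}.
Local Notation V := 'rV[R]_n.+1.
Local Notation N := (n.+1%:R : R).
Implicit Types (x y z : V) (c r M : R) (O : set V) (f g h : V -> R^o).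

Lemma bsup_blim O f M :
  (\bd z of O, blim O f z (f z) /\ f z <= M) -> bsup O f (fun=> M).
Proof.
move=> h z cz nz e e0; have [cf fz] := h z cz nz; have [d d0 hd] := cf e e0.
exists d => // x Ox /(hd x Ox); rewrite ltr_norml => /andP[_]; lra.
Qed.

Lemma max_blim O f L M : open O -> ebounded O -> lapl O f L -> (forall x, O x -> 0 <= L x) ->
  (\bd z of O, blim O f z (f z) /\ f z <= M) ->
  forall x, O x -> f x <= M.
Proof. by move=> oO bO lf L0 /bsup_blim h; exact: max_principle lf L0 h. Qed.

Lemma blim_sub (A B : set V) f z l : A `<=` B -> blim B f z l -> blim A f z l.
Proof.
by move=> AB h e /h[d d0 hd]; exists d => // y /AB; exact: hd.
Qed.

Lemma cont_blim (A : set V) f z : cont_at f z -> blim A f z (f z).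
Proof. by move=> cf e /cf[d d0 hd]; exists d => // y _; exact: hd. Qed.

Definition cball (a : V) r : set V := [set y | enorm (y - a) <= r].
Definition sphere (a : V) r : set V := [set y | enorm (y - a) = r].

Lemma harm_max_ball a r f M : 0 < r -> harm (eB a r) f ->
  (forall z, sphere a r z -> blim (cball a r) f z (f z)) ->
  (forall z, sphere a r z -> f z <= M) -> forall x, cball a r x -> f x <= M.
Proof.
move=> r0 hf bf fM x xB.
have [xr|xr] := eqVneq (enorm (x - a)) r; first exact: fM.
have xo : eB a r x by rewrite /eB/= lt_neqAle xr.
apply: (max_blim (@eB_open _ _ a r) (@eB_bounded _ _ a r) (harm_lapl hf)) => // z cz nz.
have zr : sphere a r z.
  apply/eqP; rewrite eq_le closure_eB//=; rewrite leNgt; apply/negP => zr; exact: nz.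
split; last exact: fM.
by apply: blim_sub (bf z zr) => y /ltW.
Qed.

Lemma harm_norm_ball a r f M : 0 < r -> harm (eB a r) f ->
  (forall z, sphere a r z -> blim (cball a r) f z (f z)) ->
  (forall z, sphere a r z -> `|f z| <= M) -> forall x, cball a r x -> `|f x| <= M.
Proof.
move=> r0 hf bf fM x xB; rewrite ler_norml; apply/andP; split.
  rewrite lerNl; apply: (harm_max_ball r0 (harmN hf) _ _ xB) => z zr.
    by move=> e /(bf z zr)[d d0 hd]; exists d => // y yB yz; rewrite -opprD normrN; exact: hd.
  by have := fM z zr; rewrite ler_norml => /andP[]; lra.
by apply: (harm_max_ball r0 hf bf _ xB) => z zr; have := fM z zr; rewrite ler_norml => /andP[].
Qed.

(** The exponent is the root of [2 N + 4 (a - 1) + 4 m], the factor that [radial_lapl] produces. *)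
Lemma kelvin_hharm m f : hharm m f ->
  harm [set x | x != 0] (fun x => pw (1 - N / 2 - m%:R) x * f x).
Proof.
move=> /hpoly_wit_harm[hd [hdd [hh h0 hE]]]; set a := (_ - _).
have hh' : hasC2 [set x | x != 0] f hd hdd by move=> x _; exact: hh.
have [fd [fdd [h1 h2]]] := @radial_lapl _ _ [set x | x != 0] _ _ _ f hd hdd m%:R
  (fun x px => @pw_profile R n a x px) hh' (fun x _ => h0 x) (fun x _ => hE x).
exists fd, fdd; split => // x x0; rewrite h2//.
have -> : 4 * sqn x * (a * ((a - 1) * pw (a - 1 - 1) x)) = 4 * (a * ((a - 1) * pw (a - 1) x)).
  rewrite -[pw (a - 1) x](_ : sqn x * pw (a - 1 - 1) x = _); first by ring.
  rewrite /pw -{1}(powRr1 (ltW _ : 0 <= sqn x)) ?sqn_gt0// -powRD; last first.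
    by apply/implyP => _; rewrite gt_eqF ?sqn_gt0.
  by congr (_ `^ _); ring.
rewrite (_ : _ + _ = 0) ?mul0r//.
by rewrite /a; field.
Qed.

Definition kelvin f x : R := pw (1 - N / 2) x * f ((sqn x)^-1 *: x).

Lemma pwB a (m : nat) x : x != 0 -> pw (a - m%:R) x = pw a x / sqn x ^+ m.
Proof.
move=> x0; have s0 : 0 < sqn x by rewrite sqn_gt0.
rewrite /pw powRB; last by apply/implyP => _; rewrite gt_eqF.
by rewrite powR_mulrn// ltW.
Qed.

Lemma kelvin_hpoly m f x : hpoly m f -> x != 0 -> kelvin f x = pw (1 - N / 2 - m%:R) x * f x.
Proof.
by move=> hf x0; rewrite /kelvin (hpoly_homog _ _ hf) pwB// exprVn; ring.
Qed.

Lemma pw_ge0 a x : 0 <= pw a x.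
Proof. exact: powR_ge0. Qed.

Lemma pw_le1 a x : a <= 0 -> 1 <= enorm x -> pw a x <= 1.
Proof.
move=> a0 x1; rewrite /pw -[leRHS](powRr0 (sqn x)); apply: ler_powR => //.
by rewrite sqnE -[1](expr1n _ 2) lerXn2r ?nnegrE ?enorm_ge0.
Qed.

(** On the sphere the datum is a uniform limit of sums of harmonic polynomials, which are their own
    extensions; the maximum principle carries the rate inside. Kelvin's transform of each term is
    harmonic, and its weight is at most 1 outside the ball, so the same approximation gives the last
    clause. *)
Lemma unit_ball_solve g : (2 <= n.+1)%N ->
  (forall x, enorm x = 1 -> blim [set y | enorm y = 1] g x (g x)) ->
  exists h, [/\ harm (eB 0 1) h, forall x, enorm x = 1 -> h x = g x,
    forall z, enorm z <= 1 -> blim (cball 0 1) h z (h z) &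
    harm [set x | 1 < enorm x] (kelvin h)].
Proof.
move=> n2 cg.
have /choice[P hP] : forall k : nat, exists P : V -> R, sph P /\ forall x, enorm x = 1 -> `|P x - g x| <= ik k.
  by move=> k; have [P pP h] := sphere_approx cg (ik_gt0 k); exists P; split => //; exact: psum_sph.
have /choice[MH hMH] : forall k : nat, exists MH : nat * (nat -> V -> R),
    [/\ forall m, hharm m (MH.2 m) &
   forall x, enorm x = 1 -> P k x = \sum_(m < MH.1) MH.2 m x].
  move=> k; have [[M [H [a b c]]] _] := hP k; exists (M, H); split => // x x1.
  by apply: c; rewrite sqnE x1 expr1n.
pose hk k x : R := \sum_(m < (MH k).1) (MH k).2 m x.
have hharmk k : harm setT (hk k).
  by apply: harm_sum => m; have [/(_ m)[]] := hMH k.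
have ck k x : cont_at (hk k) x by apply: harm_cont (hharmk k) _.
have hks k x : enorm x = 1 -> `|hk k x - g x| <= ik k.
  by move=> x1; have [_ /(_ x x1) e] := hMH k; rewrite /hk -e; have [_] := hP k; exact.
have dif k l x : enorm x <= 1 -> `|hk k x - hk l x| <= ik k + ik l.
  move=> x1; apply: (@harm_norm_ball 0 1 (fun x => hk k x - hk l x)) => //.
  - by apply: harmB; apply: harm_sub (hharmk _).
  - by move=> z _; apply: cont_blim; exact: contB.
  - move=> z; rewrite /sphere/= subr0 => z1; rewrite -(subrKA (g z)).
    by apply: le_trans (ler_normD _ _) _; rewrite lerD ?hks// distrC hks.
  - by rewrite /cball/= subr0.
have /choice[h hh] : forall x, exists s, enorm x <= 1 -> forall k, `|hk k x - s| <= ik k.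
  move=> x; have [x1|x1] := leP (enorm x) 1; last by exists 0.
  have [s hs] := seq_lim (fun k l => dif k l x x1); exists s => _; exact: hs.
exists h; split.
- apply: harm_approx => x xB; have [r r0 rB] := open_ball_in (@eB_open _ _ 0 1) xB.
  exists r => // e e0; have [k kk] := ik_small e0.
  exists (hk k); first by apply: harm_sub (hharmk k).
  move=> y /rB; rewrite /eB/= subr0 => /ltW/hh => yh; apply: le_trans (yh k) (ltW kk).
- move=> x x1; apply/eqP; rewrite -subr_eq0 -normr_le0.
  apply: (@le_lim_ik _ _ _ 2) => k; rewrite add0r.
  rewrite -(subrKA (hk k x)); apply: le_trans (ler_normD _ _) _.
  by rewrite mulr_natl mulr2n lerD ?hks// distrC hh// x1.
- move=> z z1 e e0; have [k kk] := @ik_small _ (e / 4) ltac:(lra).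
  have [d d0 hd] := ck k z (e / 4) ltac:(lra).
  exists d => // y; rewrite /cball/= subr0 => y1 /hd yz.
  have := hh y y1 k; have := hh z z1 k; move: yz.
  rewrite !ltr_norml !ler_norml => /andP[? ?] /andP[? ?] /andP[? ?].
  by apply/andP; split; lra.
- apply: harm_approx => x /= x1.
  have o1 : open [set x : V | 1 < enorm x].
    apply/openP_enorm => y /= y1; exists (enorm y - 1) => [|z zy /=]; first lra.
    by have := enorm_rdist z y; rewrite ler_norml => /andP[]; lra.
  have [r r0 rB] := open_ball_in o1 x1.
  exists r => // e e0; have [k kk] := ik_small e0.
  have n0 y : 1 < enorm y -> y != 0 by rewrite -enorm_gt0; lra.
  have ks y : 1 < enorm y -> kelvin (hk k) y = \sum_(m < (MH k).1) pw (1 - N / 2 - m%:R) y * (MH k).2 m y.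
    move=> y1; rewrite {1}/kelvin /hk mulr_sumr; apply: sumR_eq => m.
    have [/(_ m)[hm _] _] := hMH k.
    by rewrite -(kelvin_hpoly hm)//; exact: n0.
  exists (fun y => \sum_(m < (MH k).1) pw (1 - N / 2 - m%:R) y * (MH k).2 m y).
    apply: harm_sum => m; have [/(_ m) hm _] := hMH k.
    by apply: harm_sub (kelvin_hharm hm) => y /rB/n0.
  move=> y /rB /= y1; rewrite -ks// /kelvin -mulrBr normrM ger0_norm ?pw_ge0//.
  have yy : enorm ((sqn y)^-1 *: y) <= 1.
    rewrite enormZ sqnE ger0_norm ?invr_ge0 ?sqr_ge0// expr2 invfM -mulrA mulVf ?mulr1.
      by rewrite invf_le1; [exact: ltW|lra].
    by rewrite gt_eqF//; lra.
  have := hh _ yy k.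
  have : pw (1 - N / 2) y <= 1.
    apply: pw_le1; last exact: ltW.
    by rewrite subr_le0 ler_pdivlMr// mul1r ler_nat.
  have := pw_ge0 (1 - N / 2) y; set a := pw _ _; set b := `|_|.
  have : 0 <= b by exact: normr_ge0.
  by move=> b0 a0 a1 bk; apply: le_trans (ltW kk); apply: le_trans bk; rewrite ler_piMl.
Qed.

Lemma blim_aff (A B : set V) f (b : V) (c : R) z l : 0 < c ->
  (forall y, B y -> A (b + c *: y)) -> blim A f (b + c *: z) l ->
  blim B (fun y => f (b + c *: y)) z l.
Proof.
move=> c0 AB h e /h[d d0 hd]; exists (d / c); first by rewrite divr_gt0.
move=> y By; rewrite ltr_pdivlMr// => yz; apply: hd; first exact: AB.
by rewrite opprD addrACA subrr add0r -scalerBr enormZ (gtr0_norm c0) mulrC.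
Qed.

Lemma ball_solve a r g : (2 <= n.+1)%N -> 0 < r ->
  (forall x, sphere a r x -> blim (sphere a r) g x (g x)) ->
  exists h, [/\ harm (eB a r) h, forall x, sphere a r x -> h x = g x &
    forall z, cball a r z -> blim (cball a r) h z (h z)].
Proof.
move=> n2 r0 cg; have rn0 : r != 0 by rewrite gt_eqF.
have sphE x : enorm x = 1 -> sphere a r (a + r *: x).
  by move=> x1; rewrite /sphere/= addrC addKr enormZ x1 mulr1 gtr0_norm.
have e0 x : - r^-1 *: a + r^-1 *: x = r^-1 *: (x - a) by rewrite scalerBr addrC scaleNr.
have [|h [h1 h2 h3 _]] := @unit_ball_solve (fun x => g (a + r *: x)) n2.
  move=> x x1; apply: (blim_aff (A := sphere a r)) => //; exact/cg/sphE.
have en x : enorm (- r^-1 *: a + r^-1 *: x) = enorm (x - a) / r.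
  by rewrite e0 enormZ ger0_norm ?invr_ge0 ?(ltW r0)// mulrC.
have inv x : a + r *: (- r^-1 *: a + r^-1 *: x) = x.
  by rewrite e0 scalerA mulfV// scale1r addrC subrK.
exists (fun x => h (- r^-1 *: a + r^-1 *: x)); split.
- apply: harm_sub (harm_aff _ _ h1) => x; rewrite /eB/= subr0 en.
  by rewrite ltr_pdivrMr// mul1r.
- by move=> x xs; rewrite h2 ?inv// en xs divff.
- move=> z zB; apply: (blim_aff (A := cball 0 1)); first by rewrite invr_gt0.
    by move=> y; rewrite /cball/= subr0 en ler_pdivrMr// mul1r.
  by apply: h3; rewrite en ler_pdivrMr// mul1r.
Qed.

End BallSolver.

(** * Subharmonic functions and Perron's method *)

Section Perron.
Context {R : realType} {n : nat}.
Local Notation V := 'rV[R]_n.+1.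
Local Notation N := (n.+1%:R : R).
Implicit Types (x y z w a : V) (c r M : R) (O D : set V) (f g u h s t : V -> R).
Local Notation bcont p r h := (forall z, cball p r z -> blim (cball p r) h z (h z)).
Local Notation agree p r h s := (forall x, sphere p r x -> h x = s x).
Hypothesis n2 : (2 <= n.+1)%N.

(** Defined by comparison on balls, since maxima and Poisson modifications destroy second
    derivatives. *)
Definition subh D s := (forall x, D x -> cont_at s x) /\
  forall a r h, 0 < r -> cball a r `<=` D -> harm (eB a r) h ->
    (forall z, sphere a r z -> blim (cball a r) h z (h z)) ->
    (forall z, sphere a r z -> s z <= h z) -> forall x, cball a r x -> s x <= h x.

Lemma subh_sub D O s : D `<=` O -> subh O s -> subh D s.
Proof.
move=> DO [cs hs]; split => [x /DO|a r h r0 /subset_trans/(_ DO)]; first exact: cs.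
exact: hs.
Qed.

Lemma sphere_cball a r : sphere a r `<=` cball a r.
Proof. by move=> x; rewrite /sphere/cball/= => ->. Qed.

Lemma eB_cball a r : eB a r `<=` cball a r.
Proof. by move=> x /ltW. Qed.

Lemma blimD (A : set V) f g z l m : blim A f z l -> blim A g z m ->
  blim A (fun x => f x + g x) z (l + m).
Proof.
move=> hf hg e e0; have [d d0 hd] := hf (e / 2) ltac:(lra).
have [d' d'0 hd'] := hg (e / 2) ltac:(lra).
exists (Num.min d d'); first by rewrite lt_min d0.
move=> y Ay; rewrite lt_min => /andP[h1 h2].
have := hd y Ay h1; have := hd' y Ay h2 => q1 q2.
rewrite opprD addrACA; apply: le_lt_trans (ler_normD _ _) _; lra.
Qed.

Lemma blimN (A : set V) f z l : blim A f z l -> blim A (fun x => - f x) z (- l).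
Proof. by move=> hf e /hf[d d0 hd]; exists d => // y Ay yz; rewrite -opprD normrN hd. Qed.

Lemma blimZ (A : set V) c f z l : blim A f z l -> blim A (fun x => c * f x) z (c * l).
Proof.
have [-> _ e e0|c0 hf e e0] := eqVneq c 0.
  by exists 1 => // y _ _; rewrite !mul0r subrr normr0.
have [|d d0 hd] := hf (e / `|c|); first by rewrite divr_gt0// normr_gt0.
exists d => // y Ay yz; rewrite -mulrBr normrM mulrC -ltr_pdivlMr ?normr_gt0//; exact: hd.
Qed.

Lemma blimB (A : set V) f g z l m : blim A f z l -> blim A g z m ->
  blim A (fun x => f x - g x) z (l - m).
Proof. by move=> hf /blimN; exact: blimD. Qed.

Lemma sqnD x y : sqn (x + y) = sqn x + 2 * dotp y x + sqn y.
Proof. by rewrite /sqn dotpDl !dotpDr (dotpC x y); lra. Qed.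

Lemma subh_max_principle D s c : open D -> ebounded D -> subh D s -> bsup D s (fun=> c) ->
  forall x, D x -> s x <= c.
Proof.
move=> oD bD [cs hs] bs p Dp; rewrite leNgt; apply/negP => sp.
have [B0 hB0] := bD; pose B : R := `|B0| + 1.
have hB x : D x -> enorm x <= B.
  by move=> /hB0/le_trans; apply; rewrite /B; apply: le_trans (ler_norm _) _; rewrite lerDl.
have B1 : 0 < B by rewrite ltr_wpDl.
pose m : R := s p - c; have m0 : 0 < m by rewrite /m; lra.
pose eta : R := m / (4 * B ^+ 2).
have eta0 : 0 < eta by rewrite divr_gt0// mulr_gt0// exprn_gt0.
pose F x : R := s x + eta * sqn x.
have sqle x : D x -> eta * sqn x <= m / 4.
  move=> Dx; have -> : m / 4 = eta * B ^+ 2 by rewrite /eta; field; rewrite lt0r_neq0.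
  by rewrite ler_wpM2l ?(ltW eta0)// sqnE lerXn2r ?nnegrE ?enorm_ge0 ?hB// ltW.
have sq0 x : 0 <= eta * sqn x by rewrite mulr_ge0 ?(ltW eta0)// sqnE sqr_ge0.
have [||q Dq mq] := @max_attained _ _ D F p oD bD _ Dp.
- by move=> x Dx; apply: contD; [exact: cs|apply: contZ; exact: cont_sqn].
- move=> z cz nz; have [d d0 h] := bs z cz nz (m / 4) ltac:(lra).
  exists d => // x Dx xz; have := h x Dx xz; have := sqle x Dx; have := sq0 p.
  by rewrite /F /m; lra.
have [r r0 rD] := open_ball_in oD Dq.
pose rho : R := r / 2; have rho0 : 0 < rho by rewrite /rho; lra.
(* [q] maximises [s + eta |x|^2], so on the sphere [s] lies below this affine function, whose value
   at the centre is only [s q - eta rho^2]. *)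
pose l x : R := (s q - eta * rho ^+ 2) + -1 * (2 * eta * dotp q (x - q)).
have hl : harm setT l.
  rewrite (_ : l = fun x => (s q - eta * rho ^+ 2 + 2 * eta * dotp q q) + - (2 * eta) * dotp q x).
    by apply: harmD; [exact: harm_cst|apply: harmZ; exact: harm_dotp].
  by apply/funext => x; rewrite /l dotpBr; ring.
have : s q <= l q.
  apply: (hs q rho l rho0) => //.
  - by move=> x; rewrite /cball/= /rho => xq; apply: rD; lra.
  - by apply: harm_sub hl.
  - by move=> z _; apply: cont_blim; apply: harm_cont hl _.
  - move=> z zr; have Dz : D z by apply: rD; move: zr; rewrite /sphere/= /rho => ->; lra.
    have := mq z Dz; rewrite /F /l.
    have -> : sqn z = sqn q + 2 * dotp q (z - q) + rho ^+ 2.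
      move: zr; rewrite /sphere/= => <-; rewrite enorm_sqr -/(sqn _) -[in LHS](subrK q z).
      by rewrite sqnD; ring.
    lra.
  - by rewrite /cball/= subrr enorm0 ltW.
rewrite /l subrr dotp0r !mulr0 addr0.
have : 0 < eta * rho ^+ 2 by rewrite mulr_gt0// exprn_gt0.
lra.
Qed.

Lemma subh_lapl D f L : lapl D f L -> (forall x, D x -> 0 <= L x) -> subh D f.
Proof.
move=> lf L0; split.
  by move=> x Dx; have [fd [fdd /(_ x Dx)[]]] := lf.
move=> a r h r0 rD hh bh fh x xB.
have [xr|xr] := eqVneq (enorm (x - a)) r; first exact: fh.
have xo : eB a r x by rewrite /eB/= lt_neqAle xr.
have sD : eB a r `<=` D by apply: subset_trans rD; exact: eB_cball.
rewrite -subr_le0.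
have mp := @max_principle _ _ (eB a r) (fun x => f x + -1 * h x) (fun x => L x + -1 * 0) 0
  (@eB_open _ _ a r) (@eB_bounded _ _ a r).
rewrite -mulN1r; apply: (mp _ _ _ x xo).
- by apply: laplD; [exact: lapl_sub sD lf|apply: laplZ; exact: harm_lapl].
- by move=> y /sD/L0; rewrite mulr0 addr0.
- apply: bsup_blim => z cz nz.
  have zr : sphere a r z.
    apply/eqP; rewrite eq_le closure_eB//= leNgt; apply/negP => zr; exact: nz.
  split; last by rewrite mulN1r subr_le0 fh.
  rewrite !mulN1r; under [X in blim _ X]eq_fun do rewrite mulN1r.
  apply: blimB; last by apply: blim_sub (bh z zr); exact: eB_cball.
  apply: cont_blim; have [fd [fdd /(_ z (rD z (sphere_cball zr)))[]]] := lf; by [].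
Qed.

Lemma subh_harm D f : harm D f -> subh D f.
Proof. by move=> /harm_lapl/subh_lapl; apply. Qed.

Lemma cont_max f g x : cont_at f x -> cont_at g x -> cont_at (fun y => Num.max (f y) (g y)) x.
Proof.
move=> cf cg e e0; have [d d0 hd] := cf e e0; have [d' d'0 hd'] := cg e e0.
exists (Num.min d d'); first by rewrite lt_min d0.
move=> y; rewrite lt_min => /andP[/hd + /hd']; rewrite !ltr_norml => /andP[? ?] /andP[? ?].
case: (leP (f y) (g y)) => q1; case: (leP (f x) (g x)) => q2; apply/andP; split; lra.
Qed.

Lemma subh_max D s t : subh D s -> subh D t -> subh D (fun x => Num.max (s x) (t x)).
Proof.
move=> [cs hs] [ct ht]; split => [x Dx|a r h r0 rD hh bh sh x xB].
  by apply: cont_max; [exact: cs|exact: ct].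
rewrite ge_max; apply/andP; split.
  by apply: (hs a r h) => // z zr; have := sh z zr; rewrite ge_max => /andP[].
by apply: (ht a r h) => // z zr; have := sh z zr; rewrite ge_max => /andP[].
Qed.

Lemma solve_at D s a r : 0 < r -> cball a r `<=` D -> (forall x, D x -> cont_at s x) ->
  exists h : V -> R^o, [/\ harm (eB a r) h, agree a r h s &
    bcont a r h].
Proof.
move=> r0 rD cs; apply: ball_solve => // x xr; apply: cont_blim; apply: cs.
exact/rD/sphere_cball.
Qed.

(** The comparison function has to be split between [s] and [t]: the Dirichlet solutions with data
    [s] and [t] on the sphere provide the split. *)
Lemma subhD D s t : subh D s -> subh D t -> subh D (fun x => s x + t x).
Proof.
move=> [cs hs] [ct ht]; split => [x Dx|a r h r0 rD hh bh sh x xB].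
  by apply: contD; [exact: cs|exact: ct].
have [h1 [a1 b1 c1]] := solve_at r0 rD cs.
have [h2 [a2 b2 c2]] := solve_at r0 rD ct.
apply: (@le_trans _ _ (h1 x + h2 x)).
  apply: lerD; [apply: (hs a r h1) => //|apply: (ht a r h2) => //] => z zr.
  - exact/c1/sphere_cball.
  - by rewrite b1.
  - exact/c2/sphere_cball.
  - by rewrite b2.
rewrite -subr_le0; apply: (@harm_max_ball _ _ a r (fun x => h1 x + h2 x - h x) 0 r0) => //.
- by apply: harmB => //; exact: harmD.
- move=> z zr; have zc := sphere_cball zr; apply: blimB; last exact: bh.
  by apply: blimD; [exact: c1|exact: c2].
- by move=> z zr; rewrite b1// b2// subr_le0 sh.
Qed.

Lemma subhZ D s c : 0 < c -> subh D s -> subh D (fun x => c * s x).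
Proof.
move=> c0 [cs hs]; split => [x Dx|a r h r0 rD hh bh sh x xB].
  by apply: contZ; exact: cs.
rewrite -ler_pdivlMl//; apply: (hs a r (fun x => c^-1 * h x)) => //.
- exact: harmZ.
- move=> z zr e e0; have [d d0 hd] := bh z zr (e * c) (mulr_gt0 e0 c0).
  exists d => // y yB yz; rewrite -mulrBr normrM gtr0_norm ?invr_gt0//.
  by rewrite mulrC ltr_pdivrMr//; exact: hd.
- by move=> z zr; rewrite ler_pdivlMl//; exact: sh.
Qed.

Lemma subh_cst D c : subh D (fun=> c).
Proof. by apply: subh_harm; exact: harm_cst. Qed.

Definition lift a r h s : V -> R := fun x => if enorm (x - a) <= r then h x else s x.

Lemma closureI_eB (A : set V) a r z : closure (A `&` eB a r) z -> enorm (z - a) <= r.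
Proof. by move=> h; apply: closure_eB; apply: closure_subset h => x []. Qed.

(** For a second ball meeting the first, comparison holds outside the first because [s] is
    subharmonic, and reaches the overlap by the maximum principle on the intersection of the two
    balls. *)
Lemma lift_sub D s a r h : 0 < r -> open D -> cball a r `<=` D -> subh D s ->
  harm (eB a r) h -> agree a r h s ->
  bcont a r h ->
  subh D (lift a r h s) /\ forall x, D x -> s x <= lift a r h s x.
Proof.
move=> r0 oD rD [cs hs] hh hsE bh.
have sl x : D x -> s x <= lift a r h s x.
  move=> Dx; rewrite /lift; case: ifP => // xr; apply: (hs a r h) => //.
    by move=> z /sphere_cball; exact: bh.
  by move=> z zr; rewrite hsE.
split => //; split.
  move=> x Dx; have [xr|xr|xr] := ltgtP (enorm (x - a)) r.
  - apply: (cont_congr (@eB_open _ _ a r) xr (f := h)).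
      by move=> y yr; rewrite /lift ltW.
    exact: harm_cont hh xr.
  - have oC : open [set y | r < enorm (y - a)].
      apply/openP_enorm => y /= yr; exists (enorm (y - a) - r) => [|w wy /=]; first lra.
      by have := enorm_tri w y a; rewrite (enorm_distC y w); lra.
    apply: (cont_congr oC xr (f := s)); last exact: cs.
    by move=> y /= yr; rewrite /lift leNgt yr.
  - move=> e e0; have [d d0 hd] := bh x (sphere_cball xr) e e0.
    have [d' d'0 hd'] := cs x Dx e e0.
    have lx : lift a r h s x = h x by rewrite /lift xr lexx.
    exists (Num.min d d'); first by rewrite lt_min d0.
    move=> y; rewrite lt_min => /andP[yd yd'].
    rewrite lx /lift; case: ifP => yr; first exact: hd.
    by rewrite hsE//; exact: hd'.
move=> b rho k rho0 bD hk bk lk x xB.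
have sk y : cball b rho y -> s y <= k y.
  apply: (hs b rho k) => // z zr; apply: le_trans (lk z zr); apply: sl.
  exact/bD/sphere_cball.
rewrite /lift; case: ifP => xr; last exact: sk.
have [xb|xb] := eqVneq (enorm (x - b)) rho.
  by have := lk x xb; rewrite /lift xr.
have [xa|xa] := eqVneq (enorm (x - a)) r; first by rewrite hsE// sk.
rewrite -subr_le0.
have oI : open (eB b rho `&` eB a r) by apply: openI; exact: eB_open.
have hI : harm (eB b rho `&` eB a r) (fun x => h x - k x : R^o).
  by apply: harmB; [apply: harm_sub hh => y []|apply: harm_sub hk => y []].
apply: (max_blim oI _ (harm_lapl hI)) => //; last 2 first.
- move=> z cz nz; have za := closureI_eB cz.
  have zb : enorm (z - b) <= rho by move: cz; rewrite setIC; exact: closureI_eB.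
  have sub1 : eB b rho `&` eB a r `<=` cball a r by move=> y [_ /ltW].
  have sub2 : eB b rho `&` eB a r `<=` cball b rho by move=> y [/ltW].
  split.
    apply: blimB; first by apply: blim_sub sub1 _; exact: bh.
    apply: blim_sub sub2 _; have [zr|zr] := eqVneq (enorm (z - b)) rho; first exact: bk.
    by apply: cont_blim; apply: harm_cont hk _; rewrite /eB/= lt_neqAle zr.
  rewrite subr_le0; have [zr|zr] := eqVneq (enorm (z - b)) rho.
    by have := lk z zr; rewrite /lift za.
  have [zr2|zr2] := eqVneq (enorm (z - a)) r; first by rewrite hsE// sk.
  by exfalso; apply: nz; split; rewrite /eB/= lt_neqAle ?zr ?zr2.
- by split; rewrite /eB/= lt_neqAle ?xb ?xa.
- have [B hB] := eB_bounded a r; by exists B => y [_ /hB].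
Qed.

Lemma harm_lip a r M h : 0 < r -> harm (eB a r) h ->
  (forall x, eB a r x -> `|h x| <= M) ->
  forall x y, eB a (r / 2) x -> eB a (r / 2) y -> `|h x - h y| <= 4 * N * M / r * enorm (x - y).
Proof.
move=> r0 hh hM x y xB yB.
have r20 : 0 < r / 2 by lra.
have seg (q : R) : 0 <= q <= 1 -> eB a (r / 2) (y + q *: (x - y)).
  move=> /andP[t0 t1]; rewrite /eB/=.
  have -> : y + q *: (x - y) - a = (1 - q) *: (y - a) + q *: (x - a).
    by apply/rowP => i; rewrite !mxE; ring.
  apply: le_lt_trans (enormD _ _) _; rewrite !enormZ !ger0_norm ?subr_ge0//.
  move: xB yB; rewrite /eB/= => xB yB.
  have [t00|t00] := eqVneq q 0; first by rewrite t00; lra.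
  have tp : 0 < q by rewrite lt_def t00.
  by nra.
have inB (w : V) : eB a (r / 2) w -> eB w (r / 2) `<=` eB a r.
  by move=> wB; apply: eB_sub; move: wB; rewrite /eB/=; lra.
have := @MVT_line_le _ _ h y (x - y) (fun q => Dv (x - y) h (y + q *: (x - y))) (4 * N * M / r * enorm (x - y)) 1 ler01.
rewrite scale1r mulr1 (addrC y) subrK; apply.
  move=> q tt; apply: (is_derive_Dv _ (@eB_open _ _ a r) hh).
  exact/(inB _ (seg q tt))/eB_center.
move=> q tt; have sub := inB _ (seg q tt).
have := @Dv_est _ _ (x - y) h _ _ M r20 (harm_sub sub hh) (fun w wB => hM w (sub w wB)).
move/le_trans; apply; apply: le_of_eq.
by field; rewrite gt_eqF.
Qed.

(** A local notion: superharmonic near [z], tending to 0 at [z], bounded below off every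
    neighbourhood of [z]. [glue_subh] makes it global. *)
Definition barrier D z := exists (rho : R) (b : V -> R),
  [/\ 0 < rho, subh (D `&` eB z rho) (fun x => - b x),
    forall x, D x -> eB z rho x -> 0 <= b x,
    blim (D `&` eB z rho) b z 0 &
    forall d, 0 < d -> exists2 b0 : R, 0 < b0 & forall x, D x -> eB z rho x -> d <= enorm (x - z) -> b0 <= b x].

(** * Perron's envelope below a superharmonic majorant *)

Section PerronThm.
Variables (D : set V) (psi f : V -> R) (Psi F : R).
Hypothesis oD : open D.
Hypothesis spsi : subh D (fun x => - psi x).
Hypothesis psi0 : forall x, D x -> 0 <= psi x <= Psi.
Hypothesis fpsi : \bd z of D, forall e : R, 0 < e ->
  exists2 d : R, 0 < d & forall x, D x -> enorm (x - z) < d -> `|f z| <= psi x + e.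
Hypothesis fF : \bd z of D, `|f z| <= F.
Hypothesis cf : \bd z of D, blim (closure D `\` D) f z (f z).
Hypothesis bar : \bd z of D, barrier D z.

(** Members are squeezed between [- psi] and [psi]: a constant [psi] gives the bounded problem, a
    decaying one the exterior problem with its behaviour at infinity built in. *)
Definition perS s := [/\ subh D s, forall x, D x -> - psi x <= s x,
  forall x, D x -> s x <= psi x & bsup D s f].

Definition perU x : R := sup [set s x | s in perS].

Lemma perS_psi : perS (fun x => - psi x).
Proof.
split => // [x Dx|z cz nz e e0].
  by have := psi0 Dx; lra.
have [d d0 hd] := fpsi cz nz e0; exists d => // x Dx /(hd x Dx).
by rewrite ler_norml => /andP[]; lra.
Qed.

Lemma perS_le s x : D x -> perS s -> s x <= perU x.
Proof.
move=> Dx hs; apply: ub_le_sup; last by exists s.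
by exists (psi x) => _ [t [_ _ ht _] <-]; exact: ht.
Qed.

Lemma perU_le x c : (forall s, perS s -> s x <= c) -> perU x <= c.
Proof.
move=> h; apply: ge_sup; first by exists (- psi x), (fun x => - psi x) => //; exact: perS_psi.
by move=> _ [s hs <-]; exact: h.
Qed.

Lemma perU_psi x : D x -> `|perU x| <= psi x.
Proof.
move=> Dx; rewrite ler_norml (perS_le Dx perS_psi)/=.
by apply: perU_le => s [_ _ h _]; exact: h.
Qed.

Lemma perS_max s t : perS s -> perS t -> perS (fun x => Num.max (s x) (t x)).
Proof.
move=> [a1 a2 a3 a4] [b1 b2 b3 b4]; split.
- exact: subh_max.
- by move=> x Dx; rewrite le_max a2.
- by move=> x Dx; rewrite ge_max a3// b3.
- move=> z cz nz e e0; have [d d0 hd] := a4 z cz nz e e0; have [d' d'0 hd'] := b4 z cz nz e e0.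
  exists (Num.min d d'); first by rewrite lt_min d0.
  by move=> x Dx; rewrite lt_min => /andP[? ?]; rewrite ge_max hd//= hd'.
Qed.

Lemma perS_lift s a r h : 0 < r -> cball a r `<=` D -> perS s ->
  harm (eB a r) h -> agree a r h s ->
  bcont a r h ->
  perS (lift a r h s).
Proof.
move=> r0 rD [s1 s2 s3 s4] hh hsE bh.
have [l1 l2] := lift_sub r0 oD rD s1 hh hsE bh.
split => //.
- by move=> x Dx; apply: le_trans (s2 x Dx) (l2 x Dx).
- move=> x Dx; rewrite /lift; case: ifP => xr; last exact: s3.
  rewrite -lerN2; have [_ hp] := spsi.
  apply: (hp a r (fun x => - h x)) => //.
  + exact: harmN.
  + by move=> z /sphere_cball/bh; exact: blimN.
  + by move=> z zr; rewrite hsE// lerN2 s3//; exact/rD/sphere_cball.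
- move=> z cz nz e e0; have [d d0 hd] := s4 z cz nz e e0.
  have zr : r < enorm (z - a) by rewrite ltNge; apply/negP => zr; exact/nz/rD.
  exists (Num.min d (enorm (z - a) - r)); first by rewrite lt_min d0 subr_gt0.
  move=> x Dx; rewrite lt_min => /andP[xd xr]; rewrite /lift ifF; first exact: hd.
  apply/negP => xa; have := enorm_tri x z a; rewrite (enorm_distC z x); lra.
Qed.

(** Poisson modifications are uniformly Lipschitz on the half ball. By compactness finitely many
    members, merged by maxima, therefore bring one harmonic function within [e] of the envelope on a
    smaller ball, and [harm_approx] concludes. *)
Lemma perU_harm : harm D perU.
Proof.
apply: harm_approx => p Dp.
have [r1 r10 r1D] := open_ball_in oD Dp.
have Psi0 : 0 <= Psi by have := psi0 Dp; lra.
pose r : R := r1 / 2; have r0 : 0 < r by rewrite /r; lra.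
have rD : cball p r `<=` D by move=> x; rewrite /cball/= /r => xr; apply: r1D; lra.
have hbd h s : perS s -> harm (eB p r) h -> agree p r h s ->
    bcont p r h -> forall x, cball p r x -> `|h x| <= Psi.
  move=> [_ q2 q3 _] hh hsE bh; apply: harm_norm_ball => //.
    by move=> z /sphere_cball; exact: bh.
  move=> z zr; have Dz := rD z (sphere_cball zr); rewrite hsE// ler_norml.
  have := q2 z Dz; have := q3 z Dz; have := psi0 Dz; lra.
pose C : R := 4 * N * Psi / r.
have C0 : 0 <= C by rewrite /C divr_ge0 ?(ltW r0)// !mulr_ge0.
have hlip h s : perS s -> harm (eB p r) h -> agree p r h s ->
    bcont p r h -> forall x y, eB p (r / 2) x -> eB p (r / 2) y ->
    `|h x - h y| <= C * enorm (x - y).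
  move=> qs hh hsE bh; apply: harm_lip => // x /eB_cball; exact: hbd qs hh hsE bh x.
have hU h s : perS s -> harm (eB p r) h -> agree p r h s ->
    bcont p r h -> forall x, cball p r x -> s x <= h x <= perU x.
  move=> qs hh hsE bh x xB; have Dx := rD x xB.
  have [ss _ _ _] := qs.
  have [_ l2] := lift_sub r0 oD rD ss hh hsE bh.
  have := l2 x Dx; have := perS_le Dx (perS_lift r0 rD qs hh hsE bh).
  by rewrite /lift xB => -> ->.
have sub2 : eB p (r / 2) `<=` cball p r by move=> x; rewrite /eB/cball/=; lra.
have Ulip x y : eB p (r / 2) x -> eB p (r / 2) y -> perU x <= perU y + C * enorm (x - y).
  move=> xB yB; apply: perU_le => s qs; have [[cs _] _ _ _] := qs.
  have [h [hh hsE bh]] := solve_at r0 rD cs.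
  have := hU h s qs hh hsE bh x (sub2 x xB); have := hU h s qs hh hsE bh y (sub2 y yB).
  have := hlip h s qs hh hsE bh x y xB yB; rewrite ler_norml => /andP[? ?] /andP[? ?] /andP[? ?]; lra.
exists (r / 4) => [|e e0]; first lra.
pose Q (A : set V) := exists s h, [/\ perS s, harm (eB p r) h, agree p r h s,
   bcont p r h &
   forall y, A y -> eB p (r / 2) y -> perU y - e <= h y].
suff : Q (cball p (r / 4)).
  move=> [s [h [qs hh hsE bh hA]]]; exists h; first by apply: harm_sub hh; apply: eB_sub; rewrite subrr enorm0; lra.
  move=> y yB; have y2 : eB p (r / 2) y by move: yB; rewrite /eB/=; lra.
  have := hA y (eB_cball yB) y2; have := hU h s qs hh hsE bh y (sub2 y y2).
  by rewrite ler_norml => /andP[? ?] ?; apply/andP; split; lra.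
apply: compact_ind.
- exact: compact_cball.
- have [[cs _] _ _ _] := perS_psi; have [h [hh hsE bh]] := solve_at r0 rD cs.
  by exists (fun x => - psi x), h; split => //; exact: perS_psi.
- move=> A B [s [h [qs hh hsE bh hA]]] [t [k [qt hk kE bk kB]]].
  have qm := perS_max qs qt; have [[cs _] _ _ _] := qm.
  have [m [hm mE bm]] := solve_at r0 rD cs.
  have cmp (q : V -> R) : harm (eB p r) q -> bcont p r q ->
      (forall z, sphere p r z -> q z <= m z) -> forall x, cball p r x -> q x <= m x.
    move=> hq bq qle x xB; rewrite -subr_le0.
    apply: (@harm_max_ball _ _ p r (fun x => q x - m x) 0 r0 _ _ _ x xB).
    - exact: harmB.
    - by move=> z /sphere_cball zc; apply: blimB; [exact: bq|exact: bm].
    - by move=> z zr; rewrite subr_le0 qle.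
  exists (fun x => Num.max (s x) (t x)), m; split => // y [Ay|By] yB.
    apply: le_trans (hA y Ay yB) _; apply: cmp => //; last exact: sub2.
    by move=> z zr; rewrite hsE// mE// le_max lexx.
  apply: le_trans (kB y By yB) _; apply: cmp => //; last exact: sub2.
  by move=> z zr; rewrite kE// mE// le_max lexx orbT.
- move=> A B AB [s [h [qs hh hsE bh hA]]]; exists s, h; split => // y /AB; exact: hA.
- move=> x xB; pose d : R := e / (4 * (C + 1)).
  have d0 : 0 < d by rewrite divr_gt0// mulr_gt0// ltr_wpDl.
  exists d => //.
  have xB2 : eB p (r / 2) x by move: xB; rewrite /cball/eB/=; lra.
  have [s qs sx] : exists2 s, perS s & perU x - e / 2 < s x.
    have hsup : has_sup [set s x | s in perS].
      split; first by exists (- psi x), (fun x => - psi x) => //; exact: perS_psi.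
      by exists (psi x) => _ [t [_ _ ht _] <-]; exact/ht/rD/sub2.
    have [_ [s qs <-] h] := sup_adherent (ltac:(lra) : 0 < e / 2) hsup.
    by exists s.
  have [[cs _] _ _ _] := qs; have [h [hh hsE bh]] := solve_at r0 rD cs.
  exists s, h; split => // y yx yB.
  have /andP[h1 _] := hU h s qs hh hsE bh x (sub2 x xB2).
  have h2 := hlip h s qs hh hsE bh x y xB2 yB.
  have h3 := Ulip y x yB xB2.
  have h4 : C * enorm (x - y) <= e / 4.
    have : enorm (x - y) <= d by rewrite enorm_distC; exact: ltW.
    rewrite /d ler_pdivlMr ?mulr_gt0 ?ltr_wpDl//.
    have := enorm_ge0 (x - y); nra.
  move: h2 h3; rewrite (enorm_distC y x) ler_norml => /andP[? ?] ?; lra.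
Qed.

(** On the annulus [sg / 2 <= |x - z| < sg] the maximum already equals [- b0], so the two
    definitions overlap and subharmonicity is not lost at the seam. *)
Lemma glue_subh z rho sg b b0 : 0 < sg -> sg < rho -> subh (D `&` eB z rho) (fun x => - b x) ->
  (forall x, D x -> eB z rho x -> sg / 2 <= enorm (x - z) -> b0 <= b x) ->
  subh D (fun x => if enorm (x - z) < sg then Num.max (- b x) (- b0) else - b0).
Proof.
move=> sg0 sgr [cb hb] bb0.
have far x : D x -> sg / 2 <= enorm (x - z) ->
    (if enorm (x - z) < sg then Num.max (- b x) (- b0) else - b0) = - b0.
  move=> Dx xz; case: ifP => // xs; apply/eqP; rewrite eq_maxr// lerN2.
  by apply: bb0 => //; rewrite /eB/=; lra.
split.
  move=> x Dx; have [xz|xz] := ltP (enorm (x - z)) sg.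
    have oD1 : open (D `&` eB z sg) by apply: openI => //; exact: eB_open.
    apply: (cont_congr oD1 (conj Dx xz) (f := fun y => Num.max (- b y) (- b0))).
      by move=> y [_ yz] /=; rewrite ifT.
    apply: cont_max; last exact: cont_cst.
    by apply: cb; split => //; rewrite /eB/=; lra.
  have oC : open [set y | sg / 2 < enorm (y - z)].
    apply/openP_enorm => y /= yr; exists (enorm (y - z) - sg / 2) => [|k wy /=]; first lra.
    by have := enorm_tri k y z; rewrite (enorm_distC y k); lra.
  have oD1 : open (D `&` [set y | sg / 2 < enorm (y - z)]) by exact: openI.
  have xD1 : (D `&` [set y | sg / 2 < enorm (y - z)]) x by split => //=; lra.
  apply: (cont_congr oD1 xD1 (f := fun=> - b0)); last exact: cont_cst.
  by move=> y [Dy /= yz]; rewrite far// ltW.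
move=> a r h r0 rD hh bh sh.
have hb0 x : cball a r x -> - b0 <= h x.
  move=> xB; rewrite -subr_le0.
  apply: (@harm_max_ball _ _ a r (fun x => - b0 - h x) 0 r0) => //.
  - by apply: harmB => //; exact: harm_cst.
  - move=> y ys; apply: blimB; last exact: bh.
    by apply: cont_blim; exact: cont_cst.
  - move=> y yr; rewrite subr_le0; apply: le_trans (sh y yr).
    by case: ifP => // _; rewrite le_max lexx orbT.
move=> x xB; case: ifP => xz; last exact: hb0.
rewrite ge_max hb0// andbT.
have [xr|xr] := eqVneq (enorm (x - a)) r.
  by have := sh x xr; rewrite xz ge_max => /andP[].
rewrite -subr_le0; have -> : - b x - h x = - b x + -1 * h x by rewrite mulN1r.
pose D1 := eB a r `&` eB z sg.
have D1D : D1 `<=` D `&` eB z rho.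
  by move=> y [/eB_cball/rD Dy]; rewrite /eB/= => yz; split => //; rewrite /eB/=; lra.
apply: (@subh_max_principle D1 (fun x => - b x + -1 * h x)) => //.
- by apply: openI; exact: eB_open.
- by have [B hB] := eB_bounded a r; exists B => y [/hB].
- apply: subhD; first exact: subh_sub D1D _.
  by apply: subh_harm; apply: harmZ; apply: harm_sub hh => y [].
- move=> y cy ny.
  have ya : enorm (y - a) <= r by apply: closureI_eB; move: cy; rewrite /D1 setIC; exact.
  have yz : enorm (y - z) <= sg by exact: closureI_eB cy.
  have [yzs|yzs] := eqVneq (enorm (y - z)) sg.
    move=> e e0; exists (sg / 2) => [|k Dk ky]; first lra.
    have [Dk1 Dk2] := D1D k Dk.
    have : b0 <= b k.
      by apply: bb0 => //; have := enorm_tri k y z; rewrite (enorm_distC y k); lra.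
    by have := hb0 k (eB_cball Dk.1); lra.
  have yz1 : enorm (y - z) < sg by rewrite lt_neqAle yzs.
  have yr : enorm (y - a) = r.
    apply/eqP; rewrite eq_le ya leNgt; apply/negP => yr; apply: ny; by split.
  have yD : cball a r y by rewrite /cball/= yr.
  have yB : (D `&` eB z rho) y by split; [exact: rD|rewrite /eB/=; lra].
  have bl : blim D1 (fun x => - b x + -1 * h x) y (- b y + -1 * h y).
    apply: blimD; first by apply: cont_blim; exact: cb.
    by apply: blimZ; apply: blim_sub (bh y yr) => k [/eB_cball].
  move=> e e0; have [d d0 hd] := bl e e0; exists d => // k Dk /(hd k Dk).
  have := sh y yr; rewrite yz1 ge_max => /andP[? ?].
  rewrite ltr_norml => /andP[? ?]; lra.
- by split => //; rewrite /eB/= lt_neqAle xr.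
Qed.

Local Tactic Notation "lra_on" ne_hyp_list(hs) :=
  clear -R n n2 D psi f Psi F oD spsi psi0 fpsi fF cf bar hs; lra.

(** From below, a member of the class close to [f z] near [z] is built from the glued barrier. From
    above, each member is compared near [z] with [f z + e / 2 + K b]. *)
Lemma perU_bdry z : closure D z -> ~ D z -> blim D perU z (f z).
Proof.
move=> cz nz e e0.
have [rho [b [rho0 sb b_ge0 bz blow]]] := bar cz nz.
have [d1 d10 hd1] := cf cz nz (ltac:(lra) : 0 < e / 4).
have [d2 d20 hd2] := fpsi cz nz (ltac:(lra) : 0 < e / 4).
pose sg : R := Num.min (Num.min d1 d2) rho / 2.
have mn0 : 0 < Num.min (Num.min d1 d2) rho by rewrite !lt_min d10 d20.
have mn1 : Num.min (Num.min d1 d2) rho <= d1 by rewrite !ge_min lexx.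
have mn2 : Num.min (Num.min d1 d2) rho <= d2 by rewrite !ge_min lexx orbT.
have mn3 : Num.min (Num.min d1 d2) rho <= rho by rewrite ge_min lexx orbT.
have [sg0 sgr sgd1 sgd2] : [/\ 0 < sg, sg < rho, sg < d1 & sg < d2] by rewrite /sg; split; lra.
clear mn0 mn1 mn2 mn3; clearbody sg.
have [b0 b00 bb0] := blow (sg / 2) (ltac:(lra) : 0 < sg / 2).
have F0 : 0 <= F by apply: le_trans (fF cz nz).
have fz := fF cz nz; rewrite ler_norml in fz; move/andP: fz => [fz1 fz2].
(* [K b0] exceeds [Psi + 2 F], so at distance at least [sg / 2] from [z] the barrier term outweighs
   every datum and every member of the class. *)
pose K : R := (`|Psi| + 2 * F + 1) / b0.
have P0 : 0 <= `|Psi| by [].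
have Kb0 : K * b0 = `|Psi| + 2 * F + 1 by rewrite /K divfK// gt_eqF.
have K0 : 0 < K by rewrite divr_gt0//; lra.
clearbody K.
have [d3 d30 hd3] := bz (e / (4 * K)) (divr_gt0 e0 (mulr_gt0 (ltac:(lra) : 0 < 4) K0)).
exists (Num.min d3 sg) => [|x Dx]; first by rewrite lt_min d30.
rewrite lt_min => /andP[xd3 xsg].
have xrho : eB z rho x by rewrite /eB/=; lra.
have Kbx : K * b x <= e / 4.
  have := hd3 x (conj Dx xrho) xd3; rewrite subr0 => /ltW/(le_trans (ler_norm _)).
  by rewrite ler_pdivlMr; [lra|rewrite mulr_gt0].
have far y w : enorm (y - z) >= sg -> enorm (w - y) < sg / 2 -> sg / 2 <= enorm (w - z).
  by move=> q1 q2; have := enorm_tri w y z; have := enorm_tri y w z;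
    rewrite (enorm_distC y w); lra_on q1 q2.
have lo : f z - e / 4 - K * b x <= perU x.
  pose m w := if enorm (w - z) < sg then Num.max (- b w) (- b0) else - b0.
  pose s w := Num.max (f z - e / 4 + K * m w) (- psi w).
  have m0 w : D w -> m w <= 0.
    move=> Dw; rewrite /m; case: ifP => wz; last by rewrite oppr_le0 ltW.
    by rewrite ge_max !oppr_le0 (ltW b00) b_ge0// /eB/=; lra_on wz sgr.
  have mfar w : D w -> sg / 2 <= enorm (w - z) -> m w = - b0.
    move=> Dw wz; rewrite /m; case: ifP => // ws; apply/eqP; rewrite eq_maxr// lerN2.
    by apply: bb0 => //; rewrite /eB/=; lra_on ws sgr.
  have ps : perS s.
    split.
    - apply: subh_max => //; apply: subhD; first exact: subh_cst.
      by apply: subhZ => //; apply: (glue_subh sg0 sgr sb) => w Dw wr; exact: bb0.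
    - by move=> w Dw; rewrite /s le_max lexx orbT.
    - move=> w Dw; rewrite /s ge_max; apply/andP; split; last by have := psi0 Dw; lra_on e0.
      have [wz|wz] := ltP (enorm (w - z)) sg.
        have := hd2 w Dw (lt_trans wz sgd2); rewrite ler_norml => /andP[_].
        by have : K * m w <= 0 by [rewrite pmulr_rle0// m0|]; lra_on e0.
      by rewrite (mfar w Dw) ?mulrN ?Kb0; [have := psi0 Dw; lra_on e0 fz2 F0 P0|lra_on wz sg0].
    - move=> y cy ny e' e'0; have [d4 d40 hd4] := fpsi cy ny e'0.
      have psi4 w : D w -> enorm (w - y) < d4 -> - psi w <= f y + e'.
        by move=> Dw wy; have := hd4 w Dw wy; rewrite ler_norml => /andP[]; lra_on e'0.
      have [yz|yz] := ltP (enorm (y - z)) sg.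
        exists d4 => // w Dw wy; rewrite /s ge_max psi4// andbT.
        have := hd1 y (conj cy ny) (lt_trans yz sgd1); rewrite ltr_norml => /andP[h1 h2].
        by have : K * m w <= 0 by [rewrite pmulr_rle0// m0|]; lra_on h1 h2 e0 e'0.
      exists (Num.min d4 (sg / 2)) => [|w Dw]; first by rewrite lt_min d40; lra_on sg0.
      rewrite lt_min => /andP[w1 w2]; rewrite /s ge_max psi4// andbT.
      rewrite (mfar w Dw (far y w yz w2)) mulrN Kb0.
      by have := fF cy ny; rewrite ler_norml => /andP[]; lra_on fz1 fz2 F0 P0 e0 e'0.
  apply: le_trans (perS_le Dx ps); rewrite /s le_max /m xsg; apply/orP; left.
  rewrite lerD2l -mulrN ler_pM2l// le_max lexx//.
have up : perU x <= f z + e / 2 + K * b x.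
  apply: perU_le => s [s1 s2 s3 s4].
  pose D2 := D `&` eB z sg.
  have D2D : D2 `<=` D `&` eB z rho.
    by move=> y [Dy]; rewrite /eB/= => yz; split => //; rewrite /eB/=; lra_on yz sgr.
  suff : s x + K * - b x <= f z + e / 2 by lra_on e0.
  apply: (@subh_max_principle D2 (fun x => s x + K * - b x)) => //.
  - by apply: openI => //; exact: eB_open.
  - by have [B hB] := eB_bounded z sg; exists B => y [_ /hB].
  - apply: subhD; first by apply: subh_sub s1 => y [].
    by apply: subhZ => //; exact: subh_sub D2D _.
  - move=> y cy ny.
    have yz : enorm (y - z) <= sg by exact: closureI_eB cy.
    have cDy : closure D y by apply: closure_subset cy => w [].
    have bD2 w : D2 w -> 0 <= K * b w.
      by move=> /D2D[Dw wr]; rewrite pmulr_rge0// b_ge0.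
    have [Dy|nDy] := pselect (D y).
      have yzs : sg <= enorm (y - z).
        by rewrite leNgt; apply/negP => yzs; exact/ny.
      move=> e' e'0; exists (sg / 2) => [|w Dw wy]; first lra_on sg0.
      have [Dw1 Dw2] := D2D w Dw.
      have : K * b0 <= K * b w by rewrite ler_pM2l//; apply: bb0 => //; exact: far wy.
      have := s3 w Dw1; have := psi0 Dw1; have := ler_norm Psi.
      rewrite Kb0; lra_on fz1 F0 P0 e0 e'0.
    move=> e' e'0; have [d4 d40 hd4] := s4 y cDy nDy e' e'0.
    exists d4 => // w Dw wy; have := hd4 w Dw.1 wy.
    have := hd1 y (conj cDy nDy) (le_lt_trans yz sgd1); rewrite ltr_norml => /andP[h1 h2].
    have := bD2 w Dw; lra_on h1 h2 e0 e'0.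
rewrite ltr_norml; apply/andP; split; lra_on lo up Kbx e0.
Qed.

Lemma perron : exists u : V -> R, [/\ harm D u, forall x, D x -> `|u x| <= psi x &
  \bd z of D, blim D u z (f z)].
Proof. by exists perU; split; [exact: perU_harm|exact: perU_psi|exact: perU_bdry]. Qed.

End PerronThm.
End Perron.

(** * A barrier in a cone slightly wider than a half-space *)

Section Barrier.
Context {R : realType} {n : nat}.
Local Notation V := 'rV[R]_n.+1.
Local Notation N := (n.+1%:R : R).
Local Notation AA := (@A0 R n).
Implicit Types (x y z v w nu : V) (c r M a b : R) (O D K : set V) (f g u h s : V -> R).

Lemma enorm_rdistP x y :
  - enorm (x - y) <= enorm x - enorm y /\ enorm x - enorm y <= enorm (x - y).
Proof. by apply/andP; rewrite -ler_norml enorm_rdist. Qed.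

Lemma pwD a b x : x != 0 -> pw (a + b) x = pw a x * pw b x.
Proof. by move=> x0; rewrite /pw powRD//; apply/implyP => _; rewrite gt_eqF ?sqn_gt0. Qed.

Lemma pw1 x : pw 1 x = sqn x.
Proof. by rewrite /pw powRr1// sqnE sqr_ge0. Qed.

Lemma pw_half x : pw 2^-1 x = enorm x.
Proof. by rewrite /pw powR12_sqrt ?sqnE ?sqr_ge0// sqrtr_sqr ger0_norm ?enorm_ge0. Qed.

Lemma pw_gt0 a x : x != 0 -> 0 < pw a x.
Proof. by move=> x0; rewrite /pw powR_gt0// sqn_gt0. Qed.

Lemma pw_norm a x : pw a x = enorm x `^ (2 * a).
Proof. by rewrite /pw sqnE powRrM -powR_mulrn ?enorm_ge0. Qed.

Lemma cont_pw a x : x != 0 -> cont_at (pw a) x.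
Proof. by move=> /(@pw_profile _ _ a)[]. Qed.

Lemma pw_lapl a (H : V -> R) hd hdd (k : R) : hasC2 setT (H : V -> R^o) hd hdd ->
  (forall x, \sum_i hdd i i x = 0) -> (forall x, \sum_i x 0 i * hd i x = k * H x) ->
  lapl [set x | x != 0] (fun x => pw a x * H x : R^o)
    (fun x => a * (2 * N + 4 * (a - 1) + 4 * k) * pw (a - 1) x * H x).
Proof.
move=> hH H0 HE.
have hH' : hasC2 [set x | x != 0] (H : V -> R^o) hd hdd by move=> x _; exact: hH.
have [fd [fdd [h1 h2]]] := @radial_lapl _ _ [set x | x != 0] _ _ _ H hd hdd k
  (fun x px => @pw_profile R n a x px) hH' (fun x _ => H0 x) (fun x _ => HE x).
apply: lapl_eq (hasC2_lapl h1) => x /= x0; rewrite h2//.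
have -> : pw (a - 1) x = sqn x * pw (a - 1 - 1) x.
  by rewrite -pw1 -pwD//; congr pw; ring.
ring.
Qed.

Lemma hasC2_dotp O v : hasC2 O (fun x => dotp v x : R^o) (fun i _ => v 0 i) (fun _ _ _ => 0).
Proof.
move=> x Ox; split => [|i|i j|i|i j]; try exact: cont_cst; try exact: cont_dotp.
  apply/is_deriveP => e e0; exists 1 => // t _.
  by rewrite dotpDr dotpZr dotp_ee [dotp v x + _]addrC addrK subrr normr0 mulr_ge0// ltW.
exact: is_derive_cst.
Qed.

Lemma lapl_trans O f L v : lapl O f L ->
  lapl [set x | O (x - v)] (fun x => f (x - v) : R^o) (fun x => L (x - v)).
Proof.
move=> [fd [fdd h]]; exists (fun i x => fd i (x - v)), (fun i x => fdd i (x - v)) => x Ox.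
have e (y : V) : y - v = - v + 1 *: y by rewrite scale1r addrC.
have [a b c d] := h _ Ox; rewrite e in a b c d; split => [|i|i|].
- by under [X in cont_at X _]eq_fun do rewrite e; exact: cont_aff.
- under eq_fun do rewrite e; rewrite -[X in is_derive _ _ _ X]mul1r e; exact: is_derive_aff.
- under eq_fun do rewrite e; rewrite -[X in is_derive _ _ _ X]mul1r e; exact: is_derive_aff.
- by rewrite e.
Qed.

(** Small enough for the radial contribution [lamb (lamb + N - 2)] to the Laplacian of [cbar] to be
    dominated by the angular one. *)
Definition lamb : R := (16 * N)^-1.

(* [|y|^lamb (1 + t - t^2/4)] with [t = nu.y/|y|], written in homogeneous harmonics. *)
Definition cbar nu y : R := (1 - (4 * N)^-1) * pw (lamb / 2) y +
  (pw ((lamb - 1) / 2) y * dotp nu y +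
   - 4^-1 * (pw ((lamb - 2) / 2) y * (dotp nu y * dotp nu y + - N^-1 * sqn y))).

Lemma cbarE nu y : y != 0 ->
  cbar nu y = pw (lamb / 2) y * (1 + dotp nu y / enorm y - (dotp nu y / enorm y) ^+ 2 / 4).
Proof.
move=> y0; have e0 : enorm y != 0 by rewrite enorm_eq0.
have N0 : N != 0 by rewrite pnatr_eq0.
have h1 : pw ((lamb - 1) / 2) y * enorm y = pw (lamb / 2) y.
  by rewrite -pw_half -pwD//; congr pw; field.
have h2 : pw ((lamb - 2) / 2) y * enorm y ^+ 2 = pw (lamb / 2) y.
  by rewrite -sqnE -pw1 -pwD//; congr pw; field.
rewrite /cbar -h1 sqnE.
have -> : pw ((lamb - 1) / 2) y = pw ((lamb - 2) / 2) y * enorm y.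
  by apply: (mulIf e0); rewrite h1 -h2; ring.
by field; rewrite e0 nat1r.
Qed.

(** With [t = nu.y / |y|] the Laplacian is a positive factor times [mu (1 + t - t^2 / 4) - (N - 1) t
    + N t^2 / 2 - 1 / 2], where [mu = lamb (lamb + N - 2) <= 1 / 16]. It is nonpositive for
    [t >= - 1 / (4 N)]; the negative values of [t] are what a domain merely tangent to a half-space
    requires. *)
Lemma cbar_lapl nu : enorm nu = 1 -> exists2 L : V -> R,
  lapl [set x | x != 0] (cbar nu) L &
  forall y, y != 0 -> (2 <= n.+1)%N -> - (4 * N)^-1 * enorm y <= dotp nu y -> L y <= 0.
Proof.
move=> nu1; have N0 : N != 0 by rewrite pnatr_eq0.
have nn : dotp nu nu = 1 by rewrite -enorm_sqr nu1 expr1n.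
have l0 := @pw_lapl (lamb / 2) (fun=> 1) _ _ 0 (@hasC2_cst _ _ setT 1).
have {}l0 := l0 (fun x => ltac:(by rewrite big1)) (fun x => ltac:(rewrite mul0r big1// => i _; rewrite mulr0 //)).
have l1 := @pw_lapl ((lamb - 1) / 2) _ _ _ 1 (@hasC2_dotp setT nu).
have {}l1 := l1 (fun x => ltac:(by rewrite big1)) (fun x => ltac:(rewrite mul1r; apply: sumR_eq => i; rewrite mulrC //)).
have hq : hasC2 setT (sqn : V -> R^o) (fun i x => 2 * x 0 i) (fun i j _ => 2 * (i == j)%:R).
  move=> x _; split => [|i|i j|i|i j]; try exact: cont_cst; try exact: cont_sqn.
  - by apply: contZ; exact: cont_coord.
  - exact: is_derive_sqn.
  - apply: (@is_deriveZ _ _ _ (fun x : V => x 0 i : R^o) 2 x (ee j) _ (is_derive_coord x i j)).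
have h2 := hasC2D (hasC2M (@hasC2_dotp setT nu) (@hasC2_dotp setT nu)) (hasC2Z (- N^-1) hq).
have l2 := @pw_lapl ((lamb - 2) / 2) _ _ _ 2 h2.
have {}l2 := l2 _ _.
have l2' : lapl [set x | x != 0] (fun x => pw ((lamb - 2) / 2) x * (dotp nu x * dotp nu x + - N^-1 * sqn x) : R^o)
   (fun x => (lamb - 2) / 2 * (2 * N + 4 * ((lamb - 2) / 2 - 1) + 4 * 2) *
      pw ((lamb - 2) / 2 - 1) x * (dotp nu x * dotp nu x + - N^-1 * sqn x)).
  apply: l2 => x.
    apply: (etrans (sumR_eq (G := fun i => 2 * (nu 0 i * nu 0 i) + - N^-1 * 2) _)).
      by move=> i; rewrite eqxx mulr1; ring.
    rewrite big_split/= -mulr_sumr sumr_const card_ord -/(dotp nu nu) nn.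
    by rewrite -mulr_natr; field.
  apply: (etrans (sumR_eq (G := fun i => 2 * dotp nu x * (nu 0 i * x 0 i) + - N^-1 * 2 * (x 0 i * x 0 i)) _)).
    by move=> i; ring.
  rewrite big_split/= -!mulr_sumr -/(dotp nu x) -/(dotp x x) /sqn; ring.
have l0' : lapl [set x | x != 0] (pw (lamb / 2))
    (fun x => lamb / 2 * (2 * N + 4 * (lamb / 2 - 1) + 4 * 0) * pw (lamb / 2 - 1) x * 1).
  by move: l0; under [X in lapl _ X]eq_fun do rewrite mulr1.
eexists; first exact: (laplD (laplZ (1 - (4 * N)^-1) l0') (laplD l1 (laplZ (- 4^-1) l2'))).
move=> y y0 n2 yc.
have e0 : 0 < enorm y by rewrite enorm_gt0.
pose t : R := dotp nu y / enorm y; pose P := pw ((lamb - 2) / 2 - 1) y.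
have dE : dotp nu y = t * enorm y by rewrite /t divfK// gt_eqF.
have p1 : pw ((lamb - 1) / 2 - 1) y = P * enorm y.
  by rewrite -pw_half -pwD//; congr pw; field.
have p2 : pw (lamb / 2 - 1) y = P * enorm y ^+ 2.
  by rewrite -sqnE -pw1 -pwD//; congr pw; field.
have P0 : 0 < P by exact: pw_gt0.
pose mu := lamb * (lamb + N - 2).
rewrite p1 p2 -/P sqnE dE.
have N2 : 2 <= N by rewrite ler_nat.
pose k : R := (4 * N)^-1.
have k0 : 0 < k by rewrite invr_gt0; lra.
have kN : k * N = 4^-1 by rewrite /k; field.
have lk : lamb = k / 4 by rewrite /lamb /k; field.
have -> : N^-1 = 4 * k by rewrite /k; field.
set Q := (X in X <= 0).
have -> : Q = P * enorm y ^+ 2 * (mu * (1 + t - t ^+ 2 / 4) - (N - 1) * t + N / 2 * t ^+ 2 - 2^-1).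
  have NN : N = (4 * k)^-1 by rewrite /k; field.
  rewrite /Q /mu NN; field; rewrite gt_eqF//.
rewrite pmulr_rle0; last by rewrite mulr_gt0// exprn_gt0.
have t1 : t <= 1.
  rewrite /t ler_pdivrMr// mul1r; apply: le_trans (ler_norm _) _.
  by apply: le_trans (cauchy_schwarz _ _) _; rewrite nu1 mul1r.
have tk : - k <= t by rewrite /t ler_pdivlMr.
have mu0 : 0 <= mu by rewrite /mu lk; clear -R n k0 N2; apply: mulr_ge0; lra.
have mu1 : mu <= 16^-1 by rewrite /mu lk; clear -R n k0 kN N2; nra.
have tt : t ^+ 2 <= (1 - k) * t + k by clear -R n t1 tk; nra.
have k8 : k <= 8^-1 by clear -R n k0 kN N2; nra.
have q1 : mu * (1 + t - t ^+ 2 / 4) <= 16^-1 * 2.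
  by apply: ler_pM => //; clear -R n t1 tk k8 k0 tt; nra.
nra.
Qed.

(** In the cone the angular factor of [cbar] stays between 1/2 and 2, so [cbar] is comparable with
    [|x - z|^lamb]. *)
Lemma cone_barrier D z nu (rho : R) : (2 <= n.+1)%N -> ~ D z -> 0 < rho -> enorm nu = 1 ->
  (forall x, D x -> enorm (x - z) < rho -> - (4 * N)^-1 * enorm (x - z) <= dotp nu (x - z)) ->
  barrier D z.
Proof.
move=> n2 nz rho0 nu1 cone.
have N2 : 2 <= N by rewrite ler_nat.
have l0 : 0 < lamb by rewrite invr_gt0; lra.
have xz x : D x -> x - z != 0 by move=> Dx; rewrite subr_eq0; apply: contra_notN nz => /eqP<-.
have bE x : D x -> enorm (x - z) < rho -> exists2 k : R, 2^-1 <= k <= 2 & cbar nu (x - z) = k * enorm (x - z) `^ lamb.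
  move=> Dx xr; have e0 : 0 < enorm (x - z) by rewrite enorm_gt0 xz.
  rewrite cbarE ?xz//; set t := dotp nu _ / _; exists (1 + t - t ^+ 2 / 4); last first.
    by rewrite mulrC pw_norm; congr (_ * _ `^ _); field.
  have t1 : t <= 1.
    rewrite /t ler_pdivrMr// mul1r; apply: le_trans (ler_norm _) _.
    by apply: le_trans (cauchy_schwarz _ _) _; rewrite nu1 mul1r.
  have k8 : (4 * N)^-1 <= 8^-1 by rewrite lef_pV2 ?posrE; lra.
  have tk : - 8^-1 <= t.
    rewrite /t ler_pdivlMr//; apply: le_trans (cone x Dx xr).
    by rewrite ler_pM2r// lerN2.
  by apply/andP; split; nra.
exists rho, (fun x => cbar nu (x - z)); split => //.
- have [L lL hL] := cbar_lapl nu1.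
  rewrite (_ : (fun x => - _) = fun x => -1 * cbar nu (x - z)); last first.
    by apply/funext => x; rewrite mulN1r.
  apply: (subh_lapl (L := fun x => -1 * L (x - z))).
    apply: laplZ; apply: lapl_sub (lapl_trans z lL) => x [Dx _] /=; exact: xz.
  by move=> x [Dx xr]; rewrite mulN1r oppr_ge0; apply: hL => //; [exact: xz|exact: cone].
- move=> x Dx xr; have [k /andP[k0 _] ->] := bE x Dx xr.
  by rewrite mulr_ge0 ?powR_ge0//; lra.
- move=> e e0; exists ((e / 4) `^ lamb^-1); first by rewrite powR_gt0; lra.
  move=> x [Dx xr] xe; have [k /andP[k0 k1] ->] := bE x Dx xr.
  rewrite subr0 ger0_norm; last by rewrite mulr_ge0 ?powR_ge0//; lra.
  have : enorm (x - z) `^ lamb <= e / 4.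
    have -> : e / 4 = ((e / 4) `^ lamb^-1) `^ lamb by rewrite -powRrM mulVf ?powRr1 ?gt_eqF//; lra.
    by rewrite ge0_ler_powR ?nnegrE ?enorm_ge0 ?powR_ge0// ltW.
  have := powR_ge0 (enorm (x - z)) lamb; nra.
- move=> d d0; exists (2^-1 * d `^ lamb); first by rewrite mulr_gt0// powR_gt0.
  move=> x Dx xr xd; have [k /andP[k0 k1] ->] := bE x Dx xr.
  have : d `^ lamb <= enorm (x - z) `^ lamb.
    by rewrite ge0_ler_powR ?nnegrE ?enorm_ge0// ltW.
  have := powR_gt0 lamb d0; nra.
Qed.

(** * Dirichlet problems in bounded and exterior domains *)

Lemma harm_max D u c : open D -> ebounded D -> harm D u ->
  bsup D u (fun=> c) -> forall x, D x -> u x <= c.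
Proof. by move=> oD bD hu; apply: max_principle (harm_lapl hu) _ => // x _. Qed.

Lemma harm_abs_max D u (c : R) : open D -> ebounded D -> harm D u ->
  bsup D (fun x => `|u x|) (fun=> c) -> forall x, D x -> `|u x| <= c.
Proof.
move=> oD bD hu bu x Dx; rewrite ler_norml lerNl; apply/andP; split.
  apply: (harm_max oD bD (harmN hu)) => // z cz nz e e0.
  have [d d0 hd] := bu z cz nz e e0; exists d => // y Dy /(hd y Dy).
  by rewrite ler_norml => /andP[]; lra.
apply: (harm_max oD bD hu) => // z cz nz e e0.
have [d d0 hd] := bu z cz nz e e0; exists d => // y Dy /(hd y Dy).
by rewrite ler_norml => /andP[].
Qed.

Lemma harm_eq D u h : open D -> ebounded D -> harm D u -> harm D h ->
  (\bd z of D, blim D (fun x => u x - h x) z 0) ->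
  forall x, D x -> u x = h x.
Proof.
move=> oD bD hu hh b0 x Dx; apply/eqP; rewrite -subr_eq0 -normr_le0.
apply: (harm_abs_max oD bD (u := fun x => u x - h x)) => //; first exact: harmB.
move=> z cz nz e e0; have [d d0 hd] := b0 z cz nz e e0; exists d => // y Dy /(hd y Dy).
by rewrite subr0 add0r => /ltW.
Qed.

Lemma dirichlet_bounded D f (F : R) : (2 <= n.+1)%N -> open D ->
  (\bd z of D, barrier D z) ->
  (\bd z of D, `|f z| <= F) -> 0 <= F ->
  (\bd z of D, blim (closure D `\` D) f z (f z)) ->
  exists u : V -> R, [/\ harm D u, forall x, D x -> `|u x| <= F &
    \bd z of D, blim D u z (f z)].
Proof.
move=> n2 oD bar fF F0 cf; apply: (perron n2 (psi := fun=> F) (Psi := F) (F := F)) => //.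
- exact: subh_cst.
- by move=> x _; rewrite F0 lexx.
- by move=> z cz nz e e0; exists 1 => // x _ _; have := fF z cz nz; lra.
Qed.

Lemma harm_pw a : a = 1 - N / 2 -> harm [set x : V | x != 0] (pw a).
Proof.
move=> ->; have h : hharm 0 (fun _ : V => 1 : R) by split; [exact: hpC|exact: harm_cst].
have := kelvin_hharm h; rewrite subr0.
by under [X in harm _ X]eq_fun do rewrite mulr1.
Qed.

(** The majorant is a multiple of [|x|^(2 - N)] that is at least [F] on the boundary, which lies in
    the ball of radius [B]; the solution inherits its decay. *)
Lemma dirichlet_exterior D f (F d B : R) : (2 <= n.+1)%N -> open D -> 0 < d ->
  (forall x, D x -> d <= enorm x) -> (\bd z of D, enorm z <= B) ->
  (\bd z of D, barrier D z) ->
  (\bd z of D, `|f z| <= F) -> 0 <= F ->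
  (\bd z of D, blim (closure D `\` D) f z (f z)) ->
  exists u : V -> R, [/\ harm D u,
    forall x, D x -> `|u x| <= F * B `^ (N - 2) * pw (1 - N / 2) x &
    \bd z of D, blim D u z (f z)].
Proof.
move=> n2 oD d0 dD DB bar fF F0 cf.
have N2 : 2 <= N by rewrite ler_nat.
have x0 x : D x -> x != 0 by move=> /dD xd; rewrite -enorm_gt0; lra.
have C0 : 0 <= F * B `^ (N - 2) by rewrite mulr_ge0// powR_ge0.
have hpsi : harm D (fun x => F * B `^ (N - 2) * pw (1 - N / 2) x).
  by apply: harmZ; apply: harm_sub (harm_pw erefl) => x /x0.
have cld z : closure D z -> d <= enorm z.
  move=> /closure_enormP cz; apply/ler_addgt0Pr => e e0; have [y /dD yd yz] := cz e e0.
  by have [] := enorm_rdistP y z; lra.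
apply: (perron n2 (psi := fun x => F * B `^ (N - 2) * pw (1 - N / 2) x)
  (Psi := F * B `^ (N - 2) * d `^ (2 - N)) (F := F)) => //.
- exact: subh_harm (harmN hpsi).
- move=> x Dx; rewrite mulr_ge0 ?pw_ge0//= ler_wpM2l// pw_norm.
  have -> : 2 * (1 - N / 2) = - (N - 2) by field.
  have -> : 2 - N = - (N - 2) by ring.
  have xd := dD x Dx.
  rewrite !powRN lef_pV2 ?posrE ?powR_gt0//; last by lra.
  by rewrite ge0_ler_powR ?nnegrE//; lra.
- move=> z cz nz e e0.
  have z0 : z != 0 by rewrite -enorm_gt0; have := cld z cz; lra.
  have [r r0 hr] := @contZ _ _ (F * B `^ (N - 2)) _ _ (cont_pw (1 - N / 2) z0) e e0.
  exists r => // x _ /hr; rewrite ltr_norml => /andP[h _].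
  have := fF z cz nz; suff : F <= F * B `^ (N - 2) * pw (1 - N / 2) z by lra.
  rewrite -mulrA ler_peMr// pw_norm (_ : 2 * (1 - N / 2) = - (N - 2)); last by field.
  have z1 := cld z cz.
  have zp : 0 < enorm z `^ (N - 2) by rewrite powR_gt0//; lra.
  rewrite powRN ler_pdivlMr// mul1r ge0_ler_powR ?nnegrE ?enorm_ge0 ?DB//; first lra.
  by apply: le_trans (DB z cz nz); exact: enorm_ge0.
Qed.

(** From dimension 3 on the decay makes [|u| <= e] outside a large ball, and the bounded maximum
    principle applies inside. The radius [a] is such that [|C| / a^(N - 2) <= e]. *)
Lemma harm_exterior_max D u (C c : R) : (3 <= n.+1)%N -> open D ->
  harm D u -> (forall x, D x -> `|u x| <= C * pw (1 - N / 2) x) -> 0 <= c ->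
  bsup D (fun x => `|u x|) (fun=> c) -> forall x, D x -> `|u x| <= c.
Proof.
move=> n3 oD hu uC c0 bu x Dx; apply/ler_addgt0Pr => e e0.
have N3 : 3 <= N by rewrite ler_nat.
pose a : R := (`|C| / e + 1) `^ (N - 2)^-1.
pose r : R := `|x| + enorm x + a + 1.
have Ce0 : 0 <= `|C| / e by rewrite divr_ge0// ltW.
have a0 : 0 < a by rewrite powR_gt0; lra.
have xr : enorm x < r by rewrite /r; have := normr_ge0 x; lra.
have far y : D y -> a <= enorm y -> `|u y| <= e.
  move=> Dy ya; apply: le_trans (uC y Dy) _.
  have yp : 0 < enorm y `^ (N - 2) by rewrite powR_gt0; lra.
  apply: le_trans (ler_wpM2r (pw_ge0 _ _) (ler_norm C)) _.
  rewrite pw_norm (_ : 2 * (1 - N / 2) = - (N - 2)); last by field.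
  rewrite powRN ler_pdivrMr// mulrC -ler_pdivrMr//.
  apply: (@le_trans _ _ (a `^ (N - 2))); last by rewrite ge0_ler_powR ?nnegrE ?enorm_ge0//; lra.
  by rewrite /a -powRrM mulVf ?gt_eqF ?powRr1; lra.
have oDr : open (D `&` eB 0 r) by apply: openI => //; exact: eB_open.
apply: (@harm_abs_max (D `&` eB 0 r) u (c + e)) => //.
- by have [M hM] := @eB_bounded _ _ (0 : V) r; exists M => y [_ /hM].
- by apply: harm_sub hu => y [].
- move=> z cz nz e' e'0.
  have zr := closureI_eB cz; rewrite subr0 in zr.
  have [Dz|nDz] := pselect (D z).
    have zr2 : enorm z = r.
      by apply/eqP; rewrite eq_le zr leNgt; apply/negP => h; apply: nz; split => //; rewrite /eB/= subr0.
    exists 1 => // y [Dy _] yz; have : `|u y| <= e.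
      apply: far => //; have [h1 h2] := enorm_rdistP y z.
      by move: h1; rewrite zr2 /r; have := normr_ge0 x; have := enorm_ge0 x; lra.
    lra.
  have cDz : closure D z by apply: closure_subset cz => w [].
  have [d d0 hd] := bu z cDz nDz e' e'0; exists d => // y [Dy _] /(hd y Dy); lra.
- by split => //; rewrite /eB/= subr0.
Qed.

Lemma bdryE O z : open O -> boundary O z <-> closure O z /\ ~ O z.
Proof. move=> oO; rewrite /boundary (_ : interior O = O)//.
by apply/seteqP; split; [exact: interior_subset|move: oO; rewrite openE]. Qed.

Lemma powR1D a (t : R) : 0 < a -> 0 <= t -> t `^ (1 + a) = t * t `^ a.
Proof. by move=> a0 t0; rewrite powRD ?powRr1//; apply/implyP; lra. Qed.

Lemma powR_mono a (t s : R) : 0 < a -> 0 <= t -> t <= s -> t `^ a <= s `^ a.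
Proof.
by move=> a0 t0 ts; apply: ge0_ler_powR; rewrite ?nnegrE// ?(ltW a0)//; exact: le_trans ts.
Qed.

(** * Hoelder bounds and flatness of boundaries of class C^{1,alpha} *)

Lemma bounded_le (T : Type) (S : set T) (f : T -> R^o) : [bounded f x | x in S] ->
  exists2 M : R, 0 <= M & forall x : T, S x -> `|f x| <= M.
Proof.
move=> [M [_ hM]]; exists (`|M| + 1) => [|x Sx]; first by rewrite addr_ge0.
by apply: (hM (`|M| + 1)) => //; apply: le_lt_trans (ler_norm _) _; rewrite ltrDl.
Qed.

Lemma holder_le a (g : V -> R^o) (S : set V) : [bounded holder_quot a g xy | xy in S `*` S] ->
  exists2 H : R, 0 <= H & forall x y, S x -> S y -> `|g x - g y| <= H * enorm (x - y) `^ a.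
Proof.
move=> /bounded_le[H H0 hH]; exists H => // x y Sx Sy.
have [->|xy] := eqVneq x y.
  by rewrite subrr normr0 mulr_ge0// powR_ge0.
have e0 : 0 < enorm (x - y) `^ a by rewrite powR_gt0// enorm_gt0 subr_eq0.
have := hH (x, y) (conj Sx Sy); rewrite /holder_quot/= normrM normfV (ger0_norm (ltW e0)).
by rewrite ler_pdivrMr.
Qed.

Lemma holder_cont a (g : V -> R^o) O x H : 0 < a -> 0 <= H -> open O -> O x ->
  (forall y, O y -> `|g x - g y| <= H * enorm (x - y) `^ a) -> cont_at g x.
Proof.
move=> a0 H0 oO Ox hg e e0; have [r r0 rO] := open_ball_in oO Ox.
pose q : R := e / (H + 1); have q0 : 0 < q by rewrite divr_gt0//; lra.
exists (Num.min r (q `^ a^-1)); first by rewrite lt_min r0 powR_gt0.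
move=> y; rewrite lt_min => /andP[/rO Oy yq]; rewrite distrC.
apply: le_lt_trans (hg y Oy) _.
have hq : enorm (x - y) `^ a < q.
  rewrite enorm_distC; have -> : q = (q `^ a^-1) `^ a by rewrite -powRrM mulVf ?powRr1 ?gt_eqF//; lra.
  by rewrite gt0_ltr_powR// nnegrE ?enorm_ge0 ?powR_ge0.
apply: (@le_lt_trans _ _ (H * q)); first by rewrite ler_wpM2l// ltW.
by rewrite /q mulrA ltr_pdivrMr ?mulrDr; lra.
Qed.

Lemma C1a_dirder a O (f : V -> R^o) x v : 0 < a -> open O -> C1a a O f -> O x ->
  is_derive x v f (\sum_i v 0 i * partial i f x : R).
Proof.
move=> a0 oO [_ _ hf] Ox; apply: (dirder (fd := fun i => partial i f) v oO Ox).
  by move=> i y Oy; have [df _ _ _] := hf i; apply: DeriveDef; [exact: df|].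
move=> i; have [_ _ _ /holder_le[H H0 hH]] := hf i.
by apply: (holder_cont a0 H0 oO Ox) => y Oy; exact: hH.
Qed.

Lemma C1a_first_order a O (f : V -> R^o) : 0 < a -> open O -> C1a a O f ->
  exists2 H : R, 0 <= H & forall x z, (forall t : R, 0 <= t <= 1 -> O (z + t *: (x - z))) ->
    `|f x - f z - \sum_i (x - z) 0 i * partial i f z| <= H * enorm (x - z) `^ (1 + a).
Proof.
move=> a0 oO Cf; have [_ _ hf] := Cf.
have /choice[H hH] : forall i, exists H : R, 0 <= H /\
    forall x y, O x -> O y -> `|partial i f x - partial i f y| <= H * enorm (x - y) `^ a.
  by move=> i; have [_ _ _ /holder_le[H H0 h]] := hf i; exists H.
exists (\sum_i H i); first by apply: sumr_ge0 => i _; have [] := hH i.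
move=> x z seg; pose v := x - z.
have [|c /andP[c0 c1]] := @MVT_line _ _ f z v (fun t => \sum_i v 0 i * partial i f (z + t *: v)) 0 1 ltr01.
  by move=> t /seg Ot; exact: C1a_dirder Cf Ot.
have -> : z + 1 *: v = x by rewrite scale1r /v addrC subrK.
rewrite scale0r addr0 subr0 mulr1 => ->.
have Oc : O (z + c *: v) by apply: seg; rewrite !ltW.
have Oz : O z by have := seg 0; rewrite scale0r addr0; apply; rewrite lexx ler01.
have -> : \sum_i v 0 i * partial i f (z + c *: v) - \sum_i v 0 i * partial i f z =
    \sum_i v 0 i * (partial i f (z + c *: v) - partial i f z).
  by rewrite -sumrB; apply: sumR_eq => i; rewrite mulrBr.
apply: le_trans (ler_norm_sum _ _ _) _; rewrite mulr_suml; apply: ler_sum => i _.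
have [Hi0 hi] := hH i; rewrite normrM powR1D ?enorm_ge0// mulrCA; apply: ler_pM => //; first exact: coord_le_enorm.
apply: le_trans (hi _ _ Oc Oz) _; apply: (ler_wpM2l Hi0).
have -> : z + c *: v - z = c *: v by rewrite addrC addKr.
apply: powR_mono => //; first exact: enorm_ge0.
rewrite enormZ ger0_norm ?(ltW c0)//.
by rewrite ler_piMl ?enorm_ge0// ltW.
Qed.

(** Near [z] the boundary lies within [kap |x - z|^(1 + a)] of the tangent plane, [O] being on the
    side of [nu]. This is all that is retained of the charts. *)
Definition flat_at a O z nu (kap r : R) := enorm nu = 1 /\ forall x, enorm (x - z) < r ->
  (kap * enorm (x - z) `^ (1 + a) < dotp nu (x - z) -> O x) /\
  (dotp nu (x - z) < - (kap * enorm (x - z) `^ (1 + a)) -> ~ closure O x).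

(** The last chart coordinate [d] is a defining function: its normalised gradient is the normal, its
    first order expansion the flatness. Compactness of the boundary makes the constants uniform. *)
Lemma C1a_flat a O : 0 < a -> open O -> ebounded O -> of_class_C1a a O ->
  exists kap r : R, [/\ 0 < kap, 0 < r & forall z, boundary O z -> exists nu, flat_at a O z nu kap r].
Proof.
move=> a0 oO bO hO.
have cK : compact (boundary O).
  apply: bounded_closed_compact.
    apply/eboundedP; have [B hB] := bO; exists (B + 1) => z /(bdryE z oO)[/closure_enormP cz _].
    have [y Oy yz] := cz 1 ltr01; have := enormD (z - y) y; rewrite subrK (enorm_distC z y).
    by have := hB y Oy; lra.
  have -> : boundary O = closure O `&` ~` O.
    by apply/seteqP; split => z /(bdryE z oO).
  by apply: closedI; [exact: closed_closure|exact: open_closedC].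
pose P z d := exists nu, flat_at a O z nu d^-1 d.
suff [r r0 hr] : exists2 r : R, 0 < r & forall z, boundary O z -> P z r.
  by exists r^-1, r; split => //; rewrite invr_gt0.
apply: compact_bounded_near => //.
  move=> z d b [nu [nu1 h]] bd b0; exists nu; split => // x xz.
  have [h1 h2] := h x (lt_le_trans xz bd).
  have le : d^-1 * enorm (x - z) `^ (1 + a) <= b^-1 * enorm (x - z) `^ (1 + a).
    by rewrite ler_wpM2r ?powR_ge0// lef_pV2// posrE; lra.
  by split => q; [apply: h1|apply: h2]; lra.
move=> z0 /hO[W [D [psi [phi [Wz0 [[[oW oD] psiW phiD Cpsi Cphi] hch]]]]]].
have [r r0 rW] := open_ball_in oW Wz0.
pose d x : R^o := psi x 0 ord_max.
have Cd : C1a a W d := Cpsi ord_max.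
have [H H0 hH] := C1a_first_order a0 oW Cd.
have /choice[M hM] : forall j, exists M : R, 0 <= M /\ forall y, D y -> `|partial ord_max (fun y => phi y 0 j : R^o) y| <= M.
  by move=> j; have [_ _ /(_ ord_max)[_ _ /bounded_le[M M0 h] _]] := Cphi j; exists M.
pose L : R := \sum_j M j + 1.
have L0 : 0 < L by rewrite ltr_wpDl// sumr_ge0// => j _; have [] := hM j.
pose G z : V := \row_i (partial i d z : R).
have GE z v : \sum_i v 0 i * partial i d z = dotp (G z) v.
  by rewrite dotpC; apply: sumR_eq => i; rewrite mxE.
have first z x : enorm (z - z0) < r / 2 -> enorm (x - z) < r / 2 ->
    `|d x - d z - dotp (G z) (x - z)| <= H * enorm (x - z) `^ (1 + a).
  move=> zz xz; rewrite -GE; apply: hH => t /andP[t0 t1]; apply: rW.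
  have := enorm_tri z (z + t *: (x - z)) z0; rewrite [z + t *: _ - z]addrC addKr enormZ ger0_norm//.
  have : t * enorm (x - z) <= enorm (x - z) by rewrite ler_piMl ?enorm_ge0.
  lra.
(* The gradient cannot be small: moving by [s] along the last axis of the chart raises [d] by [s]
   and displaces the point by at most [L s], while [s <= q] keeps the Hoelder remainder below
   [s / 2]. *)
have Glow z : boundary O z -> enorm (z - z0) < r / 2 -> (2 * L)^-1 <= enorm (G z).
  move=> bz zz; have Wz : W z by apply: rW; lra.
  have dz : d z = 0 by have [_ [h _]] := hch z Wz; exact: h.
  have [Dy phiy] := psiW z Wz.
  have [r' r'0 r'D] := open_ball_in oD Dy.
  pose q : R := ((2 * (H + 1) * L `^ (1 + a))^-1) `^ a^-1.
  have La0 : 0 < L `^ (1 + a) by rewrite powR_gt0.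
  have q0 : 0 < q by rewrite powR_gt0// invr_gt0// mulr_gt0//; lra.
  pose s : R := Num.min (Num.min (r' / 2) (r / (4 * L))) q.
  have s0 : 0 < s by rewrite !lt_min q0 !divr_gt0// mulr_gt0.
  have [sr' sr sq] : [/\ s <= r' / 2, s <= r / (4 * L) & s <= q].
    by rewrite !ge_min !lexx ?orbT.
  have inD t : 0 <= t <= s -> D (psi z + t *: ee ord_max).
    move=> /andP[t0 ts]; apply: r'D; rewrite [psi z + _]addrC addrK enormZ enorm_ee mulr1 ger0_norm//.
    by clear -R n ts sr' r'0; lra.
  pose xs := phi (psi z + s *: ee ord_max).
  have xsz : enorm (xs - z) <= L * s.
    apply: (@le_trans _ _ (\sum_j M j * s)); last first.
      by rewrite -mulr_suml ler_pM2r// lerDl.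
    apply: le_trans (enorm_le_sum _) _; apply: ler_sum => j _; have [Mj0 hMj] := hM j.
    rewrite !mxE -phiy /xs.
    apply: (@MVT_line_le _ _ (fun y => phi y 0 j : R^o) (psi z) (ee ord_max)
      (fun t => partial ord_max (fun y => phi y 0 j : R^o) (psi z + t *: ee ord_max))); first exact: ltW.
      move=> t /inD Dt; have [_ _ /(_ ord_max)[df _ _ _]] := Cphi j.
      by apply: DeriveDef; [exact: df|].
    by move=> t /inD Dt; exact: hMj.
  have dxs : d xs = s.
    have [_ e] := phiD _ (inD s ltac:(rewrite ltW//=; exact: lexx)).
    rewrite /d /xs e.
    have -> : (psi z + s *: ee ord_max) 0 ord_max = psi z 0 ord_max + s * (ee ord_max : V) 0 ord_max.
      by rewrite mxE [X in _ + X]mxE.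
    rewrite eeE eqxx mulr1; have : psi z 0 ord_max = 0 by exact: dz.
    by move=> ->; rewrite add0r.
  have Ls : L * s <= r / 4.
    by move: sr; rewrite ler_pdivlMr ?mulr_gt0//; clear -R n; lra.
  have := first z xs zz ltac:(lra).
  rewrite dxs dz subr0 => h1.
  have h2 : dotp (G z) (xs - z) <= enorm (G z) * (L * s).
    apply: le_trans (ler_norm _) _; apply: le_trans (cauchy_schwarz _ _) _.
    by rewrite ler_wpM2l// enorm_ge0.
  have h3 : H * enorm (xs - z) `^ (1 + a) <= s / 2.
    apply: (@le_trans _ _ (H * (L * s) `^ (1 + a))).
      by rewrite ler_wpM2l// powR_mono ?enorm_ge0//; clear -R n a0 xsz; lra.
    rewrite powRM ?(ltW L0) ?(ltW s0)// (@powR1D a s) ?(ltW s0)//.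
    have h : s `^ a <= (2 * (H + 1) * L `^ (1 + a))^-1.
      have -> : (2 * (H + 1) * L `^ (1 + a))^-1 = q `^ a.
        by rewrite /q -powRrM mulVf ?powRr1 ?gt_eqF// invr_ge0 mulr_ge0//; [clear -R n H0; lra|exact: ltW].
      by apply: powR_mono => //; exact: ltW.
    apply: (@le_trans _ _ (H * (L `^ (1 + a) * (s * (2 * (H + 1) * L `^ (1 + a))^-1)))).
      do 3! (rewrite ler_wpM2l//; try exact: ltW).
    rewrite !invfM !mulrA.
    have -> : H * L `^ (1 + a) * s / 2 / (H + 1) / L `^ (1 + a) = (H / (H + 1)) * (s / 2).
      by field; rewrite !gt_eqF//; clear -R n H0; lra.
    rewrite ler_piMl ?divr_ge0 ?(ltW s0)// ler_pdivrMr ?mul1r; clear -R n H0; lra.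
  have h4 : s / 2 <= enorm (G z) * (L * s).
    by move: h1; rewrite ler_norml => /andP[]; clear -R n h2 h3; lra.
  rewrite invfM ler_pdivrMr//; move: h4; rewrite mulrA.
  by rewrite mulrC ler_pM2r.
pose kap : R := 2 * L * (H + 1).
have k0 : 0 < kap by rewrite /kap !mulr_gt0//; lra.
exists (Num.min (r / 2) kap^-1); first by rewrite lt_min invr_gt0 k0 divr_gt0.
move=> z bz; rewrite lt_min => /andP[zz _].
have Wz : W z by apply: rW; lra.
have dz : d z = 0 by have [_ [h _]] := hch z Wz; exact: h.
have g0 := Glow z bz zz.
have Gp : 0 < enorm (G z) by apply: lt_le_trans g0; rewrite invr_gt0 mulr_gt0.
exists ((enorm (G z))^-1 *: G z); split.
  by rewrite enormZ ger0_norm ?invr_ge0 ?enorm_ge0// mulVf// gt_eqF.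
move=> x; rewrite lt_min => /andP[xr _].
have Wx : W x by apply: rW; have := enorm_tri z x z0; lra.
have := first z x zz xr; rewrite dz subr0 ler_norml => /andP[f1 f2].
have kk : H * enorm (x - z) `^ (1 + a) <= (Num.min (r / 2) kap^-1)^-1 * enorm (x - z) `^ (1 + a) * enorm (G z).
  rewrite mulrAC ler_wpM2r ?powR_ge0//.
  apply: (@le_trans _ _ (kap * enorm (G z))).
    apply: (@le_trans _ _ (kap * (2 * L)^-1)); last by rewrite ler_pM2l.
    by rewrite /kap mulrAC mulfV ?mul1r ?gt_eqF ?mulr_gt0//; clear -R n H0; lra.
  rewrite ler_pM2r// -[leLHS]invrK lef_pV2 ?posrE ?invr_gt0 ?lt_min ?invr_gt0 ?k0 ?divr_gt0//.
  by rewrite ge_min lexx orbT.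
have [h1 h2] := hch x Wx.
rewrite dotpZl (mulrC _ (dotp _ _)); split => h.
  by apply/h1; move: h; rewrite ltr_pdivlMr// => h; rewrite -[lastc _]/(d x); clear -R n f1 kk h; lra.
have : d x < 0 by move: h; rewrite ltr_pdivrMr// mulNr => h; clear -R n f2 kk h; lra.
move=> dx cx; have [Ox|nOx] := pselect (O x).
  by have /h1 := Ox; rewrite -[lastc _]/(d x); clear -R n dx; lra.
have /h2 : boundary O x by apply/bdryE.
by rewrite -[lastc _]/(d x); clear -R n dx; lra.
Qed.

(** Within distance [q] the deviation [kap |x - z|^(1 + a)] is at most [|x - z| / (4 N)], so the
    domain lies in the cone of [cone_barrier]. *)
Lemma flat_inner_barrier a O z nu (kap r : R) : (2 <= n.+1)%N -> 0 < a -> 0 < kap -> 0 < r ->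
  open O -> ~ O z -> flat_at a O z nu kap r -> barrier O z.
Proof.
move=> n2 a0 k0 r0 oO nz [nu1 hf].
pose q : R := (4 * N * kap)^-1 `^ a^-1.
have q0 : 0 < q by rewrite powR_gt0// invr_gt0 !mulr_gt0.
apply: (@cone_barrier _ _ nu (Num.min r q)) => //; first by rewrite lt_min r0.
move=> x Ox; rewrite lt_min => /andP[xr xq].
have [_ h] := hf x xr.
apply: (@le_trans _ _ (- (kap * enorm (x - z) `^ (1 + a)))); last first.
  by rewrite leNgt; apply/negP => /h; apply; exact: subset_closure.
rewrite mulNr lerN2 powR1D ?enorm_ge0// mulrCA mulrC ler_wpM2r ?enorm_ge0//.
rewrite -ler_pdivlMl// -invfM mulrC.
have -> : (4 * N * kap)^-1 = q `^ a.
  by rewrite /q -powRrM mulVf ?powRr1 ?gt_eqF// invr_ge0 !mulr_ge0// ltW.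
by apply: powR_mono => //; [exact: enorm_ge0|exact: ltW].
Qed.

(** The same cone argument with the normal reversed; it serves the exterior problem around the
    hole. *)
Lemma flat_outer_barrier a O z nu (kap r : R) : (2 <= n.+1)%N -> 0 < a -> 0 < kap -> 0 < r ->
  open O -> closure O z -> flat_at a O z nu kap r -> barrier (~` closure O) z.
Proof.
move=> n2 a0 k0 r0 oO cz [nu1 hf].
pose q : R := (4 * N * kap)^-1 `^ a^-1.
have q0 : 0 < q by rewrite powR_gt0// invr_gt0 !mulr_gt0.
apply: (@cone_barrier _ _ (- nu) (Num.min r q)) => //.
- by rewrite lt_min r0.
- by rewrite -scaleN1r enormZ normrN1 mul1r.
move=> x nx; rewrite lt_min => /andP[xr xq].
have [h _] := hf x xr.
rewrite mulNr dotpNl lerN2; apply: (@le_trans _ _ (kap * enorm (x - z) `^ (1 + a))).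
  by rewrite leNgt; apply/negP => /h Ox; apply: nx; exact: subset_closure.
rewrite powR1D ?enorm_ge0// mulrCA mulrC ler_wpM2r ?enorm_ge0//.
rewrite -ler_pdivlMl// -invfM mulrC.
have -> : (4 * N * kap)^-1 = q `^ a.
  by rewrite /q -powRrM mulVf ?powRr1 ?gt_eqF// invr_ge0 !mulr_ge0// ltW.
by apply: powR_mono => //; [exact: enorm_ge0|exact: ltW].
Qed.

(** * First order expansion at a boundary point *)

Hypothesis n2 : (2 <= n.+1)%N.
Local Tactic Notation "lra_on" ne_hyp_list(hs) := clear -R n n2 hs; lra.

Definition bsmall O z r u (eta : R) := \bd y of O, enorm (y - z) < r ->
  forall e : R, 0 < e -> exists2 d : R, 0 < d &
    forall x, O x -> enorm (x - y) < d -> `|u x| <= eta + e.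

Lemma bsmallN O z r u eta : bsmall O z r u eta -> bsmall O z r (fun x => - u x) eta.
Proof.
move=> h y cy ny yz e e0; have [d d0 hd] := h y cy ny yz e e0.
by exists d => // x Ox /(hd x Ox); rewrite normrN.
Qed.

(** The barrier is centred at [x] itself. With [s = nu.(y - z) + tau], nonnegative on [O], the
    function [Q (|y - x|^2 + N s (8 rho - s))] is harmonic, nonnegative on [O], at least [M] on the
    sphere of radius [rho], and at [y = x] at most linear in [s]. *)
Lemma strip_bound_le O z nu r u (M eta tau : R) : 0 < r -> open O -> enorm nu = 1 ->
  harm (O `&` eB z r) u -> (forall x, O x -> eB z r x -> `|u x| <= M) ->
  0 <= tau <= r / 8 -> (forall x, O x -> eB z r x -> - tau <= dotp nu (x - z)) ->
  bsmall O z r u eta -> 0 <= eta ->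
  forall x, O x -> enorm (x - z) <= 3 / 4 * r ->
    u x <= eta + 64 * N * M / r * (dotp nu (x - z) + tau).
Proof.
move=> r0 oO nu1 hu uM /andP[tau0 taur] strip bu eta0 x Ox xz.
pose rho : R := r / 8; have rho0 : 0 < rho by rewrite /rho; lra.
have rE : r = 8 * rho by rewrite /rho; lra.
have M0 : 0 <= M by apply: le_trans (uM x Ox _); rewrite // /eB/=; lra.
pose k := tau - dotp nu z.
pose Q : R := M / rho ^+ 2; have Q0 : 0 <= Q by rewrite divr_ge0// sqr_ge0.
pose b y : R := Q * ((dotp (y - x) (y - x) + - N * (dotp nu y * dotp nu y)) + (N * (8 * rho - 2 * k)) * dotp nu y)
  + Q * N * (8 * rho * k - k ^+ 2).
have bE y : b y = Q * (enorm (y - x) ^+ 2 + N * ((dotp nu (y - z) + tau) * (8 * rho - (dotp nu (y - z) + tau)))).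
  by rewrite /b enorm_sqr (dotpBr y z nu) /k; ring.
have lb O' : lapl O' b (fun=> 0).
  have h1 := laplD (laplZ Q (laplD (laplD (lapl_sq O' x) (laplZ (- N) (lapl_dotp2 O' nu)))
    (laplZ (N * (8 * rho - 2 * k)) (harm_lapl (harm_dotp O' nu))))) (harm_lapl (harm_cst O' (Q * N * (8 * rho * k - k ^+ 2)))).
  by apply: lapl_eq h1 => y _ /=; rewrite -enorm_sqr nu1; ring.
pose D := O `&` eB x rho.
have Dz y : enorm (y - x) <= rho -> eB z r y.
  by move=> yx; rewrite /eB/=; have := enorm_tri x y z; lra.
have D1 : D `<=` O `&` eB z r by move=> y [Oy]; rewrite /eB/= => yx; split => //; apply: Dz; lra.
have bge y : O y -> enorm (y - x) <= rho -> Q * enorm (y - x) ^+ 2 <= b y.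
  move=> Oy yx; rewrite bE ler_wpM2l// lerDl mulr_ge0// mulr_ge0//.
    by have := strip y Oy (Dz y yx); lra.
  have : dotp nu (y - z) <= enorm (y - z).
    by apply: le_trans (ler_norm _) _; apply: le_trans (cauchy_schwarz _ _) _; rewrite nu1 mul1r.
  have := enorm_tri x y z; lra.
have : u x + -1 * b x <= eta.
  apply: (@max_principle _ _ D (fun x => u x + -1 * b x) (fun x => 0 + -1 * 0)).
  - by apply: openI => //; exact: eB_open.
  - by have [B hB] := eB_bounded x rho; exists B => y [_ /hB].
  - by apply: laplD; [apply: lapl_sub D1 _; exact: harm_lapl|exact: laplZ].
  - by move=> y _; rewrite mulr0 addr0.
  - move=> y cy ny; have yx : enorm (y - x) <= rho by exact: closureI_eB cy.
    have cOy : closure O y by apply: closure_subset cy => w [].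
    have [Oy|nOy] := pselect (O y).
      have yr : enorm (y - x) = rho.
        by apply/eqP; rewrite eq_le yx leNgt; apply/negP => h; exact: ny.
      have cu : cont_at u y by apply: harm_cont hu _; split => //; exact: Dz.
      have cb : cont_at b y by have [fd [fdd /(_ y Logic.I)[]]] := lb setT.
      move=> e e0; have [d d0 hd] := contD cu (contZ (-1) cb) e0.
      exists d => // w _ /hd; rewrite ltr_norml => /andP[_ h].
      have := bge y Oy yx; rewrite yr /Q divfK ?gt_eqF ?exprn_gt0// => h2.
      by have := uM y Oy (Dz y yx); rewrite ler_norml => /andP[_ h3]; lra.
    have yzr : enorm (y - z) < r by exact: (Dz y yx).
    move=> e e0; have [d d0 hd] := bu y cOy nOy yzr e e0.
    exists d => // w [Ow wx] /(hd w Ow); rewrite ler_norml => /andP[_ h].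
    have : 0 <= b w by apply: le_trans (bge w Ow (ltW wx)); rewrite mulr_ge0// sqr_ge0.
    lra.
  - by split => //; exact: eB_center.
rewrite bE subrr enorm0 expr0n/= add0r mulN1r => h.
have sx := strip x Ox (Dz x ltac:(rewrite subrr enorm0; exact: ltW)).
have : Q * (N * ((dotp nu (x - z) + tau) * (8 * rho - (dotp nu (x - z) + tau)))) <=
    64 * N * M / r * (dotp nu (x - z) + tau).
  have -> : 64 * N * M / r * (dotp nu (x - z) + tau) = Q * (N * ((dotp nu (x - z) + tau) * (8 * rho))).
    by rewrite /Q rE; field; rewrite gt_eqF.
  rewrite ler_wpM2l// ler_wpM2l// ler_wpM2l//; lra.
lra.
Qed.

Lemma strip_bound O z nu r u (M eta tau : R) : 0 < r -> open O -> enorm nu = 1 ->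
  harm (O `&` eB z r) u -> (forall x, O x -> eB z r x -> `|u x| <= M) ->
  0 <= tau <= r / 8 -> (forall x, O x -> eB z r x -> - tau <= dotp nu (x - z)) ->
  bsmall O z r u eta -> 0 <= eta ->
  forall x, O x -> enorm (x - z) <= 3 / 4 * r ->
    `|u x| <= eta + 64 * N * M / r * (dotp nu (x - z) + tau).
Proof.
move=> r0 oO nu1 hu uM taur strip bu eta0 x Ox xz.
rewrite ler_norml; apply/andP; split; last exact: (strip_bound_le r0 oO nu1 hu).
rewrite lerNl; apply: (strip_bound_le r0 oO nu1 (harmN hu)) => //; last exact: bsmallN.
by move=> y Oy yz; rewrite normrN; exact: uM.
Qed.

Lemma blim_refl (A B : set V) f nu z l : enorm nu = 1 -> (forall y, A y -> B (refl nu y)) ->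
  blim B f (refl nu z) l -> blim A (fun x => f (refl nu x)) z l.
Proof.
move=> nu1 AB h e /h[d d0 hd]; exists d => // y Ay yz; apply: hd; first exact: AB.
by rewrite -reflB enorm_refl.
Qed.

Lemma harm_ball_odd nu (r : R) h : 0 < r -> enorm nu = 1 -> harm (eB 0 r) h ->
  (forall z, cball 0 r z -> blim (cball 0 r) h z (h z)) ->
  (forall x, sphere 0 r x -> h (refl nu x) = - h x) ->
  forall x, cball 0 r x -> h (refl nu x) = - h x.
Proof.
move=> r0 nu1 hh bh ho x xB; apply/eqP; rewrite -subr_eq0 opprK -normr_le0.
have cr y : cball 0 r y -> cball 0 r (refl nu y) by rewrite /cball/= !subr0 enorm_refl.
apply: (@harm_norm_ball _ _ 0 r (fun x => h (refl nu x) + h x) 0 r0 _ _ _ x xB).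
- apply: harmD => //; apply: harm_sub (harm_refl nu1 (@eB_open _ _ 0 r) hh) => y.
  by rewrite /eB/= !subr0 enorm_refl.
- move=> z zr; apply: blimD; last exact/bh/sphere_cball.
  by apply: (blim_refl nu1 cr); apply/bh/cr/sphere_cball.
- by move=> z zr; rewrite ho// addNr normr0.
Qed.

Lemma half_ball nu (r : R) (D := eB 0 r `&` [set x | 0 < dotp nu x]) :
  [/\ open D, ebounded D, D `<=` cball 0 r &
   forall y, closure D y -> cball 0 r y /\ 0 <= dotp nu y].
Proof.
split; last 2 first.
- by move=> y [/eB_cball].
- move=> y cy; split; first by apply: closure_eB; apply: closure_subset cy => w [].
  rewrite leNgt; apply/negP => yn; have [|d d0 hd] := @cont_dotp R n nu y (- dotp nu y); first lra.
  have /closure_enormP/(_ d d0)[w [_ /= wn] /hd] := cy.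
  by rewrite ltr_norml => /andP[]; lra.
- apply: openI; first exact: eB_open.
  apply/openP_enorm => y /= yn; have [d d0 hd] := @cont_dotp R n nu y _ yn.
  by exists d => // w /hd; rewrite ltr_norml => /andP[]; lra.
- by have [B hB] := @eB_bounded R n 0 r; exists B => y [/hB].
Qed.

(** Oddness makes the solution vanish on the hyperplane; comparison with [L nu.x] on the half-ball
    then carries the linear bound inside. *)
Lemma odd_ball_solve nu (r L : R) g : 0 < r -> 0 <= L -> enorm nu = 1 ->
  (forall x, sphere 0 r x -> blim (sphere 0 r) g x (g x)) ->
  (forall x, g (refl nu x) = - g x) ->
  (forall x, sphere 0 r x -> 0 <= dotp nu x -> `|g x| <= L * dotp nu x) ->
  exists h : V -> R, [/\ harm (eB 0 r) h, forall x, sphere 0 r x -> h x = g x,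
    forall z, cball 0 r z -> blim (cball 0 r) h z (h z),
    forall x, cball 0 r x -> 0 <= dotp nu x -> `|h x| <= L * dotp nu x &
    (forall x, cball 0 r x -> h (refl nu x) = - h x)].
Proof.
move=> r0 L0 nu1 cg godd gL.
have [h [hh hg bh]] := ball_solve n2 r0 cg.
have hodd := harm_ball_odd r0 nu1 hh bh.
have {}hodd x : cball 0 r x -> h (refl nu x) = - h x.
  by apply: hodd => z zr; rewrite !hg ?godd//; move: zr; rewrite /sphere/= !subr0 enorm_refl.
exists h; split => // x xB xn.
have h0 y : cball 0 r y -> dotp nu y = 0 -> h y = 0.
  move=> yB yn; have := hodd y yB; rewrite /refl yn mulr0 scale0r subr0 => e.
  by lra.
have bd y : cball 0 r y -> blim (cball 0 r) (fun x => L * dotp nu x) y (L * dotp nu y).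
  by move=> _; apply: cont_blim; apply: contZ; exact: cont_dotp.
pose D := eB 0 r `&` [set x | 0 < dotp nu x].
have [oD bD DB clD] : [/\ open D, ebounded D, _ & _] := half_ball nu r.
have key k : `|k| = 1 -> forall x, D x -> k * h x + -1 * (L * dotp nu x) <= 0.
  move=> k1; apply: (@max_blim _ _ D (fun x => k * h x + -1 * (L * dotp nu x)) (fun=> 0)) => //.
    apply: harm_lapl; apply: harmD; first by apply: harmZ; apply: harm_sub hh => y [].
    by do 2 apply: harmZ; exact: harm_dotp.
  move=> y cy ny; have [yB yn] := clD y cy; split.
    apply: blim_sub DB _; apply: blimD; apply: blimZ; [exact: bh|exact: bd].
  rewrite mulN1r subr_le0; apply: le_trans (ler_norm _) _; rewrite normrM k1 mul1r.
  have [y0|y0] := eqVneq (dotp nu y) 0; first by rewrite h0// normr0 y0 mulr0.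
  have ys : sphere 0 r y.
    apply/eqP; rewrite eq_le yB/= leNgt; apply/negP => yr; apply: ny; split => //=.
    by rewrite lt_def y0.
  by rewrite hg//; exact: gL.
have [xn0|xn0] := eqVneq (dotp nu x) 0; first by rewrite h0// normr0 xn0 mulr0.
have [xr|xr] := eqVneq (enorm (x - 0)) r; first by rewrite hg//; exact: gL.
have Dx : D x by split; rewrite /eB/= lt_def ?xn0// eq_sym xr.
rewrite ler_norml; have := key 1 (normr1 _) x Dx; have := key (-1) (normrN1 _) x Dx.
by move=> h1 h2; apply/andP; split; lra.
Qed.

Lemma A0_ge2N : 2 * N <= AA.
Proof. by rewrite /A0 ler_peMr//; have := @expR_ge1Dx R 1; lra. Qed.

(** [h] vanishes on the hyperplane, so its gradient at 0 is parallel to [nu] and the linear Taylor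
    term is a multiple of [nu.x]. The linear bound yields [|h| <= L r], which controls the quadratic
    remainder. *)
Lemma odd_linear nu (r L : R) h : 0 < r -> enorm nu = 1 ->
  harm (eB 0 r) h -> 0 <= L ->
  (forall x, eB 0 r x -> 0 <= dotp nu x -> `|h x| <= L * dotp nu x) ->
  (forall x, eB 0 r x -> h (refl nu x) = - h x) ->
  exists2 a : R, `|a| <= 2 * N * L & forall x, enorm x <= r / 2 ->
    `|h x - a * dotp nu x| <= 4 * AA ^+ 2 * L / r * enorm x ^+ 2.
Proof.
move=> r0 nu1 hh L0 hL hodd.
have hM x : eB 0 r x -> `|h x| <= L * r.
  move=> xB; have xr : enorm x < r by move: xB; rewrite /eB/= subr0.
  have cs : `|dotp nu x| <= r.
    by apply: le_trans (cauchy_schwarz _ _) _; rewrite nu1 mul1r ltW.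
  have [xn|xn] := leP 0 (dotp nu x).
    by apply: le_trans (hL x xB xn) _; rewrite ler_wpM2l//; exact: le_trans (ler_norm _) cs.
  have rB : eB 0 r (refl nu x) by move: xB; rewrite /eB/= !subr0 enorm_refl.
  rewrite -normrN -hodd//; apply: le_trans (hL _ rB _) _; rewrite dotp_refl//; first lra.
  by rewrite ler_wpM2l//; apply: le_trans (ler_norm _) _; rewrite normrN.
have B0 : eB 0 r (0 : V) by exact: eB_center.
have tang w : dotp nu w = 0 -> Dv w h 0 = 0.
  move=> w0; apply/esym; apply: (Dv_eq (@eB_open _ _ 0 r) hh B0).
  apply/is_deriveP => e e0; exists (r / (enorm w + 1)).
    by rewrite divr_gt0// ltr_wpDl ?enorm_ge0.
  move=> t tr; have z0 q : dotp nu q = 0 -> eB 0 r q -> h q = 0.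
    by move=> q0 qB; apply/eqP; rewrite -normr_le0; apply: le_trans (hL q qB _) _; rewrite q0 ?mulr0.
  have tB : eB 0 r (0 + t *: w).
    rewrite /eB/= subr0 add0r enormZ; apply: le_lt_trans (_ : `|t| * (enorm w + 1) < r).
      by rewrite ler_wpM2l// lerDl.
    by rewrite -ltr_pdivlMr// ltr_wpDl ?enorm_ge0.
  have e1 : h (0 + t *: w) = 0 by apply: z0 => //; rewrite add0r dotpZr w0 mulr0.
  have e2 : h 0 = 0 by apply: z0 => //; rewrite dotp0r.
  by rewrite e1 e2 mulr0 !subr0 normr0 mulr_ge0// ltW.
have DvE x : Dv x h 0 = Dv nu h 0 * dotp nu x.
  have h1 : Dv (x - dotp nu x *: nu) h 0 = 0.
    by apply: tang; rewrite dotpBr dotpZr -enorm_sqr nu1 expr1n mulr1 subrr.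
  pose G : V := \row_i (partial i h 0 : R).
  have DG w : Dv w h 0 = dotp w G by apply: sumR_eq => i; rewrite mxE.
  move: h1; rewrite !DG dotpBl dotpZl => /eqP; rewrite subr_eq0 => /eqP ->; exact: mulrC.
exists (Dv nu h 0).
  have := Dv_est nu r0 hh hM; rewrite nu1 mulr1 => /le_trans; apply.
  by apply: le_of_eq; field; rewrite gt_eqF.
move=> x xr; have := @taylor _ _ x h 0 r (L * r) 2 r0 hh hM xr.
rewrite !big_ord_recl big_ord0 /tc /= !divr1 addr0 add0r.
have -> : h 0 = 0.
  apply/eqP; rewrite -normr_le0; apply: le_trans (hL 0 B0 _) _; rewrite dotp0r ?mulr0//.
rewrite add0r DvE => /le_trans; apply.
by apply: le_of_eq; field; rewrite gt_eqF.
Qed.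

(** Soft thresholding: values of size at most [eta] become 0, the others move by [eta] towards 0,
    and continuity is kept. *)
Definition soft (eta t : R) : R := Num.max (t - eta) 0 - Num.max (- t - eta) 0.

Lemma soft_lip (eta t s : R) : 0 <= eta -> `|soft eta t - soft eta s| <= `|t - s|.
Proof.
move=> e0; rewrite /soft.
case: (leP (t - eta) 0); case: (leP (- t - eta) 0); case: (leP (s - eta) 0); case: (leP (- s - eta) 0);
  move=> *; rewrite ler_norml; have := ler_norm (t - s); have := ler_norm (- (t - s)); rewrite normrN => *;
  apply/andP; split; lra.
Qed.

Lemma soft_sub (eta t : R) : 0 <= eta -> `|soft eta t - t| <= eta.
Proof.
move=> e0; rewrite /soft.
case: (leP (t - eta) 0); case: (leP (- t - eta) 0) => *; rewrite ler_norml; apply/andP; split; lra.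
Qed.

Lemma soft_le (eta t b : R) : 0 <= eta -> 0 <= b -> `|t| <= eta + b -> `|soft eta t| <= b.
Proof.
move=> e0 b0; rewrite /soft !ler_norml => /andP[h1 h2].
case: (leP (t - eta) 0); case: (leP (- t - eta) 0) => *; apply/andP; split; lra.
Qed.

Definition C2 : R := 384 * N * AA ^+ 2.

Lemma C2_ge1 : 1 <= C2.
Proof.
have := A0_ge2N; have N1 : 1 <= N by rewrite ler1n.
rewrite /C2 => h; have : 1 <= AA ^+ 2 by rewrite exprn_ege1//; lra.
nra.
Qed.

Lemma A0_sq : N <= AA ^+ 2.
Proof.
have A2N : 2 * N <= AA := @A0_ge2N; have N1 : 1 <= N by rewrite ler1n.
by apply: (@le_trans _ _ (N * AA)); rewrite ?expr2 ?ler_peMr ?ler_wpM2r//; lra.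
Qed.

(** Near [z] the domain is compared with the half-ball cut off by the tangent plane. The values of
    [u] on the spherical part, thresholded and extended oddly, have a harmonic extension [h] with a
    linear term at the centre; the maximum principle bounds [u - h]. *)
Lemma one_step O z nu r u (M eta tau : R) : 0 < r -> open O -> enorm nu = 1 ->
  harm (O `&` eB z r) u -> (forall x, O x -> eB z r x -> `|u x| <= M) -> 0 <= M ->
  0 < tau <= r / 8 -> (forall x, enorm (x - z) < r -> (tau < dotp nu (x - z) -> O x) /\
     (dotp nu (x - z) < - tau -> ~ closure O x)) ->
  bsmall O z r u eta -> 0 <= eta ->
  exists2 a : R, `|a| <= C2 * M / r & forall q : R, 0 < q <= 4^-1 ->
    forall x, O x -> enorm (x - z) <= q * r ->
    `|u x - a * dotp nu (x - z)| <= eta + C2 * M * (tau / r + q ^+ 2).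
Proof.
move=> r0 oO nu1 hu uM M0 /andP[tau0 taur] flat bu eta0.
have strip x : O x -> eB z r x -> - tau <= dotp nu (x - z).
  move=> Ox xr; rewrite leNgt; apply/negP => h; have [_ /(_ h)] := flat x xr.
  by apply; exact: subset_closure.
pose L : R := 64 * N * M / r.
have L0 : 0 <= L by rewrite divr_ge0 ?(ltW r0)// !mulr_ge0.
have taur' : 0 <= tau <= r / 8 by rewrite ltW.
have sb : forall x, O x -> enorm (x - z) <= 3 / 4 * r -> `|u x| <= eta + L * (dotp nu (x - z) + tau).
  exact: strip_bound bu eta0.
(* With this threshold the strip bound makes the datum vanish for [nu.x <= 2 tau]; since the sphere
   is inside [O] where [nu.x > tau], the datum is continuous although [u] is not defined on the
   whole half-sphere. *)
pose e1 : R := eta + 3 * L * tau; have e10 : 0 <= e1 by rewrite /e1 addr_ge0// mulr_ge0 ?(ltW tau0)// mulr_ge0.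
pose r' : R := 3 / 4 * r; have r'0 : 0 < r' by rewrite /r'; lra.
have ts x : - (dotp nu x) = dotp nu (refl nu x) by rewrite dotp_refl.
pose gp x : R := if `[< 0 < dotp nu x /\ O (z + x) >] then soft e1 (u (z + x)) else 0.
have zx x : z + x - z = x by rewrite addrC addKr.
have gpP x : 0 < dotp nu x -> O (z + x) -> gp x = soft e1 (u (z + x)).
  by move=> h1 h2; rewrite /gp asboolT.
have gpN x : dotp nu x <= 0 -> gp x = 0.
  by move=> h; rewrite /gp asboolF// => -[]; rewrite ltNge h.
have gpL x : enorm x = r' -> `|gp x| <= Num.max (L * (dotp nu x - 2 * tau)) 0.
  move=> xr; rewrite /gp; case: asboolP => [[h1 h2]|_]; last by rewrite normr0 le_max lexx orbT.
  apply: soft_le => //; first by rewrite le_max lexx orbT.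
  apply: le_trans (sb _ h2 _) _; rewrite zx ?xr//.
  have : L * (dotp nu x - 2 * tau) <= Num.max (L * (dotp nu x - 2 * tau)) 0 by rewrite le_max lexx.
  by rewrite /e1; lra.
have gp0 x : enorm x = r' -> dotp nu x <= 2 * tau -> gp x = 0.
  move=> xr h; apply/eqP; rewrite -normr_le0; apply: le_trans (gpL x xr) _.
  by rewrite ge_max lexx andbT mulr_ge0_le0//; lra.
have cgp x : sphere 0 r' x -> blim (sphere 0 r') gp x (gp x).
  rewrite /sphere/= subr0 => xr e e0.
  have [xt|xt] := ltP (dotp nu x) (2 * tau).
    have [|d d0 hd] := @cont_dotp R n nu x (2 * tau - dotp nu x); first lra.
    exists d => // y /=; rewrite subr0 => yr /hd; rewrite ltr_norml => /andP[_ h].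
    by rewrite !gp0 ?subr0 ?normr0//; lra.
  have [d d0 hd] := @cont_dotp R n nu x tau tau0.
  have Ox : O (z + x) by apply: (flat _ _).1; rewrite zx ?xr /r'; lra_on r0 tau0 xt taur.
  have ux : cont_at u (z + x) by apply: harm_cont hu _; split => //; rewrite /eB/= zx xr /r'; lra_on r0.
  have [d' d'0 hd'] := ux e e0.
  exists (Num.min d d'); first by rewrite lt_min d0.
  move=> y /=; rewrite subr0 lt_min => yr /andP[/hd + yd'].
  rewrite ltr_norml => /andP[h _].
  have Oy : O (z + y) by apply: (flat _ _).1; rewrite zx ?yr /r'; lra_on r0 tau0 xt taur h.
  rewrite !gpP//; [|lra_on tau0 xt|lra_on tau0 xt h].
  apply: le_lt_trans (soft_lip _ _ e10) _; apply: hd'.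
  by rewrite opprD addrACA subrr add0r.
pose g x : R := gp x - gp (refl nu x).
have sr x : sphere 0 r' x -> sphere 0 r' (refl nu x) by rewrite /sphere/= !subr0 enorm_refl.
have cg x : sphere 0 r' x -> blim (sphere 0 r') g x (g x).
  by move=> xr; apply: blimB; [exact: cgp|apply: (blim_refl nu1 sr); apply/cgp/sr].
have godd x : g (refl nu x) = - g x by rewrite /g reflK// opprB.
have gpos x : 0 <= dotp nu x -> g x = gp x.
  by move=> h; rewrite /g (gpN (refl nu x)) ?subr0// -ts oppr_le0.
have gL x : sphere 0 r' x -> 0 <= dotp nu x -> `|g x| <= L * dotp nu x.
  rewrite /sphere/= subr0 => xr xn; rewrite gpos//; apply: le_trans (gpL x xr) _.
  by rewrite ge_max mulr_ge0// andbT ler_wpM2l//; lra.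
have [h [hh hg bh hL hodd]] := odd_ball_solve r'0 L0 nu1 cg godd gL.
have [||a aL ha] := odd_linear r'0 nu1 hh L0.
- by move=> x /eB_cball; exact: hL.
- by move=> x /eB_cball; exact: hodd.
have N1 : 1 <= N by rewrite ler1n.
have A2N := @A0_ge2N.
have NA := A0_sq.
exists a.
  apply: le_trans aL _; rewrite /L /C2.
  have -> : 2 * N * (64 * N * M / r) = 128 * N * N * (M / r) by ring.
  have -> : 384 * N * AA ^+ 2 * M / r = 384 * N * AA ^+ 2 * (M / r) by ring.
  rewrite ler_wpM2r ?divr_ge0 ?(ltW r0)//; nra.
move=> q /andP[q0 q4] x Ox xq.
pose C : R := C2 * M * (tau / r + q ^+ 2).
have LE : M / r = L / (64 * N) by rewrite /L; field; rewrite ?nat1r ?pnatr_eq0 ?(gt_eqF r0).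
have CE : C = 6 * AA ^+ 2 * L * tau + 6 * AA ^+ 2 * L * (r * q ^+ 2).
  rewrite /C /C2 mulrDr.
  have -> : 384 * N * AA ^+ 2 * M * (tau / r) = 384 * N * AA ^+ 2 * (M / r) * tau by ring.
  have -> : 384 * N * AA ^+ 2 * M * q ^+ 2 = 384 * N * AA ^+ 2 * (M / r) * (r * q ^+ 2).
    by field; rewrite gt_eqF.
  by rewrite LE; field; rewrite ?nat1r ?pnatr_eq0 ?(gt_eqF r0).
have Lt0 : 0 <= L * tau by rewrite mulr_ge0// ltW.
have Lq0 : 0 <= L * (r * q ^+ 2) by rewrite mulr_ge0// mulr_ge0 ?sqr_ge0 ?(ltW r0).
have ANt : 6 * N * (L * tau) <= 6 * AA ^+ 2 * (L * tau) by rewrite ler_wpM2r// ler_pM2l.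
have xr' : enorm (x - z) <= 3 / 8 * r.
  by apply: le_trans xq _; rewrite ler_wpM2r ?(ltW r0)//; lra_on q4.
(* Points of [O] below the tangent plane have height at least [- tau], and the strip bound settles
   them without [h]. *)
rewrite -/C; have [xt|xt] := leP (dotp nu (x - z)) 0.
  have xzr : eB z r x by rewrite /eB/=; lra_on xr' r0.
  have xs := strip x Ox xzr.
  have h1 : `|u x| <= eta + L * tau.
    apply: le_trans (sb x Ox _) _; first by lra_on xr' r0.
    by rewrite lerD2l ler_wpM2l//; lra_on xt.
  have h2 : `|a * dotp nu (x - z)| <= 2 * N * L * tau.
    by rewrite normrM; apply: ler_pM => //; rewrite ler0_norm//; lra_on xs.
  apply: le_trans (ler_normB _ _) _.
  have LN : L * tau <= N * (L * tau) by rewrite ler_peMl.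
  have q6 : 0 <= AA ^+ 2 * (L * (r * q ^+ 2)) by rewrite mulr_ge0 ?sqr_ge0.
  by rewrite CE; lra_on h1 h2 ANt q6 LN Lt0.
pose D := O `&` eB z r' `&` [set x | 0 < dotp nu (x - z)].
have ot : open [set x | 0 < dotp nu (x - z)].
  apply/openP_enorm => y /= yn; have [d d0 hd] := @cont_dotp R n nu (y - z) _ yn.
  exists d => // w wy; have := hd (w - z); rewrite opprB addrA subrK => /(_ wy).
  by rewrite ltr_norml => /andP[h1 _]; lra_on yn h1.
have rr' : r' < r by rewrite /r'; lra_on r0.
have cB y : enorm (y - z) <= r' -> cball 0 r' (y - z) by rewrite /cball/= subr0.
have key : `|u x - h (x - z)| <= e1.
  clear CE C ANt Lq0 LE NA A2N N1 aL ha.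
  apply: (@harm_abs_max D (fun x => u x - h (x - z)) e1).
  - by do 2 apply: openI => //; exact: eB_open.
  - by have [B hB] := @eB_bounded R n z r'; exists B => y [[_ /hB]].
  - apply: harmB.
      by apply: harm_sub hu => y [[Oy yz] _]; split => //; move: yz; rewrite /eB/=; lra_on rr'.
    have e (y : V) : y - z = - z + 1 *: y by rewrite scale1r addrC.
    under [X in harm _ X]eq_fun do rewrite e.
    apply: harm_sub (harm_aff 1 (- z) hh) => y [[_ yz] _] /=.
    by rewrite -e /eB/= subr0.
  - move=> y cy ny.
    have yz : enorm (y - z) <= r' by apply: (@closureI_eB _ _ O); apply: closure_subset cy => w [].
    have cOy : closure O y by apply: closure_subset cy => w [[]].
    have yt : 0 <= dotp nu (y - z).
      rewrite leNgt; apply/negP => yn; have [|d d0 hd] := @cont_dotp R n nu (y - z) (- dotp nu (y - z)); first by lra_on yn.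
      have /closure_enormP/(_ d d0)[w [_ /= wn] wy] := cy.
      have := hd (w - z); rewrite opprB addrA subrK => /(_ wy).
      by rewrite ltr_norml => /andP[_ h1]; lra_on wn h1.
    move=> e e0; have [d d0 hd] := bh _ (cB y yz) (e / 2) (divr_gt0 e0 (ltr0Sn _ 1)).
    have hd2 w : D w -> enorm (w - y) < d -> `|h (w - z) - h (y - z)| < e / 2.
      move=> [[Ow wz] _] wy; apply: hd; first by apply: cB; exact: ltW.
      by rewrite opprB addrA subrK.
    have [Oy|nOy] := pselect (O y).
      have uy : cont_at u y by apply: harm_cont hu _; split => //; exact: le_lt_trans yz rr'.
      have [d' d'0 hd'] := uy (e / 2) (divr_gt0 e0 (ltr0Sn _ 1)).
      have val : `|u y - h (y - z)| <= e1.
        have [yr|yr] := eqVneq (enorm (y - z)) r'.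
          rewrite hg; last by rewrite /sphere/= subr0.
          rewrite gpos//; have [y0|y0] := eqVneq (dotp nu (y - z)) 0.
            rewrite gpN ?y0// subr0; apply: le_trans (sb y Oy yz) _.
            by rewrite y0 /e1; lra_on Lt0.
          have zy : z + (y - z) = y by rewrite addrC subrK.
          rewrite (gpP (y - z)) ?zy ?lt_def ?y0 ?yt// distrC; exact: soft_sub.
        have y0 : dotp nu (y - z) = 0.
          apply/eqP; rewrite eq_le yt andbT leNgt; apply/negP => yp; apply: ny; split => //.
          by split => //; rewrite /eB/= lt_neqAle yr.
        have -> : h (y - z) = 0.
          by apply/eqP; rewrite -normr_le0; apply: le_trans (hL _ (cB y yz) _) _; rewrite y0 ?mulr0.
        rewrite subr0; apply: le_trans (sb y Oy yz) _.
        by rewrite y0 /e1; lra_on Lt0.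
      exists (Num.min d d'); first by rewrite lt_min d0.
      move=> w Dw; rewrite lt_min => /andP[/(hd2 w Dw) + /hd'].
      move: val; rewrite !ltr_norml !ler_norml => /andP[a1 a2] /andP[b1 b2] /andP[c1 c2].
      by apply/andP; split; lra_on a1 a2 b1 b2 c1 c2 Lt0 e0.
    have yt2 : dotp nu (y - z) <= tau.
      by rewrite leNgt; apply/negP => /(flat y (le_lt_trans yz rr')).1.
    have hy : `|h (y - z)| <= L * tau.
      by apply: le_trans (hL _ (cB y yz) yt) _; rewrite ler_wpM2l.
    have [d' d'0 hd'] := bu y cOy nOy (le_lt_trans yz rr') (e / 2) (divr_gt0 e0 (ltr0Sn _ 1)).
    exists (Num.min d d'); first by rewrite lt_min d0.
    move=> w Dw; rewrite lt_min => /andP[/(hd2 w Dw) + /(hd' w Dw.1.1)].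
    move: hy; rewrite /e1 ltr_norml !ler_norml => /andP[a1 a2] /andP[b1 b2] /andP[c1 c2].
    by apply/andP; split; lra_on a1 a2 b1 b2 c1 c2 Lt0 e0.
  - by split => //; split => //; rewrite /eB/= /r'; lra_on xr' r0.
have h3 : `|h (x - z) - a * dotp nu (x - z)| <= 6 * AA ^+ 2 * L * (r * q ^+ 2).
  apply: le_trans (ha (x - z) _) _; first by rewrite /r'; lra_on xr' r0.
  have -> : 6 * AA ^+ 2 * L * (r * q ^+ 2) = (4 * AA ^+ 2 * L / r') * (9 / 8 * (q * r) ^+ 2).
    by rewrite /r'; field; rewrite gt_eqF.
  rewrite ler_wpM2l//.
    by apply: divr_ge0 (ltW r'0); do 2 apply: mulr_ge0 => //; exact: sqr_ge0.
  have : enorm (x - z) ^+ 2 <= (q * r) ^+ 2.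
    by rewrite lerXn2r ?nnegrE ?enorm_ge0// mulr_ge0 ?(ltW q0) ?(ltW r0).
  by have p := sqr_ge0 (q * r) => h0; lra_on p h0.
have -> : u x - a * dotp nu (x - z) = (u x - h (x - z)) + (h (x - z) - a * dotp nu (x - z)) by ring.
apply: le_trans (ler_normD _ _) _.
have LN : L * tau <= N * (L * tau) by rewrite ler_peMl.
by rewrite CE; move: key; rewrite /e1 => key; lra_on key h3 LN ANt Lt0.
Qed.

Lemma one_step_ex : exists C : R, 1 <= C /\ forall O z nu r u (M eta tau : R),
  0 < r -> open O -> enorm nu = 1 ->
  harm (O `&` eB z r) u -> (forall x, O x -> eB z r x -> `|u x| <= M) -> 0 <= M ->
  0 < tau <= r / 8 -> (forall x, enorm (x - z) < r -> (tau < dotp nu (x - z) -> O x) /\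
     (dotp nu (x - z) < - tau -> ~ closure O x)) ->
  bsmall O z r u eta -> 0 <= eta ->
  exists2 a : R, `|a| <= C * M / r & forall q : R, 0 < q <= 4^-1 ->
    forall x, O x -> enorm (x - z) <= q * r ->
    `|u x - a * dotp nu (x - z)| <= eta + C * M * (tau / r + q ^+ 2).
Proof. by exists (@C2); split; [exact: C2_ge1|exact: one_step]. Qed.

Lemma powRX (q al : R) (k : nat) : 0 <= q -> (q ^+ k) `^ al = (q `^ al) ^+ k.
Proof.
by move=> q0; rewrite -powR_mulrn// -powRrM mulrC powRrM powR_mulrn ?powR_ge0.
Qed.

Lemma geom_between (q r s : R) : 0 < q -> q <= 4^-1 -> 0 < s -> s < r ->
  exists k : nat, q ^+ k.+1 * r <= s < q ^+ k * r.
Proof.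
move=> q0 q4 s0 sr; have r0 : 0 < r by lra.
have qk (k : nat) : q ^+ k <= @ik R k.
  elim: k => [|k IH]; first by rewrite expr0 /ik invr1.
  rewrite exprS; apply: (@le_trans _ _ (4^-1 * @ik R k)).
    by apply: ler_pM => //; [exact: ltW|exact: exprn_ge0 (ltW q0)].
  rewrite /ik -invfM lef_pV2 ?posrE// -natrM ler_nat; lia.
have [K hK] : exists k, q ^+ k * r <= s.
  have [k kk] := @ik_small R (s / r) (divr_gt0 s0 r0); exists k.
  by rewrite -ler_pdivlMr//; apply: le_trans (qk k) (ltW kk).
pose P k := q ^+ k * r <= s.
have exP : exists k, P k by exists K.
case: (ex_minnP exP) => -[|k] Pk kmin.
  by move: Pk; rewrite /P expr0 mul1r leNgt sr.
exists k; apply/andP; split; [exact: Pk|rewrite ltNge]; apply/negP => h.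
by have := kmin k h; rewrite ltnn.
Qed.

Lemma bsmall_lin O z r nu u (tau a : R) : 0 <= tau ->
  (\bd y of O, enorm (y - z) < r -> `|dotp nu (y - z)| <= tau) ->
  bsmall O z r u 0 -> bsmall O z r (fun x => u x - a * dotp nu (x - z)) (`|a| * tau).
Proof.
move=> t0 flat bu y cy ny yz e e0; have [d d0 hd] := bu y cy ny yz (e / 2) ltac:(lra).
have [d' d'0 hd'] := contZ a (@cont_dotp R n nu (y - z)) (ltac:(lra) : 0 < e / 2).
exists (Num.min d d'); first by rewrite lt_min d0.
move=> x Ox; rewrite lt_min => /andP[/(hd x Ox) + xd'].
have := hd' (x - z); rewrite opprB addrA subrK => /(_ xd').
have : `|a * dotp nu (y - z)| <= `|a| * tau.
  by rewrite normrM ler_wpM2l//; exact: flat.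
rewrite ltr_norml !ler_norml => /andP[? ?] /andP[? ?] /andP[? ?].
by apply/andP; split; lra.
Qed.

(** [one_step] is iterated on balls of radius [q^k r0], after subtracting the linear part found so
    far. The remainder shrinks by [th = q^(1 + al)] at each step, so the increments of the slope
    decrease geometrically with ratio [p = q^al]. *)
Lemma bdry_expansion (al kap : R) : 0 < al -> al < 1 -> 0 < kap ->
  exists2 rm : R, 0 < rm & forall r0 : R, 0 < r0 <= rm ->
  exists2 C : R, 0 <= C & forall O z nu u (M : R), open O -> ~ O z -> flat_at al O z nu kap r0 ->
    harm (O `&` eB z r0) u -> (forall x, O x -> eB z r0 x -> `|u x| <= M) -> 0 <= M ->
    bsmall O z r0 u 0 ->
    exists2 a : R, `|a| <= C * M & forall x, O x -> enorm (x - z) < r0 ->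
      `|u x - a * dotp nu (x - z)| <= C * M * enorm (x - z) `^ (1 + al).
Proof.
move=> al0 al1 kap0; have [C2 [C1 os]] := one_step_ex.
have C0 : 0 < C2 by lra.
(* Chosen so that [C2 q^2 <= th / 4]: this is possible because [q^2] is smaller than [q^(1 + al)] by
   the factor [q^(1 - al)]. *)
pose q : R := Num.min 4^-1 ((4 * C2)^-1 `^ (1 - al)^-1).
have c40 : 0 < (4 * C2)^-1 by rewrite invr_gt0; lra.
have q0 : 0 < q by rewrite lt_min invr_gt0 powR_gt0//= andbT; lra.
have q4 : q <= 4^-1 by rewrite ge_min lexx.
have qal : C2 * q `^ (1 - al) <= 4^-1.
  have h : q `^ (1 - al) <= (4 * C2)^-1.
    rewrite [leRHS](_ : _ = ((4 * C2)^-1 `^ (1 - al)^-1) `^ (1 - al)); last first.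
      by rewrite -powRrM mulVf ?powRr1 ?gt_eqF// ?(ltW c40)//; lra.
    by apply: powR_mono; [lra|exact: ltW|rewrite ge_min lexx orbT].
  apply: le_trans (_ : C2 * (4 * C2)^-1 <= _); first by rewrite ler_wpM2l//; lra.
  by rewrite invfM mulrCA mulfV ?mulr1// gt_eqF//; lra.
pose p : R := q `^ al; have p0 : 0 < p by rewrite powR_gt0.
have p1 : p < 1.
  have <- : 1 `^ al = 1 :> R by rewrite powR1.
  by rewrite gt0_ltr_powR ?nnegrE ?ltW//; lra.
pose th : R := q * p; have th0 : 0 < th by rewrite mulr_gt0.
have thE : th = q `^ (1 + al) by rewrite powR1D// ltW.
have q2 : C2 * q ^+ 2 <= th / 4.
  have -> : q ^+ 2 = th * q `^ (1 - al).
    rewrite thE -powRD; last by apply/implyP => _; rewrite gt_eqF.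
    by rewrite -powR_mulrn ?(ltW q0)//; congr powR; ring.
  by rewrite mulrCA; nra.
(* [m] will bound the relative flatness [w = kap r0^al]. It keeps both errors caused by the curved
   boundary, that of [one_step] and that of the subtracted linear part, below a quarter of the new
   size. *)
clear qal c40; clearbody q; pose m : R := th * (1 - p) / (4 * C2).
have m0 : 0 < m by rewrite divr_gt0 ?mulr_gt0 ?subr_gt0.
exists ((m / kap) `^ al^-1); first by rewrite powR_gt0// divr_gt0.
move=> r0 /andP[r00 r0m].
pose w : R := kap * r0 `^ al.
have w0 : 0 < w by rewrite mulr_gt0// powR_gt0.
have wm : w <= m.
  rewrite /w -ler_pdivlMl// mulrC.
  have -> : m / kap = ((m / kap) `^ al^-1) `^ al.
    by rewrite -powRrM mulVf ?powRr1 ?gt_eqF// divr_ge0 ?ltW.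
  by apply: powR_mono => //; exact: ltW.
have Cw : C2 * w <= th * (1 - p) / 4.
  apply: le_trans (_ : C2 * m <= _); first by rewrite ler_wpM2l//; lra.
  by rewrite /m invfM; apply: le_of_eq; field; rewrite gt_eqF//; lra.
have th4 : th <= 4^-1 by rewrite /th; nra.
have w8 : w <= 8^-1 by nra.
pose B : R := C2 / (r0 * (1 - p)).
have B0 : 0 <= B by rewrite divr_ge0 ?mulr_ge0 ?subr_ge0 ?ltW.
have BE : B = C2 / (r0 * (1 - p)) by [].
clearbody B.
pose E : R := (th * r0 `^ (1 + al))^-1.
have E0 : 0 < E by rewrite invr_gt0 mulr_gt0// powR_gt0.
exists (B + (1 + B * r0) * E).
  by rewrite addr_ge0// mulr_ge0 ?(ltW E0)// addr_ge0// mulr_ge0 ?(ltW r00).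
move=> O z nu u M oO nz [nu1 flat] hu uM M0 bu.
pose rr (k : nat) : R := q ^+ k * r0.
have rr0 k : 0 < rr k by rewrite mulr_gt0// exprn_gt0.
have rr1 k : rr k <= r0.
  by rewrite /rr ler_piMl ?(ltW r00)// exprn_ile1 ?(ltW q0)//; lra.
have rral k : rr k `^ al = p ^+ k * r0 `^ al.
  by rewrite /rr powRM ?exprn_ge0 ?(ltW q0) ?(ltW r00)// powRX// ltW.
have pk0 k : 0 < p ^+ k by rewrite exprn_gt0.
have pk1 k : p ^+ k <= 1 by rewrite exprn_ile1 ?(ltW p0) ?(ltW p1).
pose tt (k : nat) : R := w * p ^+ k * rr k.
have tt0 k : 0 < tt k by rewrite /tt mulr_gt0// mulr_gt0.
have ttE k : tt k = kap * rr k `^ (1 + al).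
  by rewrite powR1D ?(ltW (rr0 k))// rral /tt /w; ring.
have flatk k x : enorm (x - z) < rr k -> (tt k < dotp nu (x - z) -> O x) /\
     (dotp nu (x - z) < - tt k -> ~ closure O x).
  move=> xr; have [h1 h2] := flat x (lt_le_trans xr (rr1 k)).
  have h : kap * enorm (x - z) `^ (1 + al) <= tt k.
    by rewrite ttE ler_pM2l// powR_mono ?enorm_ge0 ?ltW//; lra_on al0.
  by split => h3; [apply: h1|apply: h2]; [exact: le_lt_trans h3|apply: lt_le_trans h3 _; rewrite lerN2].
pose Inv (k : nat) (a : R) := `|a| <= B * M * (1 - p ^+ k) /\
  forall x, O x -> eB z (rr k) x -> `|u x - a * dotp nu (x - z)| <= M * th ^+ k.
have /choice[st hst] : forall ka : nat * R, exists a' : R, Inv ka.1 ka.2 ->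
    Inv ka.1.+1 a' /\ `|a' - ka.2| <= B * M * (p ^+ ka.1 - p ^+ ka.1.+1).
  move=> [k a] /=; have [[ia iu]|nI] := pselect (Inv k a); last by exists 0.
  have Mk0 : 0 <= M * th ^+ k by rewrite mulr_ge0// exprn_ge0// ltW.
  have [||||b bL hb] := os O z nu (rr k) (fun x => u x - a * dotp nu (x - z)) (M * th ^+ k)
    (`|a| * tt k) (tt k) (rr0 k) oO nu1 _ iu Mk0 _ (flatk k).
  - apply: harmB.
      apply: harm_sub hu => x [Ox xr]; split => //; move: xr; rewrite /eB/= => xr.
      exact: lt_le_trans (rr1 k).
    apply: harmZ; have e (x : V) : dotp nu (x - z) = dotp nu x - dotp nu z by rewrite dotpBr.
    under [X in harm _ X]eq_fun do rewrite e.
    by apply: harmB; [exact: harm_dotp|exact: harm_cst].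
  - rewrite tt0/= /tt [leRHS]mulrC ler_pM2r//.
    by apply: le_trans w8; rewrite ler_piMr ?(ltW w0).
  - apply: bsmall_lin; first exact: ltW.
      move=> y cy ny yz; have [h1 h2] := flatk k y yz.
      rewrite ler_norml; apply/andP; split; rewrite leNgt; apply/negP; first by move=> /h2.
      by move=> /h1.
    by move=> y cy ny yz; apply: bu => //; exact: lt_le_trans (rr1 k).
  - by rewrite mulr_ge0// ltW.
  - exists (a + b) => _.
    have bL2 : `|b| <= B * M * (p ^+ k - p ^+ k.+1).
      apply: le_trans bL _; apply: le_of_eq.
      by rewrite /rr BE /th exprMn exprS; field; rewrite !gt_eqF ?exprn_gt0//; lra_on p1 C0.
    split; last by rewrite addrAC subrr add0r.
    split.
      apply: le_trans (ler_normD _ _) _; lra_on ia bL2.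
    move=> x Ox xr.
    have := hb q ltac:(by rewrite q0) x Ox ltac:(by move: xr; rewrite /eB/= /rr exprS mulrA => /ltW).
    have -> : u x - a * dotp nu (x - z) - b * dotp nu (x - z) = u x - (a + b) * dotp nu (x - z) by ring.
    move/le_trans; apply.
    have h1 : `|a| * tt k <= M * th ^+ k * (th / 4).
      have ia2 : `|a| <= B * M by apply: le_trans ia _; rewrite ler_piMr ?mulr_ge0// lerBlDr lerDl ltW.
      apply: le_trans (ler_wpM2r (ltW (tt0 k)) ia2) _.
      have -> : B * M * tt k = M * th ^+ k * (C2 * w / (1 - p)).
        by rewrite BE /tt /rr /th exprMn; field; rewrite !gt_eqF//; lra_on p1 C0.
      rewrite ler_wpM2l// ler_pdivrMr ?subr_gt0//; lra_on Cw.
    have h2 : tt k / rr k <= w.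
      by rewrite /tt mulfK ?gt_eqF// ler_piMr ?(ltW w0).
    have h3 : C2 * (M * th ^+ k) * (tt k / rr k + q ^+ 2) <= M * th ^+ k * (th / 2).
      rewrite [C2 * _]mulrC -[leLHS]mulrA ler_wpM2l// mulrDr.
      have : C2 * (tt k / rr k) <= C2 * w by rewrite ler_wpM2l// ltW.
      have : C2 * w <= th / 4 by clear -R n n2 Cw th0 p0; nra.
      lra_on q2.
    rewrite [th ^+ k.+1]exprSr [M * (_ * _)]mulrA; apply: le_trans (lerD h1 h3) _.
    by rewrite -mulrDr ler_wpM2l//; lra_on th0.
pose a_ := fix a_ k := if k is k'.+1 then st (k', a_ k') else 0.
have inv k : Inv k (a_ k).
  elim: k => [|k IH]; last by have [] := hst (k, a_ k) IH.
  split; first by rewrite /= normr0 expr0 subrr mulr0.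
  move=> x Ox; rewrite /rr expr0 mul1r => xr; rewrite /= mul0r subr0 expr0 mulr1; exact: uM.
have stp k j : `|a_ (k + j)%N - a_ k| <= B * M * (p ^+ k - p ^+ (k + j)).
  elim: j => [|j IH]; first by rewrite addn0 !subrr normr0 mulr0.
  have [_ /=] := hst ((k + j)%N, a_ (k + j)%N) (inv _).
  rewrite addnS /= => h.
  rewrite -(subrKA (a_ (k + j)%N)); apply: le_trans (ler_normD _ _) _; lra_on IH h.
have [|a ha] := @seq_lim R a_ (fun k => B * M * p ^+ k).
  move=> k l; have BM : 0 <= B * M by rewrite mulr_ge0.
  have [kl|/ltnW lk] := leqP k l.
    have := stp k (l - k)%N; rewrite subnKC// distrC => /le_trans; apply.
    by have := mulr_ge0 BM (ltW (pk0 l)); lra_on BM.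
  have := stp l (k - l)%N; rewrite subnKC// => /le_trans; apply.
  by have := mulr_ge0 BM (ltW (pk0 k)); lra_on BM.
exists a.
  have := ha 0%N; rewrite /= sub0r normrN expr0 mulr1 => /le_trans; apply.
  by rewrite ler_wpM2r// lerDl mulr_ge0 ?(ltW E0)// addr_ge0// mulr_ge0 ?(ltW r00).
move=> x Ox xr; have x0 : 0 < enorm (x - z).
  by rewrite enorm_gt0 subr_eq0; apply: contra_notN nz => /eqP<-.
(* At this scale [th^k] is comparable with [|x - z|^(1 + al)]. *)
have [k /andP[k1 k2]] := geom_between q0 q4 x0 xr.
have [_ /(_ x Ox k2) h1] := inv k.
have h2 : `|(a_ k - a) * dotp nu (x - z)| <= B * M * p ^+ k * rr k.
  rewrite normrM; apply: ler_pM => //.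
  apply: le_trans (cauchy_schwarz _ _) _; rewrite nu1 mul1r ltW//.
have -> : u x - a * dotp nu (x - z) = (u x - a_ k * dotp nu (x - z)) + (a_ k - a) * dotp nu (x - z) by ring.
apply: le_trans (ler_normD _ _) _; apply: le_trans (lerD h1 h2) _.
have h3 : th ^+ k <= E * enorm (x - z) `^ (1 + al).
  rewrite /E mulrC ler_pdivlMr ?mulr_gt0 ?powR_gt0//.
  have -> : th ^+ k * (th * r0 `^ (1 + al)) = (q ^+ k.+1 * r0) `^ (1 + al).
    rewrite powRM ?exprn_ge0 ?(ltW q0) ?(ltW r00)// powRX ?(ltW q0)// -thE exprSr; ring.
  by apply: powR_mono => //; [lra_on al0|rewrite mulr_ge0 ?exprn_ge0 ?(ltW q0) ?(ltW r00)].
have -> : M * th ^+ k + B * M * p ^+ k * rr k = (1 + B * r0) * M * th ^+ k.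
  by rewrite /rr /th exprMn; ring.
apply: (@le_trans _ _ ((1 + B * r0) * M * (E * enorm (x - z) `^ (1 + al)))).
  by rewrite ler_wpM2l// mulr_ge0// addr_ge0// mulr_ge0// ltW.
have : 0 <= B * M * enorm (x - z) `^ (1 + al) by rewrite !mulr_ge0// powR_ge0.
lra_on B0.
Qed.

End Barrier.

(** * Hoelder estimates of gradients up to the boundary *)

Section GradientHolder.
Context {R : realType} {n : nat}.
Local Notation V := 'rV[R]_n.+1.
Local Notation N := (n.+1%:R : R).
Implicit Types (x y z w nu : V) (c r M K a d al : R) (O D : set V) (f g u h : V -> R).

Hypothesis n2 : (2 <= n.+1)%N.
Local Tactic Notation "lra_on" ne_hyp_list(hs) := clear -R n n2 hs; lra.

Definition gL : R := 32 * N ^+ 2.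

Lemma gL_ge0 : 0 <= gL.
Proof. by rewrite mulr_ge0 ?ler0n ?sqr_ge0. Qed.

Lemma harm_grad_bd x r u K i y : 0 < r -> harm (eB x r) u ->
  (forall y, eB x r y -> `|u y| <= K) -> eB x (r / 2) y -> `|partial i u y : R| <= 4 * N * K / r.
Proof.
move=> r0 hu uK yB; have [h h0] := harm_partial_wit (@eB_open _ _ x r) hu.
exact: (partial_est i r0 h h0 uK yB).
Qed.

Lemma harm_grad_lip x r u K i y : 0 < r -> harm (eB x r) u ->
  (forall y, eB x r y -> `|u y| <= K) -> eB x (r / 4) y ->
  `|(partial i u x : R) - partial i u y| <= gL * K / r ^+ 2 * enorm (x - y).
Proof.
move=> r0 hu uK yB; have r20 : 0 < r / 2 by lra.
have sub : eB x (r / 2) `<=` eB x r by apply: eB_sub; rewrite subrr enorm0; lra.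
have hp : harm (eB x (r / 2)) (partial i u) by apply: harm_sub sub _; exact: harm_partial (@eB_open _ _ x r) hu.
have := @harm_lip R n x (r / 2) (4 * N * K / r) (partial i u) r20 hp
  (fun z zB => harm_grad_bd i r0 hu uK zB) x y.
have -> : 4 * N * (4 * N * K / r) / (r / 2) = gL * K / r ^+ 2.
  by rewrite /gL; field; rewrite gt_eqF.
apply; first by apply: eB_center; lra.
by move: yB; rewrite /eB/=; lra.
Qed.

Lemma partial_sub_lin O u (a : R) nu z i y : open O -> harm O u -> O y ->
  partial i (fun x => u x - a * dotp nu (x - z) : R^o) y = (partial i u y : R) - a * nu 0 i.
Proof.
move=> oO hu Oy; have [h _] := harm_partial_wit oO hu; have [_ _ _ d1 _] := h y Oy.
have d2 : is_derive y (ee i) (fun x => a * dotp nu (x - z) : R^o) (a * nu 0 i : R).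
  apply/is_deriveP => e e0; exists 1 => // t _.
  have -> : y + t *: ee i - z = (y - z) + t *: ee i by rewrite addrAC.
  rewrite dotpDr dotpZr dotp_ee mulrDr [a * _ + _]addrC addrK.
  by rewrite mulrCA subrr normr0 mulr_ge0// ltW.
have d3 := @is_deriveB _ _ _ _ _ _ _ _ _ (d1 i) d2.
by rewrite /partial; apply: (@derive_val _ _ _ _ _ _ _ d3).
Qed.

(** Once the linear part is subtracted, [u] is of size [d^(1 + al)] on the ball of radius [d].
    Interior estimates divide this by [d] for the gradient and by [d^2] for its Lipschitz constant,
    and the latter becomes a Hoelder bound since [|x - y| <= d]. *)
Lemma expansion_interior O u (al K a d r0 : R) nu z x i : 0 < al -> al < 1 -> open O ->
  harm O u -> 0 < d -> eB x d `<=` O -> enorm (z - x) <= 2 * d -> 3 * d <= r0 -> 0 <= K ->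
  (forall y, O y -> enorm (y - z) < r0 ->
     `|u y - a * dotp nu (y - z)| <= K * enorm (y - z) `^ (1 + al)) ->
  `|(partial i u x : R) - a * nu 0 i| <= 36 * N * K * d `^ al /\
  forall y, eB x (d / 4) y -> `|(partial i u x : R) - partial i u y| <= 9 * gL * K * enorm (x - y) `^ al.
Proof.
move=> al0 al1 oO hu d0 dO zx dr K0 hexp.
pose h y : R := u y - a * dotp nu (y - z).
have hh : harm O h.
  apply: harmB => //; apply: harmZ.
  have e (y : V) : dotp nu (y - z) = dotp nu y - dotp nu z by rewrite dotpBr.
  under [X in harm _ X]eq_fun do rewrite e.
  by apply: harmB; [exact: harm_dotp|exact: harm_cst].
have hhB := harm_sub dO hh.
have dal : 0 < d `^ al by rewrite powR_gt0.
have hB y : eB x d y -> `|h y| <= 9 * K * (d * d `^ al).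
  move=> yB; have yz : enorm (y - z) <= 3 * d.
    have := enorm_tri x y z; rewrite (enorm_distC x z).
    by move: yB; rewrite /eB/=; lra_on zx.
  have yz2 : enorm (y - z) < 3 * d.
    have := enorm_tri x y z; rewrite (enorm_distC x z).
    by move: yB; rewrite /eB/=; lra_on zx.
  apply: le_trans (hexp y (dO y yB) (lt_le_trans yz2 dr)) _.
  have -> : 9 * K * (d * d `^ al) = K * (9 * d `^ (1 + al)) by rewrite (powR1D al0 (ltW d0)); ring.
  rewrite ler_wpM2l//; apply: le_trans (_ : (3 * d) `^ (1 + al) <= _).
    by apply: powR_mono => //; [lra|exact: enorm_ge0].
  rewrite powRM ?(ltW d0)// ler_wpM2r ?powR_ge0//.
  have -> : 9 = 3 `^ 2%:R :> R by rewrite powR_mulrn//; ring.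
  by rewrite ler_powR//; lra.
have Ox : O x by apply: dO; exact: eB_center.
split.
  rewrite -(@partial_sub_lin O u a nu z i x oO hu Ox).
  apply: le_trans (harm_grad_bd i d0 hhB hB (eB_center x _)) _; first lra.
  by apply: le_of_eq; field; rewrite gt_eqF.
move=> y yB; have Oy : O y by apply: dO; move: yB; rewrite /eB/=; lra.
have -> : (partial i u x : R) - partial i u y = (partial i h x : R) - partial i h y.
  by rewrite !(partial_sub_lin a nu z i oO hu)//; ring.
apply: le_trans (harm_grad_lip i d0 hhB hB yB) _.
have c288 : 0 <= 9 * gL * K by apply: mulr_ge0 => //; apply: mulr_ge0 => //; exact: gL_ge0.
have [->|xy] := eqVneq x y; first by rewrite subrr enorm0 mulr0 mulr_ge0 ?powR_ge0.
set s := enorm (x - y); have s0 : 0 < s by rewrite enorm_gt0 subr_eq0.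
have sd : s <= d by move: yB; rewrite /eB/= (enorm_distC y x) -/s; lra.
have -> : gL * (9 * K * (d * d `^ al)) / d ^+ 2 * s = 9 * gL * K * (d `^ al / d * s).
  by field; rewrite gt_eqF.
rewrite ler_wpM2l//.
have sE : s = s `^ al * s `^ (1 - al).
  by rewrite -powRD ?subrKC ?powRr1 ?(ltW s0)//; apply/implyP => _; rewrite gt_eqF.
rewrite [X in _ * X <= _]sE mulrC -mulrA ler_piMr ?powR_ge0//.
have -> : d `^ al / d = (d `^ (1 - al))^-1.
  by rewrite -powRN opprB powRB ?powRr1 ?(ltW d0)//; apply/implyP => _; rewrite gt_eqF.
rewrite ler_pdivrMr ?powR_gt0// mul1r; apply: powR_mono => //; [lra|exact: ltW].
Qed.

(** Both affine functions approximate the same [u] on a common ball, so they differ there by order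
    [rr^(1 + al)]; an increment over length [s] compares their slopes. *)
Lemma affine_compare O u (al K a1 a2 r0 rr s : R) nu1 nu2 z1 z2 q i : 0 < al -> 0 < s -> rr < r0 -> 0 <= K ->
  (forall y, O y -> enorm (y - z1) < r0 ->
     `|u y - a1 * dotp nu1 (y - z1)| <= K * enorm (y - z1) `^ (1 + al)) ->
  (forall y, O y -> enorm (y - z2) < r0 ->
     `|u y - a2 * dotp nu2 (y - z2)| <= K * enorm (y - z2) `^ (1 + al)) ->
  (forall y, eB q s y -> [/\ O y, enorm (y - z1) <= rr & enorm (y - z2) <= rr]) ->
  `|a1 * nu1 0 i - a2 * nu2 0 i| <= 4 * K * rr `^ (1 + al) / s.
Proof.
move=> al0 s0 rr0 K0 e1 e2 hq.
pose l y : R := a1 * dotp nu1 (y - z1) - a2 * dotp nu2 (y - z2).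
have lb y : eB q s y -> `|l y| <= 2 * K * rr `^ (1 + al).
  move=> yB; have [Oy y1 y2] := hq y yB.
  have h1 : `|u y - a1 * dotp nu1 (y - z1)| <= K * rr `^ (1 + al).
    apply: le_trans (e1 y Oy (le_lt_trans y1 rr0)) _.
    by rewrite ler_wpM2l// powR_mono ?enorm_ge0//; lra.
  have h2 : `|u y - a2 * dotp nu2 (y - z2)| <= K * rr `^ (1 + al).
    apply: le_trans (e2 y Oy (le_lt_trans y2 rr0)) _.
    by rewrite ler_wpM2l// powR_mono ?enorm_ge0//; lra.
  have -> : l y = (u y - a2 * dotp nu2 (y - z2)) - (u y - a1 * dotp nu1 (y - z1)) by rewrite /l; ring.
  apply: le_trans (ler_normB _ _) _; lra_on h1 h2.
have inB t : `|t| < s -> eB q s (q + t *: ee i).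
  by rewrite /eB/= [q + _]addrC addrK enormZ enorm_ee mulr1.
have lE t : l (q + t *: ee i) = l q + t * (a1 * nu1 0 i - a2 * nu2 0 i).
  rewrite /l ![q + _ - _]addrAC !dotpDr !dotpZr !dotp_ee; ring.
have h1 := lb _ (inB (s / 2) _); have h2 := lb _ (inB (- (s / 2)) _).
rewrite ler_pdivlMr// -[X in _ * X](gtr0_norm s0) -normrM.
have -> : (a1 * nu1 0 i - a2 * nu2 0 i) * s = l (q + (s / 2) *: ee i) - l (q + (- (s / 2)) *: ee i).
  by rewrite !lE; field.
apply: le_trans (ler_normB _ _) _.
have {}h1 := h1 (ltac:(rewrite gtr0_norm; lra)).
have {}h2 := h2 (ltac:(rewrite normrN gtr0_norm; lra)).
lra_on h1 h2.
Qed.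

Lemma segment_exit O x y : open O -> O x -> ~ O y ->
  exists z, [/\ closure O z, ~ O z & enorm (z - x) <= enorm (y - x)].
Proof.
move=> oO Ox nOy.
pose S := [set t : R | 0 <= t <= 1 /\ forall s : R, 0 <= s <= t -> O (x + s *: (y - x))].
have y1 : x + 1 *: (y - x) = y by rewrite scale1r addrC subrK.
have S0 : S 0.
  split; first by rewrite lexx ler01.
  move=> s hs; suff -> : s = 0 by rewrite scale0r addr0.
  by apply/eqP; rewrite eq_le andbC.
have hS : has_sup S by split; [exists 0|exists 1 => t [/andP[]]].
pose T := sup S.
have T0 : 0 <= T by apply: ub_le_sup => //; exact: hS.2.
have T1 : T <= 1 by apply: ge_sup; [exists 0|move=> t [/andP[]]].
have below s : 0 <= s -> s < T -> O (x + s *: (y - x)).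
  move=> s0 sT; have [t [t01 ht] st] := sup_adherent (ltac:(rewrite subr_gt0; exact: sT) : 0 < T - s) hS.
  by apply: ht; rewrite s0/=; rewrite -/T in st; lra.
pose L : R := enorm (y - x) + 1; have L0 : 0 < L by rewrite ltr_wpDl ?enorm_ge0.
have dist s t : enorm (x + s *: (y - x) - (x + t *: (y - x))) <= `|s - t| * L.
  have -> : x + s *: (y - x) - (x + t *: (y - x)) = (s - t) *: (y - x).
    by apply/rowP => i; rewrite !mxE; ring.
  by rewrite enormZ ler_wpM2l// lerDl.
exists (x + T *: (y - x)); split.
- apply/closure_enormP => r r0.
  pose s : R := Num.max 0 (T - r / (2 * L)).
  have rL : 0 < r / (2 * L) by rewrite divr_gt0// mulr_gt0.
  have [T00|T00] := eqVneq T 0.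
    by exists x => //; rewrite T00 scale0r addr0 subrr enorm0.
  have Tp : 0 < T by rewrite lt_def T00.
  have sT : s < T by rewrite gt_max Tp gtrBl.
  exists (x + s *: (y - x)); first by apply: below => //; rewrite le_max lexx.
  apply: le_lt_trans (dist _ _) _.
  rewrite distrC ger0_norm ?subr_ge0 ?(ltW sT)//.
  have h : T - r / (2 * L) <= s by rewrite le_max lexx orbT.
  apply: (@le_lt_trans _ _ (r / (2 * L) * L)).
    by rewrite ler_wpM2r ?(ltW L0)//; lra_on h.
  have -> : r / (2 * L) * L = r / 2 by field; rewrite gt_eqF.
  lra_on r0.
- move=> OT; have [r r0 rO] := open_ball_in oO OT.
  pose e : R := r / (2 * L); have e0 : 0 < e by rewrite divr_gt0// mulr_gt0.
  have eL : e * L < r.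
    have -> : e * L = r / 2 by rewrite /e; field; rewrite gt_eqF.
    lra_on r0.
  have ext s : 0 <= s <= T + e -> O (x + s *: (y - x)).
    move=> /andP[s0 sT]; have [sT2|sT2] := ltP s T; first exact: below.
    apply: rO; apply: le_lt_trans (dist _ _) _; rewrite ger0_norm ?subr_ge0//.
    by apply: le_lt_trans eL; rewrite ler_pM2r//; lra_on sT.
  have [Te|Te] := leP (T + e) 1; last first.
    apply: nOy; rewrite -y1; apply: ext; rewrite ler01/=; exact: ltW.
  suff : T + e <= T by lra.
  apply: ub_le_sup; first exact: hS.2.
  by split => //; rewrite Te andbT addr_ge0// ltW.
- rewrite addrC addKr enormZ ger0_norm//.
  by rewrite ler_piMl ?enorm_ge0.
Qed.

(** [d] is the supremum of the radii of balls around [x] inside [O]. The ball of radius [2 d] leaves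
    [O], and the segment towards a point outside meets the boundary. *)
Lemma near_bdry O x r : open O -> O x -> 0 < r -> eB x r `<=` O \/
  exists d z, [/\ 0 < d, d <= r, eB x d `<=` O, closure O z /\ ~ O z & enorm (z - x) <= 2 * d].
Proof.
move=> oO Ox r0; have [h|nh] := pselect (eB x r `<=` O); first by left.
right; pose S := [set t : R | 0 <= t /\ eB x t `<=` O].
have Sr t : S t -> t <= r.
  move=> [t0 tO]; rewrite leNgt; apply/negP => rt; apply: nh => y; rewrite /eB/= => yr.
  by apply: tO; rewrite /eB/=; lra.
have [d1 d10 d1O] := open_ball_in oO Ox.
have S1 : S d1 by split => //; exact: ltW.
have hS : has_sup S by split; [exists d1|exists r => t /Sr].
pose d := sup S.
have d0 : 0 < d by apply: lt_le_trans d10 _; apply: ub_le_sup => //; exact: hS.2.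
have dr : d <= r by apply: ge_sup; [exists d1|exact: Sr].
have dO : eB x d `<=` O.
  move=> y; rewrite /eB/= => yd.
  have [t [t0 tO] st] := sup_adherent (ltac:(rewrite subr_gt0; exact: yd) : 0 < d - enorm (y - x)) hS.
  by apply: tO; rewrite /eB/=; rewrite -/d in st; lra.
have [y yd nOy] : exists2 y, enorm (y - x) < 2 * d & ~ O y.
  apply: contrapT => h; have : 2 * d <= d.
    apply: ub_le_sup; first exact: hS.2.
    split; first lra.
    move=> y; rewrite /eB/= => yd; apply: contrapT => nOy; apply: h; by exists y.
  lra.
have [z [cz nz zx]] := segment_exit oO Ox nOy.
by exists d, z; split => //; lra.
Qed.

Lemma flat_at_le (al kap r r' : R) O z nu : r <= r' -> flat_at al O z nu kap r' -> flat_at al O z nu kap r.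
Proof. by move=> rr [nu1 h]; split => // x xr; apply: h; exact: lt_le_trans rr. Qed.

Definition outr O (del : R) : set V := O `&` [set x | del < enorm x].

Lemma outr_open O (del : R) : open O -> open (outr O del).
Proof.
move=> oO; apply: openI => //; apply/openP_enorm => x /= xd.
exists (enorm x - del) => [|y yx /=]; first by rewrite subr_gt0.
by have [h _] := enorm_rdistP y x; lra.
Qed.

(** For points at distance [s] there are three regimes: [s] not small, where the gradient bound
    suffices; [s] small against the distance to the boundary, where an interior estimate applies;
    both points within order [s] of the boundary, where each gradient is compared with the slope at
    a boundary point and the two slopes with each other. *)
Lemma bdry_gradient O (al kap rf del : R) : 0 < al -> al < 1 -> 0 < kap -> 0 < rf -> 0 < del -> open O ->
  (\bd z of O, exists nu, flat_at al O z nu kap rf) ->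
  exists2 C : R, 0 <= C & forall u (M : R), 0 <= M -> harm (outr O del) u ->
    (forall x, outr O del x -> `|u x| <= M) ->
    (\bd z of O, del < enorm z -> blim (outr O del) u z 0) ->
    forall i, (forall x, O x -> 3 * del <= enorm x -> `|partial i u x : R| <= C * M) /\
    forall x y, O x -> O y -> 3 * del <= enorm x -> 3 * del <= enorm y ->
      `|(partial i u x : R) - partial i u y| <= C * M * enorm (x - y) `^ al.
Proof.
move=> al0 al1 kap0 rf0 del0 oO hflat.
have [rm rm0 hrm] := bdry_expansion n2 al0 al1 kap0.
pose r0 : R := Num.min (Num.min rm rf) (Num.min del 1).
have r00 : 0 < r0 by rewrite !lt_min rm0 rf0 del0 ltr01.
have [r0m r0f r0d r01] : [/\ r0 <= rm, r0 <= rf, r0 <= del & r0 <= 1].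
  by rewrite !ge_min !lexx ?orbT.
have [C0 C00 hexp] := hrm r0 (ltac:(by rewrite r00)).
clearbody r0.
(* [k0] and [c0] ensure [kap (3 s)^(1 + al) < s] for [s <= c0], so that the comparison ball used at
   the end lies inside [O]. *)
pose k0 : R := (10 * kap)^-1 `^ al^-1.
have k00 : 0 < k0 by rewrite powR_gt0// invr_gt0 mulr_gt0.
pose c0 : R := Num.min (r0 / 80) k0.
have c00 : 0 < c0 by rewrite lt_min k00 divr_gt0.
have [c0r c0k] : c0 <= r0 / 80 /\ c0 <= k0 by rewrite !ge_min !lexx orbT.
have kapc (s : R) : 0 <= s -> s <= c0 -> kap * (9 * s `^ al) < 1.
  move=> s0 sc; have h : s `^ al <= (10 * kap)^-1.
    have -> : (10 * kap)^-1 = k0 `^ al by rewrite /k0 -powRrM mulVf ?powRr1 ?gt_eqF// invr_ge0 mulr_ge0// ltW.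
    by apply: powR_mono => //; exact: le_trans c0k.
  apply: le_lt_trans (_ : kap * (9 * (10 * kap)^-1) < 1).
    by rewrite ler_wpM2l ?(ltW kap0)// ler_wpM2l.
  have -> : kap * (9 * (10 * kap)^-1) = 9 / 10 by field; rewrite gt_eqF.
  lra.
clearbody c0; clear k00 c0k hrm; clearbody k0.
have N1 : 1 <= N by rewrite ler1n.
pose C1 : R := 16 * N / r0 + C0 + 36 * N * C0.
have C10 : 0 <= C1 by rewrite /C1 !addr_ge0// ?mulr_ge0// ?invr_ge0 ?(ltW r00)//.
have C1E : C1 = 16 * N / r0 + C0 + 36 * N * C0 by [].
clearbody C1.
have r0i : 0 <= (r0 ^+ 2)^-1 by rewrite invr_ge0 sqr_ge0.
have gL0 := gL_ge0.
pose C3 : R := 16 * gL / r0 ^+ 2 + 9 * gL * C0.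
have C30 : 0 <= C3 by rewrite addr_ge0// mulr_ge0// mulr_ge0.
have C3E : C3 = 16 * gL / r0 ^+ 2 + 9 * gL * C0 by [].
clearbody C3.
pose C4 : R := 2 * (36 * N * C0) * 4 + 4 * (20 * 20) * C0.
have C40 : 0 <= C4 by rewrite addr_ge0 ?mulr_ge0.
have C4E : C4 = 2 * (36 * N * C0) * 4 + 4 * (20 * 20) * C0 by [].
clearbody C4.
pose C5 : R := 2 * C1 / c0 `^ al.
have C50 : 0 <= C5 by rewrite divr_ge0 ?powR_ge0 ?mulr_ge0.
have C5E : C5 = 2 * C1 / c0 `^ al by [].
clearbody C5.
exists (C1 + C3 + C4 + C5); first by rewrite !addr_ge0.
move=> u M M0 hu uM u0 i.
have K0 : 0 <= C0 * M by rewrite mulr_ge0.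
have sub x r : 3 * del <= enorm x -> r <= r0 -> eB x r `<=` O -> eB x r `<=` outr O del.
  move=> xd rr rO y yB; split; first exact: rO.
  have [h _] := enorm_rdistP y x.
  by move: yB h; rewrite /eB/=; lra_on r0d rr xd del0.
have oOd : open (outr O del) := outr_open oO.
have uB x r : 3 * del <= enorm x -> r <= r0 -> eB x r `<=` O -> forall y, eB x r y -> `|u y| <= M.
  by move=> xd rr rO y /(sub x r xd rr rO); exact: uM.
have r40 : 0 < r0 / 4 by lra_on r00.
have r4r : r0 / 4 <= r0 by lra_on r00.
have alt x : O x -> 3 * del <= enorm x -> eB x (r0 / 4) `<=` O \/
   exists d z nu a, [/\ 0 < d, d <= r0 / 4, eB x d `<=` O, enorm (z - x) <= 2 * d &
     [/\ flat_at al O z nu kap r0, `|a| <= C0 * M & forall y, O y -> enorm (y - z) < r0 ->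
     `|u y - a * dotp nu (y - z)| <= C0 * M * enorm (y - z) `^ (1 + al)]].
  move=> Ox xd; have [h|[d [z [d0 dr dO [cz nz] zx]]]] := near_bdry oO Ox r40; first by left.
  right; have [nu fl] := hflat z cz nz; have fl0 := flat_at_le r0f fl.
  have zd : 2 * del <= enorm z.
    have [h _] := enorm_rdistP z x.
    by lra_on h zx xd dr r0d del0.
  have far y : enorm (y - z) < r0 -> del < enorm y.
    move=> yz; have [h _] := enorm_rdistP y z.
    by lra_on h yz zd r0d del0.
  have [|||a aM ha] := hexp O z nu u M oO nz fl0 _ _ M0.
  - by apply: harm_sub hu => y [Oy yz]; split => //; exact: far.
  - by move=> y Oy yz; apply: uM; split => //; exact: far.
  - move=> y cy ny yz e e0; have [d' d'0 hd'] := u0 y cy ny (far y yz) e e0.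
    exists (Num.min d' (enorm y - del)); first by rewrite lt_min d'0 subr_gt0 far.
    move=> w Ow; rewrite lt_min => /andP[wd wy].
    have wo : outr O del w.
      split => //=; have [h _] := enorm_rdistP w y.
      by lra_on h wy.
    by have := hd' w wo wd; rewrite subr0 add0r => /ltW.
  by exists d, z, nu, a; split.
have grad x : O x -> 3 * del <= enorm x -> `|partial i u x : R| <= C1 * M.
  move=> Ox xd; have [hO|[d [z [nu [a [d0 dr dO zx [fl aM ha]]]]]]] := alt x Ox xd.
    apply: le_trans (harm_grad_bd i r40 (harm_sub (sub x _ xd r4r hO) hu) (uB x _ xd r4r hO) (eB_center x _)) _.
      by lra_on r00.
    have -> : 4 * N * M / (r0 / 4) = 16 * N / r0 * M by field; rewrite gt_eqF.
    by rewrite ler_wpM2r// C1E -addrA lerDl addr_ge0// mulr_ge0.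
  have d3 : 3 * d <= r0 by lra_on dr r00.
  have dr0 : d <= r0 := le_trans dr r4r.
  have [h _] := expansion_interior i al0 al1 oOd hu d0 (sub x d xd dr0 dO) zx d3 K0 (fun y Oy => ha y Oy.1).
  have nui : `|nu 0 i| <= 1 by apply: le_trans (coord_le_enorm nu i) _; rewrite fl.1.
  have -> : partial i u x = (partial i u x - a * nu 0 i) + a * nu 0 i :> R by rewrite subrK.
  apply: le_trans (ler_normD _ _) _.
  have h1 : `|a * nu 0 i| <= C0 * M by rewrite normrM; apply: le_trans aM; rewrite ler_piMr.
  have h2 : 36 * N * (C0 * M) * d `^ al <= 36 * N * C0 * M.
    rewrite [leRHS](_ : _ = 36 * N * (C0 * M) * 1); last by ring.
    rewrite ler_wpM2l ?mulr_ge0//.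
    have <- : 1 `^ al = 1 :> R by rewrite powR1.
    by apply: powR_mono => //; [exact: ltW|lra_on dr r01].
  have h3 : 0 <= 16 * N / r0 * M by rewrite mulr_ge0// divr_ge0 ?(ltW r00)// mulr_ge0.
  by rewrite C1E; lra_on h h1 h2 h3.
have lipx x y : O x -> O y -> 3 * del <= enorm x -> 0 < enorm (x - y) -> enorm (x - y) < c0 ->
  `|(partial i u x : R) - partial i u y| <= C3 * M * enorm (x - y) `^ al \/
   exists d z nu a, [/\ 0 < d, d <= 4 * enorm (x - y), eB x d `<=` O, enorm (z - x) <= 2 * d &
     [/\ 3 * d <= r0, flat_at al O z nu kap r0 & forall y, O y -> enorm (y - z) < r0 ->
     `|u y - a * dotp nu (y - z)| <= C0 * M * enorm (y - z) `^ (1 + al)]].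
  move=> Ox Oy xd; set s := enorm (x - y) => s0 sc.
  have sal : 0 <= s `^ al by rewrite powR_ge0.
  have [hO|[d [z [nu [a [d0 dr dO zx [fl aM ha]]]]]]] := alt x Ox xd.
    left; have yB : eB x (r0 / 4 / 4) y by rewrite /eB/= enorm_distC -/s; lra_on sc c0r r00.
    apply: le_trans (harm_grad_lip i r40 (harm_sub (sub x _ xd r4r hO) hu) (uB x _ xd r4r hO) yB) _.
    have -> : gL * M / (r0 / 4) ^+ 2 * enorm (x - y) = 16 * gL / r0 ^+ 2 * M * s.
      by rewrite /s; field; rewrite gt_eqF.
    have ss : s <= s `^ al.
      have e : s = s `^ al * s `^ (1 - al).
        by rewrite -powRD ?subrKC ?powRr1 ?(ltW s0)//; apply/implyP => _; rewrite gt_eqF.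
      rewrite {1}e ler_piMr//; apply: (@le_trans _ _ (1 `^ (1 - al))); last by rewrite powR1.
      apply: powR_mono; [|exact: ltW|].
        by rewrite subr_gt0.
      by lra_on sc c0r r01.
    apply: (@le_trans _ _ (16 * gL / r0 ^+ 2 * M * s `^ al)).
      by rewrite ler_wpM2l// mulr_ge0// mulr_ge0// mulr_ge0.
    by rewrite ler_wpM2r// ler_wpM2r// C3E lerDl mulr_ge0// mulr_ge0.
  have d3 : 3 * d <= r0 by lra_on dr r00.
  have [ds|ds] := ltP s (d / 4); last first.
    by right; exists d, z, nu, a; split => //; lra_on ds.
  left; have [_ h] := expansion_interior i al0 al1 oOd hu d0 (sub x d xd (le_trans dr r4r) dO) zx d3 K0 (fun y Oy => ha y Oy.1).
  apply: le_trans (h y _) _; first by rewrite /eB/= enorm_distC.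
  rewrite -/s ler_wpM2r//.
  rewrite [leLHS](_ : _ = 9 * gL * C0 * M); last by ring.
  by rewrite ler_wpM2r// C3E lerDr mulr_ge0// mulr_ge0.
split.
  move=> x Ox xd; apply: le_trans (grad x Ox xd) _.
  by rewrite ler_wpM2r// -!addrA lerDl !addr_ge0.
move=> x y Ox Oy xd yd.
set s := enorm (x - y).
have sal : 0 <= s `^ al by rewrite powR_ge0.
have CM (k : R) : 0 <= k -> forall k', k <= k' -> k * M * s `^ al <= k' * M * s `^ al.
  by move=> k0' k' kk; rewrite ler_wpM2r// ler_wpM2r.
have [->|xy] := eqVneq x y; first by rewrite subrr normr0 !mulr_ge0// !addr_ge0.
have s0 : 0 < s by rewrite enorm_gt0 subr_eq0.
have [cs|sc] := leP c0 s.
  apply: le_trans (ler_normB _ _) _.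
  have h1 := grad x Ox xd; have h2 := grad y Oy yd.
  apply: (@le_trans _ _ (C5 * M * s `^ al)); last first.
    by apply: CM => //; rewrite lerDr !addr_ge0.
  have h3 : 1 <= s `^ al / c0 `^ al.
    by rewrite ler_pdivlMr ?powR_gt0// mul1r powR_mono// ltW.
  have -> : C5 * M * s `^ al = 2 * (C1 * M) * (s `^ al / c0 `^ al) by rewrite C5E; ring.
  apply: (@le_trans _ _ (2 * (C1 * M))); first by lra_on h1 h2.
  by rewrite ler_peMr// mulr_ge0// mulr_ge0.
have c3 : C3 * M * s `^ al <= (C1 + C3 + C4 + C5) * M * s `^ al.
  by apply: CM => //; lra_on C10 C40 C50.
have [h|[d1 [z1 [nu1 [a1 [d10 d1s d1O zx1 [d1r fl1 ha1]]]]]]] := lipx x y Ox Oy xd s0 sc.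
  exact: le_trans c3.
have syx : enorm (y - x) = s by rewrite enorm_distC.
have syx0 : 0 < enorm (y - x) by rewrite syx.
have syxc : enorm (y - x) < c0 by rewrite syx.
have [h|[d2 [z2 [nu2 [a2 [d20 d2s d2O zx2 [d2r fl2 ha2]]]]]]] := lipx y x Oy Ox yd syx0 syxc.
  by rewrite distrC; move: h; rewrite syx => h; exact: le_trans c3.
rewrite -/s in d1s; rewrite syx in d2s.
have dle (d : R) : 0 < d -> 3 * d <= r0 -> d <= r0 by clear -R n n2; lra.
have [g1 _] := expansion_interior i al0 al1 oOd hu d10 (sub x d1 xd (dle _ d10 d1r) d1O) zx1 d1r K0 (fun y Oy => ha1 y Oy.1).
have [g2 _] := expansion_interior i al0 al1 oOd hu d20 (sub y d2 yd (dle _ d20 d2r) d2O) zx2 d2r K0 (fun y Oy => ha2 y Oy.1).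
have h4 (d : R) : 0 < d -> d <= 4 * s -> 36 * N * (C0 * M) * d `^ al <= 36 * N * (C0 * M) * (4 * s `^ al).
  move=> d0 ds; rewrite ler_wpM2l ?mulr_ge0//.
  apply: (@le_trans _ _ ((4 * s) `^ al)); first by apply: powR_mono => //; exact: ltW.
  rewrite powRM ?(ltW s0)// ler_wpM2r//.
  rewrite -[leRHS](@powRr1 R 4)//; apply: ler_powR; [clear -R n n2; lra|exact: ltW].
have g3 : `|a1 * nu1 0 i - a2 * nu2 0 i| <= 4 * (C0 * M) * (20 * s) `^ (1 + al) / s.
  have [n1 f1] := fl1.
  (* The ball of radius [s] about [z1 + 2 s nu1] clears the boundary near [z1] and stays within
     [20 s] of both boundary points. *)
  apply: (@affine_compare O u al (C0 * M) a1 a2 r0 (20 * s) s nu1 nu2 z1 z2 (z1 + (2 * s) *: nu1) i) => //.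
    by lra_on sc c0r r00.
  move=> y'; rewrite /eB/= => yq.
  have e1 : y' - z1 = (y' - (z1 + (2 * s) *: nu1)) + (2 * s) *: nu1.
    by rewrite opprD addrA subrK.
  have yz1 : enorm (y' - z1) <= 3 * s.
    rewrite e1; apply: le_trans (enormD _ _) _; rewrite enormZ n1 mulr1 gtr0_norm; last by lra_on s0.
    by lra_on yq.
  have z12 : enorm (z1 - z2) <= 17 * s.
    have := enorm_tri x z1 z2; have := enorm_tri y x z2.
    by rewrite (enorm_distC y z2) -/s; lra_on zx1 zx2 d1s d2s.
  split.
  - apply: (f1 y' _).1; first by lra_on yz1 sc c0r r00.
    have h1 : kap * enorm (y' - z1) `^ (1 + al) < s.
      apply: le_lt_trans (_ : kap * (3 * s) `^ (1 + al) < s).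
        by rewrite ler_wpM2l ?(ltW kap0)// powR_mono ?enorm_ge0//; lra_on al0.
      rewrite powRM ?(ltW s0)// (powR1D al0 (ltW s0)).
      apply: (@le_lt_trans _ _ (kap * (9 * s `^ al) * s)).
        rewrite -[leRHS]mulrA ler_wpM2l ?(ltW kap0)// [s * _]mulrC mulrA ler_wpM2r ?(ltW s0)// ler_wpM2r//.
        have -> : 9 = 3 `^ 2%:R :> R by rewrite powR_mulrn//; ring.
        by rewrite ler_powR//; lra_on al1.
      by rewrite gtr_pMl// kapc// ltW.
    apply: lt_le_trans h1 _; rewrite e1 dotpDr dotpZr -enorm_sqr n1 expr1n mulr1.
    have := cauchy_schwarz nu1 (y' - (z1 + (2 * s) *: nu1)); rewrite n1 mul1r ler_norml => /andP[h2 _].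
    by lra_on h2 yq.
  - by lra_on yz1 s0.
  - by have := enorm_tri z1 y' z2; lra_on yz1 z12.
have g4 : 4 * (C0 * M) * (20 * s) `^ (1 + al) / s <= 4 * (20 * 20) * (C0 * M) * s `^ al.
  rewrite ler_pdivrMr// powRM ?(ltW s0)// (powR1D al0 (ltW s0)).
  have h : 20 `^ (1 + al) <= 20 * 20 :> R.
    have -> : 20 * 20 = 20 `^ 2%:R :> R by rewrite powR_mulrn//; ring.
    by rewrite ler_powR//; lra_on al1.
  have p : 0 <= C0 * M * (s * s `^ al) by rewrite mulr_ge0// mulr_ge0// ltW.
  have := ler_wpM2r p h; clear -R n n2; lra.
have {}g1 := le_trans g1 (h4 _ d10 d1s); have {}g2 := le_trans g2 (h4 _ d20 d2s).
have {}g3 := le_trans g3 g4.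
have -> : (partial i u x : R) - partial i u y = (partial i u x - a1 * nu1 0 i) + (a1 * nu1 0 i - a2 * nu2 0 i)
   - (partial i u y - a2 * nu2 0 i) by ring.
apply: le_trans (ler_normB _ _) _; apply: le_trans (lerD (ler_normD _ _) (lexx _)) _.
apply: (@le_trans _ _ (C4 * M * s `^ al)); last by apply: CM => //; lra_on C10 C30 C50.
rewrite C4E; lra_on g1 g2 g3.
Qed.

Lemma holder_small (K al e : R) : 0 < al -> 0 <= K -> 0 < e -> exists2 d : R, 0 < d & K * d `^ al < e.
Proof.
move=> al0 K0 e0; pose q : R := e / (K + 1); have q0 : 0 < q by rewrite divr_gt0//; lra.
exists (q `^ al^-1); first by rewrite powR_gt0.
rewrite -powRrM mulVf ?powRr1 ?gt_eqF// ?(ltW q0)//.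
by rewrite /q mulrA ltr_pdivrMr ?mulrDr; lra.
Qed.

(** [C1a] asks for a continuous extension of the derivatives to the closure; the Hoelder bound gives
    the new values as limits with an explicit rate. *)
Lemma holder_extend (S : set V) f (K al : R) : 0 < al -> 0 <= K ->
  (forall x y, S x -> S y -> `|f x - f y| <= K * enorm (x - y) `^ al) ->
  exists g : V -> R, (forall x, S x -> g x = f x) /\ forall x, closure S x -> blim (closure S) g x (g x).
Proof.
move=> al0 K0 hf.
have ik0 (k : nat) : 0 < @ik R k := ik_gt0 k.
have /choice[l hl] : forall x, exists l : R, closure S x -> forall (e : R) y, 0 < e -> S y -> enorm (y - x) <= e ->
    `|f y - l| <= 2 * K * (2 * e) `^ al.
  move=> x; have [cx|nx] := pselect (closure S x); last by exists 0.
  have /choice[y_ hy] : forall k : nat, exists y, S y /\ enorm (y - x) < @ik R k.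
    by move=> k; move/closure_enormP : cx => /(_ (@ik R k) (ik0 k))[y Sy yx]; exists y.
  have [|l hl] := @seq_lim R (fun k => f (y_ k)) (fun k => K * (2 * ik k) `^ al).
    move=> k j; have [Sk kx] := hy k; have [Sj jx] := hy j.
    apply: le_trans (hf _ _ Sk Sj) _; rewrite -mulrDr ler_wpM2l//.
    have h : enorm (y_ k - y_ j) <= 2 * Num.max (@ik R k) (ik j).
      have := enorm_tri x (y_ k) (y_ j); rewrite (enorm_distC x (y_ j)).
      have : @ik R k <= Num.max (@ik R k) (ik j) by rewrite le_max lexx.
      have : @ik R j <= Num.max (@ik R k) (ik j) by rewrite le_max lexx orbT.
      lra_on kx jx.
    apply: le_trans (powR_mono al0 (enorm_ge0 _) h) _.
    by case: (leP (@ik R k) (ik j)) => _; rewrite ?lerDl ?lerDr powR_ge0.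
  exists l => _ e y e0 Sy yx; have [k kk] := ik_small e0; have [Sk kx] := hy k.
  have h1 : `|f y - f (y_ k)| <= K * (2 * e) `^ al.
    apply: le_trans (hf _ _ Sy Sk) _; rewrite ler_wpM2l// powR_mono ?enorm_ge0//.
    have := enorm_tri x y (y_ k); rewrite (enorm_distC x (y_ k)).
    lra_on kx yx kk.
  have h2 : `|f (y_ k) - l| <= K * (2 * e) `^ al.
    apply: le_trans (hl k) _; rewrite ler_wpM2l// powR_mono//; first by rewrite mulr_ge0// ltW.
    by rewrite ler_pM2l// ltW.
  rewrite -(subrKA (f (y_ k))); apply: le_trans (ler_normD _ _) _.
  lra_on h1 h2.
have lf x : S x -> l x = f x.
  move=> Sx; apply/eqP; rewrite eq_sym -subr_eq0 -normr_le0; apply/ler_addgt0Pr => e e0.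
  have [d d0 hd] := holder_small al0 (mulr_ge0 (ler0n R 2) K0) e0.
  have := hl x (subset_closure Sx) (d / 2) x (divr_gt0 d0 (ltr0Sn _ 1)) Sx.
  rewrite subrr enorm0 => /(_ (ltW (divr_gt0 d0 (ltr0Sn _ 1)))).
  have -> : 2 * (d / 2) = d by field.
  by rewrite add0r => /le_trans; apply; exact: ltW.
exists l; split => // x cx e e0.
have [d d0 hd] := holder_small al0 (mulr_ge0 (ler0n R 4) K0) e0.
have d4 : 0 < d / 4 by lra_on d0.
exists (d / 4) => // z cz zx.
have [y Sy yz] := (closure_enormP _ _).1 cz _ d4.
have h1 := hl z cz (d / 4) y d4 Sy (ltW yz).
have h2 := hl x cx (d / 2) y (divr_gt0 d0 (ltr0Sn _ 1)) Sy.
have {}h2 : `|f y - l x| <= 2 * K * d `^ al.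
  have e2 : 2 * (d / 2) = d by field.
  rewrite e2 in h2; apply: h2.
  by have := enorm_tri z y x; lra_on zx yz.
have h3 : 2 * K * (2 * (d / 4)) `^ al <= 2 * K * d `^ al.
  rewrite ler_wpM2l ?mulr_ge0// powR_mono//; lra_on d0.
rewrite -(subrKA (f y)); apply: le_lt_trans (ler_normD _ _) _.
rewrite distrC; lra_on h1 h2 h3 hd.
Qed.

Lemma bounded_intro (T : Type) (S : set T) (f : T -> R^o) (M : R) :
  (forall x : T, S x -> `|f x| <= M) -> [bounded f x | x in S].
Proof.
move=> h; exists M; split; first exact: num_real.
by move=> M' MM x Sx; apply: le_trans (h x Sx) (ltW MM).
Qed.

Lemma holder_quot_le (al K : R) O (g : V -> R^o) xy : (O `*` O) xy -> 0 <= K ->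
  (forall x y, O x -> O y -> `|g x - g y| <= K * enorm (x - y) `^ al) -> `|holder_quot al g xy| <= K.
Proof.
case: xy => x y [/= Ox Oy] K0 h; rewrite /holder_quot/= normrM normfV (ger0_norm (powR_ge0 _ _)).
have [->|xy] := eqVneq x y; first by rewrite subrr normr0 mul0r.
by rewrite ler_pdivrMr ?powR_gt0 ?enorm_gt0 ?subr_eq0//; exact: h.
Qed.

Lemma C1a_intro (al M K : R) O f (fd : 'I_n.+1 -> V -> R) : 0 < al -> 0 <= M -> 0 <= K -> open O ->
  (forall x, closure O x -> blim (closure O) f x (f x)) ->
  (forall x, closure O x -> `|f x| <= M) ->
  (forall i x, O x -> is_derive x (ee i) (f : V -> R^o) (fd i x : R)) ->
  (forall i x, O x -> `|fd i x| <= K) ->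
  (forall i x y, O x -> O y -> `|fd i x - fd i y| <= K * enorm (x - y) `^ al) ->
  C1a al O f /\ C1a_norm al O (f : V -> R^o) <= M + N * (K + K).
Proof.
move=> al0 M0 K0 oO cf bf df bd hd.
have pE i x : O x -> partial i f x = fd i x.
  by move=> Ox; have d := df i x Ox; exact: (@derive_val _ _ _ _ _ _ _ d).
have bd' i x : O x -> `|partial i f x : R| <= K by move=> Ox; rewrite pE//; exact: bd.
have hd' i x y : O x -> O y -> `|(partial i f x : R) - partial i f y| <= K * enorm (x - y) `^ al.
  by move=> Ox Oy; rewrite !pE//; exact: hd.
split.
  split.
  - exact/withinP.
  - exact: bounded_intro bf.
  - move=> i; split.
    + by move=> x Ox; have d := df i x Ox; exact: (@ex_derive _ _ _ _ _ _ _ d).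
    + have [g [gE cg]] := holder_extend al0 K0 (hd' i).
      by exists g; split => //; exact/withinP.
    + exact: bounded_intro (bd' i).
    + by apply: (@bounded_intro _ _ _ K) => xy Oxy; exact: holder_quot_le (hd' i).
rewrite /C1a_norm; apply: lerD; first exact: supnorm_le.
have -> : N * (K + K) = \sum_(i < n.+1) (K + K) by rewrite sumr_const card_ord mulr_natl.
apply: ler_sum => i _; apply: lerD; first by apply: supnorm_le => // x; exact: bd'.
by apply: supnorm_le => // xy Oxy; exact: holder_quot_le (hd' i).
Qed.

Lemma C1a_congr (al : R) O f g : open O -> (forall x, closure O x -> f x = g x) ->
  C1a al O f -> C1a al O g.
Proof.
move=> oO fg [cf bf pf].
have fgO x : O x -> f x = g x by move=> Ox; apply: fg; exact: subset_closure.
have dg i x : O x -> is_derive x (ee i) (g : V -> R^o) (partial i f x : R).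
  move=> Ox; apply: (is_derive_congr oO Ox (f := f : V -> R^o)) => //.
  by have [df _ _ _] := pf i; apply: DeriveDef; [exact: df|].
have pE i x : O x -> partial i g x = partial i f x.
  by move=> Ox; have d := dg i x Ox; exact: (@derive_val _ _ _ _ _ _ _ d).
have hE i xy : (O `*` O) xy -> holder_quot al (partial i g) xy = holder_quot al (partial i f) xy.
  by case=> Ox Oy; rewrite /holder_quot !pE.
split.
  - apply/withinP => x cx; have := (withinP _ _).1 cf x cx; rewrite -fg//.
    by move=> h e e0; have [d d0 hd] := h e e0; exists d => // y cy yx; rewrite -fg//; exact: hd.
  - by have [M [rM hM]] := bf; exists M; split => // M' MM x cx; rewrite /= -fg//; exact: hM.
  - move=> i; have [df [g' [cg' gE]] bd hd] := pf i; split.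
    + by move=> x Ox; have d := dg i x Ox; exact: (@ex_derive _ _ _ _ _ _ _ d).
    + by exists g'; split => // x Ox; rewrite pE//; exact: gE.
    + by have [M [rM hM]] := bd; exists M; split => // M' MM x Ox; rewrite /= pE//; exact: hM.
    + by have [M [rM hM]] := hd; exists M; split => // M' MM x Ox; rewrite /= hE//; exact: hM.
Qed.

Definition ext0 O f : V -> R^o := fun x => if `[< closure O x >] then f x else 0.

Lemma ext0E O f x : closure O x -> ext0 O f x = f x.
Proof. by move=> cx; rewrite /ext0 asboolT. Qed.

Lemma ext0_out O f x : ~ closure O x -> ext0 O f x = 0.
Proof. by move=> nx; rewrite /ext0 asboolF. Qed.

Lemma ext0_pred (al : R) O f : C1a al O (ext0 O f) -> ext0 O f \in C1a_space_pred al O.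
Proof. by move=> h; apply/asboolP; split; [exact: h|exact: ext0_out]. Qed.

Definition mkC1a (al : R) O f (h : C1a al O (ext0 O f)) : C1a_space al O := MkC1a (ext0_pred h).

Lemma mkC1aE (al : R) O f (h : C1a al O (ext0 O f)) x : closure O x -> mkC1a h x = f x.
Proof. exact: ext0E. Qed.

Lemma mkC1a_norm (al : R) O f (h : C1a al O (ext0 O f)) : `|mkC1a h| = C1a_norm al O (ext0 O f).
Proof. by []. Qed.

Lemma C1a_restrict (al : R) O D f : open D -> D `<=` O -> C1a al O f ->
  C1a al D f.
Proof.
move=> oD DO [cf bf pf]; have cDO := closure_subset DO.
have cw (g : V -> R^o) : {within closure O, continuous g} -> {within closure D, continuous g}.
  move=> /withinP h; apply/withinP => x cx; apply: (blim_sub cDO); exact/h/cDO.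
split; first exact: cw.
- by have [M [rM hM]] := bf; exists M; split => // M' MM x cx; apply: hM MM _ _; exact: cDO.
- move=> i; have [df [g' [cg' gE]] bd hd] := pf i; split.
  + by move=> x /DO; exact: df.
  + by exists g'; split; [exact: cw|move=> x /DO; exact: gE].
  + by have [M [rM hM]] := bd; exists M; split => // M' MM x Dx; apply: hM MM _ _; exact: DO.
  + by have [M [rM hM]] := hd; exists M; split => // M' MM x [Dx Dy]; apply: hM MM _ _; split; exact: DO.
Qed.

(** The class in which all expansions take place before they are read in [C1a_space]: it is governed
    by a sup bound alone. *)
Definition adm O (del : R) u (M : R) := [/\ harm (outr O del) u,
  forall x, outr O del x -> `|u x| <= M &
  \bd z of O, del < enorm z -> blim (outr O del) u z 0].

(** On the closure of the observed set, the points outside [outr] are boundary points of [O], where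
    [u] tends to 0 but has no prescribed value. *)
Definition cut O (del : R) u x : R := if `[< outr O del x >] then u x else 0.

(** By [bdry_gradient] a sup bound controls first derivatives and their Hoelder quotients beyond
    [3 del]; sup estimates of series thus pass to the Schauder norm. *)
Lemma adm_embed O (al kap rf del : R) D : 0 < al -> al < 1 -> 0 < kap -> 0 < rf -> 0 < del -> open O ->
  (\bd z of O, exists nu, flat_at al O z nu kap rf) ->
  open D -> D `<=` O -> (forall x, D x -> 3 * del <= enorm x) ->
  exists2 C : R, 0 <= C & forall u (M : R), 0 <= M -> adm O del u M ->
    exists F : C1a_space al D, (forall x, closure D x -> F x = cut O del u x) /\ `|F| <= C * M.
Proof.
move=> al0 al1 kap0 rf0 del0 oO hflat oD DO D3.
have [C C0 hC] := bdry_gradient al0 al1 kap0 rf0 del0 oO hflat.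
exists (1 + N * (C + C)); first by rewrite addr_ge0// mulr_ge0// addr_ge0.
move=> u M M0 [hu uM u0].
have D3c x : closure D x -> 3 * del <= enorm x.
  move=> /closure_enormP cx; apply/ler_addgt0Pr => e e0; have [y /D3 y3 yx] := cx e e0.
  have [_ h] := enorm_rdistP y x; lra_on h y3 yx.
have Dd x : closure D x -> del < enorm x by move=> /D3c; lra_on del0.
have Do x : D x -> outr O del x by move=> Dx; split; [exact: DO|apply: Dd; exact: subset_closure].
have oo : open (outr O del) by exact: outr_open.
have cE x : outr O del x -> cut O del u x = u x by move=> h; rewrite /cut asboolT.
have [CC nE] : C1a al D (ext0 D (cut O del u)) /\ C1a_norm al D (ext0 D (cut O del u)) <= M + N * (C * M + C * M).
  apply: (@C1a_intro al M (C * M) D _ (fun i => partial i u)) => //.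
  - by rewrite mulr_ge0.
  - move=> x cx; suff : blim (closure D) (cut O del u) x (cut O del u x).
      move=> h e e0; have [d d0 hd] := h e e0; exists d => // y cy yx.
      by rewrite !ext0E//; exact: hd.
    have [Ox|nOx] := pselect (O x).
      have xo : outr O del x by split => //; exact: Dd.
      apply: cont_blim; apply: (cont_congr oo xo (f := u)); last exact: harm_cont hu xo.
      by move=> y /cE.
    have cOx := closure_subset DO cx.
    have -> : cut O del u x = 0 by rewrite /cut asboolF// => -[].
    move=> e e0; have [d d0 hd] := u0 x cOx nOx (Dd x cx) e e0; exists d => // y cy yx.
    rewrite /cut; case: asboolP => [yo|_]; first exact: hd.
    by rewrite subrr normr0.
  - by move=> x cx; rewrite ext0E// /cut; case: asboolP => [/uM//|_]; rewrite normr0.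
  - move=> i x Dx; have xo := Do x Dx; apply: (is_derive_congr oD Dx (f := u : V -> R^o)).
      by move=> y Dy; rewrite ext0E ?cE//; [exact: Do|exact: subset_closure].
    by have [h _] := harm_partial_wit oo hu; have [_ _ _ h' _] := h x xo; exact: h'.
  - move=> i x Dx; have [h _] := hC u M M0 hu uM u0 i; apply: h; [exact: DO|exact: D3].
  - move=> i x y Dx Dy; have [_ h] := hC u M M0 hu uM u0 i; apply: h; [exact: DO|exact: DO|exact: D3|exact: D3].
exists (mkC1a CC); split; first by move=> x; exact: mkC1aE.
rewrite mkC1a_norm; apply: le_trans nE _.
by apply: le_of_eq; ring.
Qed.

End GradientHolder.

(** * From double power series to real analytic maps *)

Section AnalyticSeries.
Context {R : realType}.

Lemma prod_ord_if (a b : R) (k j : nat) : (j <= k)%N ->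
  \prod_(i < k) (if (i < j)%N then a else b) = a ^+ j * b ^+ (k - j).
Proof.
elim: k => [|k IH]; first by rewrite leqn0 => /eqP->; rewrite big_ord0 !expr0 mulr1.
rewrite big_ord_recr/= leq_eqVlt => /orP[/eqP->|].
  rewrite ltnS leqnn subnn expr0 mulr1 (eq_bigr (fun=> a)); last by move=> i _; rewrite ltnS ltnW.
  by rewrite prodr_const card_ord exprSr.
rewrite ltnS => jk; rewrite IH// ltnNge jk/= subSn// -mulrA; congr (_ * _).
by rewrite exprSr.
Qed.

Lemma pow2_ge (k : nat) : k.+1%:R * (2^-1 : R) ^+ k <= 1.
Proof.
rewrite exprVn ler_pdivrMr ?exprn_gt0// mul1r -natrX ler_nat.
by elim: k => // k IH; rewrite expnS; lia.
Qed.

Lemma half_pow_le (k : nat) : (2^-1 : R) ^+ k <= @ik R k.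
Proof. by rewrite -[leRHS]mul1r /ik ler_pdivlMr// mulrC; exact: pow2_ge. Qed.

(** The form of order [k] takes first components in its first [j] arguments and second components in
    the others; on the diagonal this is the monomial of exponents [j] and [k - j]. *)
Lemma analytic_of_series (W : normedModType R) (S : set (R * R)) (UU : R * R -> W) :
  (forall e0, S e0 -> exists (c : nat -> nat -> W) (M A r C : R),
    [/\ 0 <= M, 0 < A, 0 < r, forall j l, `|c j l| <= M * A ^+ (j + l) &
     forall e, S e -> `|e - e0| < r -> forall K : nat,
       `|UU e - \sum_(k < K.+1) \sum_(j < k.+1)
          ((e - e0).1 ^+ j * (e - e0).2 ^+ (k - j)) *: c j (k - j)%N| <= C * (2^-1) ^+ K]) ->
  real_analytic_on S UU.
Proof.
move=> h e0 Se0; have [c [M [A [r [C [M0 A0 r0 cM hU]]]]]] := h e0 Se0.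
pose pr k (j : nat) (v : 'I_k -> R * R) : R := \prod_(i < k) (if (i < j)%N then (v i).1 else (v i).2).
pose P k (v : 'I_k -> R * R) : W := \sum_(j < k.+1) pr k j v *: c j (k - j)%N.
(* With [A r1 <= 1/4 = 1/2 * 1/2], one factor absorbs the [k + 1] monomials of order [k] and the
   other leaves a geometric series. *)
pose r1 : R := Num.min r (4 * A)^-1.
have r10 : 0 < r1 by rewrite lt_min r0 invr_gt0 mulr_gt0.
have rA : A * r1 <= 4^-1.
  have : r1 <= (4 * A)^-1 by rewrite ge_min lexx orbT.
  by rewrite -(ler_pM2l A0) invfM mulrCA mulfV ?mulr1// gt_eqF.
exists P, (fun k => k.+1%:R * M * A ^+ k), r1; split => //.
- move=> k i v a x y; rewrite /P scaler_sumr -big_split/=; apply: eq_bigr => j _.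
  rewrite scalerA -scalerDl; congr (_ *: _).
  have e (z : R * R) : pr k j (fun j0 => if j0 == i then z else v j0) =
      (if (i < j)%N then z.1 else z.2) * \prod_(i0 < k | i0 != i) (if (i0 < j)%N then (v i0).1 else (v i0).2).
    rewrite /pr (bigD1 i)//= eqxx; congr (_ * _).
    by apply: eq_bigr => i0 /negbTE->.
  by rewrite !e mulrA -mulrDl; congr (_ * _); case: ifP.
- move=> k v; apply: le_trans (ler_norm_sum _ _ _) _.
  have pb (j : nat) : `|pr k j v| <= \prod_(i < k) `|v i|.
    rewrite /pr normr_prod; apply: ler_prod => i _; rewrite normr_ge0/=.
    by case: ifP => _; rewrite prod_normE le_max lexx ?orbT.
  have p0 : 0 <= \prod_(i < k) `|v i| by apply: prodr_ge0.
  apply: (@le_trans _ _ (\sum_(j < k.+1) (M * A ^+ k * \prod_(i < k) `|v i|))).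
    apply: ler_sum => j _; rewrite normrZ mulrC; apply: ler_pM => //.
    by apply: le_trans (cM _ _) _; rewrite subnKC// -ltnS.
  by rewrite sumr_const card_ord -[leRHS]mulrA -[leRHS]mulrA mulr_natl mulrA.
- apply: (@series_le_cvg _ _ (geometric M 2^-1)).
  + by move=> k; rewrite !mulr_ge0// exprn_ge0// ltW.
  + by move=> k; rewrite /geometric/= mulr_ge0// exprn_ge0.
  + move=> k; rewrite /geometric/= -[leLHS]mulrA -exprMn mulrAC mulrC ler_wpM2l//.
    apply: (@le_trans _ _ (k.+1%:R * (4^-1) ^+ k)).
      by rewrite ler_wpM2l// lerXn2r// nnegrE ?mulr_ge0 ?ltW.
    have -> : 4^-1 = 2^-1 * 2^-1 :> R by field.
    by rewrite exprMn mulrA ler_piMl ?exprn_ge0// pow2_ge.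
  + by apply: is_cvg_geometric_series; rewrite ger0_norm// invf_lt1// ltr1n.
- move=> e Se; rewrite lt_min => /andP[er _].
  have {}hU := hU e Se er.
  have PE k : P k (fun=> e - e0) = \sum_(j < k.+1) ((e - e0).1 ^+ j * (e - e0).2 ^+ (k - j)) *: c j (k - j)%N.
    by apply: eq_bigr => j _; rewrite /pr prod_ord_if// -ltnS.
  have C0 : 0 <= C by have := hU 0%N; rewrite expr0 mulr1; apply: le_trans.
  apply/cvgrPdist_le => eps eps0.
  have C1 : 0 < C + 1 by rewrite ltr_wpDl.
  have [k0 kk] := @ik_small R (eps / (C + 1)) (divr_gt0 eps0 C1).
  exists k0.+1 => // K /=; case: K => // K; rewrite ltnS => kK.
  rewrite /series/= big_mkord.
  under eq_bigr do rewrite PE.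
  apply: le_trans (hU K) _.
  apply: (@le_trans _ _ (C * @ik R k0)).
    rewrite ler_wpM2l//; apply: le_trans (half_pow_le K) _.
    by rewrite /ik lef_pV2 ?posrE// ler_nat ltnS.
  apply: (@le_trans _ _ ((C + 1) * ik k0)); last by rewrite mulrC -ler_pdivlMr// ltW.
  by rewrite ler_wpM2r// ?ltW ?ik_gt0// ltrDl.
Qed.

End AnalyticSeries.

(** * Double series with a geometric rate *)

Section DoubleSeries.
Context {R : realType}.
Implicit Types (g s : nat -> R) (G : nat -> nat -> R) (C M q S x : R) (j k l : nat).
Local Notation h2 := (2^-1 : R).

(** The rate [2^-K] is fixed once and for all and [C] also bounds the sum; nested sums and
    convolutions then stay quantitative and uniform in parameters. *)
Definition lim1 g C S := forall K : nat, `|S - \sum_(j < K) g j| <= C * h2 ^+ K.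

Definition sum2 (K : nat) G : R := \sum_(j < K) \sum_(l < K) G j l.

Definition lim2 G C S := forall K : nat, `|S - sum2 K G| <= C * h2 ^+ K.

Lemma h2_ge0 k : 0 <= h2 ^+ k. Proof. by rewrite exprn_ge0. Qed.

Lemma lim2_le G C C' S : C <= C' -> lim2 G C S -> lim2 G C' S.
Proof. by move=> CC h K; apply: le_trans (h K) _; rewrite ler_wpM2r// h2_ge0. Qed.

Lemma lim1_eq g g' C S : (forall j, g j = g' j) -> lim1 g C S -> lim1 g' C S.
Proof. by move=> /funext ->. Qed.

Lemma lim2_eq G G' C S : (forall j l, G j l = G' j l) -> lim2 G C S -> lim2 G' C S.
Proof.
move=> gg; have -> // : G = G' by apply/funext => j; apply/funext => l.
Qed.

Lemma lim1_bound g C S : lim1 g C S -> `|S| <= C.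
Proof. by move=> /(_ 0%N); rewrite big_ord0 subr0 expr0 mulr1. Qed.

Lemma lim2_bound G C S : lim2 G C S -> `|S| <= C.
Proof. by move=> /(_ 0%N); rewrite /sum2 big_ord0 subr0 expr0 mulr1. Qed.

Lemma lim1Z x g C S : lim1 g C S -> lim1 (fun j => x * g j) (`|x| * C) (x * S).
Proof.
by move=> h K; rewrite -mulr_sumr -mulrBr normrM -mulrA ler_wpM2l.
Qed.

Lemma lim2Z x G C S : lim2 G C S -> lim2 (fun j l => x * G j l) (`|x| * C) (x * S).
Proof.
move=> h K; rewrite /sum2; under eq_bigr do rewrite -mulr_sumr.
by rewrite -mulr_sumr -mulrBr normrM -mulrA ler_wpM2l//; exact: h.
Qed.

Lemma lim2D G G' C C' S S' : lim2 G C S -> lim2 G' C' S' ->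
  lim2 (fun j l => G j l + G' j l) (C + C') (S + S').
Proof.
move=> h h' K; rewrite /sum2; under eq_bigr do rewrite big_split.
rewrite big_split/= opprD addrACA mulrDl; apply: le_trans (ler_normD _ _) _.
by apply: lerD; [exact: h|exact: h'].
Qed.

Lemma lim2B G G' C C' S S' : lim2 G C S -> lim2 G' C' S' ->
  lim2 (fun j l => G j l - G' j l) (C + C') (S - S').
Proof.
move=> h /(lim2Z (-1)); rewrite normrN1 mul1r mulN1r => /(lim2D h).
by apply: lim2_eq => j l; rewrite mulN1r.
Qed.

Lemma lim2_uniq G C C' S S' : lim2 G C S -> lim2 G C' S' -> S = S'.
Proof.
move=> h h'; apply/eqP; rewrite -subr_eq0 -normr_le0.
apply: (@le_lim_ik R _ _ (C + C')) => k; rewrite add0r.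
have C0 : 0 <= C by apply: le_trans (lim2_bound h).
have C'0 : 0 <= C' by apply: le_trans (lim2_bound h').
rewrite -(subrKA (sum2 k G)); apply: le_trans (ler_normD _ _) _.
rewrite mulrDl; apply: lerD.
  by apply: le_trans (h k) _; rewrite ler_wpM2l// half_pow_le.
by rewrite distrC; apply: le_trans (h' k) _; rewrite ler_wpM2l// half_pow_le.
Qed.

Lemma geom_sum q K : 0 <= q -> q <= h2 -> \sum_(j < K) q ^+ j <= 2.
Proof.
move=> q0 q1; suff : \sum_(j < K) q ^+ j <= 2 - 2 * h2 ^+ K.
  by move/le_trans; apply; rewrite gerBl mulr_ge0// h2_ge0.
elim: K => [|K IH]; first by rewrite big_ord0 expr0 mulr1 subrr.
rewrite big_ord_recr/=; have : q ^+ K <= h2 ^+ K by rewrite lerXn2r// nnegrE.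
by rewrite exprS; move: IH; lra.
Qed.

Lemma lim1_ex g M q : 0 <= M -> 0 <= q -> q <= h2 -> (forall j, `|g j| <= M * q ^+ j) ->
  exists S, lim1 g (2 * M) S.
Proof.
move=> M0 q0 q1 gM.
have stp k j : `|\sum_(i < k + j) g i - \sum_(i < k) g i| <= 2 * M * (h2 ^+ k - h2 ^+ (k + j)).
  elim: j => [|j IH]; first by rewrite addn0 !subrr normr0 mulr0.
  rewrite addnS big_ord_recr/= -addrA addrCA; apply: le_trans (ler_normD _ _) _.
  have h : `|g (k + j)%N| <= M * h2 ^+ (k + j).
    by apply: le_trans (gM _) _; rewrite ler_wpM2l// lerXn2r// nnegrE.
  rewrite exprS; move: IH h; clear; lra.
have p0 k : 0 <= 2 * M * h2 ^+ k by rewrite !mulr_ge0// h2_ge0.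
have [|S hS] := @seq_lim R (fun k => \sum_(i < k) g i) (fun k => 2 * M * h2 ^+ k).
  move=> k l; have [kl|/ltnW lk] := leqP k l.
    have := stp k (l - k)%N; rewrite subnKC// distrC => /le_trans; apply.
    by have := p0 l; lra.
  have := stp l (k - l)%N; rewrite subnKC// => /le_trans; apply.
  by have := p0 k; lra.
by exists S => k; rewrite distrC; exact: hS.
Qed.

(** The factors [q^j] in the inner constants make the errors of the [K] inner truncations add up to
    at most [2 C 2^-K]. *)
Lemma lim2_nest G s C C' q S : 0 <= C -> 0 <= q -> q <= h2 ->
  (forall j, lim1 (G j) (C * q ^+ j) (s j)) -> lim1 s C' S -> lim2 G (C' + 2 * C) S.
Proof.
move=> C0 q0 q1 hG hs K.
rewrite -(subrKA (\sum_(j < K) s j)); apply: le_trans (ler_normD _ _) _.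
rewrite mulrDl; apply: lerD; first exact: hs.
rewrite /sum2 -sumrB; apply: le_trans (ler_norm_sum _ _ _) _.
apply: (@le_trans _ _ (\sum_(j < K) C * h2 ^+ K * q ^+ j)).
  by apply: ler_sum => j _; rewrite mulrAC; exact: hG.
have -> : 2 * C * h2 ^+ K = C * h2 ^+ K * 2 by ring.
rewrite -mulr_sumr ler_wpM2l//; last exact: geom_sum.
by apply: mulr_ge0 => //; exact: h2_ge0.
Qed.

Lemma lim2_ex G M q : 0 <= M -> 0 <= q -> q <= h2 -> (forall j l, `|G j l| <= M * q ^+ (j + l)) ->
  exists S, lim2 G (8 * M) S.
Proof.
move=> M0 q0 q1 GM.
have /choice[s hs] : forall j, exists s : R, lim1 (G j) (2 * M * q ^+ j) s.
  move=> j; have [||S hS] := @lim1_ex (G j) (M * q ^+ j) q _ q0 q1.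
  - by rewrite mulr_ge0// exprn_ge0.
  - by move=> l; rewrite -mulrA -exprD.
  by exists S; rewrite -mulrA.
have [||S hS] := @lim1_ex s (2 * M) q _ q0 q1.
- by rewrite mulr_ge0.
- by move=> j; exact: lim1_bound (hs j).
exists S; apply: lim2_le (lim2_nest _ q0 q1 hs hS); last by rewrite mulr_ge0.
by rewrite -mulrDl mulrA; lra.
Qed.

Lemma sum_tri (F : nat -> nat -> R) K : \sum_(A < K) \sum_(a < A.+1) F a (A - a)%N =
  \sum_(a < K) \sum_(b < K) (if (a + b < K)%N then F a b else 0).
Proof.
have e1 (A : 'I_K) : \sum_(a < A.+1) F a (A - a)%N = \sum_(a < K) (if (a <= A)%N then F a (A - a)%N else 0).
  rewrite -big_mkcond/= -(big_mkord (fun a => (a <= A)%N) (fun a => F a (A - a)%N)).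
  rewrite -(big_mkord xpredT (fun a => F a (A - a)%N)).
  rewrite (@big_cat_nat _ _ _ A.+1 0 K)//= ?ltn_ord//.
  rewrite [X in _ + X]big_nat_cond [X in _ + X]big1 ?addr0; last first.
    by move=> i /andP[/andP[h1 _] h3]; move: (leq_trans h1 h3); rewrite ltnn.
  by rewrite big_nat_cond [RHS]big_nat_cond; apply: eq_bigl => i; rewrite ltnS; case: (i <= A)%N.
rewrite (eq_bigr _ (fun A _ => e1 A)) exchange_big; apply: eq_bigr => a _ /=.
rewrite -(big_mkord xpredT (fun A => if (a <= A)%N then F a (A - a)%N else 0)).
rewrite -(big_mkord xpredT (fun b => if (a + b < K)%N then F a b else 0)).
rewrite (@big_cat_nat _ _ _ (val a) 0 K)//= ?(ltnW (ltn_ord a))//.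
rewrite big_nat_cond big1 ?add0r; last first.
  by move=> i /andP[/andP[_ h1] _]; rewrite leqNgt h1.
rewrite (@big_cat_nat _ _ _ (K - a)%N 0 K)//= ?leq_subr//.
rewrite [X in _ = _ + X]big_nat_cond [X in _ = _ + X]big1 ?addr0; last first.
  move=> i /andP[/andP[h1 _] _]; rewrite ltnNge ifF//; apply/negbTE; rewrite negbK.
  by rewrite -leq_subLR.
rewrite -{1}[val a]add0n big_addn big_nat_cond [RHS]big_nat_cond.
apply: eq_bigr => i /andP[/andP[_ h1] _]; rewrite leq_addl addnK ifT//.
by move: h1 => /=; have := ltn_ord a; lia.
Qed.

(* Crude count: at most [K^4 <= 16^K] terms, each at most [64^-K]. *)
Lemma pow4_le (K : nat) : K%:R ^+ 4 * (64^-1 : R) ^+ K <= h2 ^+ K.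
Proof.
have k2 : K%:R <= 2 ^+ K :> R by rewrite -natrX ler_nat ltnW// ltn_expl.
have : K%:R ^+ 4 <= 16 ^+ K :> R.
  have -> : 16 = 2 ^+ 4 :> R by ring.
  by rewrite exprAC lerXn2r// nnegrE.
move=> h; apply: (@le_trans _ _ (16 ^+ K * 64^-1 ^+ K)); first by rewrite ler_wpM2r// exprn_ge0.
by rewrite -exprMn lerXn2r// ?nnegrE; lra.
Qed.

Lemma pow2_le (K : nat) : K%:R ^+ 2 * (64^-1 : R) ^+ K <= h2 ^+ K.
Proof.
case: K => [|K]; first by rewrite expr0n/= mul0r expr0.
apply: le_trans (pow4_le K.+1); rewrite ler_wpM2r ?exprn_ge0//.
by rewrite ler_weXn2l// ler1n.
Qed.

Lemma sum_cst K x : \sum_(j < K) x = K%:R * x.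
Proof. by rewrite sumr_const card_ord mulr_natl. Qed.

Lemma tri_trunc G M C S : 0 <= M -> (forall j l, `|G j l| <= M * 64^-1 ^+ (j + l)) -> lim2 G C S ->
  forall K, `|S - \sum_(k < K) \sum_(j < k.+1) G j (k - j)%N| <= (C + M) * h2 ^+ K.
Proof.
move=> M0 GM hG K; rewrite sum_tri -(subrKA (sum2 K G)); apply: le_trans (ler_normD _ _) _.
rewrite mulrDl; apply: lerD; first exact: hG.
rewrite /sum2 -sumrB; apply: le_trans (ler_norm_sum _ _ _) _.
apply: (@le_trans _ _ (\sum_(j < K) \sum_(l < K) M * 64^-1 ^+ K)).
  apply: ler_sum => j _; rewrite -sumrB; apply: le_trans (ler_norm_sum _ _ _) _.
  apply: ler_sum => l _; case: ifPn => [_|]; first by rewrite subrr normr0 mulr_ge0// exprn_ge0.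
  rewrite -leqNgt => h; rewrite subr0; apply: le_trans (GM _ _) _; rewrite ler_wpM2l//.
  by apply: ler_wiXn2l => //; rewrite invf_le1 ?ler1n.
rewrite !sum_cst; move: (pow2_le K); move: (64^-1 ^+ K) => x hx.
have -> : K%:R * (K%:R * (M * x)) = M * (K%:R ^+ 2 * x) by ring.
by rewrite ler_wpM2l.
Qed.

(** A double series of double series is regrouped by total exponents. The two truncations differ by
    at most [K^4] terms, each of total exponent at least [K] and hence of size at most [M 64^-K]. *)
Lemma lim2_conv (G : nat -> nat -> nat -> nat -> R) (s : nat -> nat -> R) M C C' S : 0 <= M -> 0 <= C ->
  (forall a' b' a b, `|G a' b' a b| <= M * 64^-1 ^+ (a' + b' + (a + b))) ->
  (forall a' b', lim2 (G a' b') (C * 64^-1 ^+ (a' + b')) (s a' b')) -> lim2 s C' S ->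
  lim2 (fun A B => \sum_(a < A.+1) \sum_(b < B.+1) G a b (A - a)%N (B - b)%N) (C' + 4 * C + M) S.
Proof.
move=> M0 C0 GM hG hs K.
have q0 : 0 <= 64^-1 :> R by [].
have q1 : 64^-1 <= h2 by lra.
pose W := \sum_(a' < K) \sum_(b' < K) sum2 K (G a' b').
have h1 : `|S - W| <= (C' + 4 * C) * h2 ^+ K.
  rewrite -(subrKA (sum2 K s)); apply: le_trans (ler_normD _ _) _.
  rewrite mulrDl; apply: lerD; first exact: hs.
  rewrite /sum2 /W -sumrB; apply: le_trans (ler_norm_sum _ _ _) _.
  apply: (@le_trans _ _ (\sum_(a' < K) C * h2 ^+ K * 64^-1 ^+ a' * 2)).
    apply: ler_sum => a' _; rewrite -sumrB; apply: le_trans (ler_norm_sum _ _ _) _.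
    apply: (@le_trans _ _ (\sum_(b' < K) C * h2 ^+ K * 64^-1 ^+ a' * 64^-1 ^+ b')).
      by apply: ler_sum => b' _; apply: le_trans (hG _ _ K) _; rewrite exprD; apply: le_of_eq; ring.
    rewrite -mulr_sumr ler_wpM2l//; last exact: geom_sum.
    by apply: mulr_ge0; [apply: mulr_ge0 => //; exact: h2_ge0|exact: exprn_ge0].
  rewrite -mulr_suml -mulr_sumr.
  have -> : 4 * C * h2 ^+ K = C * h2 ^+ K * 2 * 2 by ring.
  rewrite ler_wpM2r// ler_wpM2l//; last exact: geom_sum.
  by apply: mulr_ge0 => //; exact: h2_ge0.
rewrite mulrDl -(subrKA W); apply: le_trans (ler_normD _ _) _; apply: lerD => //.
pose T (a' b' a b : nat) : R := if (a' + a < K)%N && (b' + b < K)%N then G a' b' a b else 0.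
have -> : sum2 K (fun A B => \sum_(a < A.+1) \sum_(b < B.+1) G a b (A - a)%N (B - b)%N) =
    \sum_(a' < K) \sum_(b' < K) sum2 K (T a' b').
  have e (A : 'I_K) : \sum_(B < K) \sum_(a < A.+1) \sum_(b < B.+1) G a b (A - a)%N (B - b)%N =
      \sum_(a < A.+1) (\sum_(b' < K) \sum_(b < K) (if (b' + b < K)%N then G a b' (A - a)%N b else 0)).
    rewrite exchange_big; apply: eq_bigr => a _; exact: (sum_tri (fun b' b => G a b' (A - a)%N b)).
  rewrite /sum2 (eq_bigr _ (fun A _ => e A)).
  rewrite (sum_tri (fun a' a => \sum_(b' < K) \sum_(b < K) (if (b' + b < K)%N then G a' b' a b else 0))).
  apply: eq_bigr => a' _; rewrite [RHS]exchange_big/=; apply: eq_bigr => a _; rewrite /T.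
  case: ifP => _; first by apply: eq_bigr => b' _; apply: eq_bigr.
  by rewrite big1// => b' _; rewrite big1.
apply: (@le_trans _ _ (\sum_(a' < K) \sum_(b' < K) \sum_(a < K) \sum_(b < K) M * 64^-1 ^+ K)).
  rewrite /W -sumrB; apply: le_trans (ler_norm_sum _ _ _) _; apply: ler_sum => a' _.
  rewrite -sumrB; apply: le_trans (ler_norm_sum _ _ _) _; apply: ler_sum => b' _.
  rewrite /sum2 -sumrB; apply: le_trans (ler_norm_sum _ _ _) _; apply: ler_sum => a _.
  rewrite -sumrB; apply: le_trans (ler_norm_sum _ _ _) _; apply: ler_sum => b _.
  rewrite /T; case: ifPn => [_|]; first by rewrite subrr normr0 mulr_ge0// exprn_ge0.
  rewrite negb_and -!leqNgt subr0 => h; apply: le_trans (GM _ _ _ _) _; rewrite ler_wpM2l//.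
  apply: ler_wiXn2l => //; first by rewrite invf_le1 ?ler1n.
  by case/orP: h; lia.
rewrite !sum_cst; move: (pow4_le K); move: (64^-1 ^+ K) => x hx.
have -> : K%:R * (K%:R * (K%:R * (K%:R * (M * x)))) = M * (K%:R ^+ 4 * x) by ring.
by rewrite ler_wpM2l.
Qed.

Lemma lim2_embed g C S : 0 <= C -> lim1 g C S -> lim2 (fun a b => if a == 0%N then g b else 0) C S.
Proof.
move=> C0 h [|K]; first by rewrite /sum2 big_ord0; have := h 0%N; rewrite big_ord0.
have -> : sum2 K.+1 (fun a b => if a == 0%N then g b else 0) = \sum_(b < K.+1) g b; last exact: h.
by rewrite /sum2 big_ord_recl/= [X in _ + X]big1 ?addr0// => i _; rewrite big1.
Qed.

End DoubleSeries.

(** * The multipole expansion of a decaying exterior solution *)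

Section ExteriorExpansion.
Context {R : realType} {n : nat}.
Local Notation V := 'rV[R]_n.+1.
Local Notation N := (n.+1%:R : R).
Local Notation L := n.-1.
Local Notation AA := (@A0 R n).
Implicit Types (x y z v : V) (r M K a b d m t s : R) (E : set V) (f g u h w : V -> R).

(** [f (x + t v)] is harmonic in [v], so [coef_harm] applies to its expansion in [t]. This also
    yields the continuity of the coefficients in the direction. *)
Lemma tc_harm_dir f x r M k : 0 < r -> harm (eB x r) f ->
  (forall y, eB x r y -> `|f y| <= M) -> harm setT (fun v => tc k v f x).
Proof.
move=> r0 hf fM; apply: harm_local => v _; exists 1 => //.
pose Q : R := enorm v + 1; have Q0 : 0 < Q by rewrite ltr_wpDl// enorm_ge0.
have vQ y : eB v 1 y -> enorm y <= Q.
  rewrite /eB/= => h; have [_] := enorm_rdistP y v.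
  by rewrite /Q; clear -R n h; lra.
apply: (@coef_harm _ _ (eB v 1) (fun t y => f (x + t *: y)) (fun k y => tc k y f x) M (2 * AA * Q / r) (r / (2 * Q))).
- exact: eB_open.
- by rewrite divr_gt0// mulr_gt0.
- move=> t /andP[t0 tr]; apply: harm_sub (harm_aff t x hf) => y /vQ yQ.
  rewrite /eB/= addrC addKr enormZ gtr0_norm//; rewrite ltr_pdivlMr ?mulr_gt0// in tr.
  have := ler_wpM2l (ltW t0) yQ; clear -R n tr r0 t0 Q0; nra.
- move=> J t y /andP[t0 tr] /vQ yQ; rewrite ltr_pdivlMr ?mulr_gt0// in tr.
  have ty : enorm (t *: y) <= r / 2.
    rewrite enormZ gtr0_norm//; have := ler_wpM2l (ltW t0) yQ; clear -R n tr r0 t0 Q0; nra.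
  have M0 : 0 <= M by apply: le_trans (fM x (eB_center x r0)).
  have := taylor J r0 hf fM ty.
  have -> : \sum_(j < J) tc j (t *: y) f x = \sum_(j < J) t ^+ j * tc j y f x.
    by apply: eq_bigr => j _; rewrite (tc_scale _ _ _ (@eB_open _ _ x r) hf (eB_center x r0)).
  move/le_trans; apply; rewrite ler_wpM2l// lerXn2r ?nnegrE//.
  + by rewrite divr_ge0 ?(ltW r0)// mulr_ge0 ?enorm_ge0// mulr_ge0// ltW// A0_gt0.
  + by rewrite mulr_ge0 ?(ltW t0)// divr_ge0 ?(ltW r0)// mulr_ge0 ?(ltW Q0)// mulr_ge0// ltW// A0_gt0.
  + rewrite [leRHS]mulrAC ler_wpM2r ?invr_ge0 ?(ltW r0)// -[leRHS]mulrA ler_wpM2l//.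
      by rewrite mulr_ge0// ltW// A0_gt0.
    by rewrite enormZ gtr0_norm// mulrC ler_wpM2r// ltW.
Qed.

Lemma taylor_lim1 f x r M v s : 0 < r -> harm (eB x r) f ->
  (forall y, eB x r y -> `|f y| <= M) -> 4 * AA * (`|s| * enorm v) <= r ->
  lim1 (fun j => tc j v f x * s ^+ j) M (f (x + s *: v)).
Proof.
move=> r0 hf fM sv J; have M0 : 0 <= M by apply: le_trans (fM x (eB_center x r0)).
have A1 := @A0_ge1 R n; have sv0 : 0 <= `|s| * enorm v by rewrite mulr_ge0// enorm_ge0.
have vr : enorm (s *: v) <= r / 2 by rewrite enormZ; clear -R n A1 sv0 sv; nra.
have := taylor J r0 hf fM vr.
have -> : \sum_(j < J) tc j (s *: v) f x = \sum_(j < J) tc j v f x * s ^+ j.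
  by apply: eq_bigr => j _; rewrite (tc_scale _ _ _ (@eB_open _ _ x r) hf (eB_center x r0)) mulrC.
move/le_trans; apply; rewrite ler_wpM2l// lerXn2r ?nnegrE//.
  by rewrite divr_ge0 ?(ltW r0)// mulr_ge0 ?enorm_ge0// mulr_ge0// ltW// A0_gt0.
rewrite ler_pdivrMr// enormZ; move: sv; clear -R n; move: (`|s| * _) => q; nra.
Qed.

Lemma pw_fund x : (2 <= n.+1)%N -> pw (1 - N / 2) x = (enorm x ^+ L)^-1.
Proof.
move=> n2; rewrite pw_norm -powR_mulrn ?enorm_ge0// -powRN; congr (_ `^ _).
have -> : N = L%:R + 2 by rewrite -natrD; congr (_%:R); lia.
by field.
Qed.

(** Inversion fixes the unit sphere and is continuous there, so Kelvin's transform keeps boundary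
    values. *)
Lemma inversion_dist y z : y != 0 -> enorm z = 1 ->
  enorm ((sqn y)^-1 *: y - z) = enorm (y - z) / enorm y.
Proof.
move=> y0 z1; have yp : 0 < enorm y by rewrite enorm_gt0.
have q0 : sqn y != 0 by rewrite gt_eqF// sqn_gt0.
apply/eqP; rewrite -(@eqrXn2 _ 2) ?divr_ge0 ?enorm_ge0//; apply/eqP.
rewrite exprMn exprVn !enorm_sqr -/(sqn y) !dotpBl !dotpBr !dotpZl !dotpZr (dotpC z y) -!/(sqn _).
by rewrite [sqn z]sqnE z1; field.
Qed.

(* Outside a ball a decaying harmonic function is the Kelvin transform of a harmonic function in the unit ball,
   whose Taylor coefficients at 0 yield the multipole expansion. *)
Lemma exterior_kelvin E u r C : (3 <= n.+1)%N -> 0 < r -> 0 <= C -> open E ->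
  (forall x, r <= enorm x -> E x) -> harm E u ->
  (forall x, E x -> `|u x| <= C * pw (1 - N / 2) x) ->
  exists h, [/\ harm (eB 0 1) h, (forall y, eB 0 1 y -> `|h y| <= C * (r ^+ L)^-1) &
    forall y, 1 < enorm y -> u (r *: y) = kelvin h y].
Proof.
move=> n3 r0 C0 oE rE hu uC; have n2 : (2 <= n.+1)%N by exact: ltnW.
have Er y : 1 <= enorm y -> E (r *: y).
  by move=> y1; apply: rE; rewrite enormZ gtr0_norm// ler_peMr// ltW.
pose g y : R := u (r *: y).
have gC y : 1 <= enorm y -> `|g y| <= C * (r ^+ L)^-1 * (enorm y ^+ L)^-1.
  move=> y1; apply: le_trans (uC _ (Er y y1)) _.
  by rewrite pw_fund// enormZ (gtr0_norm r0) exprMn invfM mulrA.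
have cg y : 1 <= enorm y -> cont_at g y.
  move=> y1; have := @cont_aff _ _ u r 0 y; rewrite add0r => h.
  have := h (harm_cont hu (Er y y1)); rewrite /g.
  by have -> : (fun y => u (0 + r *: y)) = (fun y => u (r *: y)) by apply/funext => q; rewrite add0r.
have [|h [h1 h2 h3 h4]] := @unit_ball_solve R n g n2.
  by move=> x x1; apply: cont_blim; apply: cg; rewrite x1.
have CC0 : 0 <= C * (r ^+ L)^-1 by rewrite mulr_ge0// invr_ge0 exprn_ge0// ltW.
have hC y : enorm y <= 1 -> `|h y| <= C * (r ^+ L)^-1.
  move=> y1; apply: (@harm_norm_ball _ _ (0 : V) 1 h) => //.
  - by move=> z zs; apply: h3; move: zs; rewrite /sphere/= subr0 => ->.
  - move=> z; rewrite /sphere/= subr0 => z1; rewrite h2//; apply: le_trans (gC z _) _; rewrite z1//.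
    by rewrite expr1n invr1 mulr1.
  - by rewrite /cball/= subr0.
exists h; split => //.
  by move=> y; rewrite /eB/= subr0 => /ltW; exact: hC.
move=> y y1; apply/eqP; rewrite -subr_eq0 -normr_le0.
have oD : open [set x : V | 1 < enorm x].
  apply/openP_enorm => x /= x1; exists (enorm x - 1) => [|q /= qx]; first by rewrite subr_gt0.
  by have [+ _] := enorm_rdistP q x; clear -R n qx; lra.
have inv1 x : 1 <= enorm x -> enorm ((sqn x)^-1 *: x) <= 1.
  move=> x1; have xp : 0 < enorm x by lra.
  rewrite enormZ sqnE ger0_norm ?invr_ge0 ?sqr_ge0// expr2 invfM -mulrA mulVf ?gt_eqF// mulr1.
  by rewrite invf_le1.
apply: (@harm_exterior_max _ _ [set x : V | 1 < enorm x] (fun x => g x - kelvin h x) (C * (r ^+ L)^-1 + C * (r ^+ L)^-1)) => //.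
- apply: harmB => //; have := @harm_aff _ _ E u r 0 hu.
  have -> : (fun y => u (0 + r *: y)) = g by apply/funext => q; rewrite add0r.
  by apply: harm_sub => x /= x1; rewrite add0r; exact/Er/ltW.
- move=> x /= x1; apply: le_trans (ler_normB _ _) _; rewrite mulrDl; apply: lerD.
    by rewrite pw_fund//; apply: gC; exact: ltW.
  rewrite /kelvin normrM (ger0_norm (pw_ge0 _ _)) [leLHS]mulrC.
  by apply: ler_wpM2r; [exact: pw_ge0|apply: hC; apply: inv1; exact: ltW].
move=> z cz nz.
have z1 : enorm z = 1.
  apply/eqP; rewrite eq_le leNgt; apply/andP; split; first exact/negP.
  apply/ler_addgt0Pr => e e0; move/closure_enormP: cz => /(_ e e0)[q /= q1 qz].
  by have [_] := enorm_rdistP q z; clear -R n q1 qz; lra.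
have z0 : z != 0 by rewrite -enorm_gt0 z1.
have pz : pw (1 - N / 2) z = 1 by rewrite pw_fund// z1 expr1n invr1.
have bk : blim [set x : V | 1 < enorm x] (kelvin h) z (1 * g z).
  have b1 : blim [set x : V | 1 < enorm x] (fun x => h ((sqn x)^-1 *: x)) z (g z).
    move=> e e0; have zz : enorm z <= 1 by rewrite z1.
    have [d d0 hd] := h3 z zz e e0; exists d => // x /= x1 xz; rewrite -h2//; apply: hd.
      by rewrite /cball/= subr0; apply: inv1; exact: ltW.
    have xp : 0 < enorm x by lra.
    rewrite inversion_dist// -?enorm_gt0// ltr_pdivrMr//; apply: lt_le_trans xz _.
    by rewrite ler_peMr ?ltW//.
  have b2 := @cont_blim _ _ [set x : V | 1 < enorm x] _ z (cont_pw (1 - N / 2) z0); rewrite pz in b2.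
  move=> e e0; have e1 : 0 < Num.min 1 (e / (`|g z| + 2)).
    by rewrite lt_min ltr01 divr_gt0// ltr_wpDl.
  have [d1 d10 hd1] := b1 _ e1; have [d2 d20 hd2] := b2 _ e1.
  exists (Num.min d1 d2) => [|x Dx]; first by rewrite lt_min d10.
  rewrite lt_min => /andP[/(hd1 x Dx) h5 /(hd2 x Dx) h6]; rewrite /kelvin.
  move: h5 h6; rewrite !lt_min => /andP[p1 p2] /andP[p3 p4].
  set P := pw _ x in p3 p4 *; set H := h _ in p1 p2 *.
  have -> : P * H - 1 * g z = (P - 1) * (H - g z) + (H - g z) + (P - 1) * g z by ring.
  rewrite ltr_pdivlMr ?ltr_wpDl// in p2; rewrite ltr_pdivlMr ?ltr_wpDl// in p4.
  apply: le_lt_trans (ler_normD _ _) _; apply: le_lt_trans (lerD (ler_normD _ _) (lexx _)) _.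
  rewrite !normrM; move: p1 p2 p3 p4 (normr_ge0 (H - g z)) (normr_ge0 (P - 1)) (normr_ge0 (g z)).
  by move: `|H - _| `|P - 1| `|g z| => q1 q2 q3; clear -R n e0; nra.
have bg : blim [set x : V | 1 < enorm x] g z (g z) by apply: cont_blim; apply: cg; rewrite z1.
move=> e e0; have := blimB bg bk; rewrite mul1r subrr => /(_ e e0)[d d0 hd].
by exists d => // x Dx xz; rewrite add0r; have := hd x Dx xz; rewrite subr0 => /ltW.
Qed.

Lemma sum_shift (g : nat -> R) (m K : nat) :
  \sum_(j < K) (if (j < m)%N then 0 else g (j - m)%N) = \sum_(j < K - m) g j.
Proof.
elim: K => [|K IH]; first by rewrite sub0n !big_ord0.
rewrite big_ord_recr/= IH; case: (ltnP K m) => Km; last by rewrite subSn// big_ord_recr.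
by rewrite addr0 (eqP (_ : (K.+1 - m == 0)%N)) ?subn_eq0// (eqP (_ : (K - m == 0)%N)) ?subn_eq0// ltnW.
Qed.

(** For [U v = r v / |v|^2] one has [w (v / t) = (t r / |v|)^L h (t U v)] with [h] harmonic in the
    unit ball. The expansion in [t] is thus the Taylor expansion of [h] at 0 shifted by [L], the
    dimension minus 2; the shift makes [P 0] vanish. *)
Lemma multipoles E w r C : (3 <= n.+1)%N -> 0 < r -> 0 <= C -> open E ->
  (forall x, r <= enorm x -> E x) -> harm E w ->
  (forall x, E x -> `|w x| <= C * pw (1 - N / 2) x) ->
  exists P : nat -> V -> R, [/\ forall k, harm [set v : V | v != 0] (P k),
    forall v, P 0%N v = 0,
    forall del k v, 0 < del -> del <= enorm v -> `|P k v| <= C * (r ^+ L)^-1 * (AA * r / del) ^+ k &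
    forall del v t, 0 < t -> 0 < del -> 4 * AA * r * t <= del -> del <= enorm v ->
      lim1 (fun k => P k v * t ^+ k) (C * (r ^+ L)^-1) (w (t^-1 *: v))].
Proof.
move=> n3 r0 C0 oE rE hw wC; have n2 : (2 <= n.+1)%N by exact: ltnW.
have [h [hh hC wh]] := exterior_kelvin n3 r0 C0 oE rE hw wC.
set B := C * _ in hC *; have B0 : 0 <= B by rewrite mulr_ge0// invr_ge0 exprn_ge0// ltW.
clearbody B; clear C0 wC.
have A1 := @A0_ge1 R n; have Ap := @A0_gt0 R n.
pose U v : V := r *: ((sqn v)^-1 *: v).
have UE v : v != 0 -> enorm (U v) = r / enorm v.
  move=> v0; rewrite /U !enormZ sqnE ger0_norm ?(ltW r0)// ger0_norm ?invr_ge0 ?sqr_ge0//.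
  by have := v0; rewrite -enorm_gt0 => vp; field; rewrite gt_eqF.
pose P k v : R := if (k < L)%N then 0 else (r / enorm v) ^+ L * tc (k - L) (U v) h 0.
have est (eta : R) v t (K : nat) : 0 < eta -> 0 < t -> eta <= enorm v -> 2 * AA * r * t <= eta ->
    `|w (t^-1 *: v) - \sum_(k < K) P k v * t ^+ k| <= B * (2 * AA * r * t / eta) ^+ K.
  move=> e0 t0 ev te; have vp : 0 < enorm v by apply: lt_le_trans ev.
  have v0 : v != 0 by rewrite -enorm_gt0.
  set q := r / enorm v; have q0 : 0 < q by rewrite divr_gt0.
  have tr0 : 0 < t * r by rewrite mulr_gt0.
  have tq : 2 * AA * (t * q) <= 2 * AA * r * t / eta.
    have -> : 2 * AA * (t * q) = 2 * AA * r * t / enorm v by rewrite /q; ring.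
    by rewrite ler_pM2l ?lef_pV2 ?posrE ?mulr_gt0.
  have tq0 : 0 <= t * q by rewrite mulr_ge0 ?ltW.
  have le1 : 2 * AA * r * t / eta <= 1 by rewrite ler_pdivrMr// mul1r.
  have tq1 : t * q <= 2^-1 by move: tq le1; clear -R n A1 tq0; move: (t * q) tq0 => s; nra.
  have -> : w (t^-1 *: v) = (t * q) ^+ L * h (t *: U v).
    have -> : t^-1 *: v = r *: ((t * r)^-1 *: v).
      by rewrite scalerA; congr (_ *: _); field; rewrite !gt_eqF.
    have ny : enorm ((t * r)^-1 *: v) = (t * q)^-1.
      by rewrite enormZ ger0_norm ?invr_ge0 ?ltW// /q; field; rewrite !gt_eqF.
    have ny1 : 1 < enorm ((t * r)^-1 *: v).
      have tqp : 0 < t * q by exact: mulr_gt0.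
      by rewrite ny -[ltLHS]invr1 ltf_pV2 ?posrE ?ltr01//; move: tq1; clear -R n; lra.
    rewrite wh// /kelvin pw_fund// ny exprVn invrK; congr (_ * h _).
    rewrite sqnE ny /U !scalerA sqnE; congr (_ *: _); rewrite /q.
    by field; rewrite !gt_eqF.
  have -> : \sum_(k < K) P k v * t ^+ k = (t * q) ^+ L * \sum_(j < K - L) tc j (t *: U v) h 0.
    rewrite mulr_sumr -(sum_shift (fun j => (t * q) ^+ L * tc j (t *: U v) h 0)).
    apply: eq_bigr => k _; rewrite /P; case: ltnP => kL; first by rewrite mul0r.
    rewrite (tc_scale _ _ _ (@eB_open _ _ (0 : V) 1) hh (eB_center (0 : V) ltr01)) -/q.
    have -> : t ^+ k = t ^+ (k - L) * t ^+ L by rewrite -exprD subnK.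
    by rewrite [(t * q) ^+ L]exprMn; move: (tc _ _ _ _) (q ^+ L) (t ^+ L) (t ^+ (k - L)) => a1 a2 a3 a4; ring.
  have tU : enorm (t *: U v) = t * q by rewrite enormZ (gtr0_norm t0) UE.
  have b2 : enorm (t *: U v) <= 1 / 2 by rewrite tU div1r.
  rewrite -mulrBr normrM ger0_norm ?exprn_ge0//.
  have := taylor (K - L) ltr01 hh hC b2; rewrite add0r tU divr1.
  move=> h1; apply: (@le_trans _ _ ((t * q) ^+ L * (B * (2 * AA * (t * q)) ^+ (K - L)))).
    by rewrite ler_wpM2l// exprn_ge0.
  rewrite mulrCA ler_wpM2l//; set Q := 2 * AA * (t * q) in tq *.
  have Q0 : 0 <= Q by rewrite mulr_ge0// mulr_ge0// ltW.
  have QQ : t * q <= Q by rewrite /Q; clear -R n A1 tq0; move: (t * q) tq0 => s; nra.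
  apply: (@le_trans _ _ (Q ^+ K)); last by rewrite lerXn2r ?nnegrE//; apply: le_trans tq.
  apply: (@le_trans _ _ (Q ^+ L * Q ^+ (K - L))).
    by rewrite ler_wpM2r ?exprn_ge0// lerXn2r ?nnegrE.
  have Q1 : Q <= 1 by exact: le_trans tq le1.
  clearbody Q; rewrite -exprD; apply: ler_wiXn2l => //; clear; lia.
exists P; split.
- move=> k; apply: harm_local => x x0; have xp : 0 < enorm x by rewrite enorm_gt0.
  pose eta := enorm x / 2; have e0 : 0 < eta by rewrite divr_gt0.
  have near y : eB x eta y -> eta <= enorm y.
    rewrite /eB/= => yx; have [+ _] := enorm_rdistP y x.
    by move: yx; rewrite /eta; clear -R n; lra.
  exists eta => //; apply: (@coef_harm _ _ (eB x eta) (fun t y => w (t^-1 *: y)) P B (2 * AA * r / eta) (eta / (2 * AA * r))).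
  + exact: eB_open.
  + by rewrite divr_gt0// !mulr_gt0.
  + move=> t /andP[t0]; rewrite ltr_pdivlMr ?mulr_gt0// => tA.
    have := @harm_aff _ _ E w t^-1 0 hw.
    have -> : (fun y => w (0 + t^-1 *: y)) = (fun y => w (t^-1 *: y)) by apply/funext => y; rewrite add0r.
    apply: harm_sub => y /near yx /=; rewrite add0r; apply: rE.
    rewrite enormZ ger0_norm ?invr_ge0 ?(ltW t0)// mulrC ler_pdivlMr//.
    apply: le_trans yx; apply: le_trans (ltW tA); rewrite mulrC ler_wpM2l ?(ltW t0)//.
    by clear -R n A1 r0; nra.
  + move=> K t y /andP[t0]; rewrite ltr_pdivlMr ?mulr_gt0// => tA /near yx.
    have := est eta y t K e0 t0 yx.
    under [X in _ - X]eq_bigr do rewrite mulrC.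
    rewrite [_ * t / eta]mulrAC; apply; rewrite mulrC; exact: ltW.
- move=> v; rewrite /P; case: (ltnP 0 L) => // h0; exfalso; move: h0 n3; clear; lia.
- move=> del k v d0 dv; rewrite /P; have vp : 0 < enorm v by apply: lt_le_trans dv.
  have b0 : 0 <= AA * r / del by rewrite divr_ge0 ?mulr_ge0 ?ltW.
  case: ltnP => kL; first by rewrite normr0 mulr_ge0// exprn_ge0.
  have v0 : v != 0 by rewrite -enorm_gt0.
  have q0 : 0 <= (r / enorm v) ^+ L by rewrite exprn_ge0// divr_ge0 ?(ltW r0) ?(ltW vp).
  rewrite normrM ger0_norm//.
  apply: le_trans (ler_wpM2l q0 (tc_est (U v) (k - L) ltr01 hh hC)) _.
  rewrite UE// divr1 mulrCA ler_wpM2l// -{2}(subnKC kL) exprD; apply: ler_pM.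
  + exact: q0.
  + by rewrite exprn_ge0// mulr_ge0 ?(ltW Ap)// divr_ge0 ?(ltW r0) ?(ltW vp).
  + rewrite lerXn2r ?nnegrE//; first by rewrite divr_ge0 ?(ltW r0) ?(ltW vp).
    apply: (@le_trans _ _ (r / del)).
      by rewrite ler_wpM2l ?(ltW r0)// lef_pV2 ?posrE.
    by rewrite ler_wpM2r ?invr_ge0 ?(ltW d0)//; clear -R n r0 A1; nra.
  + rewrite lerXn2r ?nnegrE//; first by rewrite mulr_ge0 ?divr_ge0 ?(ltW r0) ?(ltW Ap) ?(ltW vp).
    by rewrite mulrA ler_wpM2l ?mulr_ge0 ?(ltW r0) ?(ltW Ap)// lef_pV2 ?posrE.
- move=> del v t t0 d0 td dv K; apply: le_trans (est del v t K d0 t0 dv _) _.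
    have s0 : 0 < AA * r * t by rewrite !mulr_gt0.
    by move: td s0; rewrite -!mulrA; move: (AA * (r * t)) => s; clear -R n; lra.
  have p0 : 0 <= 2 * AA * r * t by rewrite !mulr_ge0 ?(ltW r0) ?(ltW Ap) ?(ltW t0).
  rewrite ler_wpM2l// lerXn2r ?nnegrE//; first by rewrite divr_ge0 ?(ltW d0).
  rewrite ler_pdivrMr//; move: td; rewrite -!mulrA; move: (AA * (r * t)) => s; clear -R n; lra.
Qed.

End ExteriorExpansion.

Lemma choice2 (S T U : Type) (P : S -> T -> U -> Prop) :
  (forall a b, exists x, P a b x) -> exists f, forall a b, P a b (f a b).
Proof. by move=> h; exists (fun a b => projT1 (cid (h a b))) => a b; exact: projT2 (cid (h a b)). Qed.

(** * Monomials in the two parameters and their rearrangement *)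

Section MonomialSeries.
Context {R : realType}.
Implicit Types (G : nat -> nat -> R) (C M q S A : R) (j k l : nat).
Local Notation q0 := (64^-1 : R).

Definition mon (e1 e2 : R) (a b : nat) : R := e1 ^+ a * e2 ^+ b.

(** The margin [1 / 64] pays for the number of terms in [lim2_conv]. *)
Definition small A (e1 e2 : R) := A * `|e1| <= q0 /\ A * `|e2| <= q0.

Lemma q0_ge0 k : 0 <= q0 ^+ k. Proof. by rewrite exprn_ge0. Qed.

Lemma q0_le : q0 <= 2^-1. Proof. by rewrite lef_pV2 ?posrE// ler_nat. Qed.

Lemma small_le A A' e1 e2 : 0 <= A' <= A -> small A e1 e2 -> small A' e1 e2.
Proof.
by move=> /andP[A0 AA] [h1 h2]; split; [apply: le_trans h1|apply: le_trans h2]; rewrite ler_wpM2r.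
Qed.

Lemma mon_bound M A c e1 e2 a b : 0 <= M -> 0 <= A -> small A e1 e2 -> `|c : R| <= M * A ^+ (a + b) ->
  `|c * mon e1 e2 a b| <= M * q0 ^+ (a + b).
Proof.
move=> M0 A0 [h1 h2] hc; rewrite normrM /mon normrM !normrX.
apply: (@le_trans _ _ (M * A ^+ (a + b) * (`|e1| ^+ a * `|e2| ^+ b))).
  by rewrite ler_wpM2r// mulr_ge0// exprn_ge0.
rewrite -mulrA ler_wpM2l// !exprD mulrACA -!exprMn; apply: ler_pM; rewrite ?exprn_ge0 ?mulr_ge0//.
- by rewrite lerXn2r ?nnegrE ?mulr_ge0.
- by rewrite lerXn2r ?nnegrE ?mulr_ge0.
Qed.

Lemma lim1_tri G C M S : 0 <= M -> (forall j l, `|G j l| <= M * q0 ^+ (j + l)) -> lim2 G C S ->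
  lim1 (fun k => \sum_(j < k.+1) G j (k - j)%N) (C + M) S.
Proof. by move=> M0 GM hG K; exact: tri_trunc. Qed.

(** Passes from the variables [e1] and [t = e1 e2] to [e1] and [e2]: the monomial [e1^l t^j]
    acquires exponents [(j + l, j)], so only [b <= a] occurs. *)
Lemma lim2_shear G C M S : 0 <= M -> (forall j l, `|G j l| <= M * q0 ^+ (j + l)) -> lim2 G C S ->
  lim2 (fun a b => if (b <= a)%N then G b (a - b)%N else 0) (C + M) S.
Proof.
move=> M0 GM hG K; have := tri_trunc M0 GM hG K.
suff -> : sum2 K (fun a b => if (b <= a)%N then G b (a - b)%N else 0) =
  \sum_(k < K) \sum_(j < k.+1) G j (k - j)%N by [].
apply: eq_bigr => a _; rewrite -big_mkcond/= -(big_mkord (fun b => (b <= a)%N) (fun b => G b (a - b)%N)).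
rewrite -(big_mkord xpredT (fun b => G b (a - b)%N)).
rewrite (@big_cat_nat _ _ _ a.+1 0 K)//= ?ltn_ord//.
rewrite [X in _ + X]big_nat_cond [X in _ + X]big1 ?addr0; last first.
  by move=> i /andP[/andP[h1 _] h3]; move: (leq_trans h1 h3); rewrite ltnn.
by rewrite big_nat_cond [RHS]big_nat_cond; apply: eq_bigl => i; rewrite ltnS; case: (i <= a)%N.
Qed.

End MonomialSeries.

(** * Expansions of the field away from the hole and at the hole *)

Section FarNear.
Context {R : realType} {n : nat}.
Local Notation V := 'rV[R]_n.+1.
Local Notation N := (n.+1%:R : R).
Local Notation AA := (@A0 R n).
Local Notation q0 := (64^-1 : R).
Implicit Types (x y z v nu p xi : V) (r B del M A X : R) (P : nat -> V -> R) (O D E Om : set V) (f g h u w : V -> R).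

Record multipole w P r B : Prop := Multipole {
  mp_r : 0 < r;
  mp_B : 0 <= B;
  mp_harm : forall k, harm [set v : V | v != 0] (P k);
  mp_0 : forall v, P 0%N v = 0;
  mp_bound : forall del k v, 0 < del -> del <= enorm v -> `|P k v| <= B * (AA * r / del) ^+ k;
  mp_lim : forall del v t, 0 < t -> 0 < del -> 4 * AA * r * t <= del -> del <= enorm v ->
    lim1 (fun k => P k v * t ^+ k) B (w (t^-1 *: v)) }.

(** Coefficient of [e1^a e2^b] in [w ((x - e1 p) / (e1 e2))]: the multipole of order [b] in
    [t = e1 e2], expanded to order [a - b] along [- p]. *)
Definition fcoef P p (a b : nat) x : R := if (b <= a)%N then tc (a - b) (- p) (P b) x else 0.

(** Collects the ratios of both expansions, multipoles at distance [del / 2] and Taylor series of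
    radius [del / 2] along [p], with the margin 4 asked for by [mp_lim] and [taylor_lim1]. *)
Definition fA r del p : R := 1 + 4 * AA * (2 * r / del + 2 * enorm p / del).

Lemma n0_open : open [set v : V | v != 0].
Proof.
apply/openP_enorm => x x0; exists (enorm x); first by rewrite enorm_gt0.
by move=> y yx /=; apply: contraTneq yx => ->; rewrite sub0r enormN ltxx.
Qed.

Lemma far_ball del x y : del <= enorm x -> eB x (del / 2) y -> del / 2 <= enorm y.
Proof.
rewrite /eB/= => xd yx; have [+ _] := enorm_rdistP y x.
by move: yx xd; clear -R n; lra.
Qed.

Lemma fA_ge1 r del p : 0 < r -> 0 < del -> 1 <= fA r del p.
Proof.
move=> r0 d0; rewrite /fA lerDl mulr_ge0// ?mulr_ge0 ?(ltW (@A0_gt0 R n))//.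
by rewrite addr_ge0// divr_ge0 ?(ltW d0)// mulr_ge0// ?(ltW r0) ?enorm_ge0.
Qed.

Lemma fA_parts r del p : 0 < r -> 0 < del -> [/\ 4 * (AA * r / (del / 2)) <= fA r del p,
  4 * (AA * enorm p / (del / 2)) <= fA r del p, 0 <= AA * r / (del / 2) & 0 <= AA * enorm p / (del / 2)].
Proof.
move=> r0 d0; have h (s : R) : 0 <= s -> 0 <= AA * s / (del / 2).
  by move=> s0; apply: divr_ge0; [rewrite mulr_ge0// ltW// A0_gt0|rewrite divr_ge0// ltW].
have h1 := h r (ltW r0); have h2 := h _ (enorm_ge0 p).
have -> : fA r del p = 1 + 4 * (AA * r / (del / 2)) + 4 * (AA * enorm p / (del / 2)).
  by rewrite /fA; field; rewrite gt_eqF.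
by split => //; move: h1 h2; move: (AA * r / _) (AA * enorm p / _) => s1 s2; clear -R n; lra.
Qed.

Lemma small_fA r del p e1 e2 : 0 < r -> 0 < del -> 0 < e1 -> 0 < e2 -> small (fA r del p) e1 e2 ->
  [/\ fA r del p * e1 <= q0, fA r del p * e2 <= q0, e1 <= 1 & e2 <= 1].
Proof.
move=> r0 d0 e10 e20 []; rewrite !gtr0_norm// => s1 s2; have A1 := fA_ge1 p r0 d0.
have q1 : q0 <= 1 by rewrite invf_le1 ?ler1n.
split => //.
  by apply: le_trans q1; apply: le_trans s1; rewrite ler_peMl ?(ltW e10).
by apply: le_trans q1; apply: le_trans s2; rewrite ler_peMl ?(ltW e20).
Qed.

Section Fixed.
Variables (w : V -> R) (P : nat -> V -> R) (r B : R).
Hypothesis mp : multipole w P r B.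

Lemma P_ball del x k : 0 < del -> del <= enorm x -> harm (eB x (del / 2)) (P k).
Proof.
move=> d0 xd; apply: harm_sub (mp_harm mp k) => y /(far_ball xd) yd /=.
by rewrite -enorm_gt0; apply: lt_le_trans yd; rewrite divr_gt0.
Qed.

Lemma fcoef_harm p a b : harm [set v : V | v != 0] (fcoef P p a b).
Proof.
rewrite /fcoef; have [_|_] := leqP b a; last exact: harm_cst.
by apply: harm_tc; [exact: n0_open|exact: (mp_harm mp)].
Qed.

Lemma fcoef0 p a x : fcoef P p a 0 x = 0.
Proof.
rewrite /fcoef leq0n subn0; apply/eqP; rewrite -normr_le0.
have -> : P 0%N = (fun=> 0) by apply/funext => v; rewrite (mp_0 mp).
have := @tc_est R n (- p) (fun=> 0) x 1 0 a ltr01 (harm_cst _ _); rewrite mul0r; apply.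
by move=> y _; rewrite normr0.
Qed.

Lemma tcP_bound del x k j p : 0 < del -> del <= enorm x ->
  `|tc j p (P k) x| <= B * (AA * r / (del / 2)) ^+ k * (AA * enorm p / (del / 2)) ^+ j.
Proof.
move=> d0 xd; have d20 : 0 < del / 2 by rewrite divr_gt0.
apply: (tc_est _ _ d20 (P_ball k d0 xd)) => y yB; apply: (mp_bound mp) => //; exact: far_ball yB.
Qed.

Lemma fcoef_bound del x a b p : 0 < del -> del <= enorm x -> `|fcoef P p a b x| <= B * fA r del p ^+ (a + b).
Proof.
move=> d0 xd; have [r0 B0] := (mp_r mp, mp_B mp).
have A1 := fA_ge1 p r0 d0; have A0 : 0 <= fA r del p by apply: le_trans A1.
rewrite /fcoef; case: ifP => ba; last by rewrite normr0 mulr_ge0// exprn_ge0.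
apply: le_trans (tcP_bound _ _ _ d0 xd) _; rewrite enormN.
have [h1 h2 h3 h4] := fA_parts p r0 d0; rewrite -mulrA ler_wpM2l//.
apply: (@le_trans _ _ (fA r del p ^+ b * fA r del p ^+ (a - b))); last first.
  by rewrite -exprD; apply: ler_weXn2l => //; move: ba; clear; lia.
move: h1 h2 h3 h4 A0; move: (fA r del p) (AA * r / _) (AA * enorm p / _) => F s1 s2 h1 h2 h3 h4 A0.
apply: ler_pM; rewrite ?exprn_ge0//; apply: lerXn2r; rewrite ?nnegrE//; lra.
Qed.

Lemma near_lim1 del p x k s : 0 < del -> del <= enorm x -> 4 * (AA * enorm p / (del / 2)) * `|s| <= 1 ->
  lim1 (fun j => tc j p (P k) x * s ^+ j) (B * (AA * r / (del / 2)) ^+ k) (P k (x + s *: p)).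
Proof.
move=> d0 xd sp; have d20 : 0 < del / 2 by rewrite divr_gt0.
apply: (taylor_lim1 d20 (P_ball k d0 xd)).
  by move=> y yB; apply: (mp_bound mp) => //; exact: far_ball yB.
have -> : 4 * AA * (`|s| * enorm p) = 4 * (AA * enorm p / (del / 2)) * `|s| * (del / 2).
  by field; rewrite gt_eqF.
by rewrite ler_piMl ?(ltW d20).
Qed.

Lemma far_shift del p x s : 0 < del -> del <= enorm x -> 4 * (AA * enorm p / (del / 2)) * `|s| <= 1 ->
  del / 2 <= enorm (x + s *: p).
Proof.
move=> d0 xd; have -> : 4 * (AA * enorm p / (del / 2)) * `|s| = 8 * AA * (`|s| * enorm p) / del.
  by field; rewrite gt_eqF.
rewrite ler_pdivrMr// mul1r -enormZ => h.
apply: (far_ball xd); rewrite /eB/= addrC addKr.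
have := @A0_ge1 R n; have := enorm_ge0 (s *: p); move: h d0; move: (enorm (s *: p)) AA => q A.
by clear -R n w P r B mp; nra.
Qed.

(* The multipole series in [t], each multipole being expanded about [x]. *)
Lemma shift_lim2 del p x s t : 0 < del -> 0 < t -> del <= enorm x ->
  fA r del p * `|s| <= q0 -> fA r del p * t <= q0 ->
  (forall k j, `|tc j p (P k) x * s ^+ j * t ^+ k| <= B * q0 ^+ (k + j)) /\
  lim2 (fun k j => tc j p (P k) x * s ^+ j * t ^+ k) (3 * B) (w (t^-1 *: (x + s *: p))).
Proof.
move=> d0 t0 xd hs ht; have [r0 B0] := (mp_r mp, mp_B mp).
have A1 := fA_ge1 p r0 d0; have [h1 h2 h3 h4] := fA_parts p r0 d0.
have q1 : 2 * q0 <= 1 by lra.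
have sp : 4 * (AA * enorm p / (del / 2)) * `|s| <= 1.
  have := ler_wpM2r (normr_ge0 s) h2; move: hs q1; move: (q0) => Q; lra.
set X := AA * r / (del / 2) in h1 h3; set Y := AA * enorm p / (del / 2) in h2 h4.
have s0 := normr_ge0 s.
have Xt : X * t <= q0 by apply: le_trans ht; move: h1 h3 t0; clear -R n; nra.
have Ys : Y * `|s| <= q0 by apply: le_trans hs; move: h2 h4 s0; clear -R n; nra.
have Xt0 : 0 <= X * t by rewrite mulr_ge0// ltW.
have Ys0 : 0 <= Y * `|s| by rewrite mulr_ge0.
split.
  move=> k j; rewrite normrM normrM !normrX (gtr0_norm t0).
  apply: (@le_trans _ _ (B * X ^+ k * Y ^+ j * `|s| ^+ j * t ^+ k)).
    rewrite ler_wpM2r ?exprn_ge0 ?(ltW t0)// ler_wpM2r ?exprn_ge0//; exact: tcP_bound.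
  have -> : B * X ^+ k * Y ^+ j * `|s| ^+ j * t ^+ k = B * ((X * t) ^+ k * (Y * `|s|) ^+ j).
    by rewrite !exprMn; ring.
  by rewrite ler_wpM2l// exprD; apply: ler_pM; rewrite ?exprn_ge0// lerXn2r ?nnegrE.
have -> : 3 * B = B + 2 * B by ring.
apply: (@lim2_nest R _ (fun k => P k (x + s *: p) * t ^+ k) _ _ (X * t)) => //.
- apply: le_trans Xt _; exact: q0_le.
- move=> k; have := lim1Z (t ^+ k) (near_lim1 k d0 xd sp).
  rewrite ger0_norm ?exprn_ge0 ?(ltW t0)// -/X (exprMn k X t).
  have -> : t ^+ k * (B * X ^+ k) = B * (X ^+ k * t ^+ k) by ring.
  by rewrite [_ * P k _]mulrC; apply: lim1_eq => j; rewrite mulrC.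
- apply: (mp_lim mp (del := del / 2)) => //; first by rewrite divr_gt0.
    have -> : 4 * AA * r * t = (4 * X) * t * (del / 2) by rewrite /X; field; rewrite gt_eqF.
    rewrite ler_piMl//; first by rewrite divr_ge0// ltW.
    by have := ler_wpM2r (ltW t0) h1; move: ht q1; move: (q0) => Q; clear -R n; lra.
  exact: far_shift.
Qed.

Lemma far_series del p x e1 e2 : 0 < del -> 0 < e1 -> 0 < e2 -> del <= enorm x ->
  small (fA r del p) e1 e2 ->
  lim2 (fun a b => fcoef P p a b x * mon e1 e2 a b) (4 * B) (w ((e1 * e2)^-1 *: (x - e1 *: p))).
Proof.
move=> d0 e10 e20 xd sm; have [r0 B0] := (mp_r mp, mp_B mp).
have [s1 s2 l1 l2] := small_fA r0 d0 e10 e20 sm.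
have A1 := fA_ge1 p r0 d0.
have pN : fA r del (- p) = fA r del p by rewrite /fA enormN.
have [|||h1 h2] := @shift_lim2 del (- p) x e1 (e1 * e2) d0 _ xd.
- by rewrite mulr_gt0.
- by rewrite pN gtr0_norm.
- rewrite pN; apply: le_trans s2; rewrite mulrCA ler_piMl// mulr_ge0 ?(ltW e20)//.
  exact: le_trans A1.
rewrite scalerN in h2; have := lim2_shear B0 h1 h2.
have -> : 4 * B = 3 * B + B by ring.
apply: lim2_eq => a b; rewrite /fcoef /mon; case: ifP => ba; last by rewrite mul0r.
have -> : e1 ^+ a = e1 ^+ (a - b) * e1 ^+ b by rewrite -exprD subnK.
by rewrite (exprMn b e1 e2) !mulrA.
Qed.

(** Coefficient of [e2^b] in [w ((z + e2 xi) / e2)]. It describes the mirror image as seen from the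
    hole, where [e1] cancels. *)
Definition ncoef z (xi : V) (b : nat) : R := \sum_(k < b.+1) tc (b - k) xi (P k) z.

Lemma near_series del z xi e2 : 0 < del -> 0 < e2 -> del <= enorm z -> fA r del xi * e2 <= q0 ->
  lim1 (fun b => ncoef z xi b * e2 ^+ b) (4 * B) (w (e2^-1 *: (z + e2 *: xi))).
Proof.
move=> d0 e20 zd sm; have [r0 B0] := (mp_r mp, mp_B mp).
have [|h1 h2] := @shift_lim2 del xi z e2 e2 d0 e20 zd _ sm; first by rewrite gtr0_norm.
have := lim1_tri B0 h1 h2; have -> : 4 * B = 3 * B + B by ring.
apply: lim1_eq => b; rewrite /ncoef mulr_suml; apply: eq_bigr => k _.
by rewrite -mulrA -exprD subnK// -ltnS.
Qed.

Lemma ncoef0 z xi : ncoef z xi 0 = 0.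
Proof.
rewrite /ncoef big_ord_recl big_ord0 addr0; have := fcoef0 (- xi) 0 z.
by rewrite /fcoef leqnn opprK.
Qed.

Lemma ncoef_bound del z xi b : 0 < del -> del <= enorm z ->
  `|ncoef z xi b| <= B * (2 * fA r del xi) ^+ b.
Proof.
move=> d0 zd; have [r0 B0] := (mp_r mp, mp_B mp).
have A1 := fA_ge1 xi r0 d0; have [h1 h2 h3 h4] := fA_parts xi r0 d0.
have F0 : 0 <= fA r del xi by apply: le_trans A1.
apply: le_trans (ler_norm_sum _ _ _) _.
apply: (@le_trans _ _ (\sum_(k < b.+1) B * fA r del xi ^+ b)).
  apply: ler_sum => k _; apply: le_trans (tcP_bound _ _ _ d0 zd) _.
  rewrite -mulrA ler_wpM2l//; have kb : (k <= b)%N by rewrite -ltnS.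
  rewrite -[X in _ <= _ ^+ X](subnKC kb) exprD.
  move: h1 h2 h3 h4 F0; move: (fA r del xi) (AA * r / _) (AA * enorm xi / _) => F s1 s2 h1 h2 h3 h4 F0.
  apply: ler_pM; rewrite ?exprn_ge0//; apply: lerXn2r; rewrite ?nnegrE//; lra.
rewrite sum_cst exprMn mulrCA ler_wpM2l// ler_wpM2r ?exprn_ge0//.
by rewrite -natrX ler_nat ltn_expl.
Qed.

Lemma ncoef_cont z (xi : V) b : z != 0 -> cont_at (fun xi => ncoef z xi b) xi.
Proof.
move=> z0; have zp : 0 < enorm z by rewrite enorm_gt0.
rewrite /ncoef; apply: cont_sum => k.
have d20 : 0 < enorm z / 2 by rewrite divr_gt0.
apply: (harm_cont (O := setT)) => //.
apply: (tc_harm_dir (M := B * (AA * r / (enorm z / 2)) ^+ k) _ d20 (P_ball k zp (lexx _))) => y yB.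
by apply: (mp_bound mp) => //; exact: far_ball (lexx _) yB.
Qed.

End Fixed.

(** Coefficient of [e1^m e2^l] in [f (e1 p + e1 e2 xi)]: the Taylor coefficient of order [m] at 0
    along [p + e2 xi] is harmonic in its direction, and is expanded at [p] along [xi]. *)
Definition qcoef f p (m l : nat) xi : R := tc l xi (fun v => tc m v f 0) p.

Definition hA r p X : R := 1 + 4 * (AA * (enorm p + 1) / r) + 4 * (AA * X).

Lemma hA_parts r p X : 0 < r -> 0 <= X -> [/\ 1 <= hA r p X, 4 * (AA * (enorm p + 1) / r) <= hA r p X,
  4 * (AA * X) <= hA r p X, 0 <= AA * (enorm p + 1) / r & 0 <= AA * X].
Proof.
move=> r0 X0; have A0 := ltW (@A0_gt0 R n).
have h1 : 0 <= AA * (enorm p + 1) / r by rewrite divr_ge0 ?(ltW r0)// mulr_ge0// addr_ge0// enorm_ge0.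
have h2 : 0 <= AA * X by rewrite mulr_ge0.
split => //; rewrite /hA; move: h1 h2; move: (AA * _ / r) (AA * X) => s1 s2; clear -R n; lra.
Qed.

Section Fixed.
Variables (f : V -> R) (r M : R).
Hypothesis r0 : 0 < r.
Hypothesis hf : harm (eB 0 r) f.
Hypothesis fM : forall y, eB 0 r y -> `|f y| <= M.

Lemma eB1 p y : eB p 1 y -> enorm y <= enorm p + 1.
Proof.
rewrite /eB/= => yp; have [_] := enorm_rdistP y p.
by move: yp; clear -R n f r M r0 hf fM; lra.
Qed.

Lemma tc_p_bound p m y : eB p 1 y -> `|tc m y f 0| <= M * (AA * (enorm p + 1) / r) ^+ m.
Proof.
move=> /eB1 yp; have M0 : 0 <= M by apply: le_trans (fM (eB_center (0 : V) r0)).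
apply: le_trans (tc_est y m r0 hf fM) _; rewrite ler_wpM2l// lerXn2r ?nnegrE//.
- by rewrite divr_ge0 ?(ltW r0)// mulr_ge0 ?enorm_ge0// ltW// A0_gt0.
- by rewrite divr_ge0 ?(ltW r0)// mulr_ge0 ?addr_ge0 ?enorm_ge0// ltW// A0_gt0.
- by rewrite ler_wpM2r ?invr_ge0 ?(ltW r0)// ler_wpM2l// ltW// A0_gt0.
Qed.

Lemma tc_p_harm m D : harm D (fun v => tc m v f 0).
Proof. by apply: harm_sub (tc_harm_dir m r0 hf fM). Qed.

Lemma qcoef_tc p m l xi : `|qcoef f p m l xi| <= M * (AA * (enorm p + 1) / r) ^+ m * (AA * enorm xi) ^+ l.
Proof.
have := tc_est xi l ltr01 (tc_p_harm m (eB p 1)) (tc_p_bound m).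
by rewrite divr1.
Qed.

Lemma qcoef_bound p X m l xi : enorm xi <= X -> `|qcoef f p m l xi| <= M * hA r p X ^+ (m + l).
Proof.
move=> xX; have X0 : 0 <= X by apply: le_trans xX; exact: enorm_ge0.
have M0 : 0 <= M by apply: le_trans (fM (eB_center (0 : V) r0)).
apply: le_trans (qcoef_tc _ _ _ _) _; rewrite -mulrA ler_wpM2l// exprD.
have [h0 h1 h2 h3 h4] := hA_parts p r0 X0.
have h5 : AA * enorm xi <= AA * X by rewrite ler_wpM2l// ltW// A0_gt0.
have h6 : 0 <= AA * enorm xi by rewrite mulr_ge0 ?enorm_ge0// ltW// A0_gt0.
move: h0 h1 h2 h3 h4 h5 h6; move: (hA r p X) (AA * _ / r) (AA * X) (AA * enorm xi) => F s1 s2 s3 *.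
apply: ler_pM; rewrite ?exprn_ge0//; apply: lerXn2r; rewrite ?nnegrE//; lra.
Qed.

Lemma qcoef_cont p m l xi : cont_at (qcoef f p m l) xi.
Proof.
apply: (harm_cont (O := setT)) => //.
by apply: (tc_harm_dir _ ltr01 (tc_p_harm m (eB p 1))) => y yB; exact: (tc_p_bound m yB).
Qed.

Lemma qcoef_lim2 p X xi e1 e2 : enorm xi <= X -> small (hA r p X) e1 e2 ->
  lim2 (fun m l => qcoef f p m l xi * mon e1 e2 m l) (3 * M) (f (e1 *: p + (e1 * e2) *: xi)).
Proof.
move=> xX [s1 s2]; have X0 : 0 <= X by apply: le_trans xX; exact: enorm_ge0.
have M0 : 0 <= M by apply: le_trans (fM (eB_center (0 : V) r0)).
have [h0 h1 h2 h3 h4] := hA_parts p r0 X0; have A1 := @A0_ge1 R n.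
have n1 := normr_ge0 e1; have n2 := normr_ge0 e2.
have t1 : 4 * (AA * (enorm p + 1) / r) * `|e1| <= q0 by apply: le_trans s1; rewrite ler_wpM2r.
have t2 : 4 * (AA * X) * `|e2| <= q0 by apply: le_trans s2; rewrite ler_wpM2r.
have q1 : q0 <= 1 by rewrite invf_le1 ?ler1n.
have xe2 : 4 * AA * (`|e2| * enorm xi) <= 1.
  apply: le_trans (le_trans t2 q1).
  have -> : 4 * (AA * X) * `|e2| = 4 * AA * (`|e2| * X) by ring.
  by rewrite ler_wpM2l ?mulr_ge0 ?(ltW (@A0_gt0 R n))// ler_wpM2l.
have pB : eB p 1 (p + e2 *: xi).
  rewrite /eB/= addrC addKr enormZ.
  have : 0 <= `|e2| * enorm xi by rewrite mulr_ge0 ?enorm_ge0.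
  by move: xe2 A1; move: (`|e2| * _) AA => s A; clear -R n f r M r0 hf fM; nra.
have -> : 3 * M = M + 2 * M by ring.
have -> : e1 *: p + (e1 * e2) *: xi = 0 + e1 *: (p + e2 *: xi) by rewrite add0r scalerDr scalerA.
apply: (@lim2_nest R _ (fun m => tc m (p + e2 *: xi) f 0 * e1 ^+ m) _ _ (AA * (enorm p + 1) / r * `|e1|)) => //.
- by rewrite mulr_ge0.
- apply: le_trans (_ : _ <= q0) (@q0_le R); apply: le_trans t1.
  by move: h3 n1; move: (AA * _ / r) `|e1| => s s'; clear -R n f r M r0 hf fM; nra.
- move=> m.
  have := taylor_lim1 ltr01 (tc_p_harm m (eB p 1)) (fun y yB => tc_p_bound m yB) xe2.
  move/(lim1Z (e1 ^+ m)); rewrite normrX.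
  have -> : `|e1| ^+ m * (M * (AA * (enorm p + 1) / r) ^+ m) = M * (AA * (enorm p + 1) / r * `|e1|) ^+ m.
    by rewrite (exprMn m (AA * (enorm p + 1) / r) `|e1|); move: (_ ^+ m) (_ ^+ m) => s s'; ring.
  rewrite [e1 ^+ m * tc m _ _ _]mulrC; apply: lim1_eq => l.
  by rewrite /qcoef /mon mulrCA.
- apply: (taylor_lim1 r0 hf fM).
  have := eB1 pB; move: (enorm (p + _)) => s sp.
  have : 4 * (AA * (enorm p + 1) / r) * `|e1| * r <= r by rewrite ler_piMl ?(ltW r0)//; exact: le_trans t1 q1.
  have -> : 4 * (AA * (enorm p + 1) / r) * `|e1| * r = 4 * AA * (`|e1| * (enorm p + 1)).
    by field; rewrite gt_eqF.
  by apply: le_trans; rewrite ler_wpM2l ?mulr_ge0 ?(ltW (@A0_gt0 R n))// ler_wpM2l.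
Qed.

End Fixed.

(** Schwarz reflection. The odd extension is continuous because [u] tends to 0 on the hyperplane;
    the Dirichlet solution with this datum on a smaller sphere is odd, hence equals [u] on the
    half-ball by uniqueness. *)
Lemma odd_extend nu O u r s M : (2 <= n.+1)%N -> enorm nu = 1 -> 0 < r -> r < s -> open O ->
  (forall x, O x -> 0 < dotp nu x) -> (forall x, 0 < dotp nu x -> enorm x < s -> O x) ->
  harm O u -> 0 <= M -> (forall x, O x -> `|u x| <= M) ->
  (\bd z of O, enorm z < s -> blim O u z 0) ->
  exists h : V -> R, [/\ harm (eB 0 r) h, forall x, eB 0 r x -> `|h x| <= M &
    forall x, eB 0 r x -> 0 < dotp nu x -> h x = u x].
Proof.
move=> n2 nu1 r0 rs oO Onu Os hu M0 uM ub.
have dr x : dotp nu (refl nu x) = - dotp nu x by exact: dotp_refl.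
pose g x : R := if 0 < dotp nu x then u x else if dotp nu x < 0 then - u (refl nu x) else 0.
have gr x : g (refl nu x) = - g x.
  rewrite /g dr oppr_gt0 oppr_lt0 reflK//; case: (ltgtP (dotp nu x) 0) => _ //.
  - by rewrite opprK.
  - by rewrite oppr0.
have gM x : enorm x < s -> `|g x| <= M.
  move=> xs; rewrite /g; case: ifP => [xn|_]; first exact/uM/Os.
  case: ifP => [xn|_]; last by rewrite normr0.
  by rewrite normrN; apply/uM/Os; rewrite ?dr ?oppr_gt0// enorm_refl.
have hypO z : dotp nu z = 0 -> enorm z < s -> closure O z /\ ~ O z.
  move=> z0 zs; split; last by move=> /Onu; rewrite z0 ltxx.
  apply/closure_enormP => e e0; pose t : R := Num.min (e / 2) ((s - enorm z) / 2).
  have s0 : 0 < s - enorm z by rewrite subr_gt0.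
  have t0 : 0 < t by rewrite lt_min !divr_gt0.
  have te : t <= e / 2 by rewrite /t ge_min lexx.
  have ts : t <= (s - enorm z) / 2 by rewrite /t ge_min lexx orbT.
  have tn : enorm (t *: nu) = t by rewrite enormZ nu1 mulr1 gtr0_norm.
  exists (z + t *: nu); last by rewrite [z + _]addrC addrK tn; clear -R n te e0; lra.
  apply: Os; last by apply: le_lt_trans (enormD _ _) _; rewrite tn; clear -R n ts s0; lra.
  by rewrite dotpDr z0 add0r dotpZr -[dotp nu nu]enorm_sqr nu1 expr1n mulr1.
have cg_pos x : enorm x < s -> 0 < dotp nu x -> cont_at g x.
  move=> xs xn; apply: (cont_congr (O := O) (f := u)) => //; first exact: Os.
    by move=> y /Onu yn; rewrite /g yn.
  by apply: harm_cont hu _; exact: Os.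
have cg x : enorm x < s -> cont_at g x.
  move=> xs; case: (ltgtP (dotp nu x) 0) => xn.
  - have : cont_at (fun y => g (refl nu y)) x.
      have h1 : cont_at g (refl nu x) by apply: cg_pos; rewrite ?enorm_refl// dr oppr_gt0.
      move=> e /h1[d d0 hd]; exists d => // y yx; apply: hd.
      by rewrite -reflB enorm_refl.
    move/contN; rewrite /cont_at => h1 e /h1[d d0 hd]; exists d => // y /hd.
    by rewrite !gr !opprK.
  - exact: cg_pos.
  - have [cx nx] := hypO x xn xs.
    have g0 : g x = 0 by rewrite /g xn ltxx.
    move=> e e0; have [d d0 hd] := ub x cx nx xs e e0.
    exists (Num.min d (s - enorm x)); first by rewrite lt_min d0 subr_gt0.
    move=> y; rewrite lt_min g0 subr0 => /andP[yd ys].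
    have {}ys : enorm y < s by have [_] := enorm_rdistP y x; move: ys; clear -R n; lra.
    rewrite /g; case: ifP => yn1; first by have := hd y (Os y yn1 ys) yd; rewrite subr0.
    case: ifP => yn2; last by rewrite normr0.
    have xr : refl nu x = x by rewrite /refl xn mulr0 scale0r subr0.
    have := hd (refl nu y) (Os _ _ _); rewrite subr0 normrN; apply; rewrite ?dr ?oppr_gt0 ?enorm_refl//.
    by rewrite -[X in _ - X]xr -reflB enorm_refl.
have sph_s x : sphere 0 r x -> enorm x < s by rewrite /sphere/= subr0 => ->.
have [h [hh hg bh]] := @ball_solve R n 0 r g n2 r0 (fun x xs => cont_blim _ (cg x (sph_s x xs))).
have hM x : cball 0 r x -> `|h x| <= M.
  apply: (harm_norm_ball r0 hh).
    by move=> z zs; apply: bh; exact: sphere_cball.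
  by move=> z zs; rewrite hg//; apply: gM; exact: sph_s.
have hodd := harm_ball_odd r0 nu1 hh bh.
have {}hodd x : cball 0 r x -> h (refl nu x) = - h x.
  by apply: hodd => z zr; rewrite !hg ?gr//; move: zr; rewrite /sphere/= !subr0 enorm_refl.
exists h; split => //; first by move=> x /eB_cball; exact: hM.
pose D := eB 0 r `&` [set x | 0 < dotp nu x].
have [oD bD _ clD] : [/\ open D, ebounded D, _ & _] := half_ball nu r.
have DO x : D x -> O x.
  by move=> [xB xn]; apply: Os => //; move: xB; rewrite /eB/= subr0 => xB; exact: lt_trans xB rs.
suff key : forall x, D x -> h x = u x by move=> x xB xn; apply: key.
apply: (harm_eq oD) => //.
- by apply: harm_sub hh => y [].
- by apply: harm_sub hu => y; exact: DO.
move=> z cz nz.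
have [zB zn0] := clD z cz.
have zs : enorm z < s by move: zB; rewrite /cball/= subr0 => zB; exact: le_lt_trans zB rs.
have gz : h z = g z.
  have [zn|zn] := ltP 0 (dotp nu z).
    have zr : sphere 0 r z.
      by apply/eqP; rewrite eq_le zB/= leNgt; apply/negP => zr; apply: nz; split.
    by rewrite hg.
  have {}zn0 : dotp nu z = 0 by apply/eqP; rewrite eq_le zn zn0.
  have := hodd z zB; rewrite /refl zn0 mulr0 scale0r subr0 /g zn0 ltxx => e.
  by clear -R n e; lra.
have b1 : blim D h z (g z) by rewrite -gz; apply: blim_sub (bh z zB) => y [/eB_cball].
have b2 : blim D g z (g z) by apply: cont_blim; exact: cg.
have := blimB b1 b2; rewrite subrr => b3 e e0; have [d d0 hd] := b3 e e0.
by exists d => // y Dy yz; have := hd y Dy yz; rewrite /g; case: Dy => _ /= ->.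
Qed.

(** * The field of one hole datum: source, mirror image and corrector *)

Implicit Types (m : R).

(** Here [E] stands for the complement of the closed hole. The regularity of both boundaries
    survives only through barriers, the flat part of the boundary only through [nu] and [r1]. *)
Record hole_geometry Om E nu p r1 r : Prop := HoleGeometry {
  hg_n3 : (3 <= n.+1)%N;
  hg_nu : enorm nu = 1;
  hg_Om : open Om;
  hg_Omb : ebounded Om;
  hg_up : forall x, Om x -> 0 < dotp nu x;
  hg_bar : \bd z of Om, barrier Om z;
  hg_r1 : 0 < r1;
  hg_half : forall x, 0 < dotp nu x -> enorm x < r1 -> Om x;
  hg_E : open E;
  hg_r : 0 < r;
  hg_Er : forall x, r <= enorm x -> E x;
  hg_E0 : exists2 d : R, 0 < d & forall x, E x -> d <= enorm x;
  hg_Ebar : \bd z of E, barrier E z;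
  hg_p : 0 < dotp nu p }.

Definition hole_pt p (e1 e2 : R) xi : V := e1 *: p + (e1 * e2) *: xi.

Definition holed Om E p e1 e2 := forall y, ~ E y -> Om (hole_pt p e1 e2 y).

Definition unscale p (e1 e2 : R) x : V := (e1 * e2)^-1 *: (x - e1 *: p).

Definition perf Om E p e1 e2 : set V := [set x | Om x /\ E (unscale p e1 e2 x)].

Definition bdry_data E f m := (\bd xi of E, `|f xi| <= m) /\
  (\bd xi of E, blim (closure E `\` E) f xi (f xi)).

(** [U] is the field of the datum [f], [c] its coefficients away from 0, and [s] those of the error
    [f - U] on the hole. The vanishing for [b = 0] is the gain of one power of [e2]; all bounds are
    proportional to the size [m] of the datum. *)
Record hole_op Om E p del M A f m (c s : nat -> nat -> V -> R) (U : R -> R -> V -> R) : Prop := HoleOp {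
  ho_adm : forall a b, adm Om del (c a b) (m * M * A ^+ (a + b));
  ho_c0 : forall a x, c a 0%N x = 0;
  ho_cont : forall a b xi, cont_at (s a b) xi;
  ho_bound : forall a b xi, ~ E xi -> `|s a b xi| <= m * M * A ^+ (a + b);
  ho_s0 : forall a xi, s a 0%N xi = 0;
  ho_harm : forall e1 e2, 0 < e1 -> 0 < e2 -> small A e1 e2 -> holed Om E p e1 e2 ->
    harm (perf Om E p e1 e2) (U e1 e2);
  ho_outer : forall e1 e2, 0 < e1 -> 0 < e2 -> small A e1 e2 -> holed Om E p e1 e2 ->
    \bd z of Om, blim (perf Om E p e1 e2) (U e1 e2) z 0;
  ho_inner : forall e1 e2, 0 < e1 -> 0 < e2 -> small A e1 e2 -> holed Om E p e1 e2 ->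
    \bd xi of E, exists S,
      lim2 (fun a b => s a b xi * mon e1 e2 a b) (m * M) S /\
      blim (perf Om E p e1 e2) (U e1 e2) (hole_pt p e1 e2 xi) (f xi - S);
  ho_far : forall e1 e2, 0 < e1 -> 0 < e2 -> small A e1 e2 -> holed Om E p e1 e2 ->
    forall x, outr Om del x -> lim2 (fun a b => c a b x * mon e1 e2 a b) (m * M) (U e1 e2 x) }.

Lemma hole_ptK p e1 e2 xi : 0 < e1 -> 0 < e2 -> unscale p e1 e2 (hole_pt p e1 e2 xi) = xi.
Proof.
move=> e10 e20; rewrite /unscale /hole_pt addrC addKr scalerA mulVf ?scale1r//.
by rewrite gt_eqF// mulr_gt0.
Qed.

Lemma unscaleK p e1 e2 x : 0 < e1 -> 0 < e2 -> hole_pt p e1 e2 (unscale p e1 e2 x) = x.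
Proof.
move=> e10 e20; rewrite /unscale /hole_pt scalerA mulfV ?gt_eqF ?mulr_gt0// scale1r.
by rewrite addrC subrK.
Qed.

Lemma unscaleE p e1 e2 x : unscale p e1 e2 x = - ((e1 * e2)^-1 * e1) *: p + (e1 * e2)^-1 *: x.
Proof. by rewrite /unscale scalerBr addrC scaleNr scalerA. Qed.

Lemma unscaleB p e1 e2 x y : unscale p e1 e2 x - unscale p e1 e2 y = (e1 * e2)^-1 *: (x - y).
Proof. by rewrite !unscaleE opprD addrACA subrr add0r -scalerBr. Qed.

Lemma exterior_multipole Om E nu p r1 r : hole_geometry Om E nu p r1 r -> exists2 K : R, 0 <= K &
  forall f m, 0 <= m -> bdry_data E f m -> exists w P, [/\ multipole w P r (m * K), harm E w &
    \bd xi of E, blim E w xi (f xi)].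
Proof.
move=> hg; have n3 := hg_n3 hg; have n2 : (2 <= n.+1)%N by exact: ltnW.
have [d d0 Ed] := hg_E0 hg; have r0 := hg_r hg.
exists (r `^ (N - 2) * (r ^+ n.-1)^-1).
  by rewrite mulr_ge0 ?powR_ge0// invr_ge0 exprn_ge0// ltW.
move=> f m m0 [fm fc].
have Er z : closure E z -> ~ E z -> enorm z <= r.
  by move=> _ nz; rewrite leNgt; apply/negP => zr; apply: nz; apply: (hg_Er hg); exact: ltW.
have [w [wh wb wl]] := dirichlet_exterior n2 (hg_E hg) d0 Ed Er (hg_Ebar hg) fm m0 fc.
have C0 : 0 <= m * r `^ (N - 2) by rewrite mulr_ge0// powR_ge0.
have [P [P1 P2 P3 P4]] := multipoles n3 r0 C0 (hg_E hg) (hg_Er hg) wh wb.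
exists w, P; split => //; rewrite mulrA; split => //.
by rewrite mulr_ge0// invr_ge0 exprn_ge0// ltW.
Qed.

Section Geometry.
Variables (Om E : set V) (nu p : V) (r1 r : R).
Hypothesis hg : hole_geometry Om E nu p r1 r.

Lemma closure_up z : closure Om z -> 0 <= dotp nu z.
Proof.
move=> /closure_enormP cz; rewrite leNgt; apply/negP => zn; rewrite -oppr_gt0 in zn.
have [d d0 hd] := @cont_dotp R n nu z _ zn.
have [w /(hg_up hg) wn /hd] := cz d d0; rewrite ltr_norml => /andP[_].
by rewrite ltrBlDr addNr => /(lt_trans wn); rewrite ltxx.
Qed.

Lemma flat_refl z : closure Om z -> ~ Om z -> enorm z < r1 -> refl nu z = z.
Proof.
move=> cz nz zr; have z0 : dotp nu z = 0.
  apply/eqP; rewrite eq_le closure_up// andbT leNgt; apply/negP => zn.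
  by apply: nz; exact: (hg_half hg).
by rewrite /refl z0 mulr0 scale0r subr0.
Qed.

Lemma out_E e1 e2 x : 0 < e1 -> 0 < e2 -> holed Om E p e1 e2 -> ~ Om x -> E (unscale p e1 e2 x).
Proof.
move=> e10 e20 ho nx; apply: contrapT => /ho; rewrite unscaleK//.
Qed.

Lemma refl_out x : closure Om x -> ~ Om (refl nu x).
Proof.
move=> /closure_up xn /(hg_up hg); rewrite dotp_refl ?(hg_nu hg)// oppr_gt0.
by move=> /lt_le_trans/(_ xn); rewrite ltxx.
Qed.

Lemma unscale_open e1 e2 : open [set x | E (unscale p e1 e2 x)].
Proof.
apply/openP_enorm => x /= xE; have [d d0 hd] := open_ball_in (hg_E hg) xE.
pose k : R := `|(e1 * e2)^-1| + 1; have k0 : 0 < k by rewrite ltr_wpDl.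
exists (d / k); first by rewrite divr_gt0.
move=> y; rewrite ltr_pdivlMr// => yx; apply: hd.
rewrite unscaleB enormZ.
apply: le_lt_trans yx; rewrite mulrC ler_wpM2l ?enorm_ge0// /k lerDl//.
Qed.

Lemma perf_open e1 e2 : open (perf Om E p e1 e2).
Proof.
have -> : perf Om E p e1 e2 = Om `&` [set x | E (unscale p e1 e2 x)] by [].
by apply: openI; [exact: hg_Om hg|exact: unscale_open].
Qed.

Lemma perf_bdry e1 e2 z : 0 < e1 -> 0 < e2 -> closure (perf Om E p e1 e2) z -> ~ perf Om E p e1 e2 z ->
  (closure Om z /\ ~ Om z) \/ exists xi, [/\ closure E xi, ~ E xi & z = hole_pt p e1 e2 xi].
Proof.
move=> e10 e20 cz nz; have cO : closure Om z by apply: closure_subset cz => x [].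
have [Oz|] := pselect (Om z); last by left.
right; exists (unscale p e1 e2 z); split; last by rewrite unscaleK.
  apply/closure_enormP => e e0; have t0 : 0 < e1 * e2 by rewrite mulr_gt0.
  have [|y [Oy Ey] yz] := (closure_enormP _ _).1 cz (e * (e1 * e2)); first by rewrite mulr_gt0.
  exists (unscale p e1 e2 y) => //; rewrite unscaleB enormZ.
  by rewrite ger0_norm ?invr_ge0 ?(ltW t0)// mulrC ltr_pdivrMr.
by move=> Ez; apply: nz.
Qed.

Section Fixed.
Variables (w : V -> R) (P : nat -> V -> R) (B : R).
Hypothesis mp : multipole w P r B.

(** Subtracting the mirror image makes the coefficient vanish on the flat part of the boundary,
    which tames its singularity at 0. *)
Definition gcoef (a b : nat) x : R := fcoef P p a b x - fcoef P p a b (refl nu x).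

Lemma gcoef0 a x : gcoef a 0 x = 0.
Proof. by rewrite /gcoef !(fcoef0 mp) subrr. Qed.

Lemma gcoef_harm a b : harm [set x : V | x != 0] (gcoef a b).
Proof.
apply: harmB; first exact: (fcoef_harm mp).
apply: harm_sub (harm_refl (hg_nu hg) n0_open (fcoef_harm mp p a b)) => x /= x0.
by rewrite -enorm_gt0 enorm_refl ?(hg_nu hg)// enorm_gt0.
Qed.

Lemma gcoef_bound del a b x : 0 < del -> del <= enorm x -> `|gcoef a b x| <= 2 * B * fA r del p ^+ (a + b).
Proof.
move=> d0 xd; have -> : 2 * B * fA r del p ^+ (a + b) = B * fA r del p ^+ (a + b) + B * fA r del p ^+ (a + b) by ring.
apply: le_trans (ler_normB _ _) _; apply: lerD; apply: (fcoef_bound mp) => //.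
by rewrite enorm_refl ?(hg_nu hg).
Qed.

Lemma gcoef_flat a b z : closure Om z -> ~ Om z -> enorm z < r1 -> gcoef a b z = 0.
Proof. by move=> cz nz zr; rewrite /gcoef flat_refl// subrr. Qed.

Lemma gcoef_bdry del a b z : 0 < del -> del <= r1 -> closure Om z -> ~ Om z ->
  `|gcoef a b z| <= 2 * B * fA r del p ^+ (a + b).
Proof.
move=> d0 dr cz nz; have [zd|zd] := leP del (enorm z); first exact: gcoef_bound.
rewrite gcoef_flat//; last exact: lt_le_trans zd dr.
have B0 := mp_B mp; have := fA_ge1 p (mp_r mp) d0 => A1.
by rewrite normr0 mulr_ge0 ?mulr_ge0// exprn_ge0// (le_trans _ A1).
Qed.

Lemma bdry_blim g z : (\bd z of Om, enorm z < r1 -> g z = 0) ->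
  (\bd z of Om, r1 <= enorm z -> cont_at g z) ->
  closure Om z -> ~ Om z -> blim (closure Om `\` Om) g z (g z).
Proof.
move=> g0 gc cz nz; have [zr|zr] := leP r1 (enorm z); first by apply: cont_blim; exact: gc.
move=> e e0; exists (r1 - enorm z); first by rewrite subr_gt0.
move=> y [cy ny] yz; rewrite !g0// ?subrr ?normr0//.
by have [_] := enorm_rdistP y z; rewrite lerBlDr => /le_lt_trans; apply; rewrite -ltrBrDr.
Qed.

(** Although [gcoef] is singular at 0, on the boundary it is 0 near 0 and bounded elsewhere. The
    case [b = 0] is separated so that [K] vanishes identically, also off [Om]. *)
Lemma corrector del : 0 < del -> del <= r1 -> forall a b, exists K : V -> R,
  [/\ harm Om K, forall x, Om x -> `|K x| <= 2 * B * fA r del p ^+ (a + b),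
    \bd z of Om, blim Om K z (gcoef a b z) & b = 0%N -> forall x, K x = 0].
Proof.
move=> d0 dr; have n2 : (2 <= n.+1)%N by exact: ltnW (hg_n3 hg).
have B0 := mp_B mp; have A1 := fA_ge1 p (mp_r mp) d0.
have F0 k : 0 <= 2 * B * fA r del p ^+ k.
  by rewrite mulr_ge0 ?mulr_ge0// exprn_ge0// (le_trans _ A1).

move=> a b; have [->|b0] := eqVneq b 0%N.
  exists (fun=> 0); split => //; first exact: harm_cst.
    by move=> x _; rewrite normr0 F0.
  by move=> z _ _; rewrite gcoef0; apply: cont_blim; exact: cont_cst.
have [|K [K1 K2 K3]] := dirichlet_bounded n2 (hg_Om hg) (hg_bar hg) (fun z => @gcoef_bdry del a b z d0 dr) (F0 _).
  move=> z; apply: bdry_blim; first by move=> y; exact: gcoef_flat.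
  move=> y cy ny yr; apply: (harm_cont (gcoef_harm a b)) => /=.
  by rewrite -enorm_gt0; apply: lt_le_trans yr; exact: hg_r1 hg.
by exists K; split => // bb; move: b0; rewrite bb.
Qed.

End Fixed.
End Geometry.

Lemma lim2_0 (C : R) : 0 <= C -> lim2 (fun _ _ => 0) C 0.
Proof.
move=> C0 K; have -> : sum2 K (fun _ _ => 0 : R) = 0 by rewrite /sum2 big1// => i _; rewrite big1.
by rewrite subrr normr0 mulr_ge0// h2_ge0.
Qed.

Lemma blim_sum D (K : nat) (g : nat -> V -> R) (l : nat -> R) z : (forall j, blim D (g j) z (l j)) ->
  blim D (fun x => \sum_(j < K) g j x) z (\sum_(j < K) l j).
Proof.
move=> h; elim: K => [|K IH].
  rewrite big_ord0; have -> : (fun x => \sum_(j < 0) g j x) = (fun=> 0 : R).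
    by apply/funext => x; rewrite big_ord0.
  by apply: cont_blim; exact: cont_cst.
rewrite big_ord_recr/=; have -> : (fun x => \sum_(j < K.+1) g j x) = (fun x => \sum_(j < K) g j x + g K x).
  by apply/funext => x; rewrite big_ord_recr.
exact: blimD.
Qed.

Lemma blim_sum2 D (K : nat) (g : nat -> nat -> V -> R) (l : nat -> nat -> R) z :
  (forall a b, blim D (g a b) z (l a b)) -> blim D (fun x => sum2 K (fun a b => g a b x)) z (sum2 K l).
Proof.
move=> h; apply: (@blim_sum D K (fun a x => \sum_(b < K) g a b x) (fun a => \sum_(b < K) l a b)) => a.
by apply: (@blim_sum D K (g a)) => b; exact: h.
Qed.

Lemma harm_sum2 D (K : nat) (g : nat -> nat -> V -> R) : (forall a b, harm D (g a b)) ->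
  harm D (fun x => sum2 K (fun a b => g a b x)).
Proof. by move=> h; apply: harm_sum => a; apply: harm_sum => b; exact: h. Qed.

Lemma bsup_norm D u z (l c : R) : blim D u z l -> `|l| <= c ->
  forall e : R, 0 < e -> exists2 d : R, 0 < d & forall x, D x -> enorm (x - z) < d -> `|u x| <= c + e.
Proof.
move=> h lc e /h[d d0 hd]; exists d => // x Dx /(hd x Dx) ux.
have := ler_normD (u x - l) l; rewrite subrK; move: ux lc; clear -R n; lra.
Qed.

Section Fixed.
Variables (Om E : set V) (nu p : V) (r1 r del : R) (w : V -> R) (P : nat -> V -> R) (B e1 e2 : R).
Hypothesis hg : hole_geometry Om E nu p r1 r.
Hypothesis wh : harm E w.
Hypothesis mp : multipole w P r B.
Hypotheses (d0 : 0 < del) (dr : del <= r1) (e10 : 0 < e1) (e20 : 0 < e2).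
Hypothesis sm : small (fA r del p) e1 e2.
Hypothesis ho : holed Om E p e1 e2.

Definition image_diff x : R := w (unscale p e1 e2 x) - w (unscale p e1 e2 (refl nu x)).

Lemma image_far x : del <= enorm x ->
  lim2 (fun a b => gcoef nu p P a b x * mon e1 e2 a b) (8 * B) (image_diff x).
Proof.
move=> xd; have -> : 8 * B = 4 * B + 4 * B by ring.
have xd' : del <= enorm (refl nu x) by rewrite enorm_refl ?(hg_nu hg).
have := lim2B (far_series mp d0 e10 e20 xd sm) (far_series mp d0 e10 e20 xd' sm).
by apply: lim2_eq => a b; rewrite /gcoef mulrBl.
Qed.

Lemma image_bdry z : closure Om z -> ~ Om z ->
  lim2 (fun a b => gcoef nu p P a b z * mon e1 e2 a b) (8 * B) (image_diff z).
Proof.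
move=> cz nz; have [zd|zd] := leP del (enorm z); first exact: image_far.
have zr := lt_le_trans zd dr; rewrite /image_diff (flat_refl hg)// subrr.
have := @lim2_0 (8 * B); rewrite mulr_ge0 ?(mp_B mp)// => /(_ isT).
by apply: lim2_eq => a b; rewrite (gcoef_flat hg)// mul0r.
Qed.

Lemma unscale_harm : harm [set x | E (unscale p e1 e2 x)] (fun x => w (unscale p e1 e2 x)).
Proof.
have -> : (fun x => w (unscale p e1 e2 x) : R^o) = (fun x => w (- ((e1 * e2)^-1 * e1) *: p + (e1 * e2)^-1 *: x)).
  by apply/funext => x; rewrite unscaleE.
apply: harm_sub (harm_aff _ _ wh) => x /=; rewrite unscaleE//.
Qed.

Lemma mirror_harm : harm [set x | E (unscale p e1 e2 (refl nu x))]
  ((fun x => w (unscale p e1 e2 (refl nu x))) : V -> R^o).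
Proof. by apply: (harm_refl (hg_nu hg) _ unscale_harm); exact: (unscale_open hg). Qed.

Lemma mirror_in x : closure Om x -> E (unscale p e1 e2 (refl nu x)).
Proof. by move=> /(refl_out hg) nx; exact: (out_E e10 e20 ho nx). Qed.

Lemma image_cont z : closure Om z -> ~ Om z -> cont_at image_diff z.
Proof.
move=> cz nz; apply: contB; first exact: (harm_cont unscale_harm (out_E e10 e20 ho nz)).
exact: (harm_cont mirror_harm (mirror_in cz)).
Qed.

(** The full corrector is solved for directly; the error of each partial sum, known on the boundary,
    is carried inside by the maximum principle. *)
Lemma corrector_sum (K : nat -> nat -> V -> R) :
  (forall a b, harm Om (K a b)) ->
  (forall a b z, closure Om z -> ~ Om z -> blim Om (K a b) z (gcoef nu p P a b z)) ->
  exists Q, [/\ harm Om Q, \bd z of Om, blim Om Q z (image_diff z) &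
    forall x, Om x -> lim2 (fun a b => K a b x * mon e1 e2 a b) (8 * B) (Q x)].
Proof.
move=> Kh Kb; have n2 : (2 <= n.+1)%N by exact: ltnW (hg_n3 hg).
have B0 : 0 <= 8 * B by rewrite mulr_ge0 ?(mp_B mp).
have [||Q [Q1 Q2 Q3]] := dirichlet_bounded n2 (hg_Om hg) (hg_bar hg) _ B0 (f := image_diff).
- by move=> z cz nz; exact: lim2_bound (image_bdry cz nz).
- move=> z; apply: (bdry_blim (r1 := r1)) => y cy ny yr.
    by rewrite /image_diff (flat_refl hg)// subrr.
  exact: image_cont.
exists Q; split => // x Ox J.
apply: (harm_abs_max (hg_Om hg) (hg_Omb hg) (u := fun x => Q x - sum2 J (fun a b => K a b x * mon e1 e2 a b))) => //.
  apply: harmB => //; apply: (harm_sum2 J (g := fun a b x => K a b x * mon e1 e2 a b)) => a b.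
  by under eq_fun do rewrite mulrC; apply: harmZ.
move=> z cz nz; apply: (bsup_norm (l := image_diff z - sum2 J (fun a b => gcoef nu p P a b z * mon e1 e2 a b))).
  apply: blimB; first exact: Q3.
  apply: (blim_sum2 J (g := fun a b x => K a b x * mon e1 e2 a b)) => a b.
  by under eq_fun do rewrite mulrC; rewrite mulrC; apply: blimZ; exact: Kb.
exact: image_bdry.
Qed.

End Fixed.

Lemma reflZ nu (c : R) x : refl nu (c *: x) = c *: refl nu x.
Proof. by rewrite /refl dotpZr scalerBr scalerA mulrCA. Qed.

Lemma reflD nu x y : refl nu (x + y) = refl nu x + refl nu y.
Proof. by rewrite /refl dotpDr mulrDr scalerDl opprD addrACA. Qed.

(** The offset between the hole and its mirror is proportional to [e1], and the scale of the hole is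
    [e1 e2], so in the coordinates of the hole [e1] cancels. *)
Lemma mirror_hole nu p e1 e2 xi : 0 < e1 -> 0 < e2 ->
  unscale p e1 e2 (refl nu (hole_pt p e1 e2 xi)) = e2^-1 *: ((refl nu p - p) + e2 *: refl nu xi).
Proof.
move=> e10 e20; rewrite /unscale /hole_pt reflD !reflZ; move: (refl nu p) (refl nu xi) => x y.
rewrite addrAC -scalerBr scalerDr [RHS]scalerDr !scalerA.
have n1 : e1 != 0 by rewrite gt_eqF.
have n2 : e2 != 0 by rewrite gt_eqF.
by congr (_ *: _ + _ *: _); field; rewrite n1 n2.
Qed.

Lemma qcoef_zero p (m l : nat) xi : qcoef (fun _ : V => 0) p m l xi = 0.
Proof.
apply/eqP; rewrite -normr_le0.
have h0 : forall y : V, eB 0 1 y -> `|0 : R| <= 0 by move=> y _; rewrite normr0.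
have := @qcoef_bound (fun=> 0) 1 0 ltr01 (harm_cst _ 0) h0 p (enorm xi) m l xi (lexx _).
by rewrite mul0r.
Qed.

Lemma conv_idx (a b i j : nat) : (i < a.+1)%N -> (j < b.+1)%N -> (a + b = (i + j) + (a - i + (b - j)))%N.
Proof. by clear; lia. Qed.

(** Two errors appear on the hole: the mirror image, which depends on [e2] only and sits at [a = 0],
    and the correctors, each expanded at 0 and convolved with its own monomial. *)
Definition scoef nu p P (H : nat -> nat -> V -> R) (a b : nat) xi : R :=
  (if a == 0%N then ncoef P (refl nu p - p) (refl nu xi) b else 0) +
  \sum_(i < a.+1) \sum_(j < b.+1) qcoef (H i j) p (a - i) (b - j) xi.

Lemma cont_refl nu f x : enorm nu = 1 -> cont_at f (refl nu x) -> cont_at (fun y => f (refl nu y)) x.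
Proof. by move=> nu1 h e /h[d d0 hd]; exists d => // y yx; apply: hd; rewrite -reflB enorm_refl. Qed.

Lemma mirror_norm nu p : enorm nu = 1 -> 0 < dotp nu p -> 0 < enorm (refl nu p - p).
Proof.
move=> nu1 p0; rewrite /refl addrC addKr enormN enormZ nu1 mulr1 gtr0_norm mulr_gt0//.
Qed.

Section Scoef.
Variables (nu p : V) (r r1 : R) (w : V -> R) (P : nat -> V -> R) (B A1 A2 A : R) (H : nat -> nat -> V -> R).
Hypotheses (nu1 : enorm nu = 1) (p0 : 0 < dotp nu p) (mp : multipole w P r B) (r10 : 0 < r1).
Hypothesis Hh : forall a b, harm (eB 0 r1) (H a b).
Hypothesis A1ge : 1 <= A1.
Hypothesis Hb : forall a b x, eB 0 r1 x -> `|H a b x| <= 2 * B * A1 ^+ (a + b).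
Hypothesis H0 : forall a x, H a 0%N x = 0.
Hypothesis A2E : A2 = fA r (enorm (refl nu p - p)) (r *: nu).
Hypothesis AE : A = 2 * (A1 + 2 * A2 + hA r1 p r).

Lemma A_parts : [/\ 1 <= A2, 1 <= hA r1 p r, A1 <= A, 2 * A2 <= A & hA r1 p r <= A].
Proof.
have h2 : 1 <= A2 by rewrite A2E; apply: fA_ge1; [exact: (mp_r mp)|exact: mirror_norm].
have [h3 _ _ _ _] := hA_parts p r10 (ltW (mp_r mp)).
by rewrite AE; split => //; move: h2 h3 A1ge; lra.
Qed.

Lemma fA_mono xi : enorm xi <= r -> fA r (enorm (refl nu p - p)) xi <= A2.
Proof.
move=> xr; have z0 := mirror_norm nu1 p0.
rewrite A2E /fA lerD2l ler_wpM2l ?mulr_ge0 ?(ltW (@A0_gt0 R n))// lerD2l.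
rewrite ler_wpM2r ?invr_ge0 ?(ltW z0)// ler_wpM2l//.
by rewrite enormZ nu1 mulr1 ger0_norm// ltW// (mp_r mp).
Qed.

Lemma scoef_cont a b xi : cont_at (scoef nu p P H a b) xi.
Proof.
apply: contD.
  case: (a == 0%N); last exact: cont_cst.
  apply: (cont_refl nu1 (f := fun y => ncoef P (refl nu p - p) y b)).
  by apply: (ncoef_cont mp); rewrite -enorm_gt0; exact: mirror_norm.
apply: cont_sum => i; apply: cont_sum => j.
exact: (qcoef_cont r10 (Hh i j) (@Hb i j)).
Qed.

Lemma scoef0 a xi : scoef nu p P H a 0 xi = 0.
Proof.
rewrite /scoef (ncoef0 mp) if_same add0r big1// => i _; rewrite big_ord_recl big_ord0 addr0 /=.
have -> : H i 0%N = (fun=> 0) by apply/funext => y; rewrite H0.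
exact: qcoef_zero.
Qed.

(** The [(a + 1) (b + 1)] terms of the convolution are absorbed by the factor 2 in [A]. *)
Lemma scoef_bound a b xi : enorm xi <= r -> `|scoef nu p P H a b xi| <= 3 * B * A ^+ (a + b).
Proof.
move=> xr; have [h2 h3 h4 h5 h6] := A_parts; have B0 := mp_B mp; have z0 := mirror_norm nu1 p0.
have A0 : 0 <= A by apply: le_trans h4; apply: le_trans A1ge.
have A_1 : 1 <= A by apply: le_trans h4.
have -> : 3 * B * A ^+ (a + b) = B * A ^+ (a + b) + 2 * B * A ^+ (a + b) by ring.
apply: le_trans (ler_normD _ _) _; apply: lerD.
  case: (a =P 0%N) => [->|_]; last by rewrite normr0 mulr_ge0// exprn_ge0.
  have xr' : enorm (refl nu xi) <= r by rewrite enorm_refl.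
  apply: le_trans (ncoef_bound mp _ _ z0 (lexx _)) _; rewrite ler_wpM2l// add0n.
  have g1 := fA_ge1 (refl nu xi) (mp_r mp) z0; have g2 := fA_mono xr'.
  by rewrite lerXn2r ?nnegrE//; move: g1 g2 h5; lra.
pose AM : R := A1 + hA r1 p r.
have AM0 : 0 <= AM by rewrite addr_ge0//; [exact: le_trans A1ge|exact: le_trans h3].
have two : 2 * AM <= A by rewrite AE /AM; move: h2; lra.
apply: (@le_trans _ _ (\sum_(i < a.+1) \sum_(j < b.+1) 2 * B * AM ^+ (a + b))).
  apply: le_trans (ler_norm_sum _ _ _) _; apply: ler_sum => i _.
  apply: le_trans (ler_norm_sum _ _ _) _; apply: ler_sum => j _.
  apply: le_trans (qcoef_bound r10 (Hh i j) (@Hb i j) _ _ _ xr) _.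
  have -> : AM ^+ (a + b) = AM ^+ (i + j) * AM ^+ (a - i + (b - j)).
    by rewrite -exprD -(conv_idx (ltn_ord i) (ltn_ord j)).
  rewrite -[leLHS]mulrA ler_wpM2l ?mulr_ge0//.
  apply: ler_pM; rewrite ?exprn_ge0//; try exact: le_trans A1ge; try exact: le_trans h3.
    by rewrite lerXn2r ?nnegrE// ?(le_trans _ A1ge)// /AM lerDl (le_trans _ h3).
  by rewrite lerXn2r ?nnegrE// ?(le_trans _ h3)// /AM lerDr (le_trans _ A1ge).
rewrite !sum_cst; apply: (@le_trans _ _ (2 * B * (2 * AM) ^+ (a + b))).
  have le2 k : k.+1%:R <= 2 ^+ k :> R by rewrite -natrX ler_nat ltn_expl.
  rewrite (exprMn (a + b) 2 AM); have : 0 <= AM ^+ (a + b) by rewrite exprn_ge0.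
  move: (AM ^+ (a + b)) => s s0.
  have -> : a.+1%:R * (b.+1%:R * (2 * B * s)) = 2 * B * ((a.+1%:R * b.+1%:R) * s) by ring.
  rewrite exprD ler_wpM2l ?mulr_ge0// ler_wpM2r ?exprn_ge0//.
  exact: ler_pM.
by rewrite ler_wpM2l ?mulr_ge0// lerXn2r ?nnegrE ?mulr_ge0.
Qed.

Lemma scoef_lim2 e1 e2 xi (K : nat -> nat -> R) Q : 0 < e1 -> 0 < e2 -> small A e1 e2 -> enorm xi <= r ->
  (forall a b, K a b = H a b (hole_pt p e1 e2 xi)) -> lim2 (fun a b => K a b * mon e1 e2 a b) (8 * B) Q ->
  lim2 (fun a b => scoef nu p P H a b xi * mon e1 e2 a b) (38 * B)
    (w (unscale p e1 e2 (refl nu (hole_pt p e1 e2 xi))) + Q).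
Proof.
move=> e10 e20 sm xr KH hQ; have [h2 h3 h4 h5 h6] := A_parts; have B0 := mp_B mp.
have z0 := mirror_norm nu1 p0; have xr' : enorm (refl nu xi) <= r by rewrite enorm_refl.
have h10 : 0 <= A1 by apply: le_trans A1ge.
have h30 : 0 <= hA r1 p r by apply: le_trans h3.
have g2 : fA r (enorm (refl nu p - p)) (refl nu xi) * e2 <= q0.
  have [_] := sm; rewrite gtr0_norm//; apply: le_trans; rewrite ler_wpM2r ?(ltW e20)//.
  by apply: le_trans (fA_mono xr') _; move: h5 h2; lra.
have L1 := lim2_embed (mulr_ge0 (ler0n R 4) B0) (near_series mp z0 e20 (lexx _) g2).
have sm1 : small A1 e1 e2 by apply: small_le sm; rewrite h10.
have sm3 : small (hA r1 p r) e1 e2 by apply: small_le sm; rewrite h30.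
have B20 : 0 <= 2 * B by rewrite mulr_ge0.
have monb k a' b' : 0 <= k -> `|2 * B * A1 ^+ (a' + b') * mon e1 e2 a' b'| <= k ->
    `|mon e1 e2 a' b'| * (2 * B * A1 ^+ (a' + b')) <= k.
  move=> k0; rewrite normrM [`|2 * B * _|]ger0_norm ?mulr_ge0 ?exprn_ge0//.
  by rewrite mulrC.
have L2 : lim2 (fun a b => \sum_(i < a.+1) \sum_(j < b.+1)
    (qcoef (H i j) p (a - i) (b - j) xi * mon e1 e2 (a - i) (b - j) * mon e1 e2 i j)) (8 * B + 4 * (6 * B) + 2 * B) Q.
  apply: (@lim2_conv R (fun a' b' a b => qcoef (H a' b') p a b xi * mon e1 e2 a b * mon e1 e2 a' b')
    (fun a b => K a b * mon e1 e2 a b) (2 * B) (6 * B)) => //.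
  - by rewrite mulr_ge0.
  - move=> a' b' a b; rewrite normrM.
    have M0 : 0 <= 2 * B * A1 ^+ (a' + b') by rewrite mulr_ge0// exprn_ge0.
    have q1 := qcoef_bound r10 (Hh a' b') (@Hb a' b') p a b xr.
    have q2 := mon_bound M0 h30 sm3 q1.
    apply: le_trans (ler_wpM2r (normr_ge0 _) q2) _.
    rewrite [q0 ^+ (a' + b' + _)]exprD mulrA mulrAC ler_wpM2r ?q0_ge0// mulrC.
    apply: monb; first by rewrite mulr_ge0// q0_ge0.
    apply: (mon_bound B20 h10 sm1); rewrite ger0_norm//.
  - move=> a' b'; rewrite KH /hole_pt.
    have q1 := qcoef_lim2 r10 (Hh a' b') (@Hb a' b') xr sm3.
    have := lim2Z (mon e1 e2 a' b') q1; rewrite [_ * H _ _ _]mulrC => q2.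
    apply: (@lim2_le _ _ (`|mon e1 e2 a' b'| * (3 * (2 * B * A1 ^+ (a' + b'))))).
      rewrite mulrCA; have -> : 6 * B * q0 ^+ (a' + b') = 3 * (2 * B * q0 ^+ (a' + b')).
        by move: (q0 ^+ _) => s; ring.
      rewrite ler_wpM2l//; apply: monb; first by rewrite mulr_ge0// q0_ge0.
      by apply: (mon_bound B20 h10 sm1); rewrite ger0_norm// mulr_ge0// exprn_ge0.
    by move: q2; apply: lim2_eq => a b; rewrite mulrC.
rewrite mirror_hole//; have := lim2D L1 L2.
have -> : 4 * B + (8 * B + 4 * (6 * B) + 2 * B) = 38 * B by ring.
apply: lim2_eq => a b; rewrite /scoef mulrDl; congr (_ + _).
  by case: (a =P 0%N) => [->|_]; rewrite ?mul0r// /mon expr0 mul1r.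
rewrite mulr_suml; apply: eq_bigr => i _; rewrite mulr_suml; apply: eq_bigr => j _.
rewrite -mulrA; congr (_ * _); rewrite /mon mulrACA -!exprD !subnK// -ltnS; exact: ltn_ord.
Qed.

End Scoef.

Lemma hole_pt_small p e1 e2 xi r rho A : 0 < rho -> 0 < e1 -> 0 < e2 -> hA rho p r <= A -> small A e1 e2 ->
  enorm xi <= r -> enorm (hole_pt p e1 e2 xi) < rho.
Proof.
move=> rho0 e10 e20 hAA sm xr; have r0 : 0 <= r by apply: le_trans xr; exact: enorm_ge0.
have [h1 h2 h3 h4 h5] := hA_parts p rho0 r0; have A1 := @A0_ge1 R n.
have [|s1 s2] := small_le _ sm (A' := hA rho p r); first by rewrite hAA andbT (le_trans _ h1).
rewrite !gtr0_norm// in s1 s2.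
have q1 : q0 <= 2^-1 := @q0_le R.
have t2 : e2 * enorm xi <= 1.
  have u1 : AA * r * e2 <= hA rho p r * e2.
    by rewrite ler_wpM2r ?(ltW e20)//; apply: le_trans h3; rewrite ler_peMl// ler1n.
  have u2 : e2 * enorm xi <= AA * r * e2.
    rewrite mulrC ler_wpM2r ?(ltW e20)//; apply: le_trans xr _; rewrite ler_peMl//.
  by move: u1 u2 s2 q1; lra.
have t1 : e1 * (enorm p + 1) <= rho / 2.
  have u1 : AA * (enorm p + 1) / rho * e1 <= hA rho p r * e1.
    by rewrite ler_wpM2r ?(ltW e10)//; apply: le_trans h2; rewrite ler_peMl// ler1n.
  have u2 : e1 * (enorm p + 1) <= AA * (enorm p + 1) / rho * e1 * rho.
    have -> : AA * (enorm p + 1) / rho * e1 * rho = AA * (e1 * (enorm p + 1)) by field; rewrite gt_eqF.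
    by rewrite ler_peMl// mulr_ge0 ?(ltW e10)// addr_ge0// enorm_ge0.
  apply: le_trans u2 _; rewrite mulrC ler_wpM2l ?(ltW rho0)//; exact: le_trans (le_trans u1 s1) q1.
apply: (@le_lt_trans _ _ (e1 * (enorm p + 1))); last by apply: le_lt_trans t1 _; move: rho0; clear -R n; lra.
rewrite /hole_pt -scalerA -scalerDr enormZ gtr0_norm// ler_wpM2l ?(ltW e10)//.
by apply: le_trans (enormD _ _) _; rewrite lerD2l enormZ gtr0_norm.
Qed.

Lemma operator_package Om E nu p r1 r del : hole_geometry Om E nu p r1 r -> 0 < del -> del <= r1 ->
  exists M A, [/\ 0 <= M, 1 <= A & forall f m, 0 <= m -> bdry_data E f m ->
    exists c s U, hole_op Om E p del M A f m c s U].
Proof.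
move=> hg d0 dr; have [K K0 hK] := exterior_multipole hg.
have nu1 := hg_nu hg; have p0 := hg_p hg; have r0 := hg_r hg; have n2 : (2 <= n.+1)%N by exact: ltnW (hg_n3 hg).
have rho0 : 0 < r1 / 2 by rewrite divr_gt0 ?(hg_r1 hg).
pose A1 := fA r del p; pose A2 := fA r (enorm (refl nu p - p)) (r *: nu).
pose A := 2 * (A1 + 2 * A2 + hA (r1 / 2) p r).
have A1ge : 1 <= A1 by exact: fA_ge1.
have A2ge : 1 <= A2 by apply: fA_ge1 => //; exact: mirror_norm.
have [A3ge _ _ _ _] := hA_parts p rho0 (ltW r0).
have A_1 : A1 <= A by rewrite /A; lra.
have A_3 : hA (r1 / 2) p r <= A by rewrite /A; lra.
have Age : 1 <= A by apply: le_trans A_1.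
have A10 : 0 <= A1 by apply: le_trans A1ge.
exists (38 * K), A; split => //; first by rewrite mulr_ge0.
move=> f m m0 fd; have [w [P [mp wh wl]]] := hK f m m0 fd.
set B := m * K in mp; have B0 : 0 <= B by rewrite mulr_ge0.
have mB : m * (38 * K) = 38 * B by rewrite /B; ring.
have /choice2[C hC] := corrector hg mp d0 dr.
(* The hole shrinks to 0, a boundary point of [Om] where the correctors are known from one side
   only; their odd extensions [H] are harmonic around 0 and can be expanded there. *)
have /choice2[H hH] : forall a b, exists H : V -> R, [/\ harm (eB 0 (r1 / 2)) H,
    forall x, eB 0 (r1 / 2) x -> `|H x| <= 2 * B * A1 ^+ (a + b),
    forall x, eB 0 (r1 / 2) x -> 0 < dotp nu x -> H x = C a b x & b = 0%N -> forall x, H x = 0].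
  move=> a b; have [C1 C2 C3 C4] := hC a b.
  have F0 : 0 <= 2 * B * A1 ^+ (a + b) by rewrite mulr_ge0 ?mulr_ge0// exprn_ge0.
  have [b0|b0] := eqVneq b 0%N.
    exists (fun=> 0); split => //; first exact: harm_cst.
      by move=> x _; rewrite normr0.
    by move=> x _ _; rewrite C4.
  have rs : r1 / 2 < r1 by have := hg_r1 hg; lra.
  have [|H [H1 H2 H3]] := odd_extend n2 nu1 rho0 rs (hg_Om hg) (hg_up hg) (hg_half hg) C1 F0 C2.
    by move=> z cz nz zr; have := C3 z cz nz; rewrite (gcoef_flat hg).
  by exists H; split => // bb; move: b0; rewrite bb.
have Hh a b : harm (eB 0 (r1 / 2)) (H a b) by have [] := hH a b.
have Hb a b x : eB 0 (r1 / 2) x -> `|H a b x| <= 2 * B * A1 ^+ (a + b) by have [_ + _ _] := hH a b; apply.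
have HC a b x : eB 0 (r1 / 2) x -> 0 < dotp nu x -> H a b x = C a b x by have [_ _ + _] := hH a b; apply.
have H0 a x : H a 0%N x = 0 by have [_ _ _] := hH a 0%N; apply.
have Er xi : ~ E xi -> enorm xi <= r.
  by move=> nE; rewrite leNgt; apply/negP => xr; apply: nE; apply: (hg_Er hg); exact: ltW.
have sm1 e1 e2 : small A e1 e2 -> small A1 e1 e2 by apply: small_le; rewrite A10.
have /choice2[Q hQ] : forall e1 e2, exists Q : V -> R,
    0 < e1 -> 0 < e2 -> small A e1 e2 -> holed Om E p e1 e2 ->
    [/\ harm Om Q, \bd z of Om, blim Om Q z (image_diff nu p w e1 e2 z) &
      forall x, Om x -> lim2 (fun a b => C a b x * mon e1 e2 a b) (8 * B) (Q x)].
  move=> e1 e2; have [[e10 e20 sm ho]|nh] := pselect [/\ 0 < e1, 0 < e2, small A e1 e2 & holed Om E p e1 e2].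
    have [||Q hQ] := corrector_sum hg wh mp d0 dr e10 e20 (sm1 _ _ sm) ho (K := C).
    - by move=> a b; have [] := hC a b.
    - by move=> a b z cz nz; have [_ _ + _] := hC a b; apply.
    by exists Q => _ _ _ _.
  by exists (fun=> 0) => e10 e20 sm ho; exfalso; apply: nh.
have OmE e1 e2 x : 0 < e1 -> 0 < e2 -> holed Om E p e1 e2 -> Om x -> E (unscale p e1 e2 (refl nu x)).
  by move=> e10 e20 ho Ox; apply: (mirror_in hg e10 e20 ho); exact: subset_closure.
have c_bound a b : 4 * B * A1 ^+ (a + b) <= m * (38 * K) * A ^+ (a + b).
  rewrite mB; apply: ler_pM; rewrite ?mulr_ge0 ?exprn_ge0//; first by rewrite ler_wpM2r// ler_nat.
  by rewrite lerXn2r ?nnegrE// (le_trans A10).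
exists (fun a b x => gcoef nu p P a b x - C a b x), (scoef nu p P H),
  (fun e1 e2 x => image_diff nu p w e1 e2 x - Q e1 e2 x); split.
- move=> a b; have [C1 C2 C3 _] := hC a b; split.
  + apply: harmB; last by apply: harm_sub C1 => x [].
    apply: harm_sub (gcoef_harm hg mp a b) => x [_ /= xd].
    by rewrite -enorm_gt0; exact: lt_trans xd.
  + move=> x [Ox /= xd]; apply: le_trans (c_bound a b).
    have -> : 4 * B * A1 ^+ (a + b) = 2 * B * A1 ^+ (a + b) + 2 * B * A1 ^+ (a + b) by ring.
    apply: le_trans (ler_normB _ _) _; apply: lerD; last exact: C2.
    by apply: (gcoef_bound hg mp) => //; exact: ltW.
  + move=> z cz nz zd; rewrite -(subrr (gcoef nu p P a b z)); apply: blimB.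
      apply: cont_blim; apply: (harm_cont (gcoef_harm hg mp a b)) => /=.
      by rewrite -enorm_gt0; exact: lt_trans zd.
    by apply: blim_sub (C3 z cz nz) => x [].
- by move=> a x; rewrite (gcoef0 nu p mp); have [_ _ _ ->] := hC a 0%N; rewrite ?subrr.
- by move=> a b xi; apply: (scoef_cont nu1 p0 mp rho0 Hh Hb).
- move=> a b xi nE; rewrite mB.
  apply: le_trans (scoef_bound nu1 p0 mp rho0 Hh A1ge Hb erefl erefl a b (Er _ nE)) _.
  by rewrite ler_wpM2r ?exprn_ge0 ?(le_trans A10)// ler_wpM2r// ler_nat.
- by move=> a xi; apply: (scoef0 nu p mp H0).
- move=> e1 e2 e10 e20 sm ho; have [Q1 Q2 Q3] := hQ e1 e2 e10 e20 sm ho.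
  apply: harmB; last by apply: harm_sub Q1 => x [].
  apply: harmB; first by apply: harm_sub (unscale_harm p e1 e2 wh) => x [].
  by apply: harm_sub (mirror_harm e1 e2 hg wh) => x [Ox _]; exact: OmE.
- move=> e1 e2 e10 e20 sm ho z cz nz; have [Q1 Q2 Q3] := hQ e1 e2 e10 e20 sm ho.
  rewrite -(subrr (image_diff nu p w e1 e2 z)); apply: blimB.
    by apply: cont_blim; exact: (image_cont hg wh e10 e20 ho).
  by apply: blim_sub (Q2 z cz nz) => x [].
- move=> e1 e2 e10 e20 sm ho xi cxi nxi; have [Q1 Q2 Q3] := hQ e1 e2 e10 e20 sm ho.
  have Oz := ho xi nxi; have xr := Er xi nxi.
  have zB : eB 0 (r1 / 2) (hole_pt p e1 e2 xi).
    by rewrite /eB/= subr0; exact: (hole_pt_small rho0 e10 e20 A_3 sm xr).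
  exists (w (unscale p e1 e2 (refl nu (hole_pt p e1 e2 xi))) + Q e1 e2 (hole_pt p e1 e2 xi)); split.
    rewrite mB; apply: (scoef_lim2 nu1 p0 mp rho0 Hh A1ge Hb erefl erefl e10 e20 sm xr _ (Q3 _ Oz)).
    by move=> a b; rewrite HC//; exact: (hg_up hg).
  rewrite opprD addrA; apply: blimB; last by apply: cont_blim; exact: harm_cont Q1 Oz.
  apply: blimB.
    move=> e e0; have [d d00 hd] := wl xi cxi nxi e e0.
    have t0 : 0 < e1 * e2 by rewrite mulr_gt0.
    exists (d * (e1 * e2)); first by rewrite mulr_gt0.
    move=> y [Oy Ey] yz; apply: hd => //; rewrite -{1}(hole_ptK p xi e10 e20) unscaleB enormZ.
    by rewrite ger0_norm ?invr_ge0 ?(ltW t0)// mulrC ltr_pdivrMr.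
  by apply: cont_blim; exact: (harm_cont (mirror_harm e1 e2 hg wh) (OmE _ _ _ e10 e20 ho Oz)).
- move=> e1 e2 e10 e20 sm ho x [Ox /= xd]; have [Q1 Q2 Q3] := hQ e1 e2 e10 e20 sm ho.
  have := lim2B (image_far hg mp d0 e10 e20 (sm1 _ _ sm) (ltW xd)) (Q3 x Ox).
  move=> h; apply: (@lim2_le _ _ (8 * B + 8 * B)); first by rewrite mB -mulrDl -natrD ler_wpM2r// ler_nat.
  by move: h; apply: lim2_eq => a b; rewrite [RHS]mulrBl.
Qed.

(** * Recursive determination of the hole data *)

Lemma geom_conv (A be : R) k : 1 <= A -> 2 * A <= be -> \sum_(i < k.+1) be ^+ i * A ^+ (k - i) <= 2 * be ^+ k.
Proof.
move=> A1 Ab; have b0 : 0 <= be by lra.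
elim: k => [|k IH]; first by rewrite big_ord_recl big_ord0 subnn !expr0 addr0 mulr1; lra.
rewrite big_ord_recr/= subnn expr0 mulr1.
have -> : \sum_(i < k.+1) be ^+ i * A ^+ (k.+1 - i) = A * \sum_(i < k.+1) be ^+ i * A ^+ (k - i).
  rewrite mulr_sumr; apply: eq_bigr => i _; rewrite subSn -1?ltnS// exprS mulrCA//.
have h : A * \sum_(i < k.+1) be ^+ i * A ^+ (k - i) <= A * (2 * be ^+ k) by rewrite ler_wpM2l//; lra.
have p0 : 0 <= be ^+ k by rewrite exprn_ge0.
rewrite exprS; move: h p0; move: (be ^+ k) (\sum_(i < _) _) => s T; nra.
Qed.

(** With the top index excluded a factor [A] is always present, so the sum is smaller than [be^k] by
    a factor of order [A / be]; this lets the recursion close with a fixed ratio. *)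
Lemma geom_conv_strict (A be : R) k : 1 <= A -> 2 * A <= be ->
  be * \sum_(j < k) be ^+ j * A ^+ (k - j) <= 2 * A * be ^+ k.
Proof.
move=> A1 Ab; have b0 : 0 <= be by lra.
case: k => [|k]; first by rewrite big_ord0 mulr0 expr0 mulr1; lra.
have -> : \sum_(j < k.+1) be ^+ j * A ^+ (k.+1 - j) = A * \sum_(i < k.+1) be ^+ i * A ^+ (k - i).
  rewrite mulr_sumr; apply: eq_bigr => i _; rewrite subSn -1?ltnS// exprS mulrCA//.
rewrite exprS [2 * A]mulrC -mulrA [be * _]mulrC -mulrA ler_wpM2l//; first lra.
rewrite mulrCA mulrC ler_wpM2l//; exact: geom_conv.
Qed.

Lemma adm_sum O del (k : nat) (g : nat -> V -> R) (G : nat -> R) : (forall i, adm O del (g i) (G i)) ->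
  adm O del (fun x => \sum_(i < k) g i x) (\sum_(i < k) G i).
Proof.
move=> h; split.
- by apply: harm_sum => i; have [] := h i.
- move=> x Dx; apply: le_trans (ler_norm_sum _ _ _) _; apply: ler_sum => i _.
  by have [_ + _] := h i; apply.
- move=> z cz nz zd; have {2}-> : 0 = \sum_(i < k) (0 : R) by rewrite big1.
  by apply: (@blim_sum (outr O del) k g (fun=> 0)) => i; have [_ _] := h i; apply.
Qed.

Lemma adm_le O del u M M' : M <= M' -> adm O del u M -> adm O del u M'.
Proof. by move=> MM [h1 h2 h3]; split => // x /h2 h; exact: le_trans h MM. Qed.

Section History.
Variables (os : (V -> R) -> R -> nat -> nat -> V -> R) (d : nat -> nat -> V -> R) (mm : nat -> nat -> R).

(** The recursion uses all data with smaller [b] and any [i <= a]. Stage [k] freezes the data with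
    [b < k], which makes the definition structural. *)
Fixpoint hist (k : nat) (a b : nat) : V -> R :=
  if k is k'.+1 then
    if (b < k')%N then hist k' a b else
      fun xi => d a b xi + \sum_(i < a.+1) \sum_(j < b) os (hist k' i j) (mm i j) (a - i) (b - j) xi
  else fun=> 0.

Definition datum (a b : nat) : V -> R := hist b.+1 a b.

Lemma hist_datum k a b : (b < k)%N -> hist k a b = datum a b.
Proof.
elim: k => [//|k IH]; rewrite ltnS leq_eqVlt => /orP[/eqP ->//|bk] /=.
by rewrite bk IH.
Qed.

Lemma datumE a b xi : datum a b xi =
  d a b xi + \sum_(i < a.+1) \sum_(j < b) os (datum i j) (mm i j) (a - i) (b - j) xi.
Proof.
rewrite {1}/datum /= ltnn; congr (_ + _); apply: eq_bigr => i _; apply: eq_bigr => j _.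
by rewrite hist_datum.
Qed.

End History.

Section Series.
Variables (Om E : set V) (nu p : V) (r1 r del M A Dd Ad : R) (d : nat -> nat -> V -> R).
Variables (oc os : (V -> R) -> R -> nat -> nat -> V -> R) (oU : (V -> R) -> R -> R -> R -> V -> R).
Hypothesis hg : hole_geometry Om E nu p r1 r.
Hypotheses (M0 : 0 <= M) (A1 : 1 <= A) (D0 : 0 <= Dd) (Ad0 : 0 <= Ad).
Hypothesis op : forall f m, 0 <= m -> bdry_data E f m -> hole_op Om E p del M A f m (oc f m) (os f m) (oU f m).
Hypothesis dD : forall a b, bdry_data E (d a b) (Dd * Ad ^+ (a + b)).

(** Large against [M A], so that the feedback of lower orders fills at most half of [md], and at
    least the ratio [Ad] of the prescribed data. *)
Definition beta : R := 8 * (M + 1) * A + Ad.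
Definition md (a b : nat) : R := 2 * Dd * beta ^+ (a + b).
Definition F := datum os d md.
Definition Fser (a b : nat) x : R := \sum_(i < a.+1) \sum_(j < b.+1) oc (F i j) (md i j) (a - i) (b - j) x.

Lemma Age0 : 0 <= A. Proof. exact: le_trans A1. Qed.

Lemma beta_ge : [/\ A <= beta, 2 * A <= beta, 8 * M * A <= beta, Ad <= beta & 1 <= beta].
Proof.
have MA : 0 <= M * A by rewrite mulr_ge0//; move: A1; lra.
have -> : beta = 8 * (M * A) + 8 * A + Ad by rewrite /beta; ring.
by rewrite -(mulrA 8); move: MA A1 Ad0; move: (M * A) => s s0 a1 ad0; split; lra.
Qed.

Lemma md_ge0 a b : 0 <= md a b.
Proof. by have [_ _ _ _ b1] := beta_ge; rewrite /md mulr_ge0 ?mulr_ge0// exprn_ge0//; lra. Qed.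

(** Induction on [b]: the prescribed datum and the feedback each take half of [md a b]. The feedback
    runs over [j < b] strictly, so [geom_conv_strict] and [beta >= 8 M A] give the second half. *)
Lemma F_data a b : bdry_data E (F a b) (md a b).
Proof.
have [b1 b2 b3 b4 b5] := beta_ge; have be0 : 0 <= beta by lra.
elim/ltn_ind: b a => b IH a.
have opj i j : (j < b)%N -> hole_op Om E p del M A (F i j) (md i j) (oc (F i j) (md i j)) (os (F i j) (md i j)) (oU (F i j) (md i j)).
  by move=> jb; apply: op; [exact: md_ge0|exact: IH].
have [d1 d2] := dD a b; split => xi cxi nxi.
  rewrite /F datumE -/F; apply: le_trans (ler_normD _ _) _.
  have h1 : `|d a b xi| <= Dd * beta ^+ (a + b).
    by apply: le_trans (d1 xi cxi nxi) _; rewrite ler_wpM2l// lerXn2r ?nnegrE.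
  have h2 : `|\sum_(i < a.+1) \sum_(j < b) os (F i j) (md i j) (a - i) (b - j) xi| <= Dd * beta ^+ (a + b).
    apply: (@le_trans _ _ (\sum_(i < a.+1) \sum_(j < b) 2 * Dd * M * ((beta ^+ i * A ^+ (a - i)) * (beta ^+ j * A ^+ (b - j))))).
      apply: le_trans (ler_norm_sum _ _ _) _; apply: ler_sum => i _.
      apply: le_trans (ler_norm_sum _ _ _) _; apply: ler_sum => j _.
      apply: le_trans (ho_bound (opj i j (ltn_ord j)) _ _ nxi) _; rewrite /md !exprD.
      move: (beta ^+ i) (beta ^+ j) (A ^+ _) (A ^+ _) => s1 s2 s3 s4.
      by apply: le_of_eq; ring.
    have -> : \sum_(i < a.+1) \sum_(j < b) 2 * Dd * M * ((beta ^+ i * A ^+ (a - i)) * (beta ^+ j * A ^+ (b - j))) =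
        2 * Dd * M * ((\sum_(i < a.+1) beta ^+ i * A ^+ (a - i)) * (\sum_(j < b) beta ^+ j * A ^+ (b - j))).
      rewrite mulr_suml mulr_sumr; apply: eq_bigr => i _; rewrite !mulr_sumr; apply: eq_bigr => j _.
      by [].
    have S1 := geom_conv a A1 b2; have S2 := geom_conv_strict b A1 b2.
    have S20 : 0 <= \sum_(j < b) beta ^+ j * A ^+ (b - j).
      by apply: sumr_ge0 => j _; rewrite mulr_ge0 ?exprn_ge0// Age0.
    have pa : 0 <= beta ^+ a by rewrite exprn_ge0.
    rewrite exprD; move: S1 S2 S20 pa; move: (\sum_(i < a.+1) beta ^+ i * A ^+ (a - i)) (\sum_(j < b) beta ^+ j * A ^+ (b - j)) (beta ^+ a) (beta ^+ b) => T1 T2 s1 s2 S1 S2 S20 pa.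
    have bp : 0 < beta by lra.
    have key : 4 * M * T2 <= s2.
      have u : 4 * M * (beta * T2) <= beta * s2.
        apply: (@le_trans _ _ (4 * M * (2 * A * s2))); first by rewrite ler_wpM2l ?mulr_ge0.
        have s20 : 0 <= s2.
          have : 0 <= 2 * A * s2 by apply: le_trans S2; rewrite mulr_ge0.
          by rewrite pmulr_rge0// mulr_gt0// (lt_le_trans ltr01 A1).
        have -> : 4 * M * (2 * A * s2) = 8 * M * A * s2 by ring.
        by rewrite ler_wpM2r.
      by rewrite -(ler_pM2l bp); apply: le_trans u; apply: le_of_eq; ring.
    apply: (@le_trans _ _ (2 * Dd * M * (2 * s1 * T2))).
      by rewrite ler_wpM2l ?mulr_ge0// ler_wpM2r.
    have -> : 2 * Dd * M * (2 * s1 * T2) = Dd * (s1 * (4 * M * T2)) by ring.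
    by rewrite ler_wpM2l// ler_wpM2l.
  have -> : md a b = Dd * beta ^+ (a + b) + Dd * beta ^+ (a + b) by rewrite /md; ring.
  exact: lerD.
have e : F a b = (fun xi => d a b xi + \sum_(i < a.+1) \sum_(j < b) os (F i j) (md i j) (a - i) (b - j) xi).
  by apply/funext => y; rewrite /F datumE.
rewrite e; apply: blimD; first exact: d2.
apply: cont_blim; apply: cont_sum => i; apply: cont_sum => j.
exact: (ho_cont (opj i j (ltn_ord j))).
Qed.

Lemma F_op a b : hole_op Om E p del M A (F a b) (md a b) (oc (F a b) (md a b)) (os (F a b) (md a b)) (oU (F a b) (md a b)).
Proof. by apply: op; [exact: md_ge0|exact: F_data]. Qed.

Lemma Fser_adm a b : adm Om del (Fser a b) (2 * Dd * M * (2 * beta) ^+ (a + b)).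
Proof.
have [b1 b2 b3 b4 b5] := beta_ge; have be0 : 0 <= beta by lra.
have := @adm_sum Om del a.+1 (fun i x => \sum_(j < b.+1) oc (F i j) (md i j) (a - i) (b - j) x)
  (fun i => \sum_(j < b.+1) md i j * M * A ^+ (a - i + (b - j))).
have h i : adm Om del (fun x => \sum_(j < b.+1) oc (F i j) (md i j) (a - i) (b - j) x)
    (\sum_(j < b.+1) md i j * M * A ^+ (a - i + (b - j))).
  apply: (@adm_sum Om del b.+1 (fun j x => oc (F i j) (md i j) (a - i) (b - j) x)
    (fun j => md i j * M * A ^+ (a - i + (b - j)))) => j.
  exact: (ho_adm (F_op i j)).
move=> /(_ h); apply: adm_le.
apply: (@le_trans _ _ (\sum_(i < a.+1) \sum_(j < b.+1) 2 * Dd * M * beta ^+ (a + b))).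
  apply: ler_sum => i _; apply: ler_sum => j _.
  have -> : beta ^+ (a + b) = beta ^+ (i + j) * beta ^+ (a - i + (b - j)).
    by rewrite -exprD -(conv_idx (ltn_ord i) (ltn_ord j)).
  rewrite /md; have -> : 2 * Dd * beta ^+ (i + j) * M = 2 * Dd * M * beta ^+ (i + j).
    by move: (beta ^+ _) => s; ring.
  rewrite -!(mulrA _ (beta ^+ _)) ler_wpM2l ?mulr_ge0// ler_wpM2l ?exprn_ge0//.
  by rewrite lerXn2r ?nnegrE// Age0.
rewrite !sum_cst (exprMn (a + b) 2 beta); have : 0 <= beta ^+ (a + b) by rewrite exprn_ge0.
move: (beta ^+ (a + b)) => s s0; have le2 k : k.+1%:R <= 2 ^+ k :> R by rewrite -natrX ler_nat ltn_expl.
have -> : a.+1%:R * (b.+1%:R * (2 * Dd * M * s)) = 2 * Dd * M * ((a.+1%:R * b.+1%:R) * s) by ring.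
by rewrite exprD ler_wpM2l ?mulr_ge0// ler_wpM2r// ler_pM.
Qed.

Lemma Fser0 a x : Fser a 0 x = 0.
Proof. by rewrite /Fser big1// => i _; rewrite big_ord_recl big_ord0 addr0 (ho_c0 (F_op i 0)). Qed.

Section Epsilon.
Variables (e1 e2 Cd : R) (dE v : V -> R).
Hypotheses (e10 : 0 < e1) (e20 : 0 < e2) (Cd0 : 0 <= Cd).
Hypothesis sm : small beta e1 e2.
Hypothesis ho : holed Om E p e1 e2.
Hypothesis dElim : \bd xi of E, lim2 (fun a b => d a b xi * mon e1 e2 a b) Cd (dE xi).
Hypothesis vh : harm (perf Om E p e1 e2) v.
Hypothesis vO : \bd z of Om, blim (perf Om E p e1 e2) v z 0.
Hypothesis vE : \bd xi of E, blim (perf Om E p e1 e2) v (hole_pt p e1 e2 xi) (dE xi).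

Lemma smA : small A e1 e2.
Proof. by have [b1 _ _ _ _] := beta_ge; apply: small_le sm; rewrite b1 andbT Age0. Qed.

Lemma md_mon a b : md a b * M * `|mon e1 e2 a b| <= 2 * Dd * M * q0 ^+ (a + b).
Proof.
have [_ _ _ _ b5] := beta_ge.
have -> : md a b * M = 2 * Dd * M * beta ^+ (a + b) by rewrite /md; move: (beta ^+ _) => s; ring.
have be0 : 0 <= beta by lra.
have h0 : 0 <= 2 * Dd * M * beta ^+ (a + b) by rewrite mulr_ge0 ?mulr_ge0// exprn_ge0.
have hM : 0 <= 2 * Dd * M by rewrite mulr_ge0// mulr_ge0.
have hX : `|2 * Dd * M * beta ^+ (a + b)| <= 2 * Dd * M * beta ^+ (a + b) by rewrite (ger0_norm h0).
by apply: le_trans (mon_bound hM be0 sm hX); rewrite [leRHS]normrM (ger0_norm h0).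
Qed.

Lemma conv_bound (g : nat -> nat -> nat -> nat -> R) :
  (forall i j a b, `|g i j a b| <= md i j * M * A ^+ (a + b)) -> forall i j a b,
  `|g i j a b * mon e1 e2 a b * mon e1 e2 i j| <= 2 * Dd * M * q0 ^+ (i + j + (a + b)).
Proof.
move=> h i j a b; rewrite normrM.
have mM : 0 <= md i j * M by rewrite mulr_ge0// md_ge0.
have A0 := Age0.
apply: le_trans (ler_wpM2r (normr_ge0 _) (mon_bound mM A0 smA (h i j a b))) _.
rewrite [q0 ^+ (i + j + _)]exprD mulrA mulrAC ler_wpM2r ?q0_ge0//; exact: md_mon.
Qed.

Lemma conv_sum (g : nat -> nat -> nat -> nat -> R) a b :
  \sum_(i < a.+1) \sum_(j < b.+1) g i j (a - i)%N (b - j)%N * mon e1 e2 (a - i) (b - j) * mon e1 e2 i j =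
  (\sum_(i < a.+1) \sum_(j < b.+1) g i j (a - i)%N (b - j)%N) * mon e1 e2 a b.
Proof.
rewrite mulr_suml; apply: eq_bigr => i _; rewrite mulr_suml; apply: eq_bigr => j _.
by rewrite -mulrA; congr (_ * _); rewrite /mon mulrACA -!exprD !subnK// -ltnS; exact: ltn_ord.
Qed.

Definition Ctot : R := Cd + 42 * (Dd * M).

(** On the hole the field of [F a b] is [F a b] minus its error series. Summed over all orders,
    these errors are exactly the feedback added in the recursion, the terms [j = b] vanishing
    because [s a 0 = 0]; the series of [d] remains. *)
Lemma hole_match xi : closure E xi -> ~ E xi -> exists l, [/\ forall a b,
  blim (perf Om E p e1 e2) (oU (F a b) (md a b) e1 e2) (hole_pt p e1 e2 xi) (l a b) &
  lim2 (fun a b => l a b * mon e1 e2 a b) Ctot (dE xi)].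
Proof.
move=> cxi nxi.
have /choice2[S hS] := fun a b => ho_inner (F_op a b) e10 e20 smA ho cxi nxi.
exists (fun a b => F a b xi - S a b); split; first by move=> a b; have [] := hS a b.
have DM0 : 0 <= 2 * Dd * M by rewrite mulr_ge0// mulr_ge0.
have [S2 hS2] : exists S2, lim2 (fun a b => S a b * mon e1 e2 a b) (8 * (2 * Dd * M)) S2.
  apply: (lim2_ex DM0 (q := q0)) => //; first exact: q0_le.
  move=> a b; rewrite normrM; apply: le_trans (md_mon a b); rewrite ler_wpM2r//.
  by have [/lim2_bound] := hS a b.
have L : lim2 (fun a b => \sum_(i < a.+1) \sum_(j < b.+1)
    (os (F i j) (md i j) (a - i) (b - j) xi * mon e1 e2 (a - i) (b - j) * mon e1 e2 i j))
    (8 * (2 * Dd * M) + 4 * (2 * Dd * M) + 2 * Dd * M) S2.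
  apply: (@lim2_conv R (fun a' b' a b => os (F a' b') (md a' b') a b xi * mon e1 e2 a b * mon e1 e2 a' b')
    (fun a b => S a b * mon e1 e2 a b) (2 * Dd * M) (2 * Dd * M)) => //.
    apply: (conv_bound (g := fun i j a b => os (F i j) (md i j) a b xi)) => i j a b.
    exact: (ho_bound (F_op i j)).
  move=> a' b'; have [/(lim2Z (mon e1 e2 a' b')) q _] := hS a' b'.
  rewrite [S _ _ * _]mulrC; apply: (@lim2_le _ _ (`|mon e1 e2 a' b'| * (md a' b' * M))).
    by rewrite mulrC; exact: md_mon.
  by move: q; apply: lim2_eq => a b; rewrite mulrC.
have := lim2B (lim2D (dElim cxi nxi) L) hS2.
have -> : dE xi + S2 - S2 = dE xi by rewrite addrK.
have -> : Cd + (8 * (2 * Dd * M) + 4 * (2 * Dd * M) + 2 * Dd * M) + 8 * (2 * Dd * M) = Ctot by rewrite /Ctot; ring.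
apply: lim2_eq => a b; rewrite (conv_sum (fun i j a b => os (F i j) (md i j) a b xi)).
rewrite -mulrDl -mulrBl; congr ((_ - _) * _); rewrite [in RHS]/F datumE -/F; congr (_ + _).
apply: eq_bigr => i _; rewrite big_ord_recr/= subnn (ho_s0 (F_op i b)) addr0//.
Qed.

(** The boundary limits of the partial sums match those of [v] exactly on the outer boundary and up
    to the rate on the hole, by [hole_match]; the maximum principle does the rest. *)
Lemma total_lim2 x : perf Om E p e1 e2 x ->
  lim2 (fun a b => oU (F a b) (md a b) e1 e2 x * mon e1 e2 a b) Ctot (v x).
Proof.
move=> px K; have bp : ebounded (perf Om E p e1 e2) by have [C hC] := hg_Omb hg; exists C => y [/hC].
apply: (@harm_abs_max R n (perf Om E p e1 e2)
  (fun x => v x - sum2 K (fun a b => oU (F a b) (md a b) e1 e2 x * mon e1 e2 a b))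
  (Ctot * 2^-1 ^+ K) (@perf_open _ _ _ _ _ _ hg e1 e2) bp) => //.
  apply: harmB => //; apply: (harm_sum2 K (g := fun a b x => oU (F a b) (md a b) e1 e2 x * mon e1 e2 a b)) => a b.
  by under eq_fun do rewrite mulrC; apply: harmZ; exact: (ho_harm (F_op a b) e10 e20 smA ho).
have C0 : 0 <= Ctot by rewrite /Ctot addr_ge0// mulr_ge0// mulr_ge0.
have bl z l : (forall a b, blim (perf Om E p e1 e2) (oU (F a b) (md a b) e1 e2) z (l a b)) ->
    blim (perf Om E p e1 e2) (fun x => sum2 K (fun a b => oU (F a b) (md a b) e1 e2 x * mon e1 e2 a b)) z
      (sum2 K (fun a b => l a b * mon e1 e2 a b)).
  move=> hl; apply: (blim_sum2 K (g := fun a b x => oU (F a b) (md a b) e1 e2 x * mon e1 e2 a b)) => a b.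
  by under eq_fun do rewrite mulrC; rewrite mulrC; apply: blimZ.
move=> z cz nz; have [[cO nO]|[xi [cxi nxi ->]]] := perf_bdry e10 e20 cz nz.
  have b0 := bl z (fun _ _ => 0) (fun a b => ho_outer (F_op a b) e10 e20 smA ho cO nO).
  apply: (bsup_norm (blimB (vO cO nO) b0)).
  have -> : sum2 K (fun a b => 0 * mon e1 e2 a b) = 0.
    by rewrite /sum2 big1// => i _; rewrite big1// => j _; rewrite mul0r.
  by rewrite subr0 normr0 mulr_ge0// h2_ge0.
have [l [l1 l2]] := hole_match cxi nxi.
by apply: (bsup_norm (blimB (vE cxi nxi) (bl _ l l1))); exact: l2.
Qed.

Lemma Fser_lim2 x : perf Om E p e1 e2 x -> outr Om del x ->
  lim2 (fun a b => Fser a b x * mon e1 e2 a b) (Ctot + 10 * (Dd * M)) (v x).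
Proof.
move=> px ox; have DM0 : 0 <= 2 * Dd * M by rewrite mulr_ge0// mulr_ge0.
have := @lim2_conv R (fun a' b' a b => oc (F a' b') (md a' b') a b x * mon e1 e2 a b * mon e1 e2 a' b')
  (fun a b => oU (F a b) (md a b) e1 e2 x * mon e1 e2 a b) (2 * Dd * M) (2 * Dd * M) Ctot (v x) DM0 DM0.
have -> : Ctot + 4 * (2 * Dd * M) + 2 * Dd * M = Ctot + 10 * (Dd * M) by ring.
have c1 : forall a' b' a b, `|oc (F a' b') (md a' b') a b x * mon e1 e2 a b * mon e1 e2 a' b'| <= 2 * Dd * M * q0 ^+ (a' + b' + (a + b)).
  apply: (conv_bound (g := fun i j a b => oc (F i j) (md i j) a b x)) => i j a b.
  by have [_ + _] := ho_adm (F_op i j) a b; apply.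
move=> /(_ c1) h.
have := h _ (total_lim2 px); move=> {h} h.
have : forall a' b', lim2 (fun a b => oc (F a' b') (md a' b') a b x * mon e1 e2 a b * mon e1 e2 a' b')
    (2 * Dd * M * q0 ^+ (a' + b')) (oU (F a' b') (md a' b') e1 e2 x * mon e1 e2 a' b').
  move=> a' b'; have /(lim2Z (mon e1 e2 a' b')) q := ho_far (F_op a' b') e10 e20 smA ho ox.
  rewrite [oU _ _ _ _ _ * _]mulrC; apply: (@lim2_le _ _ (`|mon e1 e2 a' b'| * (md a' b' * M))).
    by rewrite mulrC; exact: md_mon.
  by move: q; apply: lim2_eq => a b; rewrite mulrC.
move=> /h; apply: lim2_eq => a b.
by rewrite (conv_sum (fun i j a b => oc (F i j) (md i j) a b x)).
Qed.

End Epsilon.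
End Series.

End FarNear.

(** * Analyticity with values in the Schauder space *)

Section AnalyticFamily.
Context {R : realType} {n : nat}.
Local Notation V := 'rV[R]_n.+1.
Local Notation q0 := (64^-1 : R).
Local Notation cut := (@cut R n).
Implicit Types (x y z : V) (del M A al : R) (O D : set V) (u : V -> R).

Lemma C1a_space_ext al D (F G : C1a_space al D) : (forall x, closure D x -> F x = G x) -> F = G.
Proof.
move=> h; apply/val_inj/funext => x /=; have [cx|nx] := pselect (closure D x); first exact: h.
by rewrite (C1a_spaceP F).2// (C1a_spaceP G).2.
Qed.

Lemma C1a_space_sum al D (m : nat) (F : 'I_m -> C1a_space al D) x : (\sum_i F i) x = \sum_i F i x :> R.
Proof.
elim: m F => [|m IH] F; first by rewrite !big_ord0.
by rewrite !big_ord_recr/= -IH.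
Qed.

(** Partial sums converge uniformly on [outr], which hands harmonicity and zero boundary limits over
    to the sum. *)
Lemma adm_lim2 O del (g : nat -> nat -> V -> R) (G : nat -> nat -> R) S (C : R) : 0 <= C ->
  (forall a b, adm O del (g a b) (G a b)) -> (forall x, outr O del x -> lim2 (fun a b => g a b x) C (S x)) ->
  open O -> adm O del S C.
Proof.
move=> C0 hg hS oO.
have hs K : harm (outr O del) (fun x => sum2 K (fun a b => g a b x)).
  by apply: harm_sum2 => a b; have [] := hg a b.
have close e : 0 < e -> exists K : nat, C * 2^-1 ^+ K <= e.
  move=> e0; have C1 : 0 < C + 1 by rewrite ltr_wpDl.
  have [k hk] := @ik_small R (e / (C + 1)) (divr_gt0 e0 C1); exists k.
  rewrite ltr_pdivlMr// mulrC in hk; apply: le_trans (ltW hk).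
  apply: ler_pM => //; last exact: half_pow_le.
  by rewrite lerDl.
split.
- apply: harm_approx => x Ox; have [r r0 hr] := open_ball_in (@outr_open _ _ O del oO) Ox.
  exists r => // e e0; have [K hK] := close e e0.
  exists (fun x => sum2 K (fun a b => g a b x)); first by apply: harm_sub (hs K) => y; exact: hr.
  by move=> y /hr /hS /(_ K); rewrite distrC => /le_trans; apply.
- by move=> x /hS /lim2_bound.
- move=> z cz nz zd e e0; have e2 : 0 < e / 2 by rewrite divr_gt0.
  have [K hK] := close _ e2.
  have b0 : blim (outr O del) (fun x => sum2 K (fun a b => g a b x)) z (sum2 K (fun _ _ => 0)).
    by apply: blim_sum2 => a b; have [_ _] := hg a b; apply.
  have [d d0 hd] := b0 _ e2; exists d => // x Dx xz; have := hd x Dx xz; have := hS x Dx K.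
  have -> : sum2 K (fun _ _ => 0 : R) = 0 by rewrite /sum2 big1// => i _; rewrite big1.
  rewrite !subr0; have := ler_normD (S x - sum2 K (fun a b => g a b x)) (sum2 K (fun a b => g a b x)).
  by rewrite subrK; move: hK; clear -R n; lra.
Qed.

Lemma adm_ext O del u w M : open O -> (forall x, outr O del x -> u x = w x) -> adm O del u M -> adm O del w M.
Proof.
move=> oO uw [h1 h2 h3]; split.
- exact: harm_congr (outr_open (del := del) oO) uw h1.
- by move=> x Dx; rewrite -uw//; exact: h2.
- by move=> z cz nz zd e e0; have [d d0 hd] := h3 z cz nz zd e e0; exists d => // x Dx; rewrite -uw//; exact: hd.
Qed.

Lemma admZ O del u M (k : R) : adm O del u M -> adm O del (fun x => k * u x) (`|k| * M).
Proof.
move=> [h1 h2 h3]; split; first exact: harmZ.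
  by move=> x Dx; rewrite normrM ler_wpM2l//; exact: h2.
by move=> z cz nz zd; rewrite -(mulr0 k); apply: blimZ; exact: h3.
Qed.

Lemma bin_le2 (i m : nat) : 'C(i + m, i)%:R <= 2 ^+ (i + m) :> R.
Proof.
rewrite -natrX ler_nat; move: (i + m)%N => k; elim: k i => [|k IH] [|i]; rewrite ?bin0 ?expn_gt0//.
by rewrite binS expnS mul2n -addnn leq_add.
Qed.

(** The factors produced when both powers in [(t.1 + h1)^(i1 + m1) (t.2 + h2)^(i2 + m2)] are
    expanded by the binomial theorem. *)
Definition shiftc (C : nat -> nat -> V -> R) (t : R * R) (i1 i2 m1 m2 : nat) x : R :=
  'C(i1 + m1, i1)%:R * 'C(i2 + m2, i2)%:R * C (i1 + m1)%N (i2 + m2)%N x.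

Section Family.
Variables (al del Ce M A : R) (O D : set V) (C : nat -> nat -> V -> R).
Hypotheses (oO : open O) (Ce0 : 0 <= Ce) (M0 : 0 <= M) (A1 : 1 <= A).
Hypothesis emb : forall u M, 0 <= M -> adm O del u M ->
  exists F : C1a_space al D, (forall x, closure D x -> F x = cut O del u x) /\ `|F| <= Ce * M.
Hypothesis hC : forall a b, adm O del (C a b) (M * A ^+ (a + b)).

Lemma q00 : 0 <= q0 :> R. Proof. by []. Qed.
Lemma fam_ge0 : 0 <= A. Proof. exact: le_trans A1. Qed.
Lemma fam2_ge0 : 0 <= 2 * A. Proof. by rewrite mulr_ge0// fam_ge0. Qed.

(** The values on the closure of [D] determine the element, so a single choice [J u] satisfies every
    bound [m] for which [u] is admissible. *)
Lemma embedding : exists J : (V -> R) -> C1a_space al D, forall u m, 0 <= m -> adm O del u m ->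
  (forall x, closure D x -> J u x = cut O del u x) /\ `|J u| <= Ce * m.
Proof.
pose P u (F : C1a_space al D) := (exists2 m, 0 <= m & adm O del u m) -> forall x, closure D x -> F x = cut O del u x.
have /choice[J hJ] : forall u, exists F, P u F.
  move=> u; have [[m m0 um]|nu] := pselect (exists2 m, 0 <= m & adm O del u m); last by exists 0 => /nu.
  by have [F [F1 _]] := emb m0 um; exists F; rewrite /P => _.
exists J => u m m0 um; have e := hJ u (ex_intro2 _ _ m m0 um); split => //.
have [F [F1 F2]] := emb m0 um; rewrite (@C1a_space_ext _ _ (J u) F)//.
by move=> x cx; rewrite e// F1.
Qed.

Lemma shiftc_bound (t : R * R) i1 i2 m1 m2 x : outr O del x ->
  `|shiftc C t i1 i2 m1 m2 x| <= M * (2 * A) ^+ (i1 + i2) * (2 * A) ^+ (m1 + m2).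
Proof.
move=> ox; have [_ h _] := hC (i1 + m1) (i2 + m2); have {}h := h x ox.
rewrite /shiftc normrM ger0_norm ?mulr_ge0 ?ler0n//.
apply: (@le_trans _ _ (2 ^+ (i1 + m1) * 2 ^+ (i2 + m2) * (M * A ^+ (i1 + m1 + (i2 + m2))))).
  apply: ler_pM => //.
  by apply: ler_pM => //; exact: bin_le2.
rewrite -exprD [leLHS]mulrCA -mulrA ler_wpM2l// -exprMn -exprD.
by have -> : (i1 + m1 + (i2 + m2) = i1 + i2 + (m1 + m2))%N by clear; lia.
Qed.

(** The ratio doubles because binomials are at most [2^(i + m)]. [lim2_conv] undoes the binomial
    expansion and uniqueness of sums identifies the two orders of summation. *)
Lemma recenter (t : R * R) : small (2 * A) t.1 t.2 -> exists K : nat -> nat -> V -> R,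
  (forall i j, adm O del (K i j) (8 * M * (2 * A) ^+ (i + j))) /\
  forall x h1 h2 C' S, outr O del x -> small (2 * A) h1 h2 ->
    lim2 (fun a b => C a b x * mon (t.1 + h1) (t.2 + h2) a b) C' S ->
    lim2 (fun i j => K i j x * mon h1 h2 i j) (64 * M) S.
Proof.
move=> st; have A20 := fam2_ge0.
pose g i1 i2 m1 m2 x : R := shiftc C t i1 i2 m1 m2 x * mon t.1 t.2 m1 m2.
have gb i1 i2 m1 m2 x : outr O del x -> `|g i1 i2 m1 m2 x| <= M * (2 * A) ^+ (i1 + i2) * q0 ^+ (m1 + m2).
  by move=> ox; apply: (mon_bound _ A20 st); [rewrite mulr_ge0// exprn_ge0|exact: shiftc_bound].
have [K hK] : exists K : nat -> nat -> V -> R, forall i j x, outr O del x ->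
    lim2 (fun m1 m2 => g i j m1 m2 x) (8 * M * (2 * A) ^+ (i + j)) (K i j x).
  suff h : forall i j x, exists S, outr O del x -> lim2 (fun m1 m2 => g i j m1 m2 x) (8 * M * (2 * A) ^+ (i + j)) S.
    by exists (fun i j x => projT1 (cid (h i j x))) => i j x; exact: projT2 (cid (h i j x)).
  move=> i j x; have [ox|nx] := pselect (outr O del x); last by exists 0.
  have M1 : 0 <= M * (2 * A) ^+ (i + j) by rewrite mulr_ge0// exprn_ge0.
  have [S hS] := lim2_ex M1 q00 (@q0_le R) (fun m1 m2 => gb i j m1 m2 x ox).
  by exists S => _; rewrite -mulrA.
have MA k : 0 <= 8 * M * (2 * A) ^+ k by rewrite mulr_ge0 ?exprn_ge0// mulr_ge0.
exists K; split.
  move=> i j; apply: (@adm_lim2 O del (fun m1 m2 => g i j m1 m2)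
    (fun m1 m2 => `|mon t.1 t.2 m1 m2 * ('C(i + m1, i)%:R * 'C(j + m2, j)%:R)| * (M * A ^+ (i + m1 + (j + m2))))) => //.
    move=> m1 m2; apply: (adm_ext oO) (admZ _ (hC _ _)) => x _.
    by rewrite /g /shiftc; move: (mon _ _ _ _) => s; ring.
  by move=> x ox; exact: hK.
move=> x h1 h2 C' S ox sh hS.
have Kb i j : `|K i j x * mon h1 h2 i j| <= 8 * M * q0 ^+ (i + j).
  by apply: (mon_bound _ A20 sh); [rewrite mulr_ge0|exact: lim2_bound (hK i j x ox)].
have M80 : 0 <= 8 * M by rewrite mulr_ge0.
have [T hT] := lim2_ex M80 q00 (@q0_le R) Kb.
have -> : 64 * M = 8 * (8 * M) by ring.
suff -> : S = T by [].
have G1 i j m1 m2 : `|g i j m1 m2 x * mon h1 h2 i j| <= 8 * M * q0 ^+ (i + j + (m1 + m2)).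
  rewrite normrM; apply: le_trans (ler_wpM2r (normr_ge0 _) (gb i j m1 m2 x ox)) _.
  rewrite mulrAC [q0 ^+ (i + j + _)]exprD mulrA ler_wpM2r ?q0_ge0//.
  have m0 : 0 <= M * (2 * A) ^+ (i + j) by rewrite mulr_ge0// exprn_ge0.
  have q : `|M * (2 * A) ^+ (i + j)| <= M * (2 * A) ^+ (i + j) by rewrite ger0_norm.
  have := mon_bound M0 A20 sh q; rewrite normrM ger0_norm// => /le_trans; apply.
  by rewrite ler_wpM2r ?q0_ge0// ler_peMl// ler1n.
have G2 i j : lim2 (fun m1 m2 => g i j m1 m2 x * mon h1 h2 i j) (8 * M * q0 ^+ (i + j)) (K i j x * mon h1 h2 i j).
  have := lim2Z (mon h1 h2 i j) (hK i j x ox); rewrite [mon _ _ _ _ * K _ _ _]mulrC => q.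
  apply: (@lim2_le _ _ (`|mon h1 h2 i j| * (8 * M * (2 * A) ^+ (i + j)))).
    have q' : `|8 * M * (2 * A) ^+ (i + j)| <= 8 * M * (2 * A) ^+ (i + j) by rewrite ger0_norm.
    by have := mon_bound M80 A20 sh q'; rewrite normrM ger0_norm// mulrC.
  by move: q; apply: lim2_eq => a b; rewrite mulrC.
have L := lim2_conv (G := fun i j m1 m2 => g i j m1 m2 x * mon h1 h2 i j) M80 M80 G1 G2 hT.
apply: (lim2_uniq hS (C' := 8 * (8 * M) + 4 * (8 * M) + 8 * M)).
move: L; apply: lim2_eq => a b; rewrite /g /shiftc /mon.
rewrite [(t.1 + h1) ^+ a]exprDn [(t.2 + h2) ^+ b]exprDn mulr_suml mulr_sumr.
apply: eq_bigr => i _; rewrite !mulr_sumr; apply: eq_bigr => j _.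
have -> : (i + (a - i) = a)%N by rewrite subnKC// -ltnS.
have -> : (j + (b - j) = b)%N by rewrite subnKC// -ltnS.
rewrite -(mulr_natl (t.1 ^+ _ * _)) -(mulr_natl (t.2 ^+ _ * _)).
move: (C a b x) (t.1 ^+ _) (t.2 ^+ _) (h1 ^+ _) (h2 ^+ _) ('C(a, i)%:R) ('C(b, j)%:R) => s s1 s2 s3 s4 s5 s6; ring.
Qed.

(** The sum is formed pointwise and embedded as a whole. The remainders of the recentred series are
    again admissible, so the norm of their images under [J] gives convergence in [C1a_space]. *)
Lemma analytic_family (v0 : C1a_space al D) : exists UU : R * R -> C1a_space al D,
  [/\ forall S, (forall e, S e -> small (4 * A) e.1 e.2) -> real_analytic_on S UU,
    forall e x C' S, small (4 * A) e.1 e.2 -> closure D x -> outr O del x ->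
      lim2 (fun a b => C a b x * mon e.1 e.2 a b) C' S -> UU e x = v0 x + S &
    forall e x, small (4 * A) e.1 e.2 -> closure D x -> ~ outr O del x -> UU e x = v0 x].
Proof.
have [J hJ] := embedding; have A20 := fam2_ge0; have A10 := fam_ge0.
have le24 e : small (4 * A) e.1 e.2 -> small (2 * A) e.1 e.2.
  by apply: small_le; rewrite A20/= ler_wpM2r// ler_nat.
have le14 e : small (4 * A) e.1 e.2 -> small A e.1 e.2.
  by apply: small_le; rewrite A10/= ler_peMl// ler1n.
have /choice2[FF hF] : forall (e : R * R) x, exists S, small (4 * A) e.1 e.2 -> outr O del x ->
    lim2 (fun a b => C a b x * mon e.1 e.2 a b) (8 * M) S.
  move=> e x; have [[se ox]|nx] := pselect (small (4 * A) e.1 e.2 /\ outr O del x); last first.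
    by exists 0 => se ox; exfalso; apply: nx.
  have Cb a b : `|C a b x * mon e.1 e.2 a b| <= M * q0 ^+ (a + b).
    by apply: (mon_bound M0 A10 (le14 _ se)); have [_ + _] := hC a b; apply.
  by have [S hS] := lim2_ex M0 q00 (@q0_le R) Cb; exists S.
have MA k : 0 <= 8 * M * (2 * A) ^+ k by rewrite mulr_ge0 ?exprn_ge0// mulr_ge0.
have M80 : 0 <= 8 * M by rewrite mulr_ge0.
have admF e : small (4 * A) e.1 e.2 -> adm O del (FF e) (8 * M).
  move=> se; apply: (@adm_lim2 O del (fun a b x => C a b x * mon e.1 e.2 a b)
    (fun a b => `|mon e.1 e.2 a b| * (M * A ^+ (a + b)))) => //.
    by move=> a b; apply: (adm_ext oO) (admZ (mon e.1 e.2 a b) (hC a b)) => x _; rewrite mulrC.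
  by move=> x ox; exact: hF.
exists (fun e => v0 + J (FF e)); split; last first.
- move=> e x se cx nx; have [h _] := hJ _ _ M80 (admF e se).
  rewrite -[LHS]/(v0 x + J (FF e) x) h// /cut asboolF// addr0//.
- move=> e x C' S se cx ox hS; have [h _] := hJ _ _ M80 (admF e se).
  rewrite -[LHS]/(v0 x + J (FF e) x) h// /cut asboolT//; congr (_ + _).
  exact: lim2_uniq (hF e x se ox) hS.
move=> S sS; apply: analytic_of_series => e0 Se0; have se0 := sS e0 Se0.
have [K [K1 K2]] := recenter (le24 _ se0).
(* The fixed element [v0] enters the term of order 0 only. *)
pose cc j l : C1a_space al D := (if (j + l == 0)%N then v0 else 0) + J (K j l).
exists cc, (`|v0| + Ce * (8 * M)), (2 * A), (q0 / (2 * A)), (Ce * (72 * M)).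
have A2p : 0 < 2 * A by rewrite mulr_gt0// (lt_le_trans ltr01 A1).
split => //.
- by rewrite addr_ge0// mulr_ge0.
- by rewrite divr_gt0.
- move=> j l; apply: le_trans (ler_normD _ _) _; rewrite mulrDl; apply: lerD.
    case: ifP => _; last by rewrite normr0 mulr_ge0 ?exprn_ge0.
    rewrite ler_peMr// exprn_ege1//; apply: le_trans A1 _; by rewrite ler_peMl// ler1n.
  by have [_ h] := hJ _ _ (MA _) (K1 j l); apply: le_trans h _; rewrite !mulrA.
move=> e Se; rewrite ltr_pdivlMr// => eh J0.
have se := sS e Se; set h1 := (e - e0).1; set h2 := (e - e0).2.
have sh : small (2 * A) h1 h2.
  have hh1 : `|h1| <= `|e - e0| by rewrite prod_normE le_max lexx.
  have hh2 : `|h2| <= `|e - e0| by rewrite prod_normE le_max lexx orbT.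
  by split; apply: le_trans (ltW eh); rewrite mulrC ler_wpM2r.
have ee1 : e.1 = e0.1 + h1 by rewrite /h1 /= addrC subrK.
have ee2 : e.2 = e0.2 + h2 by rewrite /h2 /= addrC subrK.
have KF x : outr O del x -> lim2 (fun i j => K i j x * mon h1 h2 i j) (64 * M) (FF e x).
  by move=> ox; apply: (K2 x h1 h2 (8 * M)) => //; rewrite -ee1 -ee2; exact: hF.
pose T x : R := FF e x - \sum_(k < J0.+1) \sum_(j < k.+1) mon h1 h2 j (k - j) * K j (k - j)%N x.
have admT : adm O del T (72 * M * 2^-1 ^+ J0).
  split.
  - apply: harmB; first by have [] := admF e se.
    by apply: harm_sum => k; apply: harm_sum => j; apply: harmZ; have [] := K1 j (k - j)%N.
  - move=> x ox.
    have Kb i j : `|K i j x * mon h1 h2 i j| <= 8 * M * q0 ^+ (i + j).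
      by apply: (mon_bound M80 A20 sh); have [_ + _] := K1 i j; apply.
    have := tri_trunc M80 Kb (KF x ox) J0.+1; rewrite -mulrDl -natrD.
    rewrite /T; under eq_bigr do under eq_bigr do rewrite mulrC.
    move=> h; apply: le_trans h _; rewrite ler_wpM2l ?mulr_ge0//.
    by rewrite exprS ler_piMl ?h2_ge0// invf_le1// ler1n.
  - move=> z cz nz zd; rewrite -[X in blim _ _ _ X](subr0 0); apply: blimB.
      by have [_ _] := admF e se; apply.
    have E0 : \sum_(k < J0.+1) \sum_(j < k.+1) (0 : R) = 0 by rewrite big1// => k _; rewrite big1.
    rewrite -[X in blim _ _ _ X]E0; apply: (@blim_sum _ _ _ J0.+1 (fun k x => \sum_(j < k.+1) mon h1 h2 j (k - j) * K j (k - j)%N x) (fun k => \sum_(j < k.+1) 0)) => k.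
    apply: (@blim_sum _ _ _ k.+1 (fun j x => mon h1 h2 j (k - j) * K j (k - j)%N x) (fun=> 0)) => j.
    by rewrite -(mulr0 (mon h1 h2 j (k - j))); apply: blimZ; have [_ _] := K1 j (k - j)%N; apply.
have T0 : 0 <= 72 * M * 2^-1 ^+ J0 by rewrite mulr_ge0 ?h2_ge0// mulr_ge0.
have [JT JTn] := hJ _ _ T0 admT.
suff -> : v0 + J (FF e) - \sum_(k < J0.+1) \sum_(j < k.+1) (h1 ^+ j * h2 ^+ (k - j)) *: cc j (k - j)%N = J T.
  by apply: le_trans JTn _; rewrite !mulrA.
apply: C1a_space_ext => x cx.
have -> : \sum_(k < J0.+1) \sum_(j < k.+1) (h1 ^+ j * h2 ^+ (k - j)) *: cc j (k - j)%N =
    v0 + \sum_(k < J0.+1) \sum_(j < k.+1) (h1 ^+ j * h2 ^+ (k - j)) *: J (K j (k - j)%N).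
  have -> : \sum_(k < J0.+1) \sum_(j < k.+1) (h1 ^+ j * h2 ^+ (k - j)) *: cc j (k - j)%N =
    \sum_(k < J0.+1) (\sum_(j < k.+1) (h1 ^+ j * h2 ^+ (k - j)) *: (if (j + (k - j) == 0)%N then v0 else 0) +
      \sum_(j < k.+1) (h1 ^+ j * h2 ^+ (k - j)) *: J (K j (k - j)%N)).
    by apply: eq_bigr => k _; rewrite -big_split; apply: eq_bigr => j _; rewrite /cc scalerDr.
  rewrite big_split/=; congr (_ + _); rewrite big_ord_recl big_ord_recl big_ord0 addr0 /= !expr0 mulr1 scale1r.
  rewrite big1 ?addr0// => k _; rewrite big1// => j _; rewrite subnKC ?[_ == _]/= ?scaler0//.
  by rewrite -ltnS.
rewrite opprD addrACA subrr add0r JT//.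
rewrite -[LHS]/(J (FF e) x - (\sum_(k < J0.+1) \sum_(j < k.+1) (h1 ^+ j * h2 ^+ (k - j)) *: J (K j (k - j)%N)) x).
rewrite C1a_space_sum; have [hFe _] := hJ _ _ M80 (admF e se); rewrite hFe//.
have -> : \sum_(k < J0.+1) (\sum_(j < k.+1) (h1 ^+ j * h2 ^+ (k - j)) *: J (K j (k - j)%N)) x =
    \sum_(k < J0.+1) \sum_(j < k.+1) mon h1 h2 j (k - j) * cut O del (K j (k - j)%N) x.
  apply: eq_bigr => k _; rewrite C1a_space_sum; apply: eq_bigr => j _.
  by have [hK _] := hJ _ _ (MA _) (K1 j (k - j)%N); rewrite -hK.
rewrite /T /cut; case: ifP => _ //.
by rewrite big1 ?subrr// => k _; rewrite big1// => j _; rewrite mulr0.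
Qed.

End Family.
End AnalyticFamily.

(** * The perforated domain in hole coordinates and the proof of the theorem *)

Section Assembly.
Context {R : realType} {n : nat}.
Local Notation V := 'rV[R]_n.+1.
Implicit Types (x y z xi p : V) (r : R) (O om Om : set V) (u : V -> R).

Lemma dotp_last x : dotp (ee ord_max) x = lastc x.
Proof. by rewrite dotpC dotp_ee. Qed.

Lemma lim2_const (c : R) e1 e2 :
  lim2 (fun a b => (if (a == 0%N) && (b == 0%N) then c else 0) * mon e1 e2 a b) `|c| c.
Proof.
move=> [|K]; first by rewrite /sum2 big_ord0 subr0 expr0 mulr1.
have -> : sum2 K.+1 (fun a b => (if (a == 0%N) && (b == 0%N) then c else 0) * mon e1 e2 a b) = c.
  rewrite /sum2 big_ord_recl big_ord_recl /= /mon !expr0 !mulr1 big1 ?addr0; last by move=> i _; rewrite mul0r.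
  by rewrite big1 ?addr0// => i _; rewrite big1// => j _; rewrite mul0r.
by rewrite subrr normr0 mulr_ge0// h2_ge0.
Qed.

Lemma blim_out O u z (l : R) : ~ closure O z -> blim O u z l.
Proof.
move=> nz e e0; apply: contrapT => h; apply: nz; apply/closure_enormP => d d0.
apply: contrapT => h'; apply: h; exists d => // y Oy yz.
by exfalso; apply: h'; exists y.
Qed.

Lemma scaledE p om (e : R * R) x : 0 < e.1 -> 0 < e.2 -> scaled p om e x <-> om (unscale p e.1 e.2 x).
Proof.
move=> e10 e20; split => [[y oy <-]|ox]; first by rewrite -/(hole_pt p e.1 e.2 y) hole_ptK.
by exists (unscale p e.1 e.2 x) => //; rewrite -[LHS]/(hole_pt p e.1 e.2 _) unscaleK.
Qed.

Lemma closure_scaledE p om (e : R * R) x : 0 < e.1 -> 0 < e.2 ->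
  closure (scaled p om e) x <-> closure om (unscale p e.1 e.2 x).
Proof.
move=> e10 e20; have t0 : 0 < e.1 * e.2 by rewrite mulr_gt0.
have en y z : enorm (unscale p e.1 e.2 y - unscale p e.1 e.2 z) = enorm (y - z) / (e.1 * e.2).
  by rewrite unscaleB enormZ ger0_norm ?invr_ge0 ?(ltW t0)// mulrC.
split => /closure_enormP h; apply/closure_enormP => d d0.
  have [y /(scaledE p om y e10 e20) oy yx] := h (d * (e.1 * e.2)) (mulr_gt0 d0 t0).
  by exists (unscale p e.1 e.2 y) => //; rewrite en ltr_pdivrMr.
have [y oy yx] := h (d / (e.1 * e.2)) (divr_gt0 d0 t0).
exists (hole_pt p e.1 e.2 y); first by apply/scaledE => //; rewrite hole_ptK.
rewrite -(hole_ptK p y e10 e20) en in yx.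
by move: yx; rewrite ltr_pM2r// invr_gt0.
Qed.

Lemma perforatedE p om Om (e : R * R) : 0 < e.1 -> 0 < e.2 ->
  perforated Om om p e = perf Om (~` closure om) p e.1 e.2.
Proof.
move=> e10 e20; apply/seteqP; split => x [Ox nx]; split => //= /(closure_scaledE p om x e10 e20) //.
Qed.

Lemma exterior_bdry om xi : open om -> closure (~` closure om) xi -> ~ (~` closure om) xi ->
  closure om xi /\ ~ om xi.
Proof.
move=> oo cx nx; split; first exact: contrapT.
move=> ox; have [d d0 hd] := open_ball_in oo ox.
have [y ny yx] := (closure_enormP _ _).1 cx d d0.
by apply: ny; apply: subset_closure; exact: hd.
Qed.

Lemma perf_closure Om E p (e1 e2 : R) xi : 0 < e1 -> 0 < e2 -> open Om -> Om (hole_pt p e1 e2 xi) ->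
  closure E xi -> closure (perf Om E p e1 e2) (hole_pt p e1 e2 xi).
Proof.
move=> e10 e20 oO Oz /closure_enormP cx; have t0 : 0 < e1 * e2 by rewrite mulr_gt0.
have [d dp hd] := open_ball_in oO Oz; apply/closure_enormP => d' dp'.
have [|y Ey yx] := cx (Num.min d d' / (e1 * e2)); first by rewrite divr_gt0// lt_min dp.
have yd : enorm (hole_pt p e1 e2 y - hole_pt p e1 e2 xi) < Num.min d d'.
  by rewrite /hole_pt opprD addrACA subrr add0r -scalerBr enormZ (gtr0_norm t0) mulrC -ltr_pdivlMr.
move: yd; rewrite lt_min => /andP[yd yd']; exists (hole_pt p e1 e2 y); last exact: yd'.
by split; [exact: hd|rewrite hole_ptK].
Qed.

Lemma scaled_norm p om r (e : R * R) x : (forall y, om y -> enorm y <= r) -> `|e.2| <= 1 ->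
  closure (scaled p om e) x -> enorm x <= `|e.1| * (enorm p + r).
Proof.
move=> omr e2 /closure_enormP cx; apply/ler_addgt0Pr => d d0; have [y [w ow wy] yx] := cx d d0.
have r0 : 0 <= r by apply: le_trans (omr w ow); exact: enorm_ge0.
have h : enorm y <= `|e.1| * (enorm p + r).
  rewrite -wy -scalerA -scalerDr enormZ ler_wpM2l//; apply: le_trans (enormD _ _) _.
  rewrite lerD2l enormZ; apply: le_trans (omr w ow); rewrite ler_piMl ?enorm_ge0//.
have := enorm_rdist x y; rewrite enorm_distC ler_norml => /andP[_].
by move: h yx; clear -R n; lra.
Qed.

End Assembly.

Theorem theorem1p2 (R : realType) (n : nat) (hn : (3 <= n.+1)%N)
  (alpha : R) (halpha : 0 < alpha < 1)
  (* the domain *)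
  (Om : set 'rV[R]_n.+1)
  (Om_open : open Om) (Om_bounded : bounded_set Om) (Om_conn : connected Om)
  (Om_upper : Om `<=` upper_half)
  (Om_C1a : of_class_C1a alpha Om)
  (Om_flat : within hyperplane (nbhs (0 : 'rV[R]_n.+1))
              (boundary Om `&` hyperplane))
  (Om_plus_compact : compact (closure (boundary Om `&` upper_half)))
  (Om_plus : C1a_submanifold_with_boundary alpha
               (closure (boundary Om `&` upper_half)))
  (* the hole *)
  (om : set 'rV[R]_n.+1)
  (om_open : open om) (om_bounded : bounded_set om) (om_conn : connected om)
  (om_C1a : of_class_C1a alpha om) (om_0 : om 0)
  (p : 'rV[R]_n.+1) (p_upper : upper_half p)
  (ead : R * R) (ead1_gt0 : 0 < ead.1) (ead1_lt1 : ead.1 < 1)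
  (ead2_gt1 : 1 < ead.2) (ead2_lt : ead.2 < 1 / ead.1)
  (ead_sub : forall e, rect 0 ead e -> closure (scaled p om e) `<=` Om)
  (* the data *)
  (go gi : 'rV[R]_n.+1 -> R^o)
  (go_C1a : C1a_on_boundary alpha Om go)
  (gi_C1a : C1a_on_boundary alpha om gi)
  (r0 : R) (r0_gt0 : 0 < r0)
  (go_analytic : real_analytic_on
     (eball r0 `&` (boundary Om `&` hyperplane)) go)
  (* the solutions *)
  (u : R * R -> 'rV[R]_n.+1 -> R^o)
  (hu : forall e, rect 0 ead e ->
     [/\ C1a alpha (perforated Om om p e) (u e),
         harmonic_in (perforated Om om p e) (u e),
         (forall x, boundary Om x -> u e x = go x) &
         (forall x, boundary (scaled p om e) x ->
            u e x = gi ((e.1 * e.2)^-1 *: (x - e.1 *: p)))])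
  (u0 : 'rV[R]_n.+1 -> R^o)
  (hu0 : [/\ C1a alpha Om u0, harmonic_in Om u0 &
             forall x, boundary Om x -> u0 x = go x])
  (* the harmonic extension of u0 across the flat part of the boundary *)
  (r1 : R) (hr1 : 0 < r1 <= r0) (r1_sub : eball_plus r1 `<=` Om)
  (U0 : 'rV[R]_n.+1 -> R^o) (U0_harm : harmonic_in (eball r1) U0)
  (U0_u0 : forall x, closure (eball_plus r1) x -> U0 x = u0 x)
  (ead_small : forall e, rect (- ead) ead e ->
     scaled p (closure om) e `<=` eball r1)
  (* the set on which the solution is observed *)
  (Om' : set 'rV[R]_n.+1) (Om'_open : open Om') (Om'_sub : Om' `<=` Om)
  (Om'_0 : ~ closure Om' 0) :
  exists e' : R * R,
    [/\ rect 0 ead e',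
        (forall e, rect (- e') e' e ->
           closure (scaled p om e) `&` closure Om' = set0) &
        exists UU : R * R -> C1a_space alpha Om',
          [/\ real_analytic_on (rect (- e') e') UU,
              (forall e, rect 0 e' e ->
                 forall x, closure Om' x -> u e x = UU e x) &
              (forall x, closure Om' x -> UU 0 x = u0 x)]].
Proof.
have n2 : (2 <= n.+1)%N by exact: ltnW.
have /andP[al0 al1] := halpha; have /andP[r10 r1r0] := hr1.
have bOm : ebounded Om by exact/eboundedP.
have bom : ebounded om by exact/eboundedP.
set nu : 'rV[R]_n.+1 := ee ord_max; set E : set 'rV[R]_n.+1 := ~` closure om.
have oE : open E by apply: closed_openC; exact: closed_closure.
have [kap [rf [kap0 rf0 flatOm]]] := C1a_flat al0 Om_open bOm Om_C1a.
have [kap' [rf' [kap0' rf0' flatom]]] := C1a_flat al0 om_open bom om_C1a.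
have flatO z : closure Om z -> ~ Om z -> exists mu, flat_at alpha Om z mu kap rf.
  by move=> cz nz; apply: flatOm; apply/bdryE.
(* The margin of 1 puts the points at distance [r] or more outside the closure of the hole. *)
have [B0 hB0] := bom; pose r : R := `|B0| + 1; have r_gt0 : 0 < r by rewrite ltr_wpDl.
have om_r y : om y -> enorm y <= r.
  by move=> /hB0 h; apply: le_trans h _; rewrite /r; apply: le_trans (ler_norm B0) _; rewrite lerDl.
have hg : hole_geometry Om E nu p r1 r.
  split => //.
  - exact: enorm_ee.
  - by move=> x Ox; rewrite dotp_last; exact: Om_upper.
  - by move=> z cz nz; have [mu hmu] := flatO z cz nz; exact: flat_inner_barrier hmu.
  - by move=> x; rewrite dotp_last => xn xr; apply: r1_sub.
  - move=> x xr /closure_enormP cx; have [y /hB0 yB yx] := cx 1 ltr01.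
    have := enorm_rdist x y; rewrite enorm_distC ler_norml => /andP[_].
    by have := ler_norm B0; move: xr yB yx; rewrite /r; clear -R; lra.
  - have [d d0 hd] := open_ball_in om_open om_0; exists d => // x nx; rewrite leNgt; apply/negP => xd.
    by apply: nx; apply: subset_closure; apply: hd; rewrite /eB/= subr0.
  - move=> z cz nz; have [co no] := exterior_bdry om_open cz nz.
    have [|mu hmu] := flatom z; first exact/bdryE.
    exact: flat_outer_barrier hmu.
  - by rewrite dotp_last.
have [d0 d00 hd0] : exists2 d : R, 0 < d & forall x, Om' x -> d <= enorm x.
  apply: contrapT => h; apply: Om'_0; apply/closure_enormP => d dp; apply: contrapT => h'.
  apply: h; exists d => // x Ox; rewrite leNgt; apply/negP => xd; apply: h'.
  by exists x => //; rewrite subr0.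
(* The observed set stays beyond [3 del], where [bdry_gradient] holds, and [del <= r1] keeps the
   boundary flat inside the excluded ball. *)
pose del : R := Num.min (d0 / 3) r1.
have del0 : 0 < del by rewrite lt_min r10 divr_gt0.
have delr1 : del <= r1 by rewrite /del ge_min lexx orbT.
have Om'del x : Om' x -> 3 * del <= enorm x.
  move=> /hd0; apply: le_trans; have : del <= d0 / 3 by rewrite /del ge_min lexx.
  by clear -R; lra.
have cOm'del x : closure Om' x -> 3 * del <= enorm x.
  move=> /closure_enormP cx; apply/ler_addgt0Pr => d dp; have [y /Om'del yd yx] := cx d dp.
  by have [_] := enorm_rdistP y x; move: yd yx; clear -R; lra.
have [Ce Ce0 emb] := adm_embed n2 al0 al1 kap0 rf0 del0 Om_open flatO Om'_open Om'_sub Om'del.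
have [M [A [M0 A1 hop]]] := operator_package hg del0 delr1.
have [oc [os [oU op]]] : exists (oc os : ('rV[R]_n.+1 -> R) -> R -> nat -> nat -> 'rV[R]_n.+1 -> R)
    (oU : ('rV[R]_n.+1 -> R) -> R -> R -> R -> 'rV[R]_n.+1 -> R), forall f m, 0 <= m -> bdry_data E f m ->
    hole_op Om E p del M A f m (oc f m) (os f m) (oU f m).
  have h : forall f m, exists csU, 0 <= m -> bdry_data E f m ->
      hole_op Om E p del M A f m csU.1.1 csU.1.2 csU.2.
    move=> f m; have [[m0 bd]|nb] := pselect (0 <= m /\ bdry_data E f m).
      by have [c [s [U hU]]] := hop f m m0 bd; exists (c, s, U).
    by exists ((fun _ _ _ => 0), (fun _ _ _ => 0), (fun _ _ _ => 0)) => m0 bd; exfalso; apply: nb.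
  exists (fun f m => (projT1 (cid (h f m))).1.1), (fun f m => (projT1 (cid (h f m))).1.2),
    (fun f m => (projT1 (cid (h f m))).2) => f m.
  exact: projT2 (cid (h f m)).
have [u0C u0harm u0go] := hu0; have u0h : harm Om u0 by apply/harmonic_inP.
have u0b z : closure Om z -> ~ Om z -> blim Om u0 z (go z).
  move=> cz nz; have [/withinP cu0 _ _] := u0C.
  rewrite -u0go; last exact/bdryE.
  by apply: blim_sub (cu0 z cz) => x; exact: subset_closure.
have epos (e : R * R) : rect 0 ead e -> 0 < e.1 /\ 0 < e.2 by case=> /andP[h1 _] /andP[h2 _].
have ho (e : R * R) : rect 0 ead e -> holed Om E p e.1 e.2.
  move=> he y /contrapT cy; apply: (ead_sub e he).
  have [e10 e20] := epos e he.
  by apply/closure_scaledE => //; rewrite hole_ptK.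
have xi_r xi : ~ E xi -> enorm xi <= r.
  by move=> nE; rewrite leNgt; apply/negP => xr; apply: nE; apply: (hg_Er hg); exact: ltW.
have bsc (e : R * R) xi : rect 0 ead e -> closure E xi -> ~ E xi ->
    u e (hole_pt p e.1 e.2 xi) = gi xi.
  move=> he cx nx; have [_ _ _ ->] := hu e he; have [e10 e20] := epos e he.
    by rewrite -[_ *: _]/(unscale p e.1 e.2 (hole_pt p e.1 e.2 xi)) hole_ptK.
  have [co no] := exterior_bdry om_open cx nx; split.
    by apply/closure_scaledE => //; rewrite hole_ptK.
  by move=> /interior_subset /scaledE; rewrite hole_ptK// => /(_ e10 e20).
have cperf (e : R * R) xi : rect 0 ead e -> closure E xi -> ~ E xi ->
    closure (perforated Om om p e) (hole_pt p e.1 e.2 xi).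
  move=> he cx nx; have [e10 e20] := epos e he; rewrite (perforatedE p om Om e10 e20).
  exact: (perf_closure e10 e20 Om_open (ho e he xi nx) cx).
have ead2_gt0 : 0 < ead.2 by apply: lt_trans ead2_gt1.
(* Any one parameter will do: the bound and the continuity of [gi] on the boundary of the hole are
   read off from the solution [u eh] instead of charts. *)
have [eh heh] : exists eh, rect 0 ead eh.
  exists (ead.1 / 2, ead.2 / 2).
  by split => /=; rewrite divr_gt0//= ltr_pdivrMr// ltr_pMr// ltr1n.
have [G G0 giG] : exists2 G : R, 0 <= G & \bd xi of E, `|gi xi| <= G.
  have [[_ bu _] _ _ _] := hu _ heh; have [G G0 hG] := bounded_le bu; exists G => // xi cx nx.
  by rewrite -(bsc eh)//; apply: hG; exact: cperf.
have giC xi : closure E xi -> ~ E xi -> blim (closure E `\` E) gi xi (gi xi).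
  move=> cx nx e e0; have [[/withinP cu _ _] _ _ _] := hu _ heh.
  have [d dp hd] := cu _ (cperf eh xi heh cx nx) e e0.
  have t0 : 0 < eh.1 * eh.2 by have [/andP[h1 _] /andP[h2 _]] := heh; exact: mulr_gt0.
  exists (d / (eh.1 * eh.2)); first by rewrite divr_gt0.
  move=> y [cy ny]; rewrite ltr_pdivlMr// => yx.
  rewrite -(bsc eh y heh cy ny) -(bsc eh xi heh cx nx); apply: hd; first exact: cperf.
  rewrite /hole_pt opprD addrACA subrr add0r -scalerBr enormZ (gtr0_norm t0) mulrC//.
have rho0 : 0 < r1 / 2 by rewrite divr_gt0.
have half : r1 / 2 < r1 by move: r10; clear -R; lra.
have eB_r1 : eball r1 = eB (0 : 'rV[R]_n.+1) r1 by apply/seteqP; split => x; rewrite /eB/eball/= subr0.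
have U0h : harm (eB 0 r1) U0 by rewrite -eB_r1; apply/harmonic_inP; rewrite // eB_r1; exact: eB_open.
have [MU MU0 hMU] : exists2 MU : R, 0 <= MU & forall x, eB 0 (r1 / 2) x -> `|U0 x| <= MU.
  have [|MU MU0 hMU] := @compact_bound R n _ U0 (@compact_cball R n 0 (r1 / 2)).
    move=> x /= xr; apply: cont_blim; apply: (harm_cont U0h); rewrite /eB/=.
    by apply: le_lt_trans xr _; rewrite ltr_pdivrMr// ltr_pMr// ltr1n.
  by exists MU; [exact: ltW|move=> x xB; apply: hMU; exact: ltW].
have U0h2 : harm (eB 0 (r1 / 2)) U0.
  by apply: harm_sub U0h => x; rewrite /eB/= => xr; apply: lt_trans xr _; rewrite ltr_pdivrMr// ltr_pMr// ltr1n.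
pose Ad := hA (r1 / 2) p r; have [Ad1 _ _ _ _] := hA_parts p rho0 (ltW r_gt0); rewrite -/Ad in Ad1.
(* Coefficients of the datum of [u e - u0] on the hole: [gi] at order [(0, 0)] minus the expansion
   of [U0 (e1 p + e1 e2 xi)]. [U0] replaces [u0] because the expansion is centred at 0. *)
pose d a b xi : R := (if (a == 0%N) && (b == 0%N) then gi xi else 0) - qcoef U0 p a b xi.
have Ad0 : 0 <= Ad by apply: le_trans Ad1.
have Dd0 : 0 <= G + MU by rewrite addr_ge0.
have dD a b : bdry_data E (d a b) ((G + MU) * Ad ^+ (a + b)).
  split => xi cx nx; rewrite /d.
    apply: le_trans (ler_normB _ _) _; rewrite mulrDl; apply: lerD; last exact: (qcoef_bound rho0 U0h2 hMU _ _ _ (xi_r xi nx)).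
    apply: (@le_trans _ _ G); first by case: ifP => _; rewrite ?normr0//; exact: giG.
    by rewrite ler_peMr// exprn_ege1.
  apply: blimB; last by apply: cont_blim; exact: (qcoef_cont rho0 U0h2 hMU).
  by case: ifP => _; [exact: giC|apply: cont_blim; exact: cont_cst].
pose be := beta M A Ad; have [be1 _ _ be4 be5] := @beta_ge R M A Ad M0 A1 Ad0.
rewrite -/be in be1 be4 be5.
pose CC := Fser M A (G + MU) Ad d oc os.
have CCadm := Fser_adm M0 A1 Dd0 Ad0 op dD; rewrite -/CC -/be in CCadm.
have CC0 := Fser0 M0 A1 Dd0 Ad0 op dD; rewrite -/CC in CC0.
have be2 : 1 <= 2 * be by move: be5; clear -R; lra.
have DM0 : 0 <= 2 * (G + MU) * M by rewrite mulr_ge0// mulr_ge0.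
have vC : C1a alpha Om' (ext0 Om' u0).
  apply: (C1a_congr (f := u0)) => //; last exact: C1a_restrict u0C.
  by move=> x cx; rewrite ext0E.
have [UU [UU1 UU2 UU3]] := analytic_family Om_open Ce0 DM0 be2 emb CCadm (mkC1a vC).
(* The ratio [2 be] of [Fser_adm], times the 4 that [analytic_family] asks for. *)
pose K8 : R := 4 * (2 * be).
have K80 : 0 < K8 by rewrite /K8; move: be5; clear -R; lra.
pose pr : R := enorm p + r; have pr0 : 0 < pr by rewrite ltr_wpDl// enorm_ge0.
have [e' [he' e'1 e'2 e'1b e'2b]] : exists e' : R * R, [/\ rect 0 ead e', e'.1 <= 64^-1 / K8, e'.2 <= 64^-1 / K8,
    e'.1 <= del / pr & e'.2 <= 1].
  have q0p : 0 < (64^-1 : R) / K8 by rewrite divr_gt0// invr_gt0.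
  (* The bound [del / pr] keeps the hole within distance [del] of 0, for negative parameters too,
     hence away from the observed set. *)
  exists (Num.min (ead.1 / 2) (Num.min (64^-1 / K8) (del / pr)), Num.min (ead.2 / 2) (Num.min (64^-1 / K8) 1)).
  move: (64^-1 / K8) q0p => q q0p /=; split => /=; rewrite ?ge_min ?lexx ?orbT//; split => /=.
    by rewrite !lt_min gt_min ltr_pdivrMr// ltr_pMr// ltr1n !divr_gt0// q0p.
  by rewrite !lt_min gt_min ltr_pdivrMr// ltr_pMr// ltr1n q0p ltr01 divr_gt0.
have rectN (e : R * R) : rect (- e') e' e -> `|e.1| < e'.1 /\ `|e.2| < e'.2.
  by move=> [h1 h2]; rewrite !ltr_norml.
have smE (e : R * R) : rect (- e') e' e -> small K8 e.1 e.2.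
  move=> /rectN[h1 h2]; split; rewrite -ler_pdivlMl// mulrC.
    exact: le_trans (ltW h1) _.
  exact: le_trans (ltW h2) _.
have e21 (e : R * R) : rect (- e') e' e -> `|e.2| <= 1.
  by move=> /rectN[_ h2]; apply: le_trans (ltW h2) _.
have sc_del (e : R * R) x : rect (- e') e' e -> closure (scaled p om e) x -> enorm x <= del.
  move=> he cx; apply: le_trans (scaled_norm om_r (e21 e he) cx) _.
  by have [h1 _] := rectN e he; rewrite -/pr -ler_pdivlMr//; apply: le_trans (ltW h1) _.
have sub' (e : R * R) : rect 0 e' e -> rect (- e') e' e /\ rect 0 ead e.
  move=> [/andP[h1 h2] /andP[h3 h4]]; have [/andP[h5 h6] /andP[h7 h8]] := he'.
  split; split; apply/andP; split => //; try exact: lt_trans h6; try exact: lt_trans h8.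
    by apply: lt_trans h1; rewrite /= oppr_lt0.
  by apply: lt_trans h3; rewrite /= oppr_lt0.
exists e'; split => //.
  move=> e he; apply/seteqP; split => // x [/(sc_del e x he) h1 /cOm'del h2].
  by exfalso; move: h1 h2 del0; clear -R; lra.
have v0E x : closure Om' x -> mkC1a vC x = u0 x by move=> cx; exact: mkC1aE.
have cOm x : closure Om' x -> closure Om x by exact: closure_subset.
exists UU; split.
- by apply: UU1 => e; exact: smE.
- move=> e he x cx; have [heN hea] := sub' e he; have sme := smE e heN.
  have [e10 e20] := epos e hea.
  have [uC uharm ugo _] := hu e hea; have xd := cOm'del x cx.
  (* The closure of the observed set may touch the boundary of [Om], where [u e] and [u0] both equal
     [go]. *)
  have [Ox|nOx] := pselect (Om x); last first.
    rewrite UU3//; last by move=> [].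
    have bx : boundary Om x by apply/bdryE => //; split => //; exact: cOm.
    by rewrite v0E// ugo// u0go.
  have ox : outr Om del x by split => //=; move: xd del0; clear -R; lra.
  have px : perf Om E p e.1 e.2 x.
    split; first exact: Ox.
    move=> cs; have := sc_del e x heN ((closure_scaledE p om x e10 e20).2 cs).
    by move: xd del0; clear -R; lra.
  have operf : open (perforated Om om p e) by rewrite (perforatedE p om Om e10 e20); exact: (@perf_open _ _ _ _ _ _ _ _ hg).
  have uh : harm (perf Om E p e.1 e.2) (u e) by rewrite -(perforatedE p om Om e10 e20); apply/harmonic_inP.
  have smb : small be e.1 e.2.
    by apply: small_le sme; apply/andP; split; rewrite /K8; move: be5; clear -R; lra.
  have smA : small Ad e.1 e.2 by apply: small_le smb; rewrite Ad0.
  have hpt xi : ~ E xi -> eB 0 (r1 / 2) (hole_pt p e.1 e.2 xi).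
    move=> nx; rewrite /eB/= subr0.
    exact: (hole_pt_small rho0 e10 e20 (lexx Ad) smA (xi_r xi nx)).
  have [/withinP cu _ _] := uC.
  have ub z : closure (perf Om E p e.1 e.2) z -> blim (perf Om E p e.1 e.2) (u e) z (u e z).
    by rewrite -(perforatedE p om Om e10 e20) => cz; apply: blim_sub (cu z cz) => y; exact: subset_closure.
  pose dE xi : R := gi xi - U0 (hole_pt p e.1 e.2 xi).
  have main := @Fser_lim2 R n Om E nu p r1 r del M A (G + MU) Ad d oc os oU hg M0 A1 Dd0 Ad0 op dD
    e.1 e.2 (G + 3 * MU) dE (fun x => u e x - u0 x) e10 e20 _ smb (ho e hea) _ _ _ _ x px ox.
  have {}main : lim2 (fun a b => CC a b x * mon e.1 e.2 a b)
      (Ctot M (G + MU) (G + 3 * MU) + 10 * ((G + MU) * M)) (u e x - u0 x).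
    apply: main.
    + by rewrite addr_ge0// mulr_ge0.
    + move=> xi cx' nx; have q := qcoef_lim2 rho0 U0h2 hMU (xi_r xi nx) smA.
      have := lim2B (lim2_const (gi xi) e.1 e.2) q => h.
      apply: (@lim2_le _ _ (`|gi xi| + 3 * MU)); first by rewrite lerD2r; exact: giG.
      by move: h; apply: lim2_eq => a b; rewrite /d mulrBl.
    + by apply: harmB => //; apply: harm_sub u0h => y [].
    + move=> z cz nz; have [cp|ncp] := pselect (closure (perf Om E p e.1 e.2) z); last exact: blim_out.
      rewrite -(subrr (go z)); apply: blimB.
        by rewrite -(ugo z); [exact: ub|exact/bdryE].
      by apply: blim_sub (u0b z cz nz) => y [].
    + move=> xi cx' nx; have Oz := ho e hea xi nx.
      have cp := perf_closure e10 e20 Om_open Oz cx'.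
      have ub' := ub _ cp; rewrite (bsc e xi hea cx' nx) in ub'; apply: (blimB ub').
      (* The boundary of the hole lies in the upper half-ball, where [U0] can be traded back for
         [u0], which is harmonic in [Om]. *)
      rewrite U0_u0; first by apply: cont_blim; exact: (harm_cont u0h).
      apply: subset_closure; split; last exact: Om_upper.
      rewrite eB_r1; exact: (lt_trans (hpt xi nx) half).
  by rewrite (UU2 e x _ _ sme cx ox main) v0E// addrC subrK.
(* At [e = 0] only the exponent [(0, 0)] survives, and its coefficient vanishes since
   [Fser a 0 = 0]. *)
- move=> x cx; have sm0 : small K8 (0 : R * R).1 (0 : R * R).2.
    by split; rewrite normr0 mulr0 ltW.
  have [ox|nox] := pselect (outr Om del x); last by rewrite UU3// v0E.
  rewrite (UU2 0 x 0 0 sm0 cx ox) ?v0E ?addr0//.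
  apply: lim2_eq (lim2_0 (lexx 0)) => a b.
  have [->|b0] := eqVneq b 0%N; first by rewrite CC0 mul0r.
  by rewrite /mon /= [X in _ * (_ * X)]expr0n (negbTE b0) mulr0 mulr0.
Qed.
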